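(* Let $\alpha>0$ and let $P,Q\in\mathbb{R}^2$ with $P\neq Q$. Then $$\max_{\partial\Sigma=\{P,Q\}}\lambda_1^\alpha(\Sigma)=\lambda_1^\alpha(\Gamma_L),$$ where the maximum is taken over all smooth open arcs $\Sigma\subset\mathbb{R}^2$ (of arbitrary length) that connect the points $P$ and $Q$, i.e. whose two endpoints are $P$ and $Q$, and $\Gamma_L$ is a line segment of length $L=|P-Q|$, the Euclidean distance between $P$ and $Q$. Moreover, for a smooth open arc $\Sigma$ connecting $P$ and $Q$, the equality $\lambda_1^\alpha(\Sigma)=\lambda_1^\alpha(\Gamma_L)$ holds if and only if $\Sigma$ is the line segment connecting $P$ and $Q$.
   Context: A smooth open arc is a compact non-closed $C^\infty$-smooth curve $\Sigma\subset\mathbb{R}^2$ of finite positive length with two (distinct) free endpoints which can be continued up to the boundary of a $C^\infty$-smooth bounded simply connected domain; that is, $\Sigma$ is a compact sub-arc with two distinct endpoints of $\partial\Omega_+$ for some bounded simply connected domain $\Omega_+\subset\mathbb{R}^2$ with $C^\infty$-smooth boundary (in particular $\Sigma$ has no self-intersections). $\partial\Sigma$ denotes the set of its two endpoints. Line segments are smooth open arcs. For a smooth open arc $\Sigma$ and $\alpha>0$, let $H_{\delta,\alpha}^\Sigma$ be the self-adjoint operator in $L^2(\mathbb{R}^2)$ associated via the first representation theorem with the closed, densely defined, symmetric, semi-bounded quadratic form $$\mathfrak{h}_{\delta,\alpha}^\Sigma[u]=\|\nabla u\|^2_{L^2(\mathbb{R}^2;\mathbb{C}^2)}-\alpha\|u|_\Sigma\|^2_{L^2(\Sigma)},\qquad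 \mathrm{dom}\,\mathfrak{h}_{\delta,\alpha}^\Sigma=H^1(\mathbb{R}^2),$$ where $u|_\Sigma$ is the trace of $u$ on $\Sigma$ and $L^2(\Sigma)$ is taken with respect to arc length. The essential spectrum of $H_{\delta,\alpha}^\Sigma$ is $[0,\infty)$ and its negative discrete spectrum is non-empty and finite; $\lambda_1^\alpha(\Sigma)<0$ denotes the lowest eigenvalue of $H_{\delta,\alpha}^\Sigma$. *)

(* Defs.v *)
From HB Require Import structures.
From mathcomp Require Import all_boot all_order all_algebra.
From mathcomp Require Import all_classical all_reals all_analysis.
From mathcomp.real_closed Require Import complex.

Set Implicit Arguments.
Unset Strict Implicit.
Unset Printing Implicit Defensive.

Import Order.TTheory GRing.Theory Num.Theory.
Import numFieldNormedType.Exports.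
Import ComplexField.

Local Open Scope classical_set_scope.
Local Open Scope ring_scope.

(* [R * R] carries the max norm of the library, which induces the usual
   topology; Euclidean lengths are computed explicitly by [enorm]. *)
Definition enorm (R : realType) (p : R * R) : R :=
  Num.sqrt (p.1 ^+ 2 + p.2 ^+ 2).

Definition segment (R : realType) (A B : R * R) : set (R * R) :=
  [set (1 - t) *: A + t *: B | t in `[0, 1]%classic].

Definition boundary (T : topologicalType) (A : set T) : set T :=
  closure A `\` A°.

(* All iterated directional derivatives exist and are Frechet differentiable.
   On a finite-dimensional [V] this is being of class C^oo. *)
Definition smooth (R : realType) (V W : normedModType R) (f : V -> W) : Prop :=
  forall (s : seq V) (x : V), differentiable (foldr (fun v g => 'D_v g) f s) x.

(* Connected, and every loop is contractible to its base point within [A]. *)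
Definition simply_connected (R : realType) (A : set (R * R)) : Prop :=
  connected A /\
  forall c : R -> R * R,
    {within `[0, 1], continuous c} -> c @` `[0, 1] `<=` A -> c 0 = c 1 ->
    exists H : R * R -> R * R,
      [/\ {within `[0, 1] `*` `[0, 1], continuous H},
          H @` (`[0, 1] `*` `[0, 1]) `<=` A,
          {in `[0, 1], forall t, H (t, 0) = c t},
          {in `[0, 1], forall t, H (t, 1) = c 0} &
          {in `[0, 1], forall s, H (0, s) = c 0 /\ H (1, s) = c 0}].

(* Near each of its boundary points, [A] is the side [rho < 0] of a smooth
   regular level curve [rho = 0]. *)
Definition smooth_boundary (R : realType) (A : set (R * R)) : Prop :=
  forall p, boundary A p -> exists rho : R * R -> R,
    [/\ smooth rho, exists v, 'D_v rho p != 0 &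
        \forall x \near p, A x <-> rho x < 0].

Definition smooth_domain (R : realType) (A : set (R * R)) : Prop :=
  [/\ A !=set0, open A, bounded_set A, simply_connected A & smooth_boundary A].

Definition arclength_param (R : realType) (S : set (R * R))
    (c : R -> R * R) (l : R) : Prop :=
  [/\ 0 < l, smooth c, {in `[0, l], forall t, enorm ('D_1 c t) = 1},
      {in `[0, l] &, injective c} & c @` `[0, l] = S].

(* The endpoints are distinct because [c] is injective on [0, l]. *)
Definition smooth_open_arc (R : realType) (S : set (R * R)) : Prop :=
  (exists c l, arclength_param S c l) /\
  exists2 Omega, smooth_domain Omega & S `<=` boundary Omega.

Definition connects (R : realType) (P Q : R * R) (S : set (R * R)) : Prop :=
  exists c l, arclength_param S c l /\ [set c 0; c l] = [set P; Q].

(* A unit-speed parametrization is unique up to reversal of the arc, so the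
   choice made here does not affect integration with respect to arc length. *)
Definition arc_param (R : realType) (S : set (R * R)) : (R -> R * R) * R :=
  xget (cst 0, 0) [set cl | arclength_param S cl.1 cl.2].

Section ComplexL2.
Context (d : measure_display) (T : measurableType d) (R : realType).
Variable mu : {measure set T -> \bar R}.
Implicit Types (D : set T) (f g : T -> R[i]).

Definition cintegral D f : R[i] :=
  Complex (\int[mu]_(x in D) complex.Re (f x))%R
          (\int[mu]_(x in D) complex.Im (f x))%R.

Definition norm2sq D f : \bar R :=
  (\int[mu]_(x in D) (Normc.normc (f x) ^+ 2)%:E)%E.

Definition memL2 D f : Prop :=
  [/\ measurable_fun D (fun x => complex.Re (f x)),
      measurable_fun D (fun x => complex.Im (f x)) &
      (norm2sq D f < +oo)%E].

Definition inner D f g : R[i] := cintegral D (fun x => f x * conjc (g x)).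

End ComplexL2.

Section DeltaInteraction.
Context (R : realType).
Implicit Types (u v f g phi : R * R -> R[i]) (S : set (R * R)) (a l : R).

Local Notation leb := (@lebesgue_measure R).
Local Notation leb2 := (leb \x leb)%E.

Definition e1 : R * R := (1, 0).
Definition e2 : R * R := (0, 1).

Definition cpartial (e : R * R) phi : R * R -> R[i] := fun x =>
  Complex ('D_e (fun y => complex.Re (phi y)) x)
          ('D_e (fun y => complex.Im (phi y)) x).

Definition test_function phi : Prop :=
  [/\ smooth (fun x => complex.Re (phi x)),
      smooth (fun x => complex.Im (phi x)) &
      exists2 K : set (R * R), compact K & forall x, ~ K x -> phi x = 0].

Definition is_weak_partial (e : R * R) u g : Prop :=
  memL2 leb2 setT g /\
  forall phi, test_function phi ->
    inner leb2 setT u (cpartial e phi) = - inner leb2 setT g phi.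

Definition memH1 u : Prop :=
  [/\ memL2 leb2 setT u, exists g, is_weak_partial e1 u g &
      exists g, is_weak_partial e2 u g].

(* Determined up to a null set for [u] in H^1; likewise [trace] below. *)
Definition weak_partial (e : R * R) u : R * R -> R[i] :=
  xget (cst 0) [set g | is_weak_partial e u g].

Definition on_arc S f : R -> R[i] := f \o (arc_param S).1.

Definition arc_dom S : set R := `[0, (arc_param S).2].

(* The trace on [S] is the continuous extension of the restriction map from
   test functions to H^1(R^2). Only the values of [t] on [S] are relevant. *)
Definition is_trace S u (t : R * R -> R[i]) : Prop :=
  memL2 leb (arc_dom S) (on_arc S t) /\
  exists phi : nat -> R * R -> R[i],
    [/\ forall n, test_function (phi n),
        norm2sq leb2 setT (phi n \- u) @[n --> \oo] --> 0%E,
        norm2sq leb2 setT (cpartial e1 (phi n) \- weak_partial e1 u)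
          @[n --> \oo] --> 0%E,
        norm2sq leb2 setT (cpartial e2 (phi n) \- weak_partial e2 u)
          @[n --> \oo] --> 0%E &
        norm2sq leb (arc_dom S) (on_arc S (phi n \- t)) @[n --> \oo] --> 0%E].

Definition trace S u : R * R -> R[i] := xget (cst 0) [set t | is_trace S u t].

(* The sesquilinear form whose diagonal is the given quadratic form. *)
Definition delta_form a S u v : R[i] :=
  inner leb2 setT (weak_partial e1 u) (weak_partial e1 v)
  + inner leb2 setT (weak_partial e2 u) (weak_partial e2 v)
  - real_complex R a * inner leb (arc_dom S) (on_arc S (trace S u)) (on_arc S (trace S v)).

(* The graph [u |-> f] of the operator which the first representation theorem
   associates with the form. *)
Definition delta_operator a S u f : Prop :=
  [/\ memH1 u, memL2 leb2 setT f &
      forall v, memH1 v -> delta_form a S u v = inner leb2 setT f v].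

Definition delta_eigenvalue a S l : Prop :=
  exists u, delta_operator a S u (fun x => real_complex R l * u x) /\
            ~ {ae leb2, forall x, u x = 0}.

(* For [0 < a] and a smooth open arc the lowest eigenvalue exists and is
   negative, so the default value 0 is not used. *)
Definition lambda1 a S : R :=
  xget 0 [set l | delta_eigenvalue a S l /\
                  forall m, delta_eigenvalue a S m -> l <= m].

End DeltaInteraction.

Definition is_max (R : realType) (A : set R) (m : R) : Prop :=
  A m /\ ubound A m.

(* Main.v *)
Require Import Defs.
From HB Require Import structures.
From mathcomp Require Import all_boot all_order all_algebra.
From mathcomp Require Import all_classical all_reals all_analysis.
From mathcomp.real_closed Require Import complex.
From mathcomp Require Import measurable_realfun.
From mathcomp Require Import ring lra zify.

(* Birman-Schwinger: [- b] is the lowest eigenvalue exactly when [alpha^-1] is the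
   largest eigenvalue of the integral operator on [L^2(0, l)] whose kernel is the
   Green function of [b - Laplacian] at pairs of points of the arc. As a time integral
   of heat kernels this kernel is positive and decreases with the distance, and a
   unit-speed arc satisfies [|gam s - gam t| <= |s - t|], with equality for a segment.
   So at fixed [b] the largest eigenvalue for an arc of length [l] joining [P] and [Q]
   is at least the one for the segment of length [L <= l]: test the eigenvalue equation
   of the arc's positive eigenfunction against the one of the segment. The inequality is
   strict if [L < l], while [l = L] forces the arc to be straight. Since the largest
   eigenvalue is continuous in [b] and tends to [0], the critical [b] of the arc is
   at least that of the segment. *)

Set Implicit Arguments.
Unset Strict Implicit.
Unset Printing Implicit Defensive.

Import Order.TTheory GRing.Theory Num.Theory.
Import numFieldNormedType.Exports.

Local Open Scope classical_set_scope.
Local Open Scope ring_scope.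

(** * Square-integrable functions *)

(** The kernel of the integral operator [T] has a logarithmic singularity on the diagonal, so [T]
    does not map [L^1] to bounded functions and Birkhoff's contraction cannot be applied to it. The
    kernel of [T^2] is bounded, and an eigenfunction [h] of [T^2] for [lam] yields
    [T h + sqrt lam h] for [T]. The link with the form is one identity: the potential [U f] of a
    density [f] on the arc satisfies [b <phi, U f> + <grad phi, grad (U f)> = \int phi f] along the
    arc. Cauchy-Schwarz in this energy bounds the restriction of [phi] to the arc by [mu] times the
    energy of [phi]; from this bound come the traces on [H^1] and, for [mu = alpha^-1], the lower
    bound [- b] on all eigenvalues. The same identity makes the potential of the positive
    eigenfunction an eigenfunction of the operator. Kernels are kept as functions of a time and a
    point, so that derivatives and integrations by parts concern Gaussians at a fixed time; Schur's
    test justifies the exchanges of integrals. Since only distances enter [T], one segment on a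
    coordinate axis represents all segments of its length. *)

Lemma discriminant_le0 (R : realType) (a b c : R) : 0 <= a ->
  (forall t, 0 <= a * t ^+ 2 + 2 * b * t + c) -> b ^+ 2 <= a * c.
Proof.
move=> a0 H; have c0 : 0 <= c by have := H 0; rewrite expr0n/= !mulr0 !add0r.
have [a00|an0] := eqVneq a 0.
  move: H; rewrite a00 mul0r => H; have [->|bn0] := eqVneq b 0; first by rewrite expr0n.
  (* With [a = 0] the polynomial is affine with slope [2 * b], and at this point it takes the value
     [-1]. *)
  have := H (- (c + 1) / (2 * b)); rewrite mul0r add0r => h.
  have e : 2 * b * (- (c + 1) / (2 * b)) = - (c + 1) by field.
  by move: h; rewrite e; lra.
have ap : 0 < a by rewrite lt_neqAle eq_sym an0.
have := H (- b / a).
have -> : a * (- b / a) ^+ 2 + 2 * b * (- b / a) + c = (a * c - b ^+ 2) / a by field.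
by rewrite pmulr_lge0 ?invr_gt0// subr_ge0.
Qed.

Lemma ler_sqr_norm (R : realDomainType) (x y : R) :
  `|x| <= `|y| -> x ^+ 2 <= y ^+ 2.
Proof.
move=> xy; rewrite -(real_normK (num_real x)) -(real_normK (num_real y)).
by rewrite lerXn2r// nnegrE.
Qed.

Section SquareIntegrable.
Context d (T : measurableType d) (R : realType) (mu : {measure set T -> \bar R}).
Implicit Types f g h : T -> R.

Definition intg f := mu.-integrable setT (EFin \o f).

Definition sqintg f := measurable_fun setT f /\ intg (fun x => f x ^+ 2).

Definition dot f g : R := \int[mu]_x (f x * g x).

Definition nsq f : R := \int[mu]_x (f x ^+ 2).

Lemma eq_intg f g : f =1 g -> intg f -> intg g.
Proof. by move=> fg; apply: eq_integrable => // x _ /=; rewrite fg. Qed.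

Lemma intg_measurable f : intg f -> measurable_fun setT f.
Proof. by move=> /measurable_int /measurable_EFinP. Qed.

Lemma intg_le f g : measurable_fun setT f -> intg g ->
  (forall x, `|f x| <= g x) -> intg f.
Proof.
move=> mf ig fg; apply: (le_integrable _ _ _ ig) => //; first exact/measurable_EFinP.
by move=> x _ /=; rewrite lee_fin (le_trans (fg x))// ler_norm.
Qed.

Lemma intgD f g : intg f -> intg g -> intg (fun x => f x + g x).
Proof. by move=> i1 i2; exact: (integrableD measurableT i1 i2). Qed.

Lemma intgB f g : intg f -> intg g -> intg (fun x => f x - g x).
Proof. by move=> i1 i2; exact: (integrableB measurableT i1 i2). Qed.

Lemma intgZ (k : R) f : intg f -> intg (fun x => k * f x).
Proof. by move=> i1; exact: (integrableZl measurableT k i1). Qed.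

Lemma intg_norm f : intg f -> intg (fun x => `|f x|).
Proof. by move=> fi; exact: integrable_norm. Qed.

Lemma intg0 : intg (fun _ => 0).
Proof. exact: integrable0. Qed.

Lemma intg_ltoo f (c : R) : measurable_fun setT f ->
  (\int[mu]_x `|f x|%:E <= c%:E)%E -> intg f.
Proof.
move=> mf H; apply/integrableP; split; first exact/measurable_EFinP.
by apply: (le_lt_trans H); rewrite ltry.
Qed.

Lemma Rint_le_ereal f (c : R) : measurable_fun setT f -> (forall x, 0 <= f x) ->
  (\int[mu]_x (f x)%:E <= c%:E)%E -> intg f /\ \int[mu]_x f x <= c.
Proof.
move=> mf f0 H; have fi : intg f.
  by apply: (intg_ltoo mf (c := c)); under eq_integral do rewrite ger0_norm//.
by split=> //; rewrite -lee_fin /Rintegral fineK//; exact: integrable_fin_num.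
Qed.

Lemma EFin_Rint f : intg f -> ((\int[mu]_x f x)%:E = \int[mu]_x (f x)%:E)%E.
Proof. by move=> fi; rewrite /Rintegral fineK//; exact: integrable_fin_num. Qed.

Lemma sqintg_le f g : measurable_fun setT f -> sqintg g ->
  (forall x, `|f x| <= `|g x|) -> sqintg f.
Proof.
move=> mf [mg ig] fg; split => //; apply: (intg_le _ ig).
  exact: measurable_funX.
by move=> x; rewrite ger0_norm ?sqr_ge0//; exact: ler_sqr_norm.
Qed.

Lemma sqintgM f g : sqintg f -> sqintg g -> intg (fun x => f x * g x).
Proof.
move=> [mf f2] [mg g2].
apply: (intg_le _ (intgD f2 g2)); first exact: measurable_funM.
move=> x; rewrite ler_norml; apply/andP; split; nra.
Qed.

Lemma sqintgZ (k : R) f : sqintg f -> sqintg (fun x => k * f x).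
Proof.
move=> [mf f2]; split; first exact: measurable_funM.
by apply: eq_intg (intgZ (k ^+ 2) f2) => x /=; rewrite exprMn.
Qed.

Lemma sqintgD f g : sqintg f -> sqintg g -> sqintg (fun x => f x + g x).
Proof.
move=> [mf f2] [mg g2]; split; first exact: measurable_funD.
apply: (intg_le _ (intgZ 2 (intgD f2 g2))).
  by apply: measurable_funX; exact: measurable_funD.
move=> x; rewrite ger0_norm ?sqr_ge0//.
have := sqr_ge0 (f x - g x); nra.
Qed.

Lemma sqintgN f : sqintg f -> sqintg (fun x => - f x).
Proof.
move=> [mf f2]; split; first exact: measurableT_comp.
by apply: eq_intg f2 => x /=; rewrite sqrrN.
Qed.

Lemma sqintgB f g : sqintg f -> sqintg g -> sqintg (fun x => f x - g x).
Proof. by move=> f2 g2; exact: (sqintgD f2 (sqintgN g2)). Qed.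

Lemma sqintg0 : sqintg (fun _ => 0).
Proof.
split; first exact: measurable_cst.
by apply: eq_intg intg0 => x /=; rewrite expr0n.
Qed.

Lemma nsq_ge0 f : 0 <= nsq f.
Proof. by apply: Rintegral_ge0 => x _; exact: sqr_ge0. Qed.

Lemma dotC f g : dot f g = dot g f.
Proof. by apply: eq_Rintegral => x _; rewrite mulrC. Qed.

Lemma dotff f : dot f f = nsq f.
Proof. by apply: eq_Rintegral => x _; rewrite -expr2. Qed.

Lemma dotDl f g h : sqintg f -> sqintg g -> sqintg h ->
  dot (fun x => f x + g x) h = dot f h + dot g h.
Proof.
move=> f2 g2 h2; rewrite /dot -RintegralD//; try exact: sqintgM.
by apply: eq_Rintegral => x _; rewrite mulrDl.
Qed.

Lemma dotZl (k : R) f g : sqintg f -> sqintg g ->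
  dot (fun x => k * f x) g = k * dot f g.
Proof.
move=> f2 g2; rewrite /dot -RintegralZl//; try exact: sqintgM.
by apply: eq_Rintegral => x _; rewrite mulrA.
Qed.

Lemma dotNl f g : sqintg f -> sqintg g -> dot (fun x => - f x) g = - dot f g.
Proof.
move=> f2 g2; rewrite -mulN1r -dotZl//.
by apply: eq_Rintegral => x _; rewrite mulN1r.
Qed.

Lemma dotBl f g h : sqintg f -> sqintg g -> sqintg h ->
  dot (fun x => f x - g x) h = dot f h - dot g h.
Proof.
by move=> f2 g2 h2; rewrite dotDl//; [rewrite dotNl|exact: sqintgN].
Qed.

Lemma dotDr f g h : sqintg f -> sqintg g -> sqintg h ->
  dot h (fun x => f x + g x) = dot h f + dot h g.
Proof. by move=> *; rewrite dotC dotDl// !(dotC h). Qed.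

Lemma dotBr f g h : sqintg f -> sqintg g -> sqintg h ->
  dot h (fun x => f x - g x) = dot h f - dot h g.
Proof. by move=> *; rewrite dotC dotBl// !(dotC h). Qed.

Lemma dotZr (k : R) f g : sqintg f -> sqintg g ->
  dot f (fun x => k * g x) = k * dot f g.
Proof. by move=> *; rewrite dotC dotZl// dotC. Qed.

Lemma nsqD f g : sqintg f -> sqintg g ->
  nsq (fun x => f x + g x) = nsq f + 2 * dot f g + nsq g.
Proof.
move=> f2 g2; rewrite -!dotff dotDl ?dotDr//; try exact: sqintgD.
by rewrite (dotC g f); ring.
Qed.

Lemma nsqZ (k : R) f : sqintg f -> nsq (fun x => k * f x) = k ^+ 2 * nsq f.
Proof.
move=> f2; rewrite -!dotff dotZl ?dotZr//; last exact: sqintgZ.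
by rewrite mulrA -expr2.
Qed.

Lemma nsqB f g : sqintg f -> sqintg g ->
  nsq (fun x => f x - g x) = nsq f - 2 * dot f g + nsq g.
Proof.
move=> f2 g2; rewrite -!dotff dotBl ?dotBr//; try exact: sqintgB.
by rewrite (dotC g f); ring.
Qed.

Lemma nsq_subC f g : nsq (fun x => f x - g x) = nsq (fun x => g x - f x).
Proof. by apply: eq_Rintegral => x _; rewrite -opprB sqrrN. Qed.

Lemma dot_CS f g : sqintg f -> sqintg g -> dot f g ^+ 2 <= nsq f * nsq g.
Proof.
move=> f2 g2; apply: discriminant_le0; first exact: nsq_ge0.
move=> t; have := nsq_ge0 (fun x => t * f x + g x).
rewrite nsqD//; last exact: sqintgZ.
by rewrite nsqZ// dotZl// mulrA -(mulrA 2) (mulrC t) mulrA (mulrC (nsq f)).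
Qed.

Lemma dot_CS_norm f g : sqintg f -> sqintg g ->
  `|dot f g| <= Num.sqrt (nsq f) * Num.sqrt (nsq g).
Proof.
move=> f2 g2; rewrite -sqrtrM ?nsq_ge0// -sqrtr_sqr ler_sqrt ?dot_CS//.
by rewrite mulr_ge0// nsq_ge0.
Qed.

Lemma nsqD_le f g : sqintg f -> sqintg g ->
  nsq (fun x => f x + g x) <= 2 * nsq f + 2 * nsq g.
Proof.
move=> f2 g2; have := nsq_ge0 (fun x => f x - g x).
by rewrite nsqB// nsqD//; nra.
Qed.

Lemma nsq_le f g : sqintg f -> sqintg g -> (forall x, `|f x| <= `|g x|) ->
  nsq f <= nsq g.
Proof.
move=> [mf f2] [mg g2] fg; apply: le_Rintegral => // x _.
exact: ler_sqr_norm.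
Qed.

Lemma nsq_eq0 f : sqintg f -> nsq f = 0 -> {ae mu, forall x, f x = 0}.
Proof.
move=> [mf f2] H.
have : ae_eq mu setT (fun x => (f x ^+ 2)%:E) (cst 0%E).
  apply/(ae_eq_integral_abs mu measurableT); first exact: measurable_int f2.
  under eq_integral do rewrite gee0_abs ?lee_fin ?sqr_ge0//.
  by rewrite -EFin_Rint// -/(nsq f) H.
apply: filterS => x /(_ I) [] /eqP; rewrite sqrf_eq0 => /eqP.
by [].
Qed.

Lemma ae_eq0_nsq f : measurable_fun setT f ->
  {ae mu, forall x, f x = 0} -> nsq f = 0.
Proof.
move=> mf H; rewrite /nsq /Rintegral (ae_eq_integral (cst 0%E)) ?integral0//.
  by apply/measurable_EFinP; exact: measurable_funX.
by apply: filterS H => x -> _; rewrite expr0n.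
Qed.

End SquareIntegrable.

(* A subsequence with |f_(k+1) - f_k|^2 <= 16^-k converges a.e.: the function
   [S = sum_k 4^k (f_(k+1) - f_k)^2] has finite integral, and where it is finite
   the increments are dominated by a geometric series. *)
Section RieszFischer.
Context d (T : measurableType d) (R : realType) (mu : {measure set T -> \bar R}).
Implicit Types f g h : T -> R.

Lemma ae_cvg_subseq (f : nat -> T -> R) : (forall n, sqintg mu (f n)) ->
  (forall n, nsq mu (fun x => f n.+1 x - f n x) <= (1/16) ^+ n) ->
  exists2 A, d.-measurable A /\ mu (~` A) = 0%E &
    forall x, A x -> cvgn (f ^~ x).
Proof.
move=> f2 H.
pose S x := (\sum_(0 <= k <oo) (4 ^+ k * (f k.+1 x - f k x) ^+ 2)%:E)%E.
have mterm k : measurable_fun setT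
    (fun x => (4 ^+ k * (f k.+1 x - f k x) ^+ 2)%:E).
  apply/measurable_EFinP; apply: measurable_funM => //.
  by apply: measurable_funX; apply: measurable_funB; case: (f2 k); case: (f2 k.+1).
have t0 k x : (0 <= (4 ^+ k * (f k.+1 x - f k x) ^+ 2)%:E)%E.
  by rewrite lee_fin mulr_ge0 ?sqr_ge0// exprn_ge0.
have mS : measurable_fun setT S.
  by apply: ge0_emeasurable_sum => // k x _ _.
have iS : (\int[mu]_x S x < +oo)%E.
  rewrite integral_nneseries//.
  apply: (@le_lt_trans _ _ (\sum_(0 <= k <oo) ((1/4) ^+ k)%:E)%E).
    apply: lee_nneseries => [k _ _|k _]; first by apply: integral_ge0 => x _.
    rewrite -EFin_Rint; last first.
      apply: intgZ; exact: (sqintgB (f2 k.+1) (f2 k)).2.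
    rewrite lee_fin RintegralZl//; last exact: (sqintgB (f2 k.+1) (f2 k)).2.
    rewrite (le_trans (ler_wpM2l _ (H k)))// -exprMn.
    by rewrite le_eqVlt; apply/orP; left; apply/eqP; congr (_ ^+ _); field.
  have -> : (fun n => \sum_(0 <= k < n) ((1 / 4 : R) ^+ k)%:E)%E =
      EFin \o series (geometric 1 (1/4 : R)).
    apply/funext => n /=; rewrite /series/= -sumEFin.
    by apply: eq_bigr => i _; rewrite [in RHS]mul1r.
  rewrite EFin_lim ?ltry//.
  by apply: is_cvg_geometric_series; rewrite ger0_norm; lra.
have S0 x : (0 <= S x)%E by apply: nneseries_ge0.
exists (S @^-1` [set y | (y < +oo)%E]).
  have mA : d.-measurable (S @^-1` [set y | (y < +oo)%E]).
    by rewrite -[X in d.-measurable X]setTI; exact: emeasurable_fun_infty_o.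
  split=> //.
  have : mu.-integrable setT S.
    apply/integrableP; split=> //.
    by under eq_integral do rewrite gee0_abs//.
  move=> /integrable_ae => /(_ measurableT) [N [mN N0 HN]].
  apply: (subset_measure0 _ mN _ N0); first exact: measurableC.
  move=> x Ax; apply: HN => /= /(_ I).
  by rewrite ge0_fin_numE.
move=> x /= Sx.
have [s s0 Ss] : exists2 s, 0 <= s & S x = s%:E.
  exists (fine (S x)); first by rewrite fine_ge0.
  by rewrite fineK// ge0_fin_numE.
have bnd k : `|f k.+1 x - f k x| <= (s + 1) * (1/2) ^+ k.
  have : (4 ^+ k * (f k.+1 x - f k x) ^+ 2) <= s.
    rewrite -lee_fin -Ss /S.
    apply: (le_trans _ (@nneseries_lim_ge _ _ _ _ k.+1 _)) => //.
    rewrite big_nat_recr//= leeDr//; exact: sume_ge0.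
  move=> h.
  have h2 : (2 ^+ k * `|f k.+1 x - f k x|) ^+ 2 <= (s + 1) ^+ 2.
    rewrite exprMn real_normK ?num_real// -exprM mulnC exprM.
    have -> : (2 : R) ^+ 2 = 4 by ring.
    by apply: (le_trans h); nra.
  have h3 : 2 ^+ k * `|f k.+1 x - f k x| <= s + 1.
    by rewrite -(@ler_pXn2r _ 2)// nnegrE ?mulr_ge0 ?exprn_ge0//; lra.
  by rewrite div1r exprVn ler_pdivlMr ?exprn_gt0// mulrC.
have c1 : cvgn (series (fun k => f k.+1 x - f k x)).
  apply: normed_cvg.
  apply: (@series_le_cvg _ _ (fun k => (s + 1) * (1/2) ^+ k)) => //.
  - by move=> n /=.
  - by move=> n; rewrite mulr_ge0 ?exprn_ge0//; lra.
  - by apply: is_cvg_geometric_series; rewrite ger0_norm; lra.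
have -> : f ^~ x = (fun n => f 0%N x + series (fun k => f k.+1 x - f k x) n).
  apply/funext => n; rewrite /series/= telescope_sumr//; lra.
by apply: is_cvgD => //; exact: is_cvg_cst.
Qed.

(** A rapidly converging subsequence has an almost everywhere limit; Fatou's lemma along it bounds
    the distance of each term to the limit by the Cauchy modulus. *)
Lemma riesz_fischer (f : nat -> T -> R) : (forall n, sqintg mu (f n)) ->
  (forall e, 0 < e -> exists N, forall n m, (N <= n)%N -> (N <= m)%N ->
     nsq mu (fun x => f n x - f m x) <= e) ->
  exists2 g, sqintg mu g & forall e, 0 < e -> exists N, forall n, (N <= n)%N ->
     nsq mu (fun x => f n x - g x) <= e.
Proof.
move=> f2 cau.
have /choice[N HN] : forall k, exists N, forall n m, (N <= n)%N -> (N <= m)%N ->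
    nsq mu (fun x => f n x - f m x) <= (1/16) ^+ k.
  by move=> k; apply: cau; rewrite exprn_gt0.
(* Summing the thresholds makes both [phi k] and [phi k.+1] exceed [N k], as two consecutive terms
   of the subsequence require; the added [k] makes [phi] tend to infinity. *)
pose phi k := (\sum_(i < k.+1) N i + k)%N.
have phiN k : (N k <= phi k)%N.
  by rewrite /phi big_ord_recr/=; lia.
have phiS k : (N k <= phi k.+1)%N.
  by rewrite /phi 2!big_ord_recr/=; lia.
have phik k : (k <= phi k)%N by rewrite /phi leq_addl.
pose h k := f (phi k).
have h2 k : sqintg mu (h k) by exact: f2.
have [|A [mA A0] cA] := ae_cvg_subseq h2.
  by move=> n; apply: HN.
(* Set to 0 on the null set, the subsequence converges everywhere and its limit is measurable. *)
pose h' k x := h k x * \1_A x.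
have mh' k : measurable_fun setT (h' k).
  by apply: measurable_funM => //; exact: (h2 k).1.
pose g x := lim (h' ^~ x @ \oo).
have cg x : h' ^~ x @ \oo --> g x.
  have [Ax|nAx] := pselect (A x).
    have -> : h' ^~ x = h ^~ x.
      by apply/funext => k; rewrite /h' indicE mem_set// mulr1.
    have := cA _ Ax.
    by rewrite /g; have -> : h' ^~ x = h ^~ x; first
      by apply/funext => k; rewrite /h' indicE mem_set// mulr1.
  have E : h' ^~ x = cst 0.
    by apply/funext => k; rewrite /h' indicE memNset// mulr0.
  by rewrite /g E; exact: is_cvg_cst.
have mg : measurable_fun setT g.
  by apply: (measurable_fun_cvg mh') => x _; exact: cg.
have aeA : {ae mu, forall x, A x}.
  by exists (~` A); split => //; exact: measurableC.
have h'2 k : sqintg mu (h' k).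
  apply: (sqintg_le (mh' k) (h2 k)) => x; rewrite /h' normrM indicE.
  by case: (_ \in _); rewrite /= ?normr1 ?normr0 ?mulr1 ?mulr0.
have hh' m k : nsq mu (fun x => h' k x - f m x) = nsq mu (fun x => h k x - f m x).
  rewrite /nsq /Rintegral; congr fine; apply: ae_eq_integral => //.
  - by apply/measurable_EFinP; apply: measurable_funX; exact: (sqintgB (h'2 k) (f2 m)).1.
  - by apply/measurable_EFinP; apply: measurable_funX; exact: (sqintgB (h2 k) (f2 m)).1.
  - by apply: filterS aeA => x Ax _; rewrite /h' indicE mem_set// mulr1.
have key e : 0 < e -> exists N, forall m, (N <= m)%N ->
    (\int[mu]_x ((g x - f m x) ^+ 2)%:E <= e%:E)%E.
  move=> e0; have [M HM] := cau _ e0; exists M => m Mm.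
  have F x : limn_einf (fun k => ((h' (k + M)%N x - f m x) ^+ 2)%:E) =
      ((g x - f m x) ^+ 2)%:E.
    have c : (fun k => ((h' (k + M)%N x - f m x) ^+ 2)%:E) @ \oo -->
        ((g x - f m x) ^+ 2)%:E.
      apply: cvg_EFin; first by near=> k.
      apply: (@cvg_comp _ _ _ (fun k => h' (k + M)%N x - f m x) (fun y => y ^+ 2)
         _ (nbhs (g x - f m x))).
        apply: cvgB; last exact: cvg_cst.
        by rewrite (cvg_shiftn M (h' ^~ x)); exact: cg.
      exact: exprn_continuous.
    by have [] := cvg_limn_einf_sup c.
  under eq_integral do rewrite -F.
  apply: le_trans (fatou _ _ _ _) _ => //.
  - move=> k; apply/measurable_EFinP.
    apply: measurable_funX; exact: (sqintgB (h'2 _) (f2 m)).1.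
  - by move=> k x _; rewrite lee_fin sqr_ge0.
  rewrite limn_einf_lim.
  apply: lime_le; first exact: is_cvg_einfs.
  apply: nearW => k; apply: (@le_trans _ _ (\int[mu]_x ((h' (k + M)%N x - f m x) ^+ 2)%:E)%E).
    by apply: ereal_inf_lbound => /=; exists k => //=.
  rewrite -EFin_Rint; last exact: (sqintgB (h'2 _) (f2 m)).2.
  rewrite lee_fin -/(nsq mu (fun x => h' (k + M)%N x - f m x)) hh'.
  by apply: HM => //; rewrite (leq_trans _ (phik _))// leq_addl.
have g2 : sqintg mu g.
  have [M HM] := key 1 ltr01.
  have /Rint_le_ereal[||i1 _] := HM M (leqnn _).
  - by apply: measurable_funX; apply: measurable_funB => //; exact: (f2 M).1.
  - by move=> x; exact: sqr_ge0.
  have gf : sqintg mu (fun x => g x - f M x).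
    by split=> //; apply: measurable_funB => //; exact: (f2 M).1.
  have [_ g2] := sqintgD gf (f2 M); split => //.
  by apply: eq_intg g2 => x; rewrite subrK.
exists g => // e /key[M HM]; exists M => n Mn.
rewrite nsq_subC -lee_fin /nsq EFin_Rint//; first exact: HM.
exact: (sqintgB g2 (f2 n)).2.
Unshelve. all: by end_near. Qed.

End RieszFischer.

(** * Fubini's theorem and Schur's test *)

Section Fubini.
Context d1 d2 (T1 : measurableType d1) (T2 : measurableType d2) (R : realType).
Variable m1 : {sigma_finite_measure set T1 -> \bar R}.
Variable m2 : {sigma_finite_measure set T2 -> \bar R}.
Implicit Types f : T1 * T2 -> R.

(** The real integral of a section is the [fine] part of an extended one, hence 0 where the section
    is not integrable. It agrees with [fubini_F] only almost everywhere, and integrability and value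
    are transported along this almost everywhere equality. *)
Lemma Rint_fubiniL f : intg (m1 \x m2)%E f ->
  intg m1 (fun x => \int[m2]_y f (x, y)) /\
  \int[(m1 \x m2)%E]_z f z = \int[m1]_x \int[m2]_y f (x, y).
Proof.
move=> fi; have Fi := integrable_fubini_F fi.
have E : ae_eq m1 setT (fubini_F m2 (EFin \o f))
    (EFin \o (fun x => \int[m2]_y f (x, y))).
  move/integrable_ae : (Fi) => /(_ measurableT).
  by apply: filterS => x /= /(_ I) + _ => /fineK <-.
have mF : measurable_fun setT (fun x => \int[m2]_y f (x, y)).
  by apply: measurableT_comp => //; exact: measurable_int Fi.
split.
  apply/integrableP; split; first exact/measurable_EFinP.
  move/integrableP : Fi => [mFi].
  rewrite (@ae_eq_integral _ _ _ m1 setT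
    (fun x => `|(\int[m2]_y f (x, y))%R%:E|)%E) //.
  - by apply: measurableT_comp => //; exact: mFi.
  - by apply: measurableT_comp => //; exact/measurable_EFinP.
  - by apply: filterS E => x /= h /h ->.
rewrite /Rintegral -integral12_prod_meas1//; congr fine.
by apply: ae_eq_integral => //; [exact: measurable_int Fi|exact/measurable_EFinP].
Qed.

Lemma Rint_fubiniR f : intg (m1 \x m2)%E f ->
  intg m2 (fun y => \int[m1]_x f (x, y)) /\
  \int[(m1 \x m2)%E]_z f z = \int[m2]_y \int[m1]_x f (x, y).
Proof.
move=> fi; have mf := measurable_int _ fi.
have Fi : m2.-integrable setT (fubini_G m1 (EFin \o f)).
  apply/integrableP; split; first exact: (measurable_fubini_G fi).
  apply: le_lt_trans ((integrable21ltyP _ _ mf).1 fi).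
  apply: ge0_le_integral => //.
  - by apply: measurableT_comp => //; exact: (measurable_fubini_G fi).
  - apply: (measurable_fun_fubini_tonelli_G (abse \o (EFin \o f))) => //=.
    exact: measurableT_comp.
  - move=> y _; apply: le_abse_integral => //.
    exact: measurableT_comp.
have E : ae_eq m2 setT (fubini_G m1 (EFin \o f))
    (EFin \o (fun y => \int[m1]_x f (x, y))).
  move/integrable_ae : (Fi) => /(_ measurableT).
  by apply: filterS => x /= /(_ I) + _ => /fineK <-.
have mF : measurable_fun setT (fun y => \int[m1]_x f (x, y)).
  by apply: measurableT_comp => //; exact: measurable_int Fi.
split.
  apply/integrableP; split; first exact/measurable_EFinP.
  move/integrableP : Fi => [mFi].
  rewrite (@ae_eq_integral _ _ _ m2 setT
    (fun y => `|(\int[m1]_x f (x, y))%R%:E|)%E) //.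
  - by apply: measurableT_comp => //; exact: mFi.
  - by apply: measurableT_comp => //; exact/measurable_EFinP.
  - by apply: filterS E => x /= h /h ->.
rewrite /Rintegral -integral21_prod_meas1//; congr fine.
by apply: ae_eq_integral => //; [exact: measurable_int Fi|exact/measurable_EFinP].
Qed.

Lemma Rint_swap f : intg (m1 \x m2)%E f ->
  \int[m1]_x \int[m2]_y f (x, y) = \int[m2]_y \int[m1]_x f (x, y).
Proof. by move=> fi; rewrite -(Rint_fubiniL fi).2 (Rint_fubiniR fi).2. Qed.

Lemma intg_prodL f (c : R) : measurable_fun setT f ->
  (\int[m1]_x \int[m2]_y `|f (x, y)|%:E <= c%:E)%E -> intg (m1 \x m2)%E f.
Proof.
move=> mf H; apply/integrable12ltyP; first exact/measurable_EFinP.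
by apply: (le_lt_trans H); rewrite ltry.
Qed.

Lemma intg_prodR f (c : R) : measurable_fun setT f ->
  (\int[m2]_y \int[m1]_x `|f (x, y)|%:E <= c%:E)%E -> intg (m1 \x m2)%E f.
Proof.
move=> mf H; apply/integrable21ltyP; first exact/measurable_EFinP.
by apply: (le_lt_trans H); rewrite ltry.
Qed.

End Fubini.

Lemma weighted_CS d (T : measurableType d) (R : realType)
    (mu : {measure set T -> \bar R}) (w f : T -> R) :
  (forall x, 0 <= w x) -> intg mu w -> intg mu (fun x => w x * f x) ->
  intg mu (fun x => w x * f x ^+ 2) ->
  (\int[mu]_x (w x * f x)) ^+ 2 <= (\int[mu]_x w x) * \int[mu]_x (w x * f x ^+ 2).
Proof.
move=> w0 iw iwf iwf2; apply: discriminant_le0; first by apply: Rintegral_ge0.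
move=> t.
have -> : (\int[mu]_x w x) * t ^+ 2 + 2 * (\int[mu]_x (w x * f x)) * t +
    \int[mu]_x (w x * f x ^+ 2) = \int[mu]_x (w x * (t + f x) ^+ 2).
  transitivity (\int[mu]_x (t ^+ 2 * w x + (2 * t) * (w x * f x) + w x * f x ^+ 2)).
    rewrite RintegralD//; last by apply: intgD; exact: intgZ.
    rewrite RintegralD//; [|exact: intgZ|exact: intgZ].
    by rewrite !RintegralZl//; ring.
  by apply: eq_Rintegral => x _; ring.
by apply: Rintegral_ge0 => x _; rewrite mulr_ge0// sqr_ge0.
Qed.

(** Measurability is enough because [fine] sends infinite values to 0: if the integral is nonzero,
    the positive and negative parts both have finite integrals and the function is integrable. *)
Lemma Rint_norm_le d (T : measurableType d) (R : realType)
    (mu : {measure set T -> \bar R}) (f : T -> R) : measurable_fun setT f ->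
  `|\int[mu]_x f x| <= \int[mu]_x `|f x|.
Proof.
move=> mf; have [fi|nfi] := pselect (intg mu f); first exact: le_normr_Rintegral.
suff -> : \int[mu]_x f x = 0.
  by rewrite normr0; apply: Rintegral_ge0.
apply/eqP; apply: contrapT => /eqP nz; apply: nfi.
have ifin : (\int[mu]_x (f x)%:E)%E \is a fin_num.
  apply: contrapT => h; move: nz; rewrite /Rintegral.
  by case: (\int[mu]_x (f x)%:E)%E h => [r|_|_] //=; rewrite eqxx.
have := ifin; rewrite integralE fin_numD => /andP[p1 p2].
apply/integrableP; split; first exact/measurable_EFinP.
have -> : (fun x => `|(EFin \o f) x|%E) = (fun x => (EFin \o f)^\+ x + (EFin \o f)^\- x)%E.
  exact: (fune_abse (EFin \o f)).
rewrite ge0_integralD//; last 2 first.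
- by apply: measurable_funepos; exact/measurable_EFinP.
- by apply: measurable_funeneg; exact/measurable_EFinP.
rewrite lte_add_pinfty//; first by move: p1; rewrite fin_numE => /andP[_]; rewrite -ltey.
by move: p2; rewrite fin_numN fin_numE => /andP[_]; rewrite -ltey.
Qed.

(** Since [0^-1 = 0], inversion equals [x * (x^2)^-1] everywhere, and the second factor is a real
    power of a nonnegative function. *)
Lemma measurable_invr (R : realType) : measurable_fun setT (fun x : R => x^-1).
Proof.
have -> : (fun x : R => x^-1) = (fun x => x * ((x ^+ 2) `^ (- 1))).
  apply/funext => x; rewrite powR_inv1 ?sqr_ge0//.
  by have [->|x0] := eqVneq x 0; [rewrite invr0 mul0r|field].
apply: measurable_funM => //; apply: (measurableT_comp (measurable_powR _)).
exact: measurable_funX.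
Qed.

Lemma measurable_Rint_fst d1 d2 (T1 : measurableType d1) (T2 : measurableType d2)
  (R : realType) (m2 : {sigma_finite_measure set T2 -> \bar R}) (f : T1 * T2 -> R) :
  measurable_fun setT f -> measurable_fun setT (fun x => \int[m2]_y f (x, y)).
Proof.
move=> mf; apply: measurableT_comp => //.
have -> : (fun x => \int[m2]_y (f (x, y))%:E)%E =
    (fun x => \int[m2]_y (EFin \o f)^\+ (x, y) - \int[m2]_y (EFin \o f)^\- (x, y))%E.
  apply/funext => x; rewrite [LHS]integralE; congr (_ - _)%E.
    by apply: eq_integral => y _; rewrite !funeposE.
  by apply: eq_integral => y _; rewrite !funenegE.
apply: emeasurable_funB.
  apply: (measurable_fun_fubini_tonelli_F (EFin \o f)^\+%E) => //.
  by apply: measurable_funepos; exact/measurable_EFinP.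
apply: (measurable_fun_fubini_tonelli_F (EFin \o f)^\-%E) => //.
by apply: measurable_funeneg; exact/measurable_EFinP.
Qed.

Section Schur.
Context d1 d2 (T1 : measurableType d1) (T2 : measurableType d2) (R : realType).
Variable m1 : {sigma_finite_measure set T1 -> \bar R}.
Variable m2 : {sigma_finite_measure set T2 -> \bar R}.
Variables (K : T1 * T2 -> R) (w h : T2 -> R) (C1 C2 : R).
Hypothesis mK : measurable_fun setT K.
Hypothesis mw : measurable_fun setT w.
Hypothesis mh : measurable_fun setT h.
Hypothesis K0 : forall x, 0 <= K x.
Hypothesis w0 : forall z, 0 <= w z.
Hypothesis wK : forall x z, w z = 0 -> K (x, z) * h z = 0.
Hypothesis H1 : forall x, (\int[m2]_z (K (x, z) * w z)%:E <= C1%:E)%E.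
Hypothesis H2 : (\int[m2]_z \int[m1]_x (K (x, z) * (h z ^+ 2 / w z))%:E <= C2%:E)%E.

Let mK2 x : measurable_fun setT (fun z => K (x, z)).
Proof. exact: (measurableT_comp mK (measurable_pair1 x)). Qed.

Let mwV : measurable_fun setT (fun z => (w z)^-1).
Proof. by apply: (measurableT_comp (@measurable_invr R)). Qed.

Let mF : measurable_fun setT (fun p : T1 * T2 => K p * `|h p.2|).
Proof.
apply: measurable_funM => //; apply: measurableT_comp => //.
exact: measurableT_comp.
Qed.

Let mG : measurable_fun setT (fun p : T1 * T2 => K p * (h p.2 ^+ 2 / w p.2)).
Proof.
apply: measurable_funM => //; apply: measurable_funM.
  by apply: measurable_funX; exact: measurableT_comp.
exact: (measurableT_comp mwV).
Qed.

Let A x := (\int[m2]_z (K (x, z) * (h z ^+ 2 / w z))%:E)%E.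

Let mA : measurable_fun setT A.
Proof.
apply: (measurable_fun_fubini_tonelli_F (fun p : T1 * T2 => (K p * (h p.2 ^+ 2 / w p.2))%:E)).
  exact/measurable_EFinP.
by move=> p; rewrite lee_fin mulr_ge0// divr_ge0 ?sqr_ge0.
Qed.

Let A0 x : (0 <= A x)%E.
Proof.
by apply: integral_ge0 => z _; rewrite lee_fin mulr_ge0// divr_ge0 ?sqr_ge0.
Qed.

Let intA : (\int[m1]_x A x <= C2%:E)%E.
Proof.
rewrite (fubini_tonelli (fun p : T1 * T2 => (K p * (h p.2 ^+ 2 / w p.2))%:E))//.
  exact/measurable_EFinP.
by move=> p; rewrite lee_fin mulr_ge0// divr_ge0 ?sqr_ge0.
Qed.

(** Cauchy-Schwarz for the measure of density [K w]: [(\int K |h|)^2 <= (\int K w) (\int K h^2 /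
    w)]. *)
Let pointwise x : (A x < +oo)%E -> intg m2 (fun z => K (x, z) * `|h z|) /\
  (((\int[m2]_z (K (x, z) * `|h z|)) ^+ 2)%:E <= C1%:E * A x)%E.
Proof.
move=> Ax.
have [i1 l1] : intg m2 (fun z => K (x, z) * w z) /\ \int[m2]_z (K (x, z) * w z) <= C1.
  apply: Rint_le_ereal => //; first exact: measurable_funM.
  by move=> z; rewrite mulr_ge0.
have AE : A x = (fine (A x))%:E by rewrite fineK// ge0_fin_numE.
have [i2 l2] : intg m2 (fun z => K (x, z) * (h z ^+ 2 / w z)) /\
   \int[m2]_z (K (x, z) * (h z ^+ 2 / w z)) <= fine (A x).
  apply: Rint_le_ereal.
  - apply: measurable_funM => //; apply: measurable_funM => //.
    exact: measurable_funX.
  - by move=> z; rewrite mulr_ge0// divr_ge0 ?sqr_ge0.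
  - by rewrite -AE.
(* Division by a vanishing weight gives 0; by [wK] the product [K * |h|] vanishes there too, so
   [K * w * f] still equals [K * |h|]. *)
pose f z := `|h z| / w z.
have e1 z : K (x, z) * w z * f z = K (x, z) * `|h z|.
  rewrite /f; have [z0|z0] := eqVneq (w z) 0; last by field.
  rewrite z0 mulr0 mul0r; have := wK x z0 => /eqP; rewrite mulf_eq0 => /orP[/eqP->|/eqP->].
    by rewrite mul0r.
  by rewrite normr0 mulr0.
have e2 z : K (x, z) * w z * f z ^+ 2 = K (x, z) * (h z ^+ 2 / w z).
  rewrite /f; have [z0|z0] := eqVneq (w z) 0; first by rewrite z0 invr0 !mulr0 !mul0r.
  by rewrite exprMn real_normK ?num_real//; field.
have i3 : intg m2 (fun z => K (x, z) * w z * f z ^+ 2).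
  by apply: eq_intg i2 => z; rewrite e2.
have mKh : measurable_fun setT (fun z => K (x, z) * `|h z|).
  by apply: measurable_funM => //; exact: measurableT_comp.
have i4 : intg m2 (fun z => K (x, z) * `|h z|).
  apply: (intg_le mKh (intgD i1 i3)) => z.
  rewrite -e1 normrM ger0_norm ?mulr_ge0// -[X in X + _]mulr1 -mulrDr.
  rewrite ler_wpM2l ?mulr_ge0//.
  rewrite ger0_norm; last by rewrite divr_ge0.
  by have := sqr_ge0 (f z - 1); nra.
have i5 : intg m2 (fun z => K (x, z) * w z * f z) by apply: eq_intg i4 => z; rewrite e1.
split => //.
have wp z : 0 <= K (x, z) * w z by rewrite mulr_ge0.
have := weighted_CS wp i1 i5 i3.
have -> : \int[m2]_z (K (x, z) * w z * f z) = \int[m2]_z (K (x, z) * `|h z|).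
  by apply: eq_Rintegral => z _; exact: e1.
have -> : \int[m2]_z (K (x, z) * w z * f z ^+ 2) =
    \int[m2]_z (K (x, z) * (h z ^+ 2 / w z)).
  by apply: eq_Rintegral => z _; exact: e2.
move=> cs; rewrite AE -EFinM lee_fin (le_trans cs)//.
apply: ler_pM => //; apply: Rintegral_ge0 => z _ //.
by rewrite mulr_ge0// divr_ge0 ?sqr_ge0.
Qed.

Let aeA : {ae m1, forall x, (A x < +oo)%E}.
Proof.
have : m1.-integrable setT A.
  apply/integrableP; split => //.
  under eq_integral do rewrite gee0_abs//.
  by apply: (le_lt_trans intA); rewrite ltry.
move=> /(integrable_ae measurableT); apply: filterS => x /(_ I).
by rewrite ge0_fin_numE.
Qed.

Lemma schur_ae : {ae m1, forall x, intg m2 (fun z => K (x, z) * `|h z|)}.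
Proof. by apply: filterS aeA => x /pointwise[]. Qed.

Lemma schur_abs : sqintg m1 (fun x => \int[m2]_z (K (x, z) * `|h z|)) /\
  nsq m1 (fun x => \int[m2]_z (K (x, z) * `|h z|)) <= C1 * C2.
Proof.
have mV : measurable_fun setT (fun x => \int[m2]_z (K (x, z) * `|h z|)).
  apply: measurableT_comp => //.
  apply: (measurable_fun_fubini_tonelli_F (fun p : T1 * T2 => (K p * `|h p.2|)%:E)).
    exact/measurable_EFinP.
  by move=> p; rewrite lee_fin mulr_ge0.
suff H : (\int[m1]_x ((\int[m2]_z (K (x, z) * `|h z|)) ^+ 2)%:E <= (C1 * C2)%:E)%E.
  have [||i l] := Rint_le_ereal _ _ H; first exact: measurable_funX.
    by move=> x; exact: sqr_ge0.
  by split.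
have C10 : (0 <= C1%:E)%E.
  by apply: le_trans (H1 point); apply: integral_ge0 => z _; rewrite lee_fin mulr_ge0.
apply: (@le_trans _ _ (\int[m1]_x (C1%:E * A x))%E).
    apply: ae_ge0_le_integral => //.
  - by move=> x _; rewrite lee_fin sqr_ge0.
  - by apply/measurable_EFinP; exact: measurable_funX.
  - by move=> x _; rewrite mule_ge0.
  - exact: measurable_funeM.
  - by apply: filterS aeA => x /pointwise[_ +] _.
by rewrite ge0_integralZl// EFinM lee_wpmul2l.
Qed.

Lemma schur : sqintg m1 (fun x => \int[m2]_z (K (x, z) * h z)) /\
  nsq m1 (fun x => \int[m2]_z (K (x, z) * h z)) <= C1 * C2.
Proof.
have [s1 s2] := schur_abs.
have mV : measurable_fun setT (fun x => \int[m2]_z (K (x, z) * h z)).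
  apply: (@measurable_Rint_fst _ _ _ _ _ m2 (fun p => K p * h p.2)).
  by apply: measurable_funM => //; exact: measurableT_comp.
have le x : `|\int[m2]_z (K (x, z) * h z)| <= `|\int[m2]_z (K (x, z) * `|h z|)|.
  rewrite [leRHS]ger0_norm; last by apply: Rintegral_ge0 => z _; rewrite mulr_ge0.
  apply: le_trans (Rint_norm_le _ _) _; first exact: measurable_funM.
  rewrite le_eqVlt; apply/orP; left; apply/eqP; apply: eq_Rintegral => z _.
  by rewrite normrM ger0_norm.
have s3 := sqintg_le mV s1 le.
split; first exact: s3.
exact: le_trans (nsq_le s3 s1 le) s2.
Qed.

End Schur.

(** * Smooth functions *)

Section Smooth.
Variables (R : realType) (V : normedModType R).
Implicit Types f g : V -> R.

Lemma smooth_differentiable f x : smooth f -> differentiable f x.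
Proof. by move=> /(_ [::] x). Qed.

Lemma smooth_derive f v : smooth f -> smooth ('D_v f).
Proof. by move=> sf s x; have := sf (rcons s v) x; rewrite foldr_rcons. Qed.

Lemma smooth_ext f g : f =1 g -> smooth f -> smooth g.
Proof. by move=> /funext ->. Qed.

Inductive gen_alg (B : (V -> R) -> Prop) : (V -> R) -> Prop :=
| gen_alg_base f : B f -> gen_alg B f
| gen_alg_cst k : gen_alg B (fun _ => k)
| gen_alg_add f g : gen_alg B f -> gen_alg B g -> gen_alg B (fun x => f x + g x)
| gen_alg_mul f g : gen_alg B f -> gen_alg B g -> gen_alg B (fun x => f x * g x).

(** By the Leibniz rule the algebra is stable under all directional derivatives as soon as the
    derivatives of its generators lie in it. Every iterated derivative is then in the algebra, hence
    differentiable, and no formula for higher derivatives is ever written. *)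
Lemma gen_alg_smooth (B : (V -> R) -> Prop) :
  (forall f, B f -> (forall x, differentiable f x) /\
                    forall v, gen_alg B ('D_v f)) ->
  forall f, gen_alg B f -> smooth f.
Proof.
move=> HB.
have H : forall f, gen_alg B f -> (forall x, differentiable f x) /\
    forall v, gen_alg B ('D_v f).
  move=> f; elim=> [{}f Bf|k|{}f g fa [df Df] ga [dg Dg]|{}f g fa [df Df] ga [dg Dg]].
  - exact: HB.
  - split=> [x|v]; first exact: differentiable_cst.
    have -> : 'D_v (fun _ : V => k) = (fun _ => 0).
      by apply/funext => x; exact: derive_cst.
    exact: gen_alg_cst.
  - split=> [x|v]; first exact: (differentiableD (df x) (dg x)).
    have -> : 'D_v (fun x => f x + g x) = (fun x => 'D_v f x + 'D_v g x).
      by apply/funext => x; exact: (deriveD (diff_derivable (df x)) (diff_derivable (dg x))).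
    by apply: gen_alg_add.
  - split=> [x|v]; first exact: (differentiableM (df x) (dg x)).
    have -> : 'D_v (fun x => f x * g x) = (fun x => f x * 'D_v g x + g x * 'D_v f x).
      by apply/funext => x; exact: (deriveM (diff_derivable (df x)) (diff_derivable (dg x))).
    by apply: gen_alg_add; apply: gen_alg_mul.
move=> f fa s x; suff : gen_alg B (foldr (fun v g => 'D_v g) f s).
  by move=> /H[].
by elim: s => // v s ih; exact: (H _ ih).2.
Qed.

Lemma alg_smooth_smooth f : gen_alg (@smooth R V R) f -> smooth f.
Proof.
apply: gen_alg_smooth => {}f sf; split=> [x|v]; first exact: smooth_differentiable.
by apply: gen_alg_base; exact: smooth_derive.
Qed.

Lemma smooth_cst (k : R) : smooth (fun _ : V => k).
Proof. by apply: alg_smooth_smooth; exact: gen_alg_cst. Qed.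

Lemma smoothD f g : smooth f -> smooth g -> smooth (fun x => f x + g x).
Proof. by move=> sf sg; apply: alg_smooth_smooth; apply: gen_alg_add; exact: gen_alg_base. Qed.

Lemma smoothM f g : smooth f -> smooth g -> smooth (fun x => f x * g x).
Proof. by move=> sf sg; apply: alg_smooth_smooth; apply: gen_alg_mul; exact: gen_alg_base. Qed.

Lemma smoothZ (k : R) f : smooth f -> smooth (fun x => k * f x).
Proof. by move=> sf; apply: smoothM => //; exact: smooth_cst. Qed.

Lemma smoothN f : smooth f -> smooth (fun x => - f x).
Proof. by move=> /(smoothZ (-1)); apply: smooth_ext => x; rewrite mulN1r. Qed.

Lemma smoothB f g : smooth f -> smooth g -> smooth (fun x => f x - g x).
Proof. by move=> sf sg; apply: smoothD => //; exact: smoothN. Qed.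

Lemma smoothX f n : smooth f -> smooth (fun x => f x ^+ n).
Proof.
move=> sf; elim: n => [|n ih].
  by apply: (smooth_ext _ (smooth_cst 1)) => x; rewrite expr0.
by apply: (smooth_ext _ (smoothM sf ih)) => x; rewrite exprS.
Qed.

Lemma smooth_continuous f : smooth f -> continuous f.
Proof. by move=> sf x; apply: differentiable_continuous; exact: smooth_differentiable. Qed.

Lemma derive_comp_real (g : R -> R) f x v : differentiable f x ->
  differentiable g (f x) -> 'D_v (g \o f) x = 'D_1 g (f x) * 'D_v f x.
Proof.
move=> df dg; rewrite !deriveE//; last exact: differentiable_comp.
rewrite diff_comp//= !deriv1E; try exact/derivable1_diffP.
by rewrite /GRing.scale/= mul1r mulrC.
Qed.

End Smooth.

Lemma smooth_comp (R : realType) (V : normedModType R) (g : R -> R) (f : V -> R) :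
  smooth g -> smooth f -> smooth (fun x => g (f x)).
Proof.
move=> sg sf.
(* The chain rule writes the derivative of a composition with [f] as a product of two generators:
   another composition with [f], and a derivative of [f]. *)
pose B h := smooth h \/ exists2 g1 : R -> R, smooth g1 & h = g1 \o f.
apply: (@gen_alg_smooth _ _ B); last by apply: gen_alg_base; right; exists g.
move=> h [sh|[g1 sg1 ->]]; split.
- by move=> x; exact: smooth_differentiable.
- by move=> v; apply: gen_alg_base; left; exact: smooth_derive.
- by move=> x; apply: differentiable_comp; exact: smooth_differentiable.
- move=> v; have -> : 'D_v (g1 \o f) = (fun x => ('D_1 g1 \o f) x * 'D_v f x).
    by apply/funext => x; rewrite derive_comp_real//; exact: smooth_differentiable.
  apply: gen_alg_mul; apply: gen_alg_base.
    by right; exists ('D_1 g1) => //; exact: smooth_derive.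
  by left; exact: smooth_derive.
Qed.

Lemma smooth_linear (R : realType) (V : normedModType R) (f : V -> R) :
  linear f -> continuous f -> smooth f.
Proof.
move=> lf cf.
pose fL : {linear V -> R} := HB.pack f (GRing.isLinear.Build _ _ _ _ _ lf).
have df x : differentiable f x by exact: (@linear_differentiable _ _ _ fL).
apply: (@gen_alg_smooth _ _ (eq f)); last exact: gen_alg_base.
move=> _ <-; split=> // v.
have -> : 'D_v f = (fun _ => f v); last exact: gen_alg_cst.
by apply/funext => x; rewrite deriveE// (@diff_lin _ _ _ fL).
Qed.

Lemma smooth_id (R : realType) : smooth (fun x : R => x).
Proof. by apply: smooth_linear => // x; exact: cvg_id. Qed.

Lemma smooth_fst (R : realType) : smooth (fun x : R * R => x.1).
Proof. by apply: smooth_linear => // x; exact: cvg_fst. Qed.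

Lemma smooth_snd (R : realType) : smooth (fun x : R * R => x.2).
Proof. by apply: smooth_linear => // x; exact: cvg_snd. Qed.

Lemma smooth_expR (R : realType) : smooth (@expR R).
Proof.
apply: (@gen_alg_smooth _ _ (eq (@expR R))); last exact: gen_alg_base.
move=> _ <-; split=> [x|v]; first exact/derivable1_diffP.
have -> : 'D_v (@expR R) = (fun x => v * expR x); last first.
  by apply: gen_alg_mul; [exact: gen_alg_cst|exact: gen_alg_base].
apply/funext => x; rewrite deriveE; last exact/derivable1_diffP.
by rewrite deriv1E// derive1E (congr1 (fun g => g x) (derive_expR R)).
Qed.

Section QuadraticRemainder.
Variables (R : realType) (V : normedModType R).

(** A quadratic bound can be read off Taylor's formula with an explicit constant; convolutions,
    [flat] at 0 and quadratic polynomials are differentiated through it. *)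
Lemma quad_remainder_diff (f : V -> R) (x : V) (L : {linear V -> R}) (C : R) :
  continuous L -> (forall h, `|h| <= 1 -> `|f (h + x) - f x - L h| <= C * `|h| ^+ 2) ->
  differentiable f x /\ 'd f x = L :> (V -> R).
Proof.
move=> cL H.
have E : f \o shift x = cst (f x) + L +o_ (0 : V) id.
  apply/eqaddoP => e e0; near=> h.
  rewrite /= -[X in `|X|]/(f (h + x) - (f x + L h)) opprD addrA.
  apply: (@le_trans _ _ (C * `|h| ^+ 2)).
    apply: H; apply: ltW; near: h.
    by apply/nbhs_norm0P; exists 1 => //=.
  rewrite expr2 mulrA ler_wpM2r//.
  have C0 : 0 < `|C| + 1 by rewrite ltr_wpDl.
  apply: (@le_trans _ _ ((`|C| + 1) * `|h|)).
    by rewrite ler_wpM2r// (le_trans (ler_norm _))// lerDl.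
  rewrite mulrC -ler_pdivlMr//; apply: ltW; near: h.
  by apply/nbhs_norm0P; exists (e / (`|C| + 1)) => //=; rewrite divr_gt0.
have dE := diff_unique cL E.
by split=> //; apply/diff_locallyP; rewrite dE.
Unshelve. all: by end_near. Qed.

End QuadraticRemainder.

Lemma is_derive_quad (R : realType) (f : R -> R) (x a C : R) :
  (forall h, `|f (h + x) - f x - h * a| <= C * h ^+ 2) -> is_derive x 1 f a.
Proof.
move=> H.
pose L (h : R) : R := h * a.
have lL : linear L by move=> k u v; rewrite /L mulrDl -mulrA.
pose fL : {linear R -> R} := HB.pack L (GRing.isLinear.Build _ _ _ _ _ lL).
have [||d1 d2] := @quad_remainder_diff R R f x fL C.
- by move=> y; apply: mulrr_continuous.
- by move=> h _; rewrite real_normK ?num_real//; exact: H.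
apply: DeriveDef; first exact: diff_derivable.
by rewrite deriveE// d2 /= /L mul1r.
Qed.

Section Flat.
Variable R : realType.

(* The derivatives at 0 of [x^-k e^(-1/x)] all vanish since
   [e^(-1/x) <= (n x)^n] for every [n]. *)
Definition flat (k : nat) (x : R) : R :=
  if 0 < x then x^-1 ^+ k * expR (- x^-1) else 0.

Lemma flat_ge0 k x : 0 <= flat k x.
Proof.
by rewrite /flat; case: ifPn => // x0; rewrite mulr_ge0 ?expR_ge0// exprn_ge0// invr_ge0 ltW.
Qed.

(** Quadratic smallness at 0 is what makes the derivative vanish there. As [e^(1/x)] is the power
    [k + 2] of [e^(1/((k+2)x))] and [e^z >= z], it is at least [((k+2)x)^-(k+2)]; this exponent
    cancels [x^-k] and leaves [x^2]. *)
Lemma flat_le k x : flat k x <= k.+2%:R ^+ k.+2 * x ^+ 2.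
Proof.
rewrite /flat; case: ifPn => [x0|_]; last by rewrite mulr_ge0 ?sqr_ge0// exprn_ge0.
have n0 : (0 : R) < k.+2%:R by rewrite ltr0n.
have h : (k.+2%:R * x)^-1 ^+ k.+2 <= expR x^-1.
  have -> : x^-1 = k.+2%:R * (k.+2%:R * x)^-1 by field; rewrite (gt_eqF x0) gt_eqF.
  rewrite expRM_natl lerXn2r ?nnegrE ?expR_ge0// ?invr_ge0 ?mulr_ge0// ?(ltW x0)//.
  by apply: le_trans (expR_ge1Dx _); rewrite lerDr.
have e0 := expR_gt0 x^-1.
rewrite expRN ler_pdivrMr//.
apply: le_trans (ler_wpM2l _ h); last by rewrite mulr_ge0 ?sqr_ge0// exprn_ge0.
rewrite le_eqVlt; apply/orP; left; apply/eqP.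
rewrite invfM exprMn -addn2 !exprD.
set a := (k + 2)%:R; have aV : a^-1 * a = 1 by rewrite mulVf// /a addn2 gt_eqF.
have ak : a^-1 ^+ k * a ^+ k = 1 by rewrite -exprMn aV expr1n.
have xV : x^-1 * x = 1 by rewrite mulVf ?gt_eqF.
transitivity ((a^-1 ^+ k * a ^+ k) * (a^-1 * a) ^+ 2 * (x^-1 * x) ^+ 2 * x^-1 ^+ k).
  by rewrite ak aV xV !expr1n !mul1r.
ring.
Qed.

Lemma is_derive_flat k (x : R) :
  is_derive x (1 : R) (flat k) (- k%:R * flat k.+1 x + flat k.+2 x).
Proof.
have [x0|x0|x0] := ltgtP x 0.
- have E : flat k.+1 x = 0 /\ flat k.+2 x = 0 by rewrite /flat (lt_gtF x0).
  rewrite E.1 E.2 mulr0 addr0.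
  apply: (@near_eq_is_derive _ _ _ (cst 0 : R -> R)).
  near=> y; rewrite /flat ltNge ltW//=.
  by near: y; exact: lt_nbhsl.
- have E j : flat j x = x^-1 ^+ j * expR (- x^-1) by rewrite /flat x0.
  rewrite !E.
  have xn0 : x != 0 by rewrite gt_eqF.
  have h : is_derive x 1 (fun y : R => y^-1 ^+ k * expR (- y^-1))
     (- k%:R * (x^-1 ^+ k.+1 * expR (- x^-1)) + x^-1 ^+ k.+2 * expR (- x^-1)).
    have d1 : is_derive x 1 (fun y : R => y^-1) (- x ^- 2).
      apply: (DeriveDef (derivableV xn0 (@derivable_id _ _ x 1))).
      by rewrite (deriveV xn0 (@derivable_id _ _ x 1)) derive_id /GRing.scale/= mulr1.
    have d2 : is_derive x 1 (fun y : R => expR (- y^-1)) (expR (- x^-1) * (x ^- 2)).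
      apply: (@is_derive1_comp _ expR (fun y => - y^-1)); rewrite -[x ^- 2]opprK.
      by apply: is_deriveN.
    have d3 : is_derive x 1 (fun y : R => y^-1 ^+ k) (k%:R * x^-1 ^+ k.-1 * (- x ^- 2)).
      apply: (@is_derive1_comp _ (fun z => z ^+ k) (fun y => y^-1)) => //.
      apply: DeriveDef; first exact: exprn_derivable.
      by rewrite exp_derive /GRing.scale/= mulr1.
    have d4 := is_deriveM d3 d2.
    apply: is_derive_eq d4 _.
    rewrite /GRing.scale/= -!exprVn.
    case: k {d3 E} => [|k]; first by rewrite /= !mul0r oppr0 mul0r mulr0 addr0 expr0; ring.
    by rewrite /= !exprS; ring.
  apply: (@near_eq_is_derive _ _ _ (fun y : R => y^-1 ^+ k * expR (- y^-1))).
  near=> y; rewrite /flat ifT//.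
  by near: y; exact: lt_nbhsr.
- have E j : flat j 0 = 0 by rewrite /flat ltxx.
  rewrite x0 !E mulr0 addr0.
  apply: (@is_derive_quad _ _ _ _ (k.+2%:R ^+ k.+2)) => h.
  rewrite addr0 E mulr0 !subr0.
  by rewrite ger0_norm ?flat_ge0// flat_le.
Unshelve. all: by end_near. Qed.

Lemma smooth_flat k : smooth (flat k).
Proof.
apply: (@gen_alg_smooth _ _ (fun f => exists k, f = flat k)); last first.
  by apply: gen_alg_base; exists k.
move=> _ [j ->]; have dj x : differentiable (flat j) x.
  by apply/derivable1_diffP; have [] := is_derive_flat j x.
split=> // v.
have -> : 'D_v (flat j) = (fun x => v * (- j%:R * flat j.+1 x + flat j.+2 x)).
  apply/funext => x; rewrite deriveE// deriv1E; last exact/derivable1_diffP.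
  by rewrite derive1E; have [_ ->] := is_derive_flat j x.
apply: gen_alg_mul; first exact: gen_alg_cst.
apply: gen_alg_add; last by apply: gen_alg_base; exists j.+2.
by apply: gen_alg_mul; [exact: gen_alg_cst|apply: gen_alg_base; exists j.+1].
Qed.

End Flat.

(** * Test functions on the plane *)

Lemma Rint0 d (T : measurableType d) (R : realType) (mu : {measure set T -> \bar R})
  (f : T -> R) : (forall x, f x = 0) -> \int[mu]_x f x = 0.
Proof. by move=> f0; rewrite /Rintegral integral0_eq// => x _; rewrite f0. Qed.

Lemma intg_indic d (T : measurableType d) (R : realType)
  (mu : {measure set T -> \bar R}) (A : set T) :
  d.-measurable A -> (mu A < +oo)%E -> intg mu (\1_A : T -> R).
Proof.
move=> mA Aoo; apply/integrableP; split; first exact/measurable_EFinP.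
rewrite (eq_integral (fun x => (\1_A x)%:E)) ?integral_indic ?setIT//.
by move=> t _; rewrite gee0_abs// lee_fin.
Qed.

Section PlaneTopology.
Variable R : realType.
Local Notation leb := (@lebesgue_measure R).
Local Notation leb2 := (leb \x leb)%E.

Lemma prod_norm_le (x : R * R) (M : R) : (`|x| <= M) = (`|x.1| <= M) && (`|x.2| <= M).
Proof. by rewrite prod_normE ge_max. Qed.

Lemma norm_fst_le (x : R * R) : `|x.1| <= `|x|.
Proof. by rewrite prod_normE le_max lexx. Qed.

Lemma norm_snd_le (x : R * R) : `|x.2| <= `|x|.
Proof. by rewrite prod_normE le_max lexx orbT. Qed.

Lemma prod_norm_lt (x : R * R) (M : R) : (`|x| < M) = (`|x.1| < M) && (`|x.2| < M).
Proof. by rewrite prod_normE gt_max. Qed.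

Definition box (M : R) : set (R * R) := [set x | `|x| <= M].

Lemma boxE M : box M = `[-M, M] `*` `[-M, M].
Proof.
apply/seteqP; split => x; rewrite /box /= prod_norm_le !in_itv/= -!ler_norml.
  by move=> /andP[].
by move=> [-> ->].
Qed.

Lemma compact_box M : compact (box M).
Proof. by rewrite boxE; apply: compact_setX; exact: segment_compact. Qed.

Lemma measurable_box M : measurable (box M).
Proof. by rewrite boxE; apply: measurableX. Qed.

Lemma measure_box_lty M : (leb2 (box M) < +oo)%E.
Proof.
rewrite boxE product_measure1E//= lebesgue_measure_itv.
by case: ifPn => _; rewrite ?mule0 ?mul0e ?ltry// -!EFinD -EFinM ltry.
Qed.

(** A ball of the max norm is a product of intervals, so it lies in the product sigma-algebra; an
    open set is the countable union of the balls with rational centre and radius [1/(n+1)] that it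
    contains. *)
Lemma open_prod_measurable (U : set (R * R)) : open U -> measurable U.
Proof.
move=> oU.
pose B (i : rat * rat * nat) : set (R * R) :=
  [set x | `|x - (ratr i.1.1, ratr i.1.2)| < i.2.+1%:R^-1].
have mB i : measurable (B i).
  have -> : B i = [set x | `|x - ratr i.1.1| < i.2.+1%:R^-1] `*`
                  [set x | `|x - ratr i.1.2| < i.2.+1%:R^-1].
    apply/seteqP; split => x; rewrite /B /= prod_norm_lt /=.
      by move=> /andP[].
    by move=> [-> ->].
  apply: measurableX.
    rewrite (_ : mkset _ = ball_ Num.norm (ratr i.1.1) i.2.+1%:R^-1); last first.
      by apply/seteqP; split => x; rewrite /ball_/= distrC.
    by rewrite ball_normE; exact: measurable_ball.
  rewrite (_ : mkset _ = ball_ Num.norm (ratr i.1.2) i.2.+1%:R^-1); last first.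
    by apply/seteqP; split => x; rewrite /ball_/= distrC.
  by rewrite ball_normE; exact: measurable_ball.
pose F i := if pselect (B i `<=` U) then B i else set0.
have -> : U = \bigcup_i F i.
  apply/seteqP; split => [x Ux|x [i _]]; last by rewrite /F; case: pselect => // s /s.
  have /nbhs_normP[e /= e0 He] : nbhs x U by exact: open_nbhs_nbhs.
  have [n n0] : exists n, n.+1%:R^-1 < e / 2.
    have e2 : 0 < e / 2 by rewrite divr_gt0.
    have [n _ nP] := near_infty_natSinv_lt (PosNum e2).
    by exists n; exact: (nP n (leqnn n)).
  have d0 : 0 < n.+1%:R^-1 :> R by rewrite invr_gt0.
  have [p Hp] : exists p : rat, `|x.1 - ratr p| < n.+1%:R^-1.
    have [|p] := @rat_in_itvoo R (x.1 - n.+1%:R^-1) (x.1 + n.+1%:R^-1); first by rewrite ltrBlDr -addrA ltrDl addr_gt0.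
    by rewrite in_itv/= => /andP[h1 h2]; exists p; rewrite ltr_norml; move: h1 h2; move: (n.+1%:R^-1) => d h1 h2; apply/andP; split; lra.
  have [q Hq] : exists q : rat, `|x.2 - ratr q| < n.+1%:R^-1.
    have [|q] := @rat_in_itvoo R (x.2 - n.+1%:R^-1) (x.2 + n.+1%:R^-1); first by rewrite ltrBlDr -addrA ltrDl addr_gt0.
    by rewrite in_itv/= => /andP[h1 h2]; exists q; rewrite ltr_norml; move: h1 h2; move: (n.+1%:R^-1) => d h1 h2; apply/andP; split; lra.
  have Bx : B (p, q, n) x by rewrite /B/= prod_norm_lt/= Hp Hq.
  exists (p, q, n) => //; rewrite /F; case: pselect => // -[] y By.
  apply: He => /=.
  have -> : x - y = (x - (ratr p, ratr q)) - (y - (ratr p, ratr q)).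
    by rewrite opprB addrA subrK.
  apply: (le_lt_trans (ler_normB _ _)).
  by apply: (lt_trans (ltrD Bx By)); rewrite /=; move: n0; move: (n.+1%:R^-1) => d; lra.
apply: countable_bigcupT_measurable => //= i.
by rewrite /F; case: pselect => h /=; [exact: mB|exact: measurable0].
Qed.

Lemma continuous_prod_measurable (f : R * R -> R) :
  continuous f -> measurable_fun setT f.
Proof.
move=> /continuousP cf; apply: (measurability _ (RGenOpens.measurableE R)).
move=> _ [_ [a [b ->] <-]]; rewrite setTI; apply: open_prod_measurable.
exact/cf/interval_open.
Qed.

End PlaneTopology.

Section DirectionalDerivative.
Variables (R : realType) (V : normedModType R).

Lemma is_derive_line (f : V -> R) (x v : V) (t : R) :
  differentiable f (x + t *: v) ->
  is_derive t (1 : R) (fun s : R => f (x + s *: v)) ('D_v f (x + t *: v)).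
Proof.
move=> df; have dfv := diff_derivable (v := v) df.
have E : (fun h : R => h^-1 *: (f (x + (h *: 1 + t) *: v) - f (x + t *: v))) =
    (fun h => h^-1 *: (f (h *: v + (x + t *: v)) - f (x + t *: v))).
  apply/funext => h; congr (_ *: (f _ - _)).
  by rewrite [h%:A]mulr1 scalerDl addrCA.
apply: DeriveDef; first by rewrite /derivable E.
by rewrite /derive E.
Qed.

Lemma derive_dirD (f : V -> R) x u v : differentiable f x ->
  'D_(u + v) f x = 'D_u f x + 'D_v f x.
Proof. by move=> df; rewrite !deriveE// linearD. Qed.

Lemma derive_dirZ (f : V -> R) x (k : R) v : differentiable f x ->
  'D_(k *: v) f x = k * 'D_v f x.
Proof. by move=> df; rewrite !deriveE// linearZ. Qed.

End DirectionalDerivative.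

Lemma Rint_derive_supp (R : realType) (g g' : R -> R) (M : R) :
  (forall t : R, is_derive t (1 : R) g (g' t)) -> continuous g' ->
  (forall t, M < `|t| -> g t = 0) -> (forall t, M < `|t| -> g' t = 0) ->
  \int[@lebesgue_measure R]_t g' t = 0.
Proof.
move=> dg cg' g0 g'0; pose N := `|M| + 1.
have N0 : 0 < N by rewrite ltr_wpDl.
have MN : M < N by rewrite /N (le_lt_trans (ler_norm M))// ltrDl.
have cg : continuous g.
  move=> t; apply: differentiable_continuous; apply/derivable1_diffP.
  by case: (dg t).
have -> : \int[@lebesgue_measure R]_t g' t =
    \int[@lebesgue_measure R]_(t in `[-N, N]) g' t.
  rewrite [RHS]Rintegral_mkcond; apply: eq_Rintegral => t _.
  rewrite patchE; case: ifPn => //; rewrite notin_setE/= in_itv/= -ler_norml.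
  by move=> /negP; rewrite -ltNge => tN; apply: g'0; exact: lt_trans tN.
rewrite /Rintegral (@continuous_FTC2 _ g' g).
- by rewrite !g0 ?subee// ?normrN (gtr0_norm N0).
- by lra.
- exact: continuous_subspaceT.
- split=> [t _|/=|/=]; first by case: (dg t).
    by apply: cvg_at_right_filter; exact: cg.
  by apply: cvg_at_left_filter; exact: cg.
- by move=> t _; rewrite derive1E; case: (dg t).
Qed.

Lemma add_scale_e1 (R : realType) (a b t : R) : (a, b) + t *: e1 R = (a + t, b).
Proof.
by apply: injective_projections; rewrite /= /GRing.scale/= ?mulr1 ?mulr0 ?addr0.
Qed.

Lemma add_scale_e2 (R : realType) (a b t : R) : (a, b) + t *: e2 R = (a, b + t).
Proof.
by apply: injective_projections; rewrite /= /GRing.scale/= ?mulr1 ?mulr0 ?addr0.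
Qed.

Lemma continuous_slice1 (R : realType) (f : R * R -> R) (y : R) :
  continuous f -> continuous (fun t => f (t, y)).
Proof.
move=> cf t; apply: (@continuous_comp _ _ _ (fun t : R => (t, y)) f); last exact: cf.
apply: differentiable_continuous; apply: differentiable_pair.
  exact/derivable1_diffP.
exact: differentiable_cst.
Qed.

Lemma continuous_slice2 (R : realType) (f : R * R -> R) (x : R) :
  continuous f -> continuous (fun t => f (x, t)).
Proof.
move=> cf t; apply: (@continuous_comp _ _ _ (fun t : R => (x, t)) f); last exact: cf.
apply: differentiable_continuous; apply: differentiable_pair.
  exact: differentiable_cst.
exact/derivable1_diffP.
Qed.

Section TestFunctions.
Variable R : realType.
Local Notation leb := (@lebesgue_measure R).
Local Notation leb2 := (leb \x leb)%E.
Implicit Types phi psi : R * R -> R.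

Definition testf phi := smooth phi /\ exists M, forall x, M < `|x| -> phi x = 0.

Lemma supp_derive phi (M : R) v : (forall x, M < `|x| -> phi x = 0) ->
  forall x, M < `|x| -> 'D_v phi x = 0.
Proof.
move=> H x Mx; rewrite -[RHS](derive_cst (0 : R) x v); apply: near_eq_derive.
apply/nbhs_normP; exists (`|x| - M) => /=; first by rewrite subr_gt0.
move=> y /= xy; apply: H.
by have := ler_distD y x 0; rewrite !subr0; move: xy => /=; lra.
Qed.

Lemma testf_smooth phi : testf phi -> smooth phi.
Proof. by case. Qed.

Lemma testf_derive phi v : testf phi -> testf ('D_v phi).
Proof.
move=> [sp [M H]]; split; first exact: smooth_derive.
by exists M; exact: supp_derive.
Qed.

Lemma testfD phi psi : testf phi -> testf psi -> testf (fun x => phi x + psi x).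
Proof.
move=> [s1 [M1 H1]] [s2 [M2 H2]]; split; first exact: smoothD.
exists (Num.max M1 M2) => x; rewrite gt_max => /andP[h1 h2].
by rewrite H1// H2// addr0.
Qed.

Lemma testfMl phi psi : smooth phi -> testf psi -> testf (fun x => phi x * psi x).
Proof.
move=> s1 [s2 [M2 H2]]; split; first exact: smoothM.
by exists M2 => x h; rewrite H2// mulr0.
Qed.

Lemma testfZ (k : R) phi : testf phi -> testf (fun x => k * phi x).
Proof. by apply: testfMl; exact: smooth_cst. Qed.

Lemma testfN phi : testf phi -> testf (fun x => - phi x).
Proof.
move=> /(testfZ (-1)); have -> // : (fun x => -1 * phi x) = (fun x => - phi x).
by apply/funext => x; rewrite mulN1r.
Qed.

Lemma testfB phi psi : testf phi -> testf psi -> testf (fun x => phi x - psi x).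
Proof. by move=> t1 t2; apply: testfD => //; exact: testfN. Qed.

Lemma testf_cst0 : testf (fun _ => 0).
Proof. by split; [exact: smooth_cst|exists 0]. Qed.

Lemma testf_continuous phi : testf phi -> continuous phi.
Proof. by move=> [s _]; exact: smooth_continuous. Qed.

Lemma testf_measurable phi : testf phi -> measurable_fun setT phi.
Proof. by move=> /testf_continuous; exact: continuous_prod_measurable. Qed.

Lemma testf_bounded phi : testf phi -> exists2 C, 0 <= C & forall x, `|phi x| <= C.
Proof.
move=> tp; have [_ [M H]] := tp.
have cn : {within box M, continuous (fun x => `|phi x|)}.
  apply: continuous_subspaceT => x.
  by apply: continuous_comp; [exact: testf_continuous|exact: norm_continuous].
have [b0|b0] := pselect (box M !=set0); last first.
  exists 0 => // x; rewrite H ?normr0// ltNge; apply/negP => xM.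
  by apply: b0; exists x.
have [c _ Hc] := compact_EVT_max b0 (@compact_box R M) cn.
exists `|phi c| => // x; have [Mx|xM] := ltP M `|x|; first by rewrite H// normr0.
by apply: Hc; rewrite inE.
Qed.

Lemma intg_bounded_supp (f : R * R -> R) (C M : R) : measurable_fun setT f ->
  (forall x, `|f x| <= C) -> (forall x, M < `|x| -> f x = 0) -> intg leb2 f.
Proof.
move=> mf fC f0; apply: (@intg_le _ _ _ leb2 _ (fun x => C * \1_(box M) x)) => //.
  apply: intgZ; apply: intg_indic; first exact: measurable_box.
  exact: measure_box_lty.
move=> x; rewrite indicE; have [xM|xM] := boolP (x \in box M).
  by rewrite mulr1.
rewrite mulr0 f0 ?normr0//.
by move: xM; rewrite notin_setE /box/= => /negP; rewrite -ltNge.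
Qed.

Lemma testf_intg phi : testf phi -> intg leb2 phi.
Proof.
move=> tp; have [C _ HC] := testf_bounded tp; have [_ [M HM]] := tp.
by apply: intg_bounded_supp HC HM; exact: testf_measurable.
Qed.

Lemma testf_sqintg phi : testf phi -> sqintg leb2 phi.
Proof.
move=> tp; split; first exact: testf_measurable.
by apply: testf_intg; apply: (testfMl (testf_smooth tp) tp).
Qed.

Lemma Rint_testf_derive phi e : testf phi -> (e = e1 R \/ e = e2 R) ->
  \int[leb2]_x 'D_e phi x = 0.
Proof.
move=> tp ee; have td := testf_derive e tp.
have it := testf_intg td; have [_ [M HM]] := tp.
have HM' := @supp_derive _ _ e HM.
have cd := testf_continuous td.
case: ee => eE; [rewrite (Rint_fubiniR it).2|rewrite (Rint_fubiniL it).2].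
- apply: Rint0 => y.
  apply: (@Rint_derive_supp _ (fun t => phi (t, y)) _ M).
  + move=> t.
    have E : (fun t => phi (t, y)) = (fun t => phi ((0, y) + t *: e)).
      by apply/funext => s; rewrite eE add_scale_e1 add0r.
    have <- : (0, y) + t *: e = (t, y).
      by rewrite eE add_scale_e1 add0r.
    by rewrite E; apply: is_derive_line; apply: smooth_differentiable; exact: testf_smooth.
  + exact: continuous_slice1 cd.
  + by move=> t Mt; apply: HM; apply: lt_le_trans Mt (norm_fst_le (t, y)).
  + by move=> t Mt; apply: HM'; apply: lt_le_trans Mt (norm_fst_le (t, y)).
- apply: Rint0 => y.
  apply: (@Rint_derive_supp _ (fun t => phi (y, t)) _ M).
  + move=> t.
    have E : (fun t => phi (y, t)) = (fun t => phi ((y, 0) + t *: e)).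
      by apply/funext => s; rewrite eE add_scale_e2 add0r.
    have <- : (y, 0) + t *: e = (y, t).
      by rewrite eE add_scale_e2 add0r.
    by rewrite E; apply: is_derive_line; apply: smooth_differentiable; exact: testf_smooth.
  + exact: continuous_slice2 cd.
  + by move=> t Mt; apply: HM; apply: lt_le_trans Mt (norm_snd_le (y, t)).
  + by move=> t Mt; apply: HM'; apply: lt_le_trans Mt (norm_snd_le (y, t)).
Qed.

Lemma derive_mul phi psi x v : smooth phi -> smooth psi ->
  'D_v (fun y => phi y * psi y) x = phi x * 'D_v psi x + psi x * 'D_v phi x.
Proof.
move=> s1 s2.
by rewrite [LHS](deriveM (diff_derivable (smooth_differentiable x s1))
  (diff_derivable (smooth_differentiable x s2))).
Qed.

Lemma test_by_parts phi psi e : smooth phi -> testf psi -> (e = e1 R \/ e = e2 R) ->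
  \int[leb2]_x (phi x * 'D_e psi x) = - \int[leb2]_x ('D_e phi x * psi x).
Proof.
move=> sp tp ee; have sp' := smooth_derive e sp.
apply/eqP; rewrite -addr_eq0 -RintegralD//; last 2 first.
- by apply: testf_intg; apply: testfMl => //; exact: testf_derive.
- by apply: testf_intg; apply: testfMl.
apply/eqP; rewrite -[RHS](Rint_testf_derive (testfMl sp tp) ee).
apply: eq_Rintegral => x _; rewrite derive_mul//; first by rewrite [X in _ + X]mulrC.
exact: testf_smooth.
Qed.

End TestFunctions.

Lemma plane_sigma_finite (R : realType) :
  sigma_finite setT (@lebesgue_measure R \x @lebesgue_measure R)%E.
Proof.
exists (fun n => box n%:R); last first.
  by move=> n; split; [exact: measurable_box|exact: measure_box_lty].
apply/esym/seteqP; split=> // x _.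
exists (Num.truncn `|x|).+1 => //; rewrite /box/=.
exact/ltW/truncnS_gt.
Qed.

(* The library declares no sigma-finite structure on the product measure that
   type inference can find, so it is attached to this synonym. *)
Definition plane (R : realType) :
    set (measurableTypeR R * measurableTypeR R)%type -> \bar R :=
  (@lebesgue_measure R \x @lebesgue_measure R)%E.

Arguments plane R : clear implicits.

HB.instance Definition _ (R : realType) := Measure.on (plane R).

HB.instance Definition _ (R : realType) :=
  @Measure_isSigmaFinite.Build _ _ R (plane R) (@plane_sigma_finite R).

(** * Mollification *)

Section Shift.
Variable R : realType.
Local Notation leb := (@lebesgue_measure R).

Lemma integral_shift (G : R -> R) (a : R) : continuous G -> (forall x, 0 <= G x) ->
  (\int[leb]_x (G (x + a))%:E = \int[leb]_x (G x)%:E)%E.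
Proof.
move=> cG G0.
have dF (x : R) : is_derive x (1 : R) (fun y : R => y + a) 1.
  have := is_deriveD (is_derive_id x (1 : R)) (is_derive_cst a x (1 : R)).
  by rewrite addr0.
have E : derive1 (fun y : R => y + a) = cst 1.
  by apply/funext => x; rewrite derive1E; case: (dF x).
rewrite (@increasing_ge0_integration_by_substitutionT _ (fun y => y + a) G) ?E//.
- by apply: eq_integral => x _; rewrite /= mulr1.
- by move=> x y; rewrite ltrD2r.
- by move=> x; exact: cvg_cst.
- exact: is_cvg_cst.
- exact: is_cvg_cst.
- exact: cvg_addrr_Ny.
- exact: cvg_addrr.
Qed.

End Shift.

Section SmoothAffine.
Variables (R : realType) (V : normedModType R).

Lemma differentiable_reflect (x y : V) : differentiable (fun z : V => x - z) y.
Proof.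
apply: (@differentiableB _ _ _ (cst x) (fun z : V => z)) => //.
Qed.

Lemma derive_reflectE (f : V -> R) (x y v : V) : differentiable f (x - y) ->
  'D_v (fun y => f (x - y)) y = - 'D_v f (x - y).
Proof.
move=> df; rewrite -mulN1r -derive_dirZ// scaleN1r /derive.
set F := (X in lim (X @ _)); set G := (X in _ = lim (X @ _)).
have -> // : F = G.
by apply/funext => h; rewrite /F /G /= opprD scalerN addrCA.
Qed.

Lemma smooth_reflect (f : V -> R) (x : V) : smooth f -> smooth (fun y => f (x - y)).
Proof.
move=> sf.
apply: (@gen_alg_smooth _ _ (fun h => exists2 g, smooth g & h = fun y => g (x - y))).
  move=> _ [g sg ->]; split=> [y|v].
    apply: (differentiable_comp (@differentiable_reflect x y)).
    exact: smooth_differentiable.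
  have -> : 'D_v (fun y => g (x - y)) = (fun y => - 1 * 'D_v g (x - y)).
    apply/funext => y; rewrite derive_reflectE ?mulN1r//.
    exact: smooth_differentiable.
  apply: gen_alg_mul; first exact: gen_alg_cst.
  by apply: gen_alg_base; exists ('D_v g) => //; exact: smooth_derive.
by apply: gen_alg_base; exists f.
Qed.

End SmoothAffine.

Lemma lebesgue_itv_lty (R : realType) (a b : R) :
  (@lebesgue_measure R `[a, b] < +oo)%E.
Proof.
by rewrite lebesgue_measure_itv/=; case: ifPn => _; rewrite ?ltry// -EFinD ltry.
Qed.

Lemma lebesgue_itv (R : realType) (a b : R) : a <= b ->
  fine (@lebesgue_measure R `[a, b]) = b - a.
Proof.
rewrite lebesgue_measure_itv/= lte_fin le_eqVlt => /predU1P[->|->//].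
by rewrite ltxx subrr.
Qed.

Section MollifierKernel.
Variable R : realType.
Local Notation leb := (@lebesgue_measure R).
Local Notation leb2 := (leb \x leb)%E.

Definition bump1 (n : nat) (r : R) : R := flat 0 (1 - (n.+1%:R * r) ^+ 2).

Lemma smooth_bump1 n : smooth (bump1 n).
Proof.
apply: smooth_comp; first exact: smooth_flat.
apply: smoothB; first exact: smooth_cst.
by apply: smoothX; apply: smoothZ; exact: smooth_id.
Qed.

Lemma bump1_ge0 n r : 0 <= bump1 n r.
Proof. exact: flat_ge0. Qed.

Lemma bump1_even n r : bump1 n (- r) = bump1 n r.
Proof. by rewrite /bump1 mulrN sqrrN. Qed.

Lemma bump1_le1 n r : bump1 n r <= 1.
Proof.
rewrite /bump1 /flat; case: ifPn => // h; rewrite expr0 mul1r expR_le1.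
by rewrite oppr_le0 invr_ge0 ltW.
Qed.

Lemma bump1_supp n r : n.+1%:R^-1 < `|r| -> bump1 n r = 0.
Proof.
move=> h; rewrite /bump1 /flat ifF//; apply/negbTE; rewrite -leNgt subr_le0.
rewrite -(real_normK (num_real (_ * r))) normrM ger0_norm// -[X in X <= _](expr1n _ 2).
rewrite lerXn2r// ?nnegrE// ?mulr_ge0//.
by move/ltW : h; rewrite -ler_pdivrMl// mulr1.
Qed.

Lemma bump1_lb n r : `|r| <= (2 * n.+1%:R)^-1 -> expR (- 2) <= bump1 n r.
Proof.
move=> h.
have h2 : (n.+1%:R * r) ^+ 2 <= 1 / 4.
  rewrite -(real_normK (num_real (_ * r))) normrM ger0_norm//.
  have -> : 1 / 4 = (1 / 2 : R) ^+ 2 by field.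
  rewrite lerXn2r// ?nnegrE// ?mulr_ge0//.
  by rewrite -ler_pdivlMl// mulrC div1r -invfM.
rewrite /bump1 /flat ifT; last by rewrite subr_gt0; move: h2; set a := _ ^+ 2; lra.
rewrite expr0 mul1r ler_expR lerN2.
rewrite -[X in _ <= X]invrK lef_pV2 ?posrE; first by move: h2; set a := _ ^+ 2; lra.
  by move: h2; set a := _ ^+ 2; lra.
by rewrite invr_gt0.
Qed.

Lemma continuous_bump1 n : continuous (bump1 n).
Proof. by apply: smooth_continuous; exact: smooth_bump1. Qed.

Lemma intg_bump1 n : intg leb (bump1 n).
Proof.
apply: (@intg_le _ _ _ leb _ (\1_`[- n.+1%:R^-1, n.+1%:R^-1])).
- by apply: continuous_measurable_fun; exact: continuous_bump1.
- apply: intg_indic => //; exact: lebesgue_itv_lty.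
- move=> r; rewrite ger0_norm ?bump1_ge0// indicE.
  have [h|h] := boolP (r \in _); first exact: bump1_le1.
  rewrite bump1_supp//; move: h; rewrite notin_setE/= in_itv/= -ler_norml.
  by move=> /negP; rewrite -ltNge.
Qed.

Definition bump1_mass n : R := \int[leb]_r bump1 n r.

Lemma bump1_mass_gt0 n : 0 < bump1_mass n.
Proof.
(* On [[-a, a]] the argument of [flat] is at least [3/4], so the bump stays above [expR (- 2)]. *)
pose a : R := (2 * n.+1%:R)^-1.
have a0 : 0 < a by rewrite invr_gt0 mulr_gt0.
have i1 : intg leb (\1_`[- a, a] : R -> R).
  apply: intg_indic => //; exact: lebesgue_itv_lty.
apply: (@lt_le_trans _ _ (expR (- 2) * (2 * a))).
  by rewrite mulr_gt0 ?expR_gt0// mulr_gt0.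
apply: (@le_trans _ _ (\int[leb]_x (expR (- 2) * \1_`[- a, a] x))).
  rewrite RintegralZl// ler_wpM2l ?expR_ge0//.
  rewrite /Rintegral integral_indic// setIT.
  have -> : fine (leb `[- a, a]) = a - - a.
    by apply: lebesgue_itv; rewrite ge0_cp// ltW.
  lra.
apply: le_Rintegral => //.
- exact: intgZ.
- exact: intg_bump1.
- move=> x _; rewrite indicE; have [h|h] := boolP (x \in _); last first.
    by rewrite mulr0 bump1_ge0.
  by rewrite mulr1 bump1_lb//; move: h; rewrite inE/= in_itv/= -ler_norml.
Qed.

Definition moll1 n (r : R) : R := (bump1_mass n)^-1 * bump1 n r.

Lemma smooth_moll1 n : smooth (moll1 n).
Proof. by apply: smoothZ; exact: smooth_bump1. Qed.

Lemma moll1_ge0 n r : 0 <= moll1 n r.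
Proof. by rewrite mulr_ge0 ?bump1_ge0// invr_ge0 ltW// bump1_mass_gt0. Qed.

Lemma moll1_even n r : moll1 n (- r) = moll1 n r.
Proof. by rewrite /moll1 bump1_even. Qed.

Lemma moll1_supp n r : n.+1%:R^-1 < `|r| -> moll1 n r = 0.
Proof. by move=> h; rewrite /moll1 bump1_supp// mulr0. Qed.

Lemma continuous_moll1 n : continuous (moll1 n).
Proof. by apply: smooth_continuous; exact: smooth_moll1. Qed.

Lemma integral_moll1 n a : (\int[leb]_r (moll1 n (r - a))%:E = 1)%E.
Proof.
rewrite (@integral_shift _ (moll1 n) (- a)); last 2 first.
- exact: continuous_moll1.
- exact: moll1_ge0.
rewrite -EFin_Rint; last by apply: intgZ; exact: intg_bump1.
rewrite RintegralZl//; last exact: intg_bump1.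
by rewrite mulVf// gt_eqF// bump1_mass_gt0.
Qed.

(** A product of bumps rather than a radial one: its mass splits by Tonelli into one-dimensional
    masses, and its support is a ball of the max norm. *)
Definition moll n (x : R * R) : R := moll1 n x.1 * moll1 n x.2.

Lemma testf_moll n : testf (moll n).
Proof.
split.
  by apply: smoothM; apply: smooth_comp; rewrite ?smooth_fst ?smooth_snd;
    try exact: smooth_moll1; [exact: smooth_fst|exact: smooth_snd].
exists n.+1%:R^-1 => x; rewrite prod_normE lt_max => /orP[|] h.
  by rewrite /moll moll1_supp// mul0r.
by rewrite /moll (moll1_supp h) mulr0.
Qed.

Lemma moll_ge0 n x : 0 <= moll n x.
Proof. by rewrite mulr_ge0// moll1_ge0. Qed.

Lemma moll_supp n x : n.+1%:R^-1 < `|x| -> moll n x = 0.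
Proof.
rewrite prod_normE lt_max => /orP[|] h; first by rewrite /moll moll1_supp// mul0r.
by rewrite /moll (moll1_supp h) mulr0.
Qed.

Lemma moll_even n x : moll n (- x) = moll n x.
Proof. by rewrite /moll /= !moll1_even. Qed.

Lemma continuous_moll_sub n (x : R * R) : continuous (fun y : R * R => moll n (y - x)).
Proof.
have -> : (fun y => moll n (y - x)) = (fun y => moll n (x - y)).
  by apply/funext => y; rewrite -moll_even opprB.
by apply: smooth_continuous; apply: smooth_reflect; case: (testf_moll n).
Qed.

Lemma continuous_moll1_sub n (a : R) : continuous (fun r : R => moll1 n (r - a)).
Proof.
have -> : (fun y => moll1 n (y - a)) = (fun y => moll1 n (a - y)).
  by apply/funext => y; rewrite -moll1_even opprB.
by apply: smooth_continuous; apply: smooth_reflect; exact: smooth_moll1.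
Qed.

Lemma integral_moll n (x : R * R) : (\int[leb2]_y (moll n (y - x))%:E = 1)%E.
Proof.
rewrite fubini_tonelli1; last 2 first.
- by apply/measurable_EFinP; apply: continuous_prod_measurable; exact: continuous_moll_sub.
- by move=> y; rewrite lee_fin moll_ge0.
rewrite -[RHS](@integral_moll1 n x.1); apply: eq_integral => y1 _.
rewrite /fubini_F/=.
under eq_integral do rewrite /moll/= EFinM.
rewrite ge0_integralZl//; last 2 first.
- by move=> r _; rewrite lee_fin moll1_ge0.
- by rewrite lee_fin moll1_ge0.
  by rewrite integral_moll1 mule1.
by apply/measurable_EFinP; apply: continuous_measurable_fun; exact: continuous_moll1_sub.
Qed.

End MollifierKernel.

Section Convolution.
Variable R : realType.
Local Notation leb := (@lebesgue_measure R).
Local Notation leb2 := (leb \x leb)%E.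
Implicit Types (phi g : R * R -> R) (x y z h : R * R).

Lemma dir_decomp h : h = h.1 *: e1 R + h.2 *: e2 R.
Proof.
have -> : h.1 *: e1 R = 0 + h.1 *: e1 R by rewrite add0r.
by rewrite add_scale_e1 add_scale_e2 !add0r; case: h.
Qed.

Lemma derive_e1e2 phi z h : differentiable phi z ->
  'D_h phi z = h.1 * 'D_(e1 R) phi z + h.2 * 'D_(e2 R) phi z.
Proof.
by move=> df; rewrite [in LHS](dir_decomp h) derive_dirD// !derive_dirZ.
Qed.

Lemma testf_reflect phi x : testf phi -> testf (fun y => phi (x - y)).
Proof.
move=> [s [M HM]]; split; first exact: smooth_reflect.
exists (M + `|x|) => y; rewrite -ltrBrDr => h; apply: HM; apply: (lt_le_trans h).
by rewrite distrC lerB_dist.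
Qed.

Lemma MVT_line phi z h : smooth phi -> exists2 c, 0 <= c <= 1 &
  phi (h + z) - phi z = 'D_h phi (z + c *: h).
Proof.
move=> s.
have d t : is_derive t (1 : R) (fun t : R => phi (z + t *: h)) ('D_h phi (z + t *: h)).
  by apply: is_derive_line; exact: smooth_differentiable.
have [|c] := @MVT_segment R (fun t => phi (z + t *: h)) _ 0 1 ler01 (fun t _ => d t).
  apply: continuous_subspaceT => t; apply: differentiable_continuous.
  by apply/derivable1_diffP; case: (d t).
rewrite in_itv/= => c01; rewrite subr0 mulr1 scale1r scale0r addr0 => E.
by exists c => //; rewrite (addrC h z).
Qed.

Lemma testf_lip phi : testf phi -> exists2 C, 0 <= C &
  forall z h, `|phi (h + z) - phi z| <= C * `|h|.
Proof.
move=> tp.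
have [C1 C10 H1] := testf_bounded (testf_derive (e1 R) tp).
have [C2 C20 H2] := testf_bounded (testf_derive (e2 R) tp).
exists (C1 + C2); first exact: addr_ge0.
move=> z h; have [c _ ->] := MVT_line z h (testf_smooth tp).
rewrite derive_e1e2; last by apply: smooth_differentiable; exact: testf_smooth.
apply: (le_trans (ler_normD _ _)); rewrite !normrM mulrDl.
by apply: lerD; rewrite mulrC ler_pM// ?norm_fst_le ?norm_snd_le.
Qed.

Lemma testf_taylor2 phi : testf phi -> exists2 C, 0 <= C &
  forall z h, `|phi (h + z) - phi z - 'D_h phi z| <= C * `|h| ^+ 2.
Proof.
move=> tp.
have [C1 C10 H1] := testf_lip (testf_derive (e1 R) tp).
have [C2 C20 H2] := testf_lip (testf_derive (e2 R) tp).
exists (C1 + C2); first exact: addr_ge0.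
move=> z h; have [c /andP[c0 c1] ->] := MVT_line z h (testf_smooth tp).
have df w : differentiable phi w.
  by apply: smooth_differentiable; exact: testf_smooth.
rewrite (derive_e1e2 h (df (z + c *: h))) (derive_e1e2 h (df z)).
have ch : `|c *: h| <= `|h| by rewrite normrZ ger0_norm// ler_piMl.
have {}H1 := le_trans (H1 z (c *: h)) (ler_wpM2l C10 ch).
have {}H2 := le_trans (H2 z (c *: h)) (ler_wpM2l C20 ch).
rewrite (addrC (c *: h) z) in H1 H2.
move: H1 H2; set A := 'D_(e1 R) phi _; set A' := 'D_(e1 R) phi z.
set B := 'D_(e2 R) phi _; set B' := 'D_(e2 R) phi z => H1 H2.
have -> : h.1 * A + h.2 * B - (h.1 * A' + h.2 * B') = h.1 * (A - A') + h.2 * (B - B').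
  by ring.
apply: (le_trans (ler_normD _ _)); rewrite !normrM mulrDl expr2.
apply: lerD.
  by rewrite (mulrCA C1); apply: ler_pM => //; exact: norm_fst_le.
by rewrite (mulrCA C2); apply: ler_pM => //; exact: norm_snd_le.
Qed.

Definition conv phi g x : R := \int[leb2]_y (phi (x - y) * g y).

Lemma conv_intg phi g x : testf phi -> sqintg leb2 g ->
  intg leb2 (fun y => phi (x - y) * g y).
Proof. by move=> tp g2; apply: sqintgM => //; apply: testf_sqintg; exact: testf_reflect. Qed.

Lemma intg_box_sq (M : R) g : sqintg leb2 g ->
  intg leb2 (fun y => \1_(box M) y * `|g y|).
Proof.
move=> g2; apply: sqintgM.
  split; first by apply: measurable_indic; exact: measurable_box.
  have i1 : intg leb2 (\1_(box M)).
    by apply: intg_indic; [exact: measurable_box|exact: measure_box_lty].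
  apply: (@eq_intg _ _ _ leb2 (\1_(box M)) _ _ i1) => y.
  by rewrite indicE; case: (_ \in _); rewrite ?expr1n ?expr0n.
by apply: (sqintg_le _ g2) => [|x]; [apply: measurableT_comp => //; case: g2|rewrite normr_id].
Qed.

(** Taylor's formula for [phi] is uniform in the base point, so it can be integrated against [g]:
    the remainder is at most [C |h|^2] times the integral of [|g|] over a box. *)
Lemma conv_diff phi g x : testf phi -> sqintg leb2 g ->
  differentiable (conv phi g) x /\
  forall v, 'D_v (conv phi g) x = conv ('D_v phi) g x.
Proof.
move=> tp g2; have td e := testf_derive e tp.
have df w : differentiable phi w.
  by apply: smooth_differentiable; exact: testf_smooth.
pose a := conv ('D_(e1 R) phi) g x; pose b := conv ('D_(e2 R) phi) g x.
have convD v : conv ('D_v phi) g x = v.1 * a + v.2 * b.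
  have i1 := conv_intg x (td (e1 R)) g2; have i2 := conv_intg x (td (e2 R)) g2.
  have -> : v.1 * a = \int[leb2]_y (v.1 * ('D_(e1 R) phi (x - y) * g y)).
    by rewrite RintegralZl.
  have -> : v.2 * b = \int[leb2]_y (v.2 * ('D_(e2 R) phi (x - y) * g y)).
    by rewrite RintegralZl.
  rewrite -RintegralD//; [|exact: (intgZ v.1 i1)|exact: (intgZ v.2 i2)].
  by apply: eq_Rintegral => y _; rewrite derive_e1e2//; ring.
pose L (h : R * R) : R := h.1 * a + h.2 * b.
have lL : linear L.
  by move=> k [u1 u2] [v1 v2]; rewrite /L /GRing.scale/= /GRing.scale/=; ring.
pose fL : {linear (R * R)%type -> R} := HB.pack L (GRing.isLinear.Build _ _ _ _ _ lL).
have cL : continuous fL.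
  move=> h; apply: cvgD; apply: cvgMr_tmp; [exact: cvg_fst|exact: cvg_snd].
have [C C0 HC] := testf_taylor2 tp.
have [_ [M HM]] := tp.
(* For [|h| <= 1] the remainder vanishes unless [|x - y| <= |M| + 1]; then [y] lies in this box, on
   which a square-integrable [g] is integrable. *)
pose N := `|M| + 1 + `|x|.
pose I := \int[leb2]_y (\1_(box N) y * `|g y|).
suff H : forall h : R * R, `|h| <= 1 ->
    `|conv phi g (h + x) - conv phi g x - fL h| <= C * I * `|h| ^+ 2.
  have [d1 d2] := quad_remainder_diff cL H.
  by split=> // v; rewrite deriveE// d2/= convD.
move=> h h1.
have i1 := conv_intg (h + x) tp g2; have i2 := conv_intg x tp g2.
have i3 := conv_intg x (td h) g2.
have -> : conv phi g (h + x) - conv phi g x - fL h =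
    \int[leb2]_y ((phi (h + (x - y)) - phi (x - y) - 'D_h phi (x - y)) * g y).
  rewrite -[fL h]convD /conv -RintegralB// -RintegralB//; last exact: (intgB i1 i2).
  by apply: eq_Rintegral => y _; rewrite addrA; ring.
have mg : measurable_fun setT g by case: g2.
have rem_meas : measurable_fun setT
    (fun y => (phi (h + (x - y)) - phi (x - y) - 'D_h phi (x - y)) * g y).
  apply: measurable_funM => //; apply: measurable_funB; last first.
    exact: (testf_measurable (testf_reflect x (td h))).
  apply: measurable_funB; last by apply: testf_measurable; exact: testf_reflect.
  rewrite (_ : (fun y => _) = (fun y => phi ((h + x) - y))).
    by apply: testf_measurable; exact: testf_reflect.
  by apply/funext => y; rewrite addrA.
apply: (le_trans (@Rint_norm_le _ _ _ leb2 _ rem_meas)).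
have iI : intg leb2 (fun y => (C * `|h| ^+ 2) * (\1_(box N) y * `|g y|)).
  by apply: intgZ; exact: intg_box_sq.
have bnd y : `|(phi (h + (x - y)) - phi (x - y) - 'D_h phi (x - y)) * g y| <=
    (C * `|h| ^+ 2) * (\1_(box N) y * `|g y|).
  rewrite normrM mulrA ler_wpM2r//.
  have [yN|Ny] := leP `|y| N.
    by rewrite indicE mem_set// mulr1.
  have My : `|M| + 1 < `|x - y|.
    rewrite distrC; apply: lt_le_trans (lerB_dist _ _).
    by rewrite ltrBrDr.
  have M1 : M < `|x - y| by apply: le_lt_trans (ler_norm M) _; apply: lt_trans My; rewrite ltrDl.
  have M2 : M < `|h + (x - y)|.
    apply: le_lt_trans (ler_norm M) _.
    apply: (@lt_le_trans _ _ (`|x - y| - `|h|)); first by move: My h1; lra.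
    by have := lerB_dist (x - y) (- h); rewrite normrN opprK (addrC _ h).
  rewrite HM// HM// (@supp_derive _ _ _ h HM)// !subr0 normr0.
  by rewrite !mulr_ge0// exprn_ge0.
apply: (@le_trans _ _ (\int[leb2]_y ((C * `|h| ^+ 2) * (\1_(box N) y * `|g y|)))).
  apply: le_Rintegral => //.
  by apply: (intg_le _ iI) => [|y]; [exact: measurableT_comp|rewrite normr_id].
rewrite RintegralZl//; last exact: intg_box_sq.
by rewrite -/I mulrAC.
Qed.

Lemma smooth_conv phi g : testf phi -> sqintg leb2 g -> smooth (conv phi g).
Proof.
move=> tp g2.
apply: (@gen_alg_smooth _ _ (fun f => exists2 psi, testf psi & f = conv psi g)).
  move=> _ [psi ts ->]; split=> [x|v]; first by case: (conv_diff x ts g2).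
  have -> : 'D_v (conv psi g) = conv ('D_v psi) g.
    by apply/funext => x; have [_ ->] := conv_diff x ts g2.
  by apply: gen_alg_base; exists ('D_v psi) => //; exact: testf_derive.
by apply: gen_alg_base; exists phi.
Qed.

End Convolution.

Section Mollification.
Variable R : realType.
Local Notation leb := (@lebesgue_measure R).
Local Notation leb2 := (leb \x leb)%E.
Implicit Types (phi g u : R * R -> R) (x y z h : R * R).

Lemma sub_fst_measurable : measurable_fun setT (fun p : (R * R) * (R * R) => p.1.1 - p.2.1).
Proof. by apply: measurable_funB; apply: measurableT_comp. Qed.

Lemma sub_snd_measurable : measurable_fun setT (fun p : (R * R) * (R * R) => p.1.2 - p.2.2).
Proof. by apply: measurable_funB; apply: measurableT_comp. Qed.

Lemma moll_kernel_measurable n :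
  measurable_fun setT (fun p : (R * R) * (R * R) => moll n (p.1 - p.2)).
Proof.
have mm : measurable_fun setT (@moll1 R n).
  by apply: continuous_measurable_fun; exact: continuous_moll1.
apply: measurable_funM; apply: (measurableT_comp mm).
  exact: sub_fst_measurable.
exact: sub_snd_measurable.
Qed.

(** Schur's test with constant weight: both marginals of the kernel [moll n (x - y)] are 1. *)
Lemma conv_moll_sq n g : sqintg leb2 g ->
  sqintg leb2 (conv (moll n) g) /\ nsq leb2 (conv (moll n) g) <= nsq leb2 g.
Proof.
move=> [mg g2].
have H1 x : (\int[leb2]_z (moll n (x - z) * cst 1 z)%:E <= 1%:E)%E.
  rewrite -(@integral_moll R n x) le_eqVlt; apply/orP; left; apply/eqP.
  by apply: eq_integral => y _; rewrite mulr1 -moll_even opprB.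
have H2 : (\int[leb2]_z \int[leb2]_x (moll n (x - z) * (g z ^+ 2 / cst 1 z))%:E
     <= (nsq leb2 g)%:E)%E.
  rewrite /nsq EFin_Rint// le_eqVlt; apply/orP; left; apply/eqP.
  apply: eq_integral => y _.
  under eq_integral do rewrite divr1 EFinM.
  rewrite ge0_integralZr//.
  - by rewrite integral_moll mul1e.
  - by apply/measurable_EFinP; apply: continuous_prod_measurable; exact: continuous_moll_sub.
  - by move=> x _; rewrite lee_fin moll_ge0.
  - by rewrite lee_fin sqr_ge0.
have K0 (p : (R * R) * (R * R)) : 0 <= moll n (p.1 - p.2) by exact: moll_ge0.
have w0 (z : R * R) : 0 <= cst (1 : R) z by [].
have wK (x z : R * R) : cst (1 : R) z = 0 -> moll n (x - z) * g z = 0.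
  by move=> /eqP; rewrite oner_eq0.
have mc : measurable_fun setT (cst (1 : R) : R * R -> R) by exact: measurable_cst.
have := @schur _ _ _ _ R (plane R) (plane R)
  (fun p : (R * R) * (R * R) => moll n (p.1 - p.2))
  (cst 1) g 1 (nsq leb2 g) (moll_kernel_measurable n) mc mg K0 w0 wK H1 H2.
by rewrite mul1r.
Qed.

Lemma convB phi g u x : testf phi -> sqintg leb2 g -> sqintg leb2 u ->
  conv phi (fun y => g y - u y) x = conv phi g x - conv phi u x.
Proof.
move=> tp g2 u2; rewrite /conv -RintegralB//; try exact: conv_intg.
by apply: eq_Rintegral => y _; rewrite mulrBr.
Qed.

Definition moll_cvg g := forall e, 0 < e -> exists N, forall n, (N <= n)%N ->
  nsq leb2 (fun x => conv (moll n) g x - g x) <= e.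

(** Mollification [M] is a contraction, so the functions that it approximates are closed in [L^2].
    The fractions of [e] come from applying [|a + b|^2 <= 2 |a|^2 + 2 |b|^2] twice to
    [M (g - f) - (g - f) + (M f - f)]. *)
Lemma moll_cvg_closed g : sqintg leb2 g ->
  (forall e, 0 < e -> exists f, [/\ sqintg leb2 f, moll_cvg f &
     nsq leb2 (fun x => g x - f x) <= e]) -> moll_cvg g.
Proof.
move=> g2 H e e0; have [|f [f2 cf gf]] := H (e / 12); first by rewrite divr_gt0.
have [|N HN] := cf (e / 6); first by rewrite divr_gt0.
exists N => n /HN fn.
have gf2 := sqintgB g2 f2.
have [c1 c2] := conv_moll_sq n gf2.
have [f3 _] := conv_moll_sq n f2.
have t1 := sqintgB f3 f2.
have E : nsq leb2 (fun x => conv (moll n) g x - g x) =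
  nsq leb2 (fun x => (conv (moll n) (fun y => g y - f y) x - (g x - f x)) +
     (conv (moll n) f x - f x)).
  apply: eq_Rintegral => x _; rewrite convB//; last exact: testf_moll.
  by congr (_ ^+ 2); ring.
rewrite E; apply: (le_trans (nsqD_le (sqintgB c1 gf2) t1)).
have := nsqD_le c1 (sqintgN gf2).
have -> : nsq leb2 (fun x => - (g x - f x)) = nsq leb2 (fun x => g x - f x).
  by apply: eq_Rintegral => x _; rewrite sqrrN.
lra.
Qed.

End Mollification.

Lemma Rint_dct d (T : measurableType d) (R : realType) (mu : {measure set T -> \bar R})
    (f_ : nat -> T -> R) (f g : T -> R) :
  (forall n, measurable_fun setT (f_ n)) -> intg mu g ->
  (forall n x, `|f_ n x| <= g x) -> (forall x, f_ n x @[n --> \oo] --> f x) ->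
  intg mu f /\ \int[mu]_x f_ n x @[n --> \oo] --> \int[mu]_x f x.
Proof.
move=> mf ig fg cf.
have mf' : measurable_fun setT f.
  by apply: (@measurable_fun_cvg _ _ _ _ f_) => // x _; exact: cf.
have fle x : `|f x| <= g x.
  have : `|f_ n x| @[n --> \oo] --> `|f x| by apply: cvg_norm; exact: cf.
  move=> h; rewrite -(cvg_lim _ h)//; apply: limr_le; first exact: (cvgP _ h).
  by apply: nearW => n; exact: fg.
have if' := intg_le mf' ig fle.
split=> //.
have [//||||_ _ h] := @dominated_convergence _ T R mu setT measurableT
    (fun n => EFin \o f_ n) (EFin \o f) (EFin \o g) _ _ _ ig _.
- by move=> n; apply/measurable_EFinP.
- by apply/measurable_EFinP.
- by apply: aeW => x _; apply: cvg_EFin; [exact: nearW|exact: cf].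
- by apply: aeW => x n _; rewrite lee_fin.
rewrite -EFin_Rint// in h.
exact: (fine_cvg h).
Qed.

Lemma cvg_nP (R : realType) (u : nat -> R) (l : R) :
  (u n @[n --> \oo] --> l) <->
  (forall e, 0 < e -> exists N, forall n, (N <= n)%N -> `|u n - l| <= e).
Proof.
split=> [/cvgrPdist_le h e /h [N _ HN]|h].
  by exists N => n Nn; rewrite distrC; exact: HN.
apply/cvgrPdist_le => e /h [N HN]; exists N => // n Nn.
by rewrite distrC; exact: HN.
Qed.

(** The product sigma-algebra is generated by the two projections, which are continuous and so
    measurable for the sigma-algebra of the open sets. This lets the pi-lambda argument for
    [moll_cvg_indic] start from open sets. *)
Lemma open_generate (R : realType) (X : set (R * R)) :
  measurable X -> (<<s [set U : set (R * R) | open U] >>) X.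
Proof.
rewrite measurable_prod_measurableType.
pose T := g_sigma_algebraType [set U : set (R * R) | open U].
have mproj (f : T -> R) : continuous (f : R * R -> R) ->
    measurable_fun setT (f : T -> measurableTypeR R).
  move=> cf; apply: (measurability _ (@RGenOpens.measurableE R)).
  move=> _ [_ [x [y ->]] <-]; rewrite setTI; apply: sub_sigma_algebra.
  by apply: open_comp => // z _; exact: cf.
apply: smallest_sub; first exact: smallest_sigma_algebra.
move=> _ [A mA [B mB <-]].
have -> : A `*` B = (setT `&` fst @^-1` A) `&` (setT `&` snd @^-1` B).
  by rewrite !setTI.
apply: (@measurableI _ T).
  by apply: (mproj fst) => // z; exact: cvg_fst.
by apply: (mproj snd) => // z; exact: cvg_snd.
Qed.

Section MollifierApproximation.
Variable R : realType.
Local Notation leb := (@lebesgue_measure R).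
Local Notation leb2 := (leb \x leb)%E.
Implicit Types (phi g u : R * R -> R) (x y z h : R * R).

Lemma sqr_indic (T : Type) (A : set T) (x : T) : (\1_A x : R) ^+ 2 = \1_A x.
Proof. by rewrite indicE; case: (_ \in _); rewrite ?expr1n ?expr0n. Qed.

Lemma indic_norm_le1 (T : Type) (A : set T) (x : T) : `|\1_A x : R| <= 1.
Proof. by rewrite indicE; case: (_ \in _); rewrite ?normr1 ?normr0. Qed.

Lemma sqintg_bounded_supp (f : R * R -> R) (C M : R) : measurable_fun setT f ->
  (forall x, `|f x| <= C) -> (forall x, M < `|x| -> f x = 0) -> sqintg leb2 f.
Proof.
move=> mf fC f0; split=> //; apply: (@intg_bounded_supp _ _ (C ^+ 2) M).
- by apply: measurable_funX.
- by move=> x; rewrite normrX ler_pXn2r ?nnegrE ?normr_ge0// (le_trans _ (fC x)).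
- by move=> x /f0 ->; rewrite expr0n.
Qed.

Lemma sqintg_indic_box A (M : R) : measurable A -> sqintg leb2 (\1_(A `&` box M)).
Proof.
move=> mA; apply: (@sqintg_bounded_supp _ 1 M).
- by apply: measurable_indic; apply: measurableI => //; exact: measurable_box.
- by move=> x; exact: indic_norm_le1.
- by move=> x Mx; rewrite indicE memNset// => -[_]; rewrite /box/= leNgt Mx.
Qed.

Lemma moll_mass n x : intg leb2 (fun y => moll n (x - y)) /\
  \int[leb2]_y moll n (x - y) = 1.
Proof.
split; first by apply: testf_intg; apply: testf_reflect; exact: testf_moll.
rewrite /Rintegral -[RHS]/(fine 1%E) -(@integral_moll R n x); congr fine.
by apply: eq_integral => y _; rewrite -moll_even opprB.
Qed.

Lemma nearby_moll (U : set (R * R)) x : open U -> U x ->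
  exists N, forall n, (N <= n)%N -> forall y, n.+1%:R^-1 >= `|x - y| -> U y.
Proof.
move=> oU Ux.
have /nbhs_normP[d /= d0 Hd] : nbhs x U by apply: open_nbhs_nbhs; split.
have [k _ kP] := near_infty_natSinv_lt (PosNum d0).
exists k => n kn y xy; apply: Hd => /=.
by apply: le_lt_trans xy _; exact: kP.
Qed.

(* [conv (moll n)] is a contraction, so it is enough to test the convergence
   weakly, against the indicator itself. *)
Lemma moll_cvg_open (U : set (R * R)) (M : R) : open U -> U `<=` box M ->
  moll_cvg (\1_U).
Proof.
move=> oU UM; have mU := open_prod_measurable oU.
have UE : \1_U = \1_(U `&` box M) :> (R * R -> R) by rewrite setIidl.
have U2 : sqintg leb2 \1_U by rewrite UE; exact: sqintg_indic_box.
have iU : intg leb2 \1_U by apply: eq_intg U2.2 => x; exact: sqr_indic.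
pose c n := conv (moll n) \1_U.
have c2 n := conv_moll_sq n U2.
have c01 n x : 0 <= c n x <= 1.
  have [im m1] := moll_mass n x.
  have ii := conv_intg x (testf_moll R n) U2.
  rewrite /c /conv; apply/andP; split.
    by apply: Rintegral_ge0 => y _; rewrite mulr_ge0 ?moll_ge0// indicE.
  rewrite -m1; apply: le_Rintegral => // y _.
  by rewrite indicE; case: (_ \in _); rewrite ?mulr1 ?mulr0 ?moll_ge0.
have [|||_ /cvg_nP cvgc] := @Rint_dct _ _ R leb2 (fun n x => \1_U x * c n x) \1_U \1_U _ iU.
- by move=> n; apply: measurable_funM; [case: U2|case: (c2 n) => -[]].
- move=> n x; rewrite normrM; have /andP[c0 c1] := c01 n x.
  rewrite (ger0_norm c0) indicE; case: (_ \in _); rewrite ?normr1 ?normr0 ?mul1r ?mul0r//.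
- move=> x; apply/cvg_nP => e e0; rewrite indicE; have [|_] := boolP (x \in U); last first.
    by exists 0 => n _; rewrite mul0r subrr normr0 ltW.
  rewrite inE => Ux; have [N HN] := nearby_moll oU Ux.
  exists N => n Nn; rewrite mul1r.
  suff -> : c n x = 1 by rewrite subrr normr0 ltW.
  rewrite -(moll_mass n x).2; apply: eq_Rintegral => y _.
  have [xy|xy] := leP `|x - y| n.+1%:R^-1.
    by rewrite indicE mem_set ?mulr1//; exact: (HN n).
  by rewrite moll_supp// mul0r.
move=> e e0; have [|N HN] := cvgc (e / 2); first by rewrite divr_gt0.
exists N => n /HN; rewrite ler_norml => /andP[h _].
have [c2n cn] := c2 n.
rewrite nsqB// -/(c n).
have : nsq leb2 (\1_U) = \int[leb2]_x \1_U x.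
  by apply: eq_Rintegral => x _; exact: sqr_indic.
have -> : dot leb2 (c n) \1_U = \int[leb2]_x (\1_U x * c n x).
  by apply: eq_Rintegral => x _; rewrite mulrC.
move: h cn; rewrite -/(c n); lra.
Qed.

Lemma moll_cvgD g u : sqintg leb2 g -> sqintg leb2 u -> moll_cvg g -> moll_cvg u ->
  moll_cvg (fun x => g x + u x).
Proof.
move=> g2 u2 cg cu e e0.
have [|N HN] := cg (e / 4); first by rewrite divr_gt0.
have [|M HM] := cu (e / 4); first by rewrite divr_gt0.
exists (maxn N M) => n; rewrite geq_max => /andP[/HN h1 /HM h2].
have -> : nsq leb2 (fun x => conv (moll n) (fun x => g x + u x) x - (g x + u x)) =
   nsq leb2 (fun x => (conv (moll n) g x - g x) + (conv (moll n) u x - u x)).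
  apply: eq_Rintegral => x _; congr (_ ^+ 2).
  have -> : conv (moll n) (fun x => g x + u x) x = conv (moll n) g x + conv (moll n) u x.
    rewrite /conv -RintegralD//; try by apply: conv_intg => //; exact: testf_moll.
    by apply: eq_Rintegral => y _; rewrite mulrDr.
  by ring.
have s1 := sqintgB (conv_moll_sq n g2).1 g2.
have s2 := sqintgB (conv_moll_sq n u2).1 u2.
by apply: le_trans (nsqD_le s1 s2) _; lra.
Qed.

Lemma moll_cvgZ (k : R) g : sqintg leb2 g -> moll_cvg g -> moll_cvg (fun x => k * g x).
Proof.
move=> g2 cg e e0.
have [|N HN] := cg (e / (k ^+ 2 + 1)); first by rewrite divr_gt0// ltr_wpDl// sqr_ge0.
exists N => n /HN h.
have -> : nsq leb2 (fun x => conv (moll n) (fun x => k * g x) x - k * g x) =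
   nsq leb2 (fun x => k * (conv (moll n) g x - g x)).
  apply: eq_Rintegral => x _; congr (_ ^+ 2).
  rewrite mulrBr; congr (_ - _).
  rewrite /conv -RintegralZl//; last by apply: conv_intg => //; exact: testf_moll.
  by apply: eq_Rintegral => y _; ring.
rewrite nsqZ; last exact: sqintgB (conv_moll_sq n g2).1 g2.
have k0 : 0 <= k ^+ 2 by exact: sqr_ge0.
have := ler_wpM2l k0 h; move/le_trans; apply.
by rewrite mulrA ler_pdivrMr ?ltr_wpDl// mulrDr mulr1 mulrC lerDl ltW.
Qed.

Lemma moll_cvg_ext g u : g =1 u -> moll_cvg g -> moll_cvg u.
Proof. by move=> /funext ->. Qed.

Lemma nsq_cvg0 (f_ : nat -> R * R -> R) (f g : R * R -> R) :
  (forall n, measurable_fun setT (f_ n)) -> sqintg leb2 g -> sqintg leb2 f ->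
  (forall n x, `|f_ n x - f x| <= `|g x|) -> (forall x, f_ n x @[n --> \oo] --> f x) ->
  forall e, 0 < e -> exists N, forall n, (N <= n)%N -> nsq leb2 (fun x => f_ n x - f x) <= e.
Proof.
move=> mf [mg g2] [mf' _] fg cf e e0.
have [|||_ /cvg_nP h] := @Rint_dct _ _ R leb2 (fun n x => (f_ n x - f x) ^+ 2) (fun _ => 0)
   (fun x => g x ^+ 2) _ g2.
- move=> n; have := measurable_funB (mf n) mf'; exact: measurable_funX.
- by move=> n x; rewrite ger0_norm ?sqr_ge0//; exact: ler_sqr_norm.
- move=> x; have : (f_ n x - f x) * (f_ n x - f x) @[n --> \oo] --> (0 * 0 : R).
    by apply: cvgM; apply/subr_cvg0; exact: cf.
  by rewrite mulr0.
have [N HN] := h e e0; exists N => n /HN.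
rewrite (@Rint0 _ _ R leb2 (fun _ => 0))// subr0 ger0_norm//; exact: nsq_ge0.
Qed.

(** Dynkin's theorem: open sets form a pi-system, and the sets whose truncation to the ball is
    approximated form a lambda-system, by linearity for proper differences and by [moll_cvg_closed]
    for increasing unions. The truncation keeps indicators in [L^2]. *)
Lemma moll_cvg_indic (A : set (R * R)) (M : R) : measurable A ->
  moll_cvg (\1_(A `&` [set x : R * R | `|x| < M])).
Proof.
set O := [set x : R * R | `|x| < M].
have oO : open O.
  have -> : O = (fun x : R * R => `|x|) @^-1` [set r | r < M] by [].
  apply: open_comp; last exact: open_lt.
  by move=> x _; exact: norm_continuous.
have OM : O `<=` box M by move=> x; rewrite /O /box/= => /ltW.
have mO := open_prod_measurable oO.
have sq X : measurable X -> sqintg leb2 \1_(X `&` O).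
  move=> mX; have -> : X `&` O = (X `&` O) `&` box M.
    by rewrite [RHS]setIidl// => x [_ /OM].
  by apply: sqintg_indic_box; exact: measurableI.
pose H := [set X : set (R * R) | measurable X /\ moll_cvg (\1_(X `&` O))].
move=> mA; suff : H A by case.
move: A mA; have -> : measurable = (<<s [set U : set (R * R) | open U] >>) :> set (set (R * R)).
  rewrite eqEsubset; split=> X; first exact: open_generate.
  apply: smallest_sub => //; first exact: sigma_algebra_measurable.
  by move=> U; exact: open_prod_measurable.
have openH : [set U : set (R * R) | open U] `<=` H.
  move=> U oU; split; first exact: open_prod_measurable.
  by apply: (@moll_cvg_open _ M); [exact: openI|move=> x [_ /OM]].
apply: lambda_system_subset => //; first by move=> X Y; exact: openI.
split=> //.
- by apply: openH; exact: openT.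
- move=> X Y YX [mX cX] [mY cY]; split; first exact: measurableD.
  apply: (@moll_cvg_ext (fun x => \1_(X `&` O) x + -1 * \1_(Y `&` O) x)).
    move=> x; rewrite setDE !indicE !in_setI in_setC.
    have [xO|_] := boolP (x \in O); last by rewrite !andbF mulr0 addr0.
    rewrite !andbT; have [xY|xY] := boolP (x \in Y); last by rewrite andbT mulr0 addr0.
    by rewrite andbF (_ : x \in X) ?mulr1 ?subrr// inE; apply: YX; rewrite inE in xY.
  apply: moll_cvgD; [exact: sq|apply: sqintgZ; exact: sq|exact: cX|].
  by apply: moll_cvgZ => //; exact: sq.
- move=> F ndF HF.
  have mF : measurable (\bigcup_i F i) by apply: bigcup_measurable => i _; case: (HF i).
  split=> //; apply: moll_cvg_closed; first exact: sq.
  move=> e e0.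
  have [|||N /(_ N (leqnn N)) HN] := @nsq_cvg0 (fun n => \1_(F n `&` O)) (\1_(\bigcup_i F i `&` O))
     (\1_(\bigcup_i F i `&` O)) _ (sq _ mF) (sq _ mF) _ _ e e0.
  + by move=> n; case: (sq (F n)) => //; case: (HF n).
  + move=> n x; rewrite !indicE !in_setI.
    case: (x \in O); rewrite ?andbF ?andbT ?subrr ?normr0//.
    have [xF|xF] := boolP (x \in F n).
      by rewrite (_ : x \in _) ?subrr ?normr0// inE; exists n => //; rewrite inE in xF.
    by rewrite sub0r normrN.
  + move=> x; apply/cvg_nP => d d0.
    have [xU|xU] := boolP (x \in \bigcup_i F i); last first.
      exists 0 => n _; rewrite !indicE !in_setI (negbTE xU).
      rewrite (_ : x \in F n = false) ?subrr ?normr0 ?ltW//; apply/negbTE; apply: contra xU.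
      by rewrite !inE => xF; exists n.
    have [k _ xk] : (\bigcup_i F i) x by rewrite inE in xU.
    exists k => n kn; rewrite !indicE !in_setI xU (_ : x \in F n) ?subrr ?normr0 ?ltW//.
    by rewrite inE; move/subsetPset: (ndF _ _ kn); apply.
  exists (\1_(F N `&` O)); split; [|by case: (HF N)|by rewrite nsq_subC].
  by apply: sq; case: (HF N).
Qed.

End MollifierApproximation.

Section Layers.
Variable R : realType.
Implicit Types (y delta : R).

(** The sum counts the positive multiples of [delta] up to [y]: it is [delta] times the integer part
    of [y / delta]. *)
Lemma layer_sum (delta : R) (K : nat) (y : R) : 0 < delta -> 0 <= y < K.+1%:R * delta ->
  0 <= y - \sum_(i < K) delta * ((i.+1%:R * delta <= y)%R)%:R < delta.
Proof.
move=> d0; elim: K => [|K IH] /andP[y0 yK].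
  by rewrite big_ord0 subr0 y0; move: yK; rewrite mul1r.
rewrite big_ord_recr/=; have [Ky|yK'] := leP (K.+1%:R * delta) y; last first.
  by rewrite mulr0 addr0; apply: IH; rewrite y0.
rewrite mulr1 (eq_bigr (fun _ => delta)) => [|i _]; last first.
  rewrite (_ : _ <= _) ?mulr1//; apply: le_trans Ky.
  by rewrite ler_pM2r// ler_nat ltnW// ltnS ltn_ord.
rewrite sumr_const card_ord -mulr_natl; move: Ky yK.
by rewrite -(natr1 K.+1) -(natr1 K); move: (K%:R : R) => k h1 h2; apply/andP; split; nra.
Qed.

End Layers.

Section MollifierConvergence.
Variable R : realType.
Local Notation leb := (@lebesgue_measure R).
Local Notation leb2 := (leb \x leb)%E.
Implicit Types (phi g u : R * R -> R) (x y z h : R * R).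

Let obox (M : R) : set (R * R) := [set x : R * R | `|x| < M].

Let mobox M : measurable (obox M).
Proof.
apply: open_prod_measurable.
have -> : obox M = (fun x : R * R => `|x|) @^-1` [set r | r < M] by [].
apply: open_comp; last exact: open_lt.
by move=> x _; exact: norm_continuous.
Qed.

Let sqobox (A : set (R * R)) M : measurable A -> sqintg leb2 (\1_(A `&` obox M)).
Proof.
move=> mA; have -> : A `&` obox M = (A `&` obox M) `&` box M.
  by rewrite [RHS]setIidl// => x [_]; rewrite /obox /box/= => /ltW.
by apply: sqintg_indic_box; exact: measurableI.
Qed.

Lemma nsq_le_box g (M e : R) : sqintg leb2 g -> 0 <= e ->
  (forall x, `|g x| <= e * \1_(obox M) x) ->
  nsq leb2 g <= e ^+ 2 * fine (leb2 (box M)).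
Proof.
move=> g2 e0 ge.
have s1 := @sqintgZ _ _ _ leb2 e _ (sqintg_indic_box M (@measurableT _ (R * R)%type)).
have : nsq leb2 g <= nsq leb2 (fun x => e * \1_(setT `&` box M) x).
  apply: nsq_le => // x; apply: (le_trans (ge x)).
  apply: le_trans (ler_norm _); rewrite ler_wpM2l// setTI !indicE ler_nat.
  have [xo|//] := boolP (x \in obox M); rewrite (_ : x \in box M)// inE.
  by move: xo; rewrite inE /obox /box/= => /ltW.
move/le_trans; apply; rewrite nsqZ; last exact: sqintg_indic_box.
rewrite ler_wpM2l ?sqr_ge0// setTI.
have -> : nsq leb2 (\1_(box M)) = \int[leb2]_x \1_(box M) x.
  by apply: eq_Rintegral => x _; exact: sqr_indic.
by rewrite /Rintegral integral_indic ?setIT//; exact: measurable_box.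
Qed.

Lemma moll_cvg_nonneg g (M B : R) : measurable_fun setT g -> (forall x, 0 <= g x <= B) ->
  (forall x, M <= `|x| -> g x = 0) -> moll_cvg g.
Proof.
move=> mg g0B gs.
have B0 : 0 <= B by have /andP[/le_trans h /h] := g0B 0.
have g2 : sqintg leb2 g.
  apply: (@sqintg_bounded_supp _ _ B M) => // x.
    by have /andP[a b] := g0B x; rewrite ger0_norm.
  by move=> /ltW /gs.
apply: moll_cvg_closed => // e e0.
pose m := fine (leb2 (box M)).
have m0 : 0 <= m by rewrite fine_ge0.
(* The layered function is within [dl] of [g] on a box of measure [m]; [dl <= 1] and
   [dl * (m + 1) <= e] give [dl^2 * m <= e]. *)
pose dl := Num.min 1 (e / (m + 1)).
have dl0 : 0 < dl by rewrite lt_min ltr01 divr_gt0// ltr_wpDl.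
pose K := Num.truncn (B / dl).
have HK x : 0 <= g x < K.+1%:R * dl.
  have /andP[-> gB] := g0B x; apply: (le_lt_trans gB).
  rewrite -ltr_pdivrMr//; apply: (lt_le_trans (truncnS_gt _)) => //.
pose A i := [set x | i.+1%:R * dl <= g x].
have mA i : measurable (A i).
  rewrite -[A i]setTI; have := @measurable_fun_le _ _ _ setT (cst (i.+1%:R * dl)) g.
  by apply => //; exact: measurable_cst.
pose f x := \sum_(i < K) dl * \1_(A i `&` obox M) x.
have fE x : f x = \1_(obox M) x * \sum_(i < K) dl * ((i.+1%:R * dl <= g x)%R)%:R.
  rewrite mulr_sumr; apply: eq_bigr => i _; rewrite !indicE in_setI.
  have -> : (x \in A i) = (i.+1%:R * dl <= g x) by apply/idP/idP; rewrite inE.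
  by case: (x \in obox M); rewrite ?andbT ?andbF ?mul1r ?mul0r ?mulr0.
have [f2 fc] : sqintg leb2 f /\ moll_cvg f.
  rewrite /f; elim: (K) => [|k [IH1 IH2]].
    split.
      by apply: (@sqintg_le _ _ _ leb2 _ _ _ (sqintg0 leb2)) => [|x]; rewrite ?big_ord0//;
       under eq_fun do rewrite big_ord0; exact: measurable_cst.
    apply: (@moll_cvg_ext _ (fun x => 0 * g x)) => [x|]; first by rewrite big_ord0 mul0r.
    move=> d d0; exists 0 => n _.
    rewrite /nsq Rint0 ?ltW// => x; rewrite /conv Rint0 ?mul0r ?subrr ?expr0n//.
    by move=> y; rewrite mul0r mulr0.
  have sk := @sqintgZ _ _ _ leb2 dl _ (sqobox M (mA k)).
  split.
    by apply: (eq_rect _ (sqintg leb2) (sqintgD IH1 sk)); apply/funext => x; rewrite big_ord_recr.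
  apply: (@moll_cvg_ext _ _ _ _ (moll_cvgD IH1 sk IH2 _)) => [x|]; first by rewrite big_ord_recr.
  by apply: moll_cvgZ; [exact: sqobox|exact: moll_cvg_indic].
exists f; split=> //.
have dlx x : `|g x - f x| <= dl * \1_(obox M) x.
  rewrite fE !indicE; have [xo|xo] := boolP (x \in obox M); last first.
    rewrite mul0r subr0 gs ?normr0 ?mulr0//.
    by rewrite leNgt; apply: contra xo => h; rewrite inE.
  rewrite mul1r mulr1; have /andP[a b] := layer_sum dl0 (HK x).
  by rewrite ger0_norm// ltW.
apply: (le_trans (nsq_le_box (sqintgB g2 f2) (ltW dl0) dlx)); rewrite -/m.
have d1 : dl <= 1 by rewrite ge_min lexx.
have d2 : dl <= e / (m + 1) by rewrite ge_min lexx orbT.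
have m1 : 0 < m + 1 by rewrite ltr_wpDl.
move: d2; rewrite ler_pdivlMr// => d2.
by rewrite expr2; have := ltW dl0; nra.
Qed.

(** Adding [B] on the ball makes the function nonnegative, and [moll_cvg] is stable under linear
    combinations. *)
Lemma moll_cvg_bounded g (M B : R) : measurable_fun setT g -> (forall x, `|g x| <= B) ->
  (forall x, M <= `|x| -> g x = 0) -> moll_cvg g.
Proof.
move=> mg gB gs.
have m1 : measurable_fun setT (fun x => g x + B * \1_(obox M) x).
  apply: measurable_funD => //; apply: measurable_funM; first exact: measurable_cst.
  by apply: measurable_indic.
have s1 : sqintg leb2 (\1_(obox M)) by have := sqobox M measurableT; rewrite setTI.
have g2 : sqintg leb2 g by apply: (@sqintg_bounded_supp _ _ B M) => // x /ltW /gs.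
apply: (@moll_cvg_ext _ (fun x => (g x + B * \1_(obox M) x) + - B * \1_(obox M) x)).
  by move=> x; ring.
apply: moll_cvgD.
- by apply: sqintgD => //; exact: sqintgZ.
- exact: sqintgZ.
- apply: (@moll_cvg_nonneg _ M (B + B)) => // x.
    have := gB x; rewrite ler_norml => /andP[a b].
    rewrite indicE; have [xo|xo] := boolP (x \in obox M); first by rewrite mulr1; lra.
    rewrite gs; last by rewrite leNgt; apply: contra xo => h; rewrite inE.
    by have := le_trans (normr_ge0 _) (gB x); rewrite mulr0 addr0 lexx/= => h; lra.
  move=> Mx; rewrite gs// indicE (_ : x \in _ = false) ?mulr0 ?addr0//.
  by apply/negbTE; rewrite notin_setE /obox/= ltNge Mx.
- apply: moll_cvgZ => //; have := @moll_cvg_indic R setT M measurableT.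
  by rewrite setTI.
Qed.

(** Truncating values and support at level [n] gives bounded functions that converge to [g] in [L^2]
    by dominated convergence; [moll_cvg_closed] concludes. *)
Lemma moll_cvg_L2 g : sqintg leb2 g -> moll_cvg g.
Proof.
move=> g2; apply: moll_cvg_closed => // e e0.
have [mg _] := g2.
pose T n := [set x | `|g x| <= n%:R] `&` obox n%:R.
have mT n : measurable (T n).
  apply: measurableI; last exact: mobox.
  rewrite -[X in measurable X]setTI.
  have := @measurable_fun_le _ _ _ setT (fun x => `|g x|) (cst n%:R) measurableT.
  by apply; [exact: measurableT_comp|exact: measurable_cst].
pose f n x := \1_(T n) x * g x.
have mf n : measurable_fun setT (f n) by apply: measurable_funM => //; exact: measurable_indic.
have f2 n : sqintg leb2 (f n).
  apply: (@sqintg_le _ _ _ leb2 _ g (mf n) g2) => x.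
  by rewrite /f normrM ler_piMl// indic_norm_le1.
have [||N /(_ N (leqnn N)) HN] := @nsq_cvg0 _ f g g mf g2 g2 _ _ e e0.
- move=> n x; rewrite /f indicE; case: (_ \in _); rewrite ?mul1r ?mul0r ?subrr ?normr0//.
  by rewrite sub0r normrN.
- move=> x; apply/cvg_nP => d d0.
  pose k := (Num.truncn `|g x| + Num.truncn `|x|).+1.
  exists k => n kn; rewrite /f indicE mem_set ?mul1r ?subrr ?normr0 ?ltW//.
  split; rewrite /obox/=.
    rewrite ltW//; apply: lt_le_trans (truncnS_gt _) _; rewrite ler_nat.
    by apply: leq_trans kn; rewrite ltnS leq_addr.
  apply: lt_le_trans (truncnS_gt _) _; rewrite ler_nat.
  by apply: leq_trans kn; rewrite ltnS leq_addl.
exists (f N); split; rewrite 1?nsq_subC//.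
apply: (@moll_cvg_bounded _ N%:R N%:R) => // x.
  rewrite /f indicE; have [|_] := boolP (x \in T N); rewrite ?mul1r ?mul0r ?normr0//.
  by rewrite inE => -[].
move=> Nx; rewrite /f indicE (_ : x \in _ = false) ?mul0r//.
by apply/negbTE; rewrite notin_setE => -[_]; rewrite /obox/= ltNge Nx.
Qed.

End MollifierConvergence.

(** * Density of test functions in H^1 *)

Section SobolevDensity.
Variable R : realType.
Local Notation leb := (@lebesgue_measure R).
Local Notation leb2 := (leb \x leb)%E.
Implicit Types (phi psi g u : R * R -> R) (x y z v : R * R).

Definition wpart (e : R * R) u g := sqintg leb2 g /\
  forall phi, testf phi -> dot leb2 u ('D_e phi) = - dot leb2 g phi.

Definition isH1 u g1 g2 :=
  [/\ sqintg leb2 u, wpart (e1 R) u g1 & wpart (e2 R) u g2].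

(** The derivative falls on the mollifier, which after reflection is a test function of [y]. The
    reflection [x - y] and the integration by parts each change the sign. *)
Lemma wpart_conv n u g e x : sqintg leb2 u -> wpart e u g ->
  'D_e (conv (moll n) u) x = conv (moll n) g x.
Proof.
move=> u2 [g2 H]; have tm := testf_moll R n.
have [_ ->] := conv_diff x tm u2.
have := H _ (testf_reflect x tm); rewrite /dot => h.
have -> : conv (moll n) g x = \int[leb2]_y (g y * moll n (x - y)).
  by apply: eq_Rintegral => y _; rewrite mulrC.
apply: oppr_inj; rewrite -h /conv -mulN1r -RintegralZl//; last first.
  exact: (conv_intg x (testf_derive e tm) u2).
apply: eq_Rintegral => y _; rewrite derive_reflectE; first by ring.
by apply: smooth_differentiable; exact: testf_smooth.
Qed.

(** Both weak derivatives have the same mollifications, namely the derivatives of the mollified [u];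
    the mollifications of their difference are 0 and yet converge to it. *)
Lemma wpart_uniq e u g h : sqintg leb2 u -> wpart e u g -> wpart e u h ->
  nsq leb2 (fun x => g x - h x) = 0.
Proof.
move=> u2 wg wh; have [g2 _] := wg; have [h2 _] := wh.
have gh2 := sqintgB g2 h2.
apply/eqP; rewrite eq_le nsq_ge0 andbT; apply/ler_addgt0Pr => e' e0; rewrite add0r.
have [N /(_ N (leqnn N))] := moll_cvg_L2 gh2 e0.
rewrite nsq_subC; congr (_ <= _); apply: eq_Rintegral => x _; congr (_ ^+ 2).
rewrite convB//; last exact: testf_moll.
by rewrite -(wpart_conv _ _ u2 wg) -(wpart_conv _ _ u2 wh) subrr subr0.
Qed.

(** The factor normalizes the value at 0 to 1, since [flat 0 1 = expR (- 1)]. *)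
Definition cut1 (r : R) : R := expR 1 * bump1 0 r.

Lemma cut1_ge0 r : 0 <= cut1 r.
Proof. by rewrite mulr_ge0 ?expR_ge0// bump1_ge0. Qed.

Lemma cut1_le1 r : cut1 r <= 1.
Proof.
rewrite /cut1 /bump1 /flat mul1r expr0; case: ifP => [h|_]; last by rewrite mulr0.
rewrite mul1r -expRD -[leRHS]expR0 ler_expR subr_le0 -[leLHS]invr1 lef_pV2 ?posrE//.
by rewrite gerBl sqr_ge0.
Qed.

Lemma cut1_0 : cut1 0 = 1.
Proof.
rewrite /cut1 /bump1 /flat mul1r expr0n subr0 ltr01 expr0 mul1r invr1.
by rewrite -expRD subrr expR0.
Qed.

Definition cut (n : nat) x : R := cut1 (n.+1%:R^-1 * x.1) * cut1 (n.+1%:R^-1 * x.2).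

Lemma smooth_cut1 : smooth cut1.
Proof. by apply: smoothZ; exact: smooth_bump1. Qed.

Lemma testf_cut n : testf (cut n).
Proof.
split.
  apply: smoothM; apply: smooth_comp smooth_cut1 _; apply: smoothZ.
    exact: smooth_fst.
  exact: smooth_snd.
exists n.+1%:R => x.
have key r : n.+1%:R < `|r| -> cut1 (n.+1%:R^-1 * r) = 0 :> R.
  move=> nr; rewrite /cut1 bump1_supp ?mulr0// invr1 normrM ger0_norm//.
  by rewrite mulrC ltr_pdivlMr// mul1r.
have [x1|x1] := ltP n.+1%:R `|x.1|; first by rewrite /cut key// mul0r.
have [x2|x2] := ltP n.+1%:R `|x.2|; first by rewrite /cut (key x.2)// mulr0.
by rewrite ltNge prod_norm_le x1 x2.
Qed.

Lemma cut01 n x : 0 <= cut n x <= 1.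
Proof. by rewrite mulr_ge0 ?cut1_ge0//= mulr_ile1 ?cut1_ge0 ?cut1_le1. Qed.

Lemma cut_scale n x : cut n x = cut 0 (n.+1%:R^-1 *: x).
Proof. by rewrite /cut invr1 !mul1r. Qed.

Lemma derive_scale (f : R * R -> R) (k : R) x v : differentiable f (k *: x) ->
  'D_v (fun y => f (k *: y)) x = k * 'D_v f (k *: x).
Proof.
move=> df; rewrite -derive_dirZ// /derive.
have -> : (fun h : R => h^-1 *: (((fun y => f (k *: y)) \o shift x) (h *: v) - f (k *: x))) =
    (fun h : R => h^-1 *: ((f \o shift (k *: x)) (h *: (k *: v)) - f (k *: x))).
  apply/funext => h /=.
  by have -> : k *: (h *: v + x) = h *: (k *: v) + k *: x by rewrite scalerDr !scalerA mulrC.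
by [].
Qed.

Lemma derive_cut_le v : exists2 C, 0 <= C & forall n x, `|'D_v (cut n) x| <= C * n.+1%:R^-1.
Proof.
have tc := testf_cut 0.
have [C C0 HC] := testf_bounded (testf_derive v tc).
exists C => // n x.
have -> : cut n = (fun x => cut 0 (n.+1%:R^-1 *: x)) by apply/funext => y; exact: cut_scale.
rewrite derive_scale; last by apply: smooth_differentiable; exact: testf_smooth.
by rewrite normrM ger0_norm// mulrC ler_wpM2r.
Qed.

Lemma cvg_cut x : cut n x @[n --> \oo] --> (1 : R).
Proof.
have c1 r : cut1 (n.+1%:R^-1 * r) @[n --> \oo] --> (1 : R).
  rewrite -[X in _ --> X]cut1_0; apply: continuous_cvg.
    by apply: smooth_continuous; exact: smooth_cut1.
  rewrite -[X in _ --> X](mul0r r); apply: cvgM; last exact: cvg_cst.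
  exact: cvg_harmonic.
by rewrite -[X in _ --> X]mulr1; apply: cvgM.
Qed.

Lemma cut_cvg_L2 g : sqintg leb2 g -> forall e, 0 < e -> exists N, forall n, (N <= n)%N ->
  nsq leb2 (fun x => cut n x * g x - g x) <= e.
Proof.
move=> g2; have [mg _] := g2.
apply: (@nsq_cvg0 _ _ g g) => //.
- by move=> n; apply: measurable_funM => //; apply: testf_measurable; exact: testf_cut.
- move=> n x; have -> : cut n x * g x - g x = (cut n x - 1) * g x by ring.
  have /andP[c0 c1] := cut01 n x.
  by rewrite normrM ler_piMl// ler_norml; lra.
- move=> x; rewrite -[X in _ --> X]mul1r; apply: cvgM; last exact: cvg_cst.
  exact: cvg_cut.
Qed.

(** In the Leibniz rule the term [phi * 'D_v (cut n)] is of order [1/(n+1)] in [L^2], because the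
    cutoff is spread over a scale [n + 1]; the other term converges by dominated convergence. *)
Lemma cutoff_density phi : smooth phi -> sqintg leb2 phi ->
  sqintg leb2 ('D_(e1 R) phi) -> sqintg leb2 ('D_(e2 R) phi) ->
  forall e, 0 < e -> exists2 N, forall n, (N <= n)%N -> testf (fun x => cut n x * phi x) &
  forall n, (N <= n)%N ->
  [/\ nsq leb2 (fun x => cut n x * phi x - phi x) <= e,
      nsq leb2 (fun x => 'D_(e1 R) (fun x => cut n x * phi x) x - 'D_(e1 R) phi x) <= e &
      nsq leb2 (fun x => 'D_(e2 R) (fun x => cut n x * phi x) x - 'D_(e2 R) phi x) <= e].
Proof.
move=> sp p2 p12 p22 e e0.
have dpart v : sqintg leb2 ('D_v phi) -> exists N, forall n, (N <= n)%N ->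
    nsq leb2 (fun x => 'D_v (fun x => cut n x * phi x) x - 'D_v phi x) <= e.
  move=> v2; have [|N1 HN1] := cut_cvg_L2 v2 (e := e / 4); first by rewrite divr_gt0.
  have [C C0 HC] := derive_cut_le v.
  pose a := 2 * C ^+ 2 * nsq leb2 phi.
  have a0 : 0 <= a by rewrite !mulr_ge0 ?sqr_ge0 ?nsq_ge0.
  pose N2 := Num.truncn (a / (e / 2)).
  exists (maxn N1 N2) => n; rewrite geq_max => /andP[/HN1 h1 h2].
  have tc := testf_cut n.
  have s1 : sqintg leb2 (fun x => cut n x * 'D_v phi x - 'D_v phi x).
    apply: sqintgB => //; apply: (sqintg_le _ v2).
      by apply: measurable_funM; [exact: testf_measurable|case: v2].
    by move=> x; have /andP[c0 c1] := cut01 n x; rewrite normrM ger0_norm// ler_piMl.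
  have s2 : sqintg leb2 (fun x => phi x * 'D_v (cut n) x).
    apply: (@sqintg_le _ _ _ leb2 _ (fun x => C * phi x)); last first.
    - move=> x; rewrite !normrM mulrC ler_wpM2r// (ger0_norm C0).
      by apply: (le_trans (HC n x)); rewrite ler_piMr// invf_le1// ler1n.
    - exact: sqintgZ.
    - apply: measurable_funM; first by case: p2.
      by apply: testf_measurable; exact: testf_derive.
  have -> : nsq leb2 (fun x => 'D_v (fun x => cut n x * phi x) x - 'D_v phi x) =
    nsq leb2 (fun x => (cut n x * 'D_v phi x - 'D_v phi x) + phi x * 'D_v (cut n) x).
    apply: eq_Rintegral => x _; congr (_ ^+ 2).
    by rewrite derive_mul//; [ring|exact: testf_smooth].
  apply: (le_trans (nsqD_le s1 s2)).
  suff : 2 * nsq leb2 (fun x => phi x * 'D_v (cut n) x) <= e / 2 by lra.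
  have h3 : nsq leb2 (fun x => phi x * 'D_v (cut n) x) <=
            (C * n.+1%:R^-1) ^+ 2 * nsq leb2 phi.
    rewrite -nsqZ//; apply: nsq_le => //; first exact: sqintgZ.
    move=> x; rewrite !normrM mulrC ler_wpM2r//.
    by apply: (le_trans (HC n x)); rewrite (ger0_norm C0) ger0_norm.
  apply: (le_trans (ler_wpM2l _ h3)) => //.
  have -> : 2 * ((C * n.+1%:R^-1) ^+ 2 * nsq leb2 phi) = a * n.+1%:R^-1 ^+ 2.
    by rewrite /a; ring.
  have n1 : n.+1%:R^-1 ^+ 2 <= n.+1%:R^-1 :> R.
    by rewrite expr2 ler_piMr// invf_le1// ler1n.
  apply: (le_trans (ler_wpM2l a0 n1)).
  rewrite ler_pdivrMr// mulrC -ler_pdivrMr ?divr_gt0// ltW//.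
  by apply: lt_le_trans (truncnS_gt _) _; rewrite ler_nat ltnS.
have [N0 H0] := cut_cvg_L2 p2 e0.
have [N1 H1] := dpart _ p12.
have [N2 H2] := dpart _ p22.
exists (maxn N0 (maxn N1 N2)) => n; rewrite !geq_max => /andP[n0 /andP[n1 n2]].
  rewrite (_ : (fun x => _) = (fun x => phi x * cut n x)); last first.
    by apply/funext => x; rewrite mulrC.
  by apply: testfMl => //; exact: testf_cut.
by split; [exact: H0|exact: H1|exact: H2].
Qed.

(** Mollification commutes with weak derivatives and produces smooth functions; a cutoff then makes
    the support bounded. *)
Lemma H1_density u g1 g2 : isH1 u g1 g2 -> forall e, 0 < e -> exists2 phi, testf phi &
  [/\ nsq leb2 (fun x => phi x - u x) <= e,
      nsq leb2 (fun x => 'D_(e1 R) phi x - g1 x) <= e &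
      nsq leb2 (fun x => 'D_(e2 R) phi x - g2 x) <= e].
Proof.
move=> [u2 w1 w2] e e0.
have [g12 _] := w1; have [g22 _] := w2.
have e40 : 0 < e / 4 by rewrite divr_gt0.
have [N0 H0] := moll_cvg_L2 u2 e40.
have [N1 H1] := moll_cvg_L2 g12 e40.
have [N2 H2] := moll_cvg_L2 g22 e40.
pose n := maxn N0 (maxn N1 N2).
have n0 : (N0 <= n)%N by rewrite leq_max leqnn.
have n1 : (N1 <= n)%N by rewrite !leq_max leqnn orbT.
have n2 : (N2 <= n)%N by rewrite !leq_max leqnn !orbT.
pose f := conv (moll n) u.
have tm := testf_moll R n.
have sf : smooth f by exact: smooth_conv.
have D1 : 'D_(e1 R) f = conv (moll n) g1 by apply/funext => x; exact: wpart_conv.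
have D2 : 'D_(e2 R) f = conv (moll n) g2 by apply/funext => x; exact: wpart_conv.
have f2 := (conv_moll_sq n u2).1.
have f12 := (conv_moll_sq n g12).1.
have f22 := (conv_moll_sq n g22).1.
have [|||||N tN /(_ N (leqnn N)) [c0 c1 c2]] := @cutoff_density f _ _ _ _ (e / 4) => //.
- by rewrite D1.
- by rewrite D2.
have {}tN := tN N (leqnn N).
exists (fun x => cut N x * f x) => //.
have tri (a b c : R * R -> R) : sqintg leb2 a -> sqintg leb2 b -> sqintg leb2 c ->
    nsq leb2 (fun x => a x - b x) <= e / 4 -> nsq leb2 (fun x => b x - c x) <= e / 4 ->
    nsq leb2 (fun x => a x - c x) <= e.
  move=> a2 b2 c2' h1 h2.
  have -> : nsq leb2 (fun x => a x - c x) = nsq leb2 (fun x => (a x - b x) + (b x - c x)).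
    by apply: eq_Rintegral => x _; congr (_ ^+ 2); ring.
  apply: (le_trans (nsqD_le (sqintgB a2 b2) (sqintgB b2 c2'))).
  have -> : e = 2 * (e / 4) + 2 * (e / 4) by field.
  by apply: lerD; rewrite ler_wpM2l.
have {}c1 : nsq leb2 (fun x => 'D_(e1 R) (fun x => cut N x * f x) x - conv (moll n) g1 x) <= e / 4.
  by rewrite -D1; exact: c1.
have {}c2 : nsq leb2 (fun x => 'D_(e2 R) (fun x => cut N x * f x) x - conv (moll n) g2 x) <= e / 4.
  by rewrite -D2; exact: c2.
split.
- by apply: tri c0 (H0 n n0) => //; exact: testf_sqintg.
- by apply: tri c1 (H1 n n1) => //; apply: testf_sqintg; exact: testf_derive.
- by apply: tri c2 (H2 n n2) => //; apply: testf_sqintg; exact: testf_derive.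
Qed.

End SobolevDensity.

(** * Gaussian integrals and heat kernels *)

Section GaussianIntegrals.
Variable R : realType.
Local Notation leb := (@lebesgue_measure R).
Local Notation leb2 := (leb \x leb)%E.

Lemma integral_gauss (k m : R) : 0 < k ->
  (\int[leb]_x (expR (- (k * (x - m) ^+ 2)))%:E = (Num.sqrt (pi / k))%:E)%E.
Proof.
move=> k0; pose s := Num.sqrt (k^-1 / 2).
have s2 : s ^+ 2 = k^-1 / 2 by rewrite sqr_sqrtr// divr_ge0// invr_ge0 ltW.
have s0 : s != 0 by rewrite gt_eqF// sqrtr_gt0 divr_gt0// invr_gt0.
have q0 : 0 < Num.sqrt (pi / k) by rewrite sqrtr_gt0 divr_gt0// pi_gt0.
have E x : expR (- (k * (x - m) ^+ 2)) = Num.sqrt (pi / k) * normal_pdf m s x.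
  rewrite normal_pdfE// /normal_peak /normal_fun s2.
  have -> : k^-1 / 2 * pi *+ 2 = pi / k.
    by rewrite -mulr_natl; field; exact: lt0r_neq0.
  have -> : k^-1 / 2 *+ 2 = k^-1 by rewrite -mulr_natl; field; exact: lt0r_neq0.
  by rewrite mulVKf ?gt_eqF// invrK mulNr [k * _]mulrC.
under eq_integral do rewrite E EFinM.
rewrite integralZl//; last exact: integrable_normal_pdf.
by rewrite integral_normal_pdf mule1.
Qed.

Lemma intg_gauss (k m : R) : 0 < k -> intg leb (fun x => expR (- (k * (x - m) ^+ 2))).
Proof.
move=> k0; apply: (@intg_ltoo _ _ _ leb _ (Num.sqrt (pi / k))).
  apply: continuous_measurable_fun => x; apply: continuous_comp; last exact: continuous_expR.
  apply: cvgN; apply: cvgM; [exact: cvg_cst|apply: cvgM; (apply: cvgB; [exact: cvg_id|exact: cvg_cst])].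
under eq_integral do rewrite ger0_norm ?expR_ge0//.
by rewrite integral_gauss.
Qed.

Lemma integral_affine1 (G : R -> R) (a k : R) : 0 < k -> continuous G ->
  (forall x, 0 <= G x) ->
  (\int[leb]_x (G x)%:E = k%:E * \int[leb]_x (G (a + k * x))%:E)%E.
Proof.
move=> k0 cG G0.
have dF (x : R) : is_derive x (1 : R) (fun y : R => a + k * y) k.
  have := is_deriveD (is_derive_cst a x (1 : R)) (is_deriveZ k (is_derive_id x (1 : R))).
  by rewrite add0r /GRing.scale/= mulr1.
have E : derive1 (fun y : R => a + k * y) = cst k.
  by apply/funext => x; rewrite derive1E; case: (dF x).
have cF : continuous (fun y : R => a + k * y).
  by move=> x; apply: cvgD; [exact: cvg_cst|apply: cvgM; [exact: cvg_cst|exact: cvg_id]].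
rewrite (@increasing_ge0_integration_by_substitutionT _ (fun y => a + k * y) G) ?E//.
- rewrite -ge0_integralZl//.
  + by apply: eq_integral => x _; rewrite /= EFinM muleC.
  + apply/measurable_EFinP; apply: (measurableT_comp (continuous_measurable_fun cG)).
    exact: continuous_measurable_fun.
  + by move=> x _; rewrite lee_fin.
  + by rewrite lee_fin ltW.
- by move=> x y xy; rewrite ltrD2l ltr_pM2l.
- by move=> x; exact: cvg_cst.
- exact: is_cvg_cst.
- exact: is_cvg_cst.
- apply/cvgrNyPle => A; exists ((A - a) / k); split; first exact: num_real.
  by move=> x /ltW; rewrite ler_pdivlMr// mulrC lerBrDl.
- apply/cvgryPge => A; exists ((A - a) / k); split; first exact: num_real.
  by move=> x /ltW; rewrite ler_pdivrMr// mulrC lerBlDl.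
Qed.

Lemma integral_affine2 (F : R * R -> R) (y : R * R) (k : R) : 0 < k -> continuous F ->
  (forall x, 0 <= F x) ->
  (\int[leb2]_x (F x)%:E = (k ^+ 2)%:E * \int[leb2]_x (F (y + k *: x))%:E)%E.
Proof.
move=> k0 cF F0.
have mF : measurable_fun setT F by exact: continuous_prod_measurable.
have mr (u : R) : measurable_fun setT (fun r : R => u + k * r).
  by apply: measurable_funD => //; exact: measurable_funM.
have mF1 : measurable_fun setT (fun p : R * R => F (p.1, y.2 + k * p.2)).
  apply: (measurableT_comp mF); apply/measurable_fun_pairP; split.
    exact: (@measurable_fst _ _ R R).
  exact: (measurableT_comp (mr y.2) (@measurable_snd _ _ R R)).
have mF2 : measurable_fun setT (fun p : R * R => F (y + k *: p)).
  apply: (measurableT_comp mF); apply/measurable_fun_pairP; split.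
    exact: (measurableT_comp (mr y.1) (@measurable_fst _ _ R R)).
  exact: (measurableT_comp (mr y.2) (@measurable_snd _ _ R R)).
rewrite fubini_tonelli1; last 2 first.
- exact/measurable_EFinP.
- by move=> x; rewrite lee_fin.
transitivity (k%:E * \int[leb2]_p (F (p.1, y.2 + k * p.2))%:E)%E.
  rewrite fubini_tonelli1; last 2 first.
  - exact/measurable_EFinP.
  - by move=> x; rewrite lee_fin.
  rewrite -ge0_integralZl//.
  - apply: eq_integral => x _; rewrite /fubini_F/=.
    by rewrite (@integral_affine1 (fun r => F (x, r)) y.2 k)//; exact: continuous_slice2.
  - apply: (@measurable_fun_fubini_tonelli_F _ _ _ _ _ leb (EFin \o (fun p : R * R => F (p.1, y.2 + k * p.2)))).
    + exact/measurable_EFinP.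
    + by move=> x; rewrite lee_fin.
  - by move=> x _; apply: integral_ge0 => r _; rewrite lee_fin.
  - by rewrite lee_fin ltW.
rewrite expr2 EFinM -muleA; congr (_ * _)%E.
rewrite fubini_tonelli2; last 2 first.
- exact/measurable_EFinP.
- by move=> x; rewrite lee_fin.
rewrite fubini_tonelli2; last 2 first.
- exact/measurable_EFinP.
- by move=> x; rewrite lee_fin.
rewrite -ge0_integralZl//.
- apply: eq_integral => x _; rewrite /fubini_G/=.
  by rewrite (@integral_affine1 (fun r => F (r, y.2 + k * x)) y.1 k)//; exact: continuous_slice1.
- apply: (@measurable_fun_fubini_tonelli_G _ _ _ _ _ leb (EFin \o (fun p : R * R => F (y + k *: p)))).
  + exact/measurable_EFinP.
  + by move=> x; rewrite lee_fin.
- by move=> x _; apply: integral_ge0 => r _; rewrite lee_fin.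
- by rewrite lee_fin ltW.
Qed.

Lemma continuous_affine2 (y : R * R) (k : R) : continuous (fun x : R * R => y + k *: x).
Proof.
move=> x; apply: cvgD; first exact: cvg_cst.
by apply: cvgZr; exact: cvg_id.
Qed.

Lemma Rint_affine2_ge0 (F : R * R -> R) (y : R * R) (k : R) : 0 < k -> continuous F ->
  (forall x, 0 <= F x) -> intg leb2 F ->
  intg leb2 (fun x => F (y + k *: x)) /\
  \int[leb2]_x F x = k ^+ 2 * \int[leb2]_x F (y + k *: x).
Proof.
move=> k0 cF F0 iF.
have k20 : 0 < k ^+ 2 by rewrite exprn_gt0.
have mF2 : measurable_fun setT (fun p : R * R => F (y + k *: p)).
  apply: continuous_prod_measurable => x.
  by apply: continuous_comp; [exact: continuous_affine2|exact: cF].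
have E := @integral_affine2 F y k k0 cF F0.
have i2 : intg leb2 (fun x => F (y + k *: x)).
  apply/integrableP; split; first exact/measurable_EFinP.
  under eq_integral do rewrite /= ger0_norm//.
  move: E; rewrite -EFin_Rint//.
  have : (0 <= \int[leb2]_x (F (y + k *: x))%:E)%E by apply: integral_ge0 => x _; rewrite lee_fin.
  case: (\int[leb2]_x _)%E => [r _ _||//]; first by rewrite ltry.
  by move=> _; rewrite gt0_muley// lte_fin.
split => //; apply: EFin_inj; rewrite EFinM EFin_Rint// EFin_Rint//.
Qed.

Lemma Rint_affine2 (F : R * R -> R) (y : R * R) (k : R) : 0 < k -> continuous F ->
  intg leb2 F -> intg leb2 (fun x => F (y + k *: x)) /\
  \int[leb2]_x F x = k ^+ 2 * \int[leb2]_x F (y + k *: x).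
Proof.
move=> k0 cF iF.
have cN : continuous (fun x => `|F x|).
  by move=> x; apply: continuous_comp; [exact: cF|exact: norm_continuous].
have [i1 E1] := @Rint_affine2_ge0 (fun x => `|F x|) y k k0 cN (fun x => normr_ge0 _) (intg_norm iF).
have [|||i2 E2] := @Rint_affine2_ge0 (fun x => `|F x| + F x) y k k0.
- by move=> x; apply: cvgD; [exact: cN|exact: cF].
- by move=> x; rewrite -lerBlDr sub0r ler_normr lexx orbT.
- by apply: intgD => //; exact: intg_norm.
have i3 : intg leb2 (fun x => F (y + k *: x)).
  by apply: eq_intg (intgB i2 i1) => x; rewrite addrC addKr.
split=> //; move: E2; rewrite !RintegralD//; last exact: intg_norm.
by rewrite mulrDr E1; move/addrI.
Qed.

End GaussianIntegrals.

Section Tails.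
Variable R : realType.
Local Notation leb := (@lebesgue_measure R).

Definition tail (b : R) (j : nat) (t : R) : R :=
  if 0 < t then t ^+ j * expR (- (b * t ^+ 4)) else 0.

Lemma tail_ge0 b j t : 0 <= tail b j t.
Proof. by rewrite /tail; case: ltP => // t0; rewrite mulr_ge0 ?expR_ge0// exprn_ge0// ltW. Qed.

Lemma measurable_if_pos d (T : measurableType d) (f g : T -> R) :
  measurable_fun setT f -> measurable_fun setT g ->
  measurable_fun setT (fun x => if 0 < f x then g x else 0).
Proof.
move=> mf mg; apply: measurable_fun_ifT => //.
by apply: measurable_fun_ltr => //; exact: measurable_cst.
Qed.

Lemma measurable_tail b j : measurable_fun setT (tail b j).
Proof.
apply: measurable_if_pos => //; apply: measurable_funM; first exact: measurable_funX.
apply: measurableT_comp => //; apply: measurableT_comp => //; apply: measurable_funM => //.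
Qed.

Lemma tail_le b j t : 0 < b -> (j <= 4)%N ->
  tail b j t <= expR (9 / (4 * b)) * expR (- (1 * (t - 0) ^+ 2)).
Proof.
move=> b0 j4; rewrite /tail; case: ltP => [t0|_]; last by rewrite mulr_ge0 ?expR_ge0.
have tj : t ^+ j <= expR (t ^+ 2) ^+ 2.
  apply: (@le_trans _ _ ((1 + t ^+ 2) ^+ 2)); last first.
    by rewrite ler_pXn2r ?nnegrE ?expR_ge0 ?expR_ge1Dx// addr_ge0 ?sqr_ge0.
  have [t1|t1] := leP t 1.
    apply: (@le_trans _ _ 1); first by rewrite exprn_ile1 ?(ltW t0).
    by rewrite exprn_ege1// lerDl sqr_ge0.
  apply: (@le_trans _ _ (t ^+ 4)); first by rewrite ler_weXn2l ?(ltW t1).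
  by have := sqr_ge0 t; nra.
apply: (le_trans (ler_wpM2r (expR_ge0 _) tj)).
rewrite -expRM_natl -!expRD ler_expR subr0.
(* Completing the square gives [2 t^2 - b t^4 <= 9/(4b) - t^2], whence the constant of the
   statement; the [2 t^2] comes from [t^j <= (1 + t^2)^2 <= (e^(t^2))^2]. *)
have : 0 <= (t ^+ 2 * (2 * b) - 3) ^+ 2 / (4 * b) by rewrite divr_ge0 ?sqr_ge0// mulr_ge0// ltW.
have -> : (t ^+ 2 * (2 * b) - 3) ^+ 2 / (4 * b) = b * t ^+ 4 - 3 * t ^+ 2 + 9 / (4 * b).
  by field; exact: lt0r_neq0.
lra.
Qed.

Lemma intg_tail b j : 0 < b -> (j <= 4)%N -> intg leb (tail b j).
Proof.
move=> b0 j4.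
have ig := @intgZ _ _ _ leb (expR (9 / (4 * b))) _ (intg_gauss 0 (@ltr01 R)).
apply: (@intg_le _ _ _ leb _ _ (measurable_tail b j) ig) => t.
by rewrite ger0_norm ?tail_ge0// tail_le.
Qed.

End Tails.

Section AlmostEverywhere.
Context d (T : measurableType d) (R : realType) (mu : {measure set T -> \bar R}).

Lemma sqintg_ae_le (f g : T -> R) : measurable_fun setT f -> sqintg mu g ->
  {ae mu, forall x, `|f x| <= `|g x|} -> sqintg mu f /\ nsq mu f <= nsq mu g.
Proof.
move=> mf [mg g2] fg.
have mf2 : measurable_fun setT (fun x => f x ^+ 2) by exact: measurable_funX.
have [|i le] := @Rint_le_ereal _ _ _ mu (fun x => f x ^+ 2) (nsq mu g) mf2 (fun x => sqr_ge0 _).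
  rewrite /nsq EFin_Rint//; apply: ae_ge0_le_integral => //.
  - by move=> x _; rewrite lee_fin sqr_ge0.
  - exact/measurable_EFinP.
  - by move=> x _; rewrite lee_fin sqr_ge0.
  - by apply/measurable_EFinP; exact: measurable_funX.
  - by apply: filterS fg => x h _; rewrite lee_fin; exact: ler_sqr_norm.
by split.
Qed.

End AlmostEverywhere.

(** * Gaussians in the plane and their integrals along an arc *)

Section EuclideanGauss.
Variable R : realType.
Local Notation leb := (@lebesgue_measure R).
Local Notation leb2 := (leb \x leb)%E.
Implicit Types (x y z : R * R).

Definition esq x : R := x.1 ^+ 2 + x.2 ^+ 2.

Lemma esq_ge0 x : 0 <= esq x.
Proof. by rewrite addr_ge0 ?sqr_ge0. Qed.

Lemma continuous_esq : continuous esq.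
Proof.
move=> x; apply: cvgD; rewrite expr2; apply: cvgM; try exact: cvg_fst; exact: cvg_snd.
Qed.

Lemma continuous_esq_sub y : continuous (fun x => esq (x - y)).
Proof.
move=> x; apply: (@continuous_comp _ _ _ (fun x => x - y) esq); last exact: continuous_esq.
by apply: cvgB; [exact: cvg_id|exact: cvg_cst].
Qed.

Lemma integral_prod_mul (F G : R -> R) : measurable_fun setT F -> measurable_fun setT G ->
  (forall s, 0 <= F s) -> (forall s, 0 <= G s) ->
  (\int[leb2]_z (F z.1 * G z.2)%:E =
   (\int[leb]_s (F s)%:E) * (\int[leb]_t (G t)%:E))%E.
Proof.
move=> mF mG F0 G0.
rewrite fubini_tonelli1; last 2 first.
- apply/measurable_EFinP; apply: measurable_funM.
    exact: (measurableT_comp mF (@measurable_fst _ _ R R)).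
  exact: (measurableT_comp mG (@measurable_snd _ _ R R)).
- by move=> x; rewrite lee_fin mulr_ge0.
rewrite -ge0_integralZr//.
- apply: eq_integral => s _; rewrite /fubini_F/=.
  under eq_integral do rewrite EFinM.
  rewrite ge0_integralZl//; first exact/measurable_EFinP.
  + by move=> t _; rewrite lee_fin.
  + by rewrite lee_fin.
- exact/measurable_EFinP.
- by move=> s _; rewrite lee_fin.
- by apply: integral_ge0 => t _; rewrite lee_fin.
Qed.

Lemma measurable_gauss (k m : R) : measurable_fun setT (fun r : R => expR (- (k * (r - m) ^+ 2))).
Proof.
apply: measurableT_comp => //; apply: measurableT_comp => //; apply: measurable_funM => //.
by apply: measurable_funX; exact: measurable_funB.
Qed.

Lemma integral_gauss2 (k : R) y : 0 < k ->
  (\int[leb2]_x (expR (- (k * esq (x - y))))%:E = (pi / k)%:E)%E.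
Proof.
move=> k0; have pk : 0 <= pi / k by rewrite divr_ge0 ?pi_ge0// ltW.
have := @integral_prod_mul _ _ (measurable_gauss k y.1) (measurable_gauss k y.2)
  (fun r => expR_ge0 _) (fun r => expR_ge0 _).
rewrite !integral_gauss// -EFinM -expr2 sqr_sqrtr// => <-.
by apply: eq_integral => x _; rewrite -expRD -opprD -mulrDr.
Qed.

(* With [t = tau^4], the heat kernel at time [t] is a multiple of
   [gker b (1/4) k tau |x|^2]: the powers of [tau] stay integrable at 0. *)
Definition gker (b a : R) (k : nat) (t r : R) : R :=
  if 0 < t then t^-1 ^+ k * expR (- (b * t ^+ 4) - a * r / t ^+ 4) else 0.

Lemma gker_ge0 b a k t r : 0 <= gker b a k t r.
Proof.
by rewrite /gker; case: ltP => // t0; rewrite mulr_ge0 ?expR_ge0// exprn_ge0// invr_ge0 ltW.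
Qed.

Lemma measurable_gker b a k : measurable_fun setT (fun p : R * R => gker b a k p.1 p.2).
Proof.
have mi := @measurable_invr R.
have m1 : measurable_fun setT (fst : R * R -> R) by [].
have m2 : measurable_fun setT (snd : R * R -> R) by [].
apply: measurable_if_pos => //; apply: measurable_funM.
  by apply: measurable_funX; exact: (measurableT_comp mi m1).
apply: measurableT_comp => //; apply: measurable_funB.
  by apply: measurableT_comp => //; apply: measurable_funM => //; exact: measurable_funX.
apply: measurable_funM; first by apply: measurable_funM.
by apply: (measurableT_comp mi); exact: measurable_funX.
Qed.

Lemma gkerE b a k t r : 0 < t ->
  gker b a k t r = t^-1 ^+ k * expR (- (b * t ^+ 4)) * expR (- ((a / t ^+ 4) * r)).
Proof.
move=> t0; rewrite /gker t0 -[RHS]mulrA -expRD; congr (_ * expR (_ - _)).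
by rewrite mulrAC.
Qed.

(** The Gaussian has width [t^2], so an integral over the plane brings a factor [t^4], while one
    over an arc brings only [t^2], as in [gker_arc]. These two powers decide which kernels are
    integrable at [t = 0]. *)
Lemma gker_space b a k t y : 0 < t -> 0 < a ->
  (\int[leb2]_x (gker b a k t (esq (x - y)))%:E =
   (pi / a * (t^-1 ^+ k * t ^+ 4) * expR (- (b * t ^+ 4)))%:E)%E.
Proof.
move=> t0 a0; have t40 : 0 < t ^+ 4 by rewrite exprn_gt0.
under eq_integral do rewrite gkerE// EFinM.
rewrite ge0_integralZl//.
- rewrite integral_gauss2 ?divr_gt0// -EFinM; congr (_%:E).
  by field; rewrite !lt0r_neq0.
- apply/measurable_EFinP; apply: continuous_prod_measurable => x.
  apply: continuous_comp; last exact: continuous_expR.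
  by apply: cvgN; apply: cvgM; [exact: cvg_cst|exact: continuous_esq_sub].
- by rewrite lee_fin mulr_ge0 ?expR_ge0// exprn_ge0// invr_ge0 ltW.
Qed.

Lemma esqB_le x y z : esq (x - z) <= 2 * esq (x - y) + 2 * esq (y - z).
Proof.
rewrite /esq /=; have := sqr_ge0 ((x.1 - y.1) - (y.1 - z.1)).
have := sqr_ge0 ((x.2 - y.2) - (y.2 - z.2)); nra.
Qed.

Lemma esq_subC x y : esq (x - y) = esq (y - x).
Proof. by rewrite /esq /=; ring. Qed.

End EuclideanGauss.

Section Arc.
Variable R : realType.
Local Notation leb := (@lebesgue_measure R).
Local Notation leb2 := (leb \x leb)%E.
Implicit Types (x y : R * R) (s t : R).
Variables (gam : R -> R * R) (l c : R).
Hypothesis l0 : 0 < l.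
Hypothesis cgam : continuous gam.
Hypothesis c0 : 0 < c.
Hypothesis gam_lb : forall s t, 0 <= s <= l -> 0 <= t <= l ->
  c ^+ 2 * (s - t) ^+ 2 <= esq (gam s - gam t).

Lemma continuous_arc_esq x : continuous (fun s => esq (x - gam s)).
Proof.
move=> s; apply: (@continuous_comp _ _ _ (fun s => x - gam s) (@esq R)).
  by apply: cvgB; [exact: cvg_cst|exact: cgam].
exact: continuous_esq.
Qed.

(** If [gam s0] is the arc point closest to [x], then [|gam s - gam s0| <= 2 |x - gam s|]. With the
    lower chord bound, [|x - gam s| >= c |s - s0| / 2], so a one-dimensional Gaussian centred at
    [s0] is a majorant whose integral does not depend on [x]. *)
Lemma arc_gauss_le (k : R) x : 0 < k ->
  (\int[leb]_s (\1_`[0, l] s * expR (- (k * esq (x - gam s))))%:E <=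
   (2 / c * Num.sqrt (pi / k))%:E)%E.
Proof.
move=> k0.
have cf : continuous (fun s => esq (x - gam s)).
  exact: continuous_arc_esq.
have [s0 s0l Hs0] := EVT_min (ltW l0) (continuous_subspaceT cf).
have s0l' : 0 <= s0 <= l by move: s0l; rewrite in_itv.
have k4 : 0 < k * c ^+ 2 / 4 by rewrite divr_gt0// mulr_gt0// exprn_gt0.
have -> : 2 / c * Num.sqrt (pi / k) = Num.sqrt (pi / (k * c ^+ 2 / 4)).
  have -> : 2 / c = Num.sqrt ((2 / c) ^+ 2).
    by rewrite sqrtr_sqr ger0_norm// divr_ge0// ltW.
  rewrite -sqrtrM ?sqr_ge0//; congr Num.sqrt.
  by field; rewrite !lt0r_neq0.
rewrite -(integral_gauss s0 k4).
apply: ge0_le_integral => //.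
- apply/measurable_EFinP; apply: measurable_funM; first exact: measurable_indic.
  apply: continuous_measurable_fun => s; apply: continuous_comp; last exact: continuous_expR.
  by apply: cvgN; apply: cvgM; [exact: cvg_cst|exact: cf].
- by apply/measurable_EFinP; exact: measurable_gauss.
move=> s _; rewrite lee_fin indicE; case: (boolP (s \in _)) => [|_]; last first.
  by rewrite mul0r expR_ge0.
rewrite inE /= => sl; rewrite mul1r ler_expR lerN2.
have sl' : 0 <= s <= l by move: sl; rewrite in_itv.
have h1 := gam_lb sl' s0l'.
have h2 := esqB_le (gam s) x (gam s0).
have h3 : esq (x - gam s0) <= esq (x - gam s) by apply: Hs0.
rewrite (esq_subC (gam s) x) in h2.
have h4 : c ^+ 2 * (s - s0) ^+ 2 / 4 <= esq (gam s - x).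
  rewrite esq_subC; move: h1 h2 h3.
  by move: (esq _) (esq _) (esq _) (c ^+ 2 * _) => p q r w; lra.
rewrite esq_subC.
have -> : k * c ^+ 2 / 4 * (s - s0) ^+ 2 = k * (c ^+ 2 * (s - s0) ^+ 2 / 4) by ring.
by rewrite ler_wpM2l// ltW.
Qed.

Lemma gker_arc b a k t x : 0 < t -> 0 < a ->
  (\int[leb]_s (\1_`[0, l] s * gker b a k t (esq (x - gam s)))%:E <=
   (2 / c * Num.sqrt (pi / a) * (t^-1 ^+ k * t ^+ 2) * expR (- (b * t ^+ 4)))%:E)%E.
Proof.
move=> t0 a0; have t40 : 0 < t ^+ 4 by rewrite exprn_gt0.
have h0 : 0 <= t^-1 ^+ k * expR (- (b * t ^+ 4)).
  by rewrite mulr_ge0 ?expR_ge0// exprn_ge0// invr_ge0 ltW.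
have cf : continuous (fun s => expR (- (a / t ^+ 4 * esq (x - gam s)))).
  move=> s; apply: continuous_comp; last exact: continuous_expR.
  apply: cvgN; apply: cvgM; first exact: cvg_cst.
  exact: continuous_arc_esq.
have E s : (\1_`[0, l] s * gker b a k t (esq (x - gam s)))%:E =
  ((t^-1 ^+ k * expR (- (b * t ^+ 4)))%:E *
   (\1_`[0, l] s * expR (- (a / t ^+ 4 * esq (x - gam s))))%:E)%E.
  by rewrite gkerE// -EFinM; congr (_%:E); ring.
under eq_integral do rewrite E.
rewrite ge0_integralZl//.
- apply: (@le_trans _ _ ((t^-1 ^+ k * expR (- (b * t ^+ 4)))%:E *
    (2 / c * Num.sqrt (pi / (a / t ^+ 4)))%:E)%E).
    by rewrite lee_wpmul2l ?lee_fin// arc_gauss_le// divr_gt0.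
  rewrite -EFinM lee_fin.
  have -> : Num.sqrt (pi / (a / t ^+ 4)) = Num.sqrt (pi / a) * t ^+ 2.
    have -> : pi / (a / t ^+ 4) = (pi / a) * (t ^+ 2) ^+ 2.
      by field; rewrite !lt0r_neq0.
    rewrite sqrtrM ?divr_ge0 ?pi_ge0 ?(ltW a0)// sqrtr_sqr ger0_norm//.
    by rewrite exprn_ge0// ltW.
  by rewrite le_eqVlt; apply/orP; left; apply/eqP; ring.
- apply/measurable_EFinP; apply: measurable_funM; first exact: measurable_indic.
  exact: continuous_measurable_fun.
Qed.

End Arc.

Section Kernels.
Variable R : realType.
Local Notation leb := (@lebesgue_measure R).
Local Notation leb2 := (leb \x leb)%E.
Implicit Types (x y : R * R) (s t r b : R).

(** A common majorant of the heat kernel and of its gradient. The gradient costs a factor of order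
    [|x| / t^4]; half of the Gaussian exponent absorbs [|x| / t^2], which turns [1/4] into [1/8] and
    leaves [t^-3]. *)
Definition mker b t r : R := gker b (1/8) 1 t r + gker b (1/8) 3 t r.
(** At time [t^4] the heat kernel is [(4 pi t^4)^-1 e^(-r/(4 t^4))]. The Jacobian [4 t^3] of the
    time substitution turns its prefactor into [1/(pi t)], and [e^(-b t^4)] accounts for the mass
    [b], so the integral of [hk b t x] over [t] is the Green function of [b - Laplacian]. *)
Definition hker b t r : R := pi^-1 * gker b (1/4) 1 t r.
Definition hk b t x : R := hker b t (esq x).

(* [p] is [fst] or [snd] and selects the partial derivative of [hk b t]. *)
Definition dk (p : R * R -> R) b t x : R := - (p x / (2 * t ^+ 4)) * hk b t x.

Lemma pi_inv_le1 : pi^-1 <= 1 :> R.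
Proof. by rewrite invf_le1 ?pi_gt0//; have := pi_ge2 R; lra. Qed.

Lemma mker_ge0 b t r : 0 <= mker b t r.
Proof. by rewrite addr_ge0 ?gker_ge0. Qed.

Lemma hker_ge0 b t r : 0 <= hker b t r.
Proof. by rewrite mulr_ge0 ?gker_ge0// invr_ge0 pi_ge0. Qed.

Lemma gker_nonpos b a k t r : t <= 0 -> gker b a k t r = 0.
Proof. by rewrite /gker ltNge => ->. Qed.

Lemma hk_le b t x : `|hk b t x| <= mker b t (esq x).
Proof.
rewrite /hk ger0_norm ?hker_ge0//; have [t0|t0] := ltP 0 t; last first.
  by rewrite /hker /mker !gker_nonpos// mulr0 addr0.
rewrite /hker /mker; apply: (@le_trans _ _ (gker b (1/4) 1 t (esq x))).
  by rewrite ler_piMl ?gker_ge0// pi_inv_le1.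
apply: ler_wpDr; first exact: gker_ge0.
rewrite /gker t0 ler_wpM2l//; first by rewrite exprn_ge0// invr_ge0 ltW.
rewrite ler_expR lerD2l lerN2 ler_wpM2r ?invr_ge0 ?exprn_ge0 ?(ltW t0)//.
by rewrite ler_wpM2r ?esq_ge0//; lra.
Qed.

Lemma dk_le (p : R * R -> R) b t x : p x ^+ 2 <= esq x -> `|dk p b t x| <= mker b t (esq x).
Proof.
move=> px; have [t0|t0] := ltP 0 t; last first.
  by rewrite /dk /hk /hker /mker !gker_nonpos// !mulr0 normr0 addr0.
apply: (@le_trans _ _ (gker b (1/8) 3 t (esq x))); last first.
  by apply: ler_wpDl => //; exact: gker_ge0.
rewrite /dk normrM normrN (ger0_norm (hker_ge0 _ _ _)).
have t20 : 0 < t ^+ 2 by rewrite exprn_gt0.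
have t40 : 0 < t ^+ 4 by rewrite exprn_gt0.
pose q := `|p x| / t ^+ 2.
have q2 : q ^+ 2 <= esq x / t ^+ 4.
  rewrite /q exprMn real_normK ?num_real// exprVn -exprM ler_pM2r ?invr_gt0//.
have q1 : q <= 2 * expR (1/8 * esq x / t ^+ 4).
  have := expR_ge1Dx (1/8 * esq x / t ^+ 4).
  have := sqr_ge0 (q - 2); move: q2.
  rewrite -[1/8 * _ / _]mulrA; move: (esq x / _) (expR _) => u v; nra.
have -> : `|p x / (2 * t ^+ 4)| = q / (2 * t ^+ 2).
  have t41 : 0 <= 2 * t ^+ 4 by rewrite pmulr_rge0// ltW.
  rewrite normrM normfV (ger0_norm t41) /q.
  by field; rewrite !lt0r_neq0.
rewrite /hk /hker !gkerE//.
set E := expR (- (b * t ^+ 4)).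
have E1 : expR (- (1 / 4 / t ^+ 4 * esq x)) =
   expR (- (1 / 8 / t ^+ 4 * esq x)) * expR (- (1 / 8 / t ^+ 4 * esq x)).
  by rewrite -expRD; congr expR; field; rewrite lt0r_neq0.
rewrite E1; set F := expR (- (1 / 8 / t ^+ 4 * esq x)).
have EF : expR (1/8 * esq x / t ^+ 4) * F = 1.
  rewrite -expRD -[RHS]expR0; congr expR; rewrite -!mulrA [esq x * _]mulrC.
  by rewrite addrN.
have F0 : 0 <= F by exact: expR_ge0.
have E0 : 0 <= E by exact: expR_ge0.
have qF : q * F <= 2.
  by have := ler_wpM2r F0 q1; rewrite -[leRHS]mulrA EF mulr1.
have -> : q / (2 * t ^+ 2) * (pi^-1 * (t^-1 ^+ 1 * E * (F * F))) =
   (q * F) * (pi^-1 * (t^-1 ^+ 3 * E * F) / 2).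
  have alg (u v w m k : R) : m != 0 -> k != 0 ->
      u / (2 * k ^+ 2) * (m^-1 * (k^-1 ^+ 1 * v * (w * w))) =
      (u * w) * (m^-1 * (k^-1 ^+ 3 * v * w) / 2).
    by move=> m0 k0; field; rewrite m0 k0.
  by apply: alg; rewrite gt_eqF// pi_gt0.
have t3 : 0 <= t^-1 ^+ 3 by rewrite exprn_ge0// invr_ge0 ltW.
have tE : 0 <= t^-1 ^+ 3 * E * F by apply: mulr_ge0 => //; apply: mulr_ge0.
have tE2 : 0 <= pi^-1 * (t^-1 ^+ 3 * E * F) / 2 by rewrite divr_ge0// mulr_ge0// invr_ge0 pi_ge0.
apply: (le_trans (ler_wpM2r tE2 qF)).
rewrite mulrCA divff// mulr1 ler_piMl//; exact: pi_inv_le1.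
Qed.

Lemma fst_sq_le x : x.1 ^+ 2 <= esq x.
Proof. by rewrite lerDl sqr_ge0. Qed.

Lemma snd_sq_le x : x.2 ^+ 2 <= esq x.
Proof. by rewrite lerDr sqr_ge0. Qed.

Lemma measurable_gker_plane b a k :
  measurable_fun setT (fun p : R * (R * R) => gker b a k p.1 (esq p.2)).
Proof.
have me : measurable_fun setT (@esq R) by apply: continuous_prod_measurable; exact: continuous_esq.
have mx : measurable_fun setT (fun p : R * (R * R) => (p.1, esq p.2)).
  apply/measurable_fun_pairP; split; first exact: (@measurable_fst _ _ R (R * R)%type).
  exact: (measurableT_comp me (@measurable_snd _ _ R (R * R)%type)).
exact: (measurableT_comp (measurable_gker b a k) mx).
Qed.

(** What the potential estimates ask of a kernel, so that they are proved once for the heat kernel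
    and its two partial derivatives. *)
Definition dominated b (N : R -> R * R -> R) :=
  measurable_fun setT (fun p : R * (R * R) => N p.1 p.2) /\
  forall t x, `|N t x| <= mker b t (esq x).

Lemma dominated_hk b : dominated b (hk b).
Proof.
split; last by move=> t x; exact: hk_le.
by apply: measurable_funM => //; exact: measurable_gker_plane.
Qed.

Lemma dominated_dk (p : R * R -> R) b : continuous p -> (forall x, p x ^+ 2 <= esq x) ->
  dominated b (dk p b).
Proof.
move=> cp px; split; last by move=> t x; exact: dk_le.
have m1 : measurable_fun setT (fun q : R * (R * R) => q.1) by exact: (@measurable_fst _ _ R (R * R)%type).
have m2 : measurable_fun setT (fun q : R * (R * R) => p q.2).
  exact: (measurableT_comp (continuous_prod_measurable cp) (@measurable_snd _ _ R (R * R)%type)).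
apply: measurable_funM; last by case: (dominated_hk b).
apply: measurableT_comp => //; apply: measurable_funM => //.
apply: (measurableT_comp (@measurable_invr R)); apply: measurable_funM => //.
exact: measurable_funX.
Qed.

Lemma dominated_dk1 b : dominated b (dk fst b).
Proof. by apply: dominated_dk => x; [exact: cvg_fst|exact: fst_sq_le]. Qed.

Lemma dominated_dk2 b : dominated b (dk snd b).
Proof. by apply: dominated_dk => x; [exact: cvg_snd|exact: snd_sq_le]. Qed.

Lemma dominated_mker b : dominated b (fun t x => mker b t (esq x)).
Proof.
split; last by move=> t x; rewrite ger0_norm// mker_ge0.
by apply: measurable_funD; exact: measurable_gker_plane.
Qed.

End Kernels.

Section Potentials.
Variable R : realType.
Local Notation leb := (@lebesgue_measure R).
Local Notation leb2 := (leb \x leb)%E.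
Implicit Types (x y : R * R) (s t : R).
Variables (gam : R -> R * R) (l c : R).
Hypothesis l0 : 0 < l.
Hypothesis cgam : continuous gam.
Hypothesis c0 : 0 < c.
Hypothesis gam_lb : forall s t, 0 <= s <= l -> 0 <= t <= l ->
  c ^+ 2 * (s - t) ^+ 2 <= esq (gam s - gam t).
Variable b : R.
Hypothesis b0 : 0 < b.

(** Densities on the arc. Boundedness makes their heat-kernel potentials finite at every point, so
    the eigenvalue equation of the integral operator can be stated pointwise and not just almost
    everywhere. *)
Definition arcfun (f : R -> R) := [/\ measurable_fun setT f, exists C, forall s, `|f s| <= C &
  forall s, ~ (0 <= s <= l) -> f s = 0].

Lemma arcfun_intg f : arcfun f -> intg leb f.
Proof.
move=> [mf [C fC] f0].
have i1 : intg leb (\1_`[0, l]) by apply: intg_indic => //; exact: lebesgue_itv_lty.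
have i2 := intgZ C i1.
apply: (@intg_le _ _ _ leb _ _ mf i2) => s; rewrite indicE.
have [_|sl] := boolP (s \in _); first by rewrite mulr1.
rewrite f0 ?normr0 ?mulr0//; move: sl; rewrite notin_setE /= in_itv/=.
by [].
Qed.

Lemma arcfunM f g : arcfun f -> arcfun g -> arcfun (fun s => f s * g s).
Proof.
move=> [mf [C fC] f0] [mg [D gD] g0]; split.
- exact: measurable_funM.
- by exists (C * D) => s; rewrite normrM ler_pM.
- by move=> s /f0 ->; rewrite mul0r.
Qed.

Lemma arcfun_sqintg f : arcfun f -> sqintg leb f.
Proof.
move=> bf; split; first by case: bf.
have := arcfun_intg (arcfunM bf bf); apply: eq_intg => s; by rewrite expr2.
Qed.

Lemma arcfun_cont_mul f (g : R -> R) : arcfun f -> continuous g -> arcfun (fun s => g s * f s).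
Proof.
move=> [mf [C fC] f0] cg.
have C0 : 0 <= C by exact: le_trans (normr_ge0 _) (fC 0).
have cng : continuous (fun s => `|g s|).
  by move=> s; apply: continuous_comp; [exact: cg|exact: norm_continuous].
have [m ml Hm] := EVT_max (ltW l0) (continuous_subspaceT cng).
split.
- by apply: measurable_funM => //; exact: continuous_measurable_fun.
- exists (`|g m| * C) => s; have [sl|sl] := boolP (0 <= s <= l).
    by rewrite normrM ler_pM// Hm// in_itv.
  by rewrite f0 ?mulr0 ?normr0 ?mulr_ge0//; exact/negP.
- by move=> s /f0 ->; rewrite mulr0.
Qed.

Definition pospart t : R := if 0 < t then t else 0.

Definition tail20 t : R := tail b 2 t + tail b 0 t.

Lemma tail20_ge0 t : 0 <= tail20 t.
Proof. by rewrite addr_ge0 ?tail_ge0. Qed.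

Lemma intg_tail20 : intg leb tail20.
Proof. by apply: intgD; exact: intg_tail. Qed.

Definition tail20_mass : R := \int[leb]_t tail20 t.

Let measurable_shift : measurable_fun setT (fun p : (R * R) * (R * R) => (p.2.2, p.1 - gam p.2.1)).
Proof.
have mg1 : measurable_fun setT (fun s => (gam s).1).
  apply: continuous_measurable_fun => s.
  by apply: (@continuous_comp _ _ _ gam (fst : R * R -> R)); [exact: cgam|exact: cvg_fst].
have mg2 : measurable_fun setT (fun s => (gam s).2).
  apply: continuous_measurable_fun => s.
  by apply: (@continuous_comp _ _ _ gam (snd : R * R -> R)); [exact: cgam|exact: cvg_snd].
have m1 : measurable_fun setT (fun p : (R * R) * (R * R) => p.2.1).
  exact: (measurableT_comp (@measurable_fst _ _ R R) (@measurable_snd _ _ (R * R)%type (R * R)%type)).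
apply/measurable_fun_pairP; split.
  exact: (measurableT_comp (@measurable_snd _ _ R R) (@measurable_snd _ _ (R * R)%type (R * R)%type)).
apply/measurable_fun_pairP; split.
  apply: measurable_funB; last exact: (measurableT_comp mg1 m1).
  exact: (measurableT_comp (@measurable_fst _ _ R R) (@measurable_fst _ _ (R * R)%type (R * R)%type)).
apply: measurable_funB; last exact: (measurableT_comp mg2 m1).
exact: (measurableT_comp (@measurable_snd _ _ R R) (@measurable_fst _ _ (R * R)%type (R * R)%type)).
Qed.

Lemma dominated_measurable N : dominated b N ->
  measurable_fun setT (fun p : (R * R) * (R * R) => N p.2.2 (p.1 - gam p.2.1)).
Proof. by move=> [mN _]; exact: (measurableT_comp mN measurable_shift). Qed.

Lemma mker_arc t x :
  (\int[leb]_s (\1_`[0, l] s * mker b t (esq (x - gam s)) * pospart t)%:E <=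
   (2 / c * Num.sqrt (pi / (1 / 8)) * tail20 t)%:E)%E.
Proof.
have A0 : 0 <= 2 / c * Num.sqrt (pi / (1 / 8)) by rewrite mulr_ge0 ?sqrtr_ge0// divr_ge0// ltW.
have [t0|t0] := ltP 0 t; last first.
  under eq_integral do rewrite /mker !gker_nonpos// addr0 mulr0 mul0r.
  by rewrite integral0 lee_fin mulr_ge0// tail20_ge0.
have mg k : measurable_fun setT (fun s => \1_`[0, l] s * gker b (1/8) k t (esq (x - gam s))).
  apply: measurable_funM; first exact: measurable_indic.
  have mx : measurable_fun setT (fun s => (t, esq (x - gam s))).
    apply/measurable_fun_pairP; split; first exact: measurable_cst.
    by apply: continuous_measurable_fun; exact: continuous_arc_esq.
  exact: (measurableT_comp (measurable_gker b (1/8) k) mx).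
have E s : (\1_`[0, l] s * mker b t (esq (x - gam s)) * pospart t)%:E =
  (t%:E * ((\1_`[0, l] s * gker b (1/8) 1 t (esq (x - gam s)))%:E +
          (\1_`[0, l] s * gker b (1/8) 3 t (esq (x - gam s)))%:E))%E.
  by rewrite /pospart t0 -EFinD -EFinM /mker; congr (_%:E); ring.
have g0 k s : (0 <= (\1_`[0, l] s * gker b (1/8) k t (esq (x - gam s)))%:E)%E.
  by rewrite lee_fin mulr_ge0 ?gker_ge0// indicE.
under eq_integral do rewrite E.
rewrite ge0_integralZl//.
- rewrite ge0_integralD//; last 2 first.
  + by apply/measurable_EFinP; exact: mg.
  + by apply/measurable_EFinP; exact: mg.
  have a0 : 0 < 1 / 8 :> R by lra.
  have h1 := @gker_arc R gam l c l0 cgam c0 gam_lb b (1/8) 1 t x t0 a0.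
  have h3 := @gker_arc R gam l c l0 cgam c0 gam_lb b (1/8) 3 t x t0 a0.
  apply: (@le_trans _ _ (t%:E * ((2 / c * Num.sqrt (pi / (1/8)) * (t^-1 ^+ 1 * t ^+ 2) * expR (- (b * t ^+ 4)))%:E + (2 / c * Num.sqrt (pi / (1/8)) * (t^-1 ^+ 3 * t ^+ 2) * expR (- (b * t ^+ 4)))%:E))%E).
    by rewrite lee_wpmul2l ?lee_fin ?(ltW t0)// leeD.
  rewrite -EFinD -EFinM lee_fin /tail20 /tail t0 le_eqVlt; apply/orP; left; apply/eqP.
  by move: (Num.sqrt _) (expR _) => u v; field; rewrite !lt0r_neq0.
- by apply: emeasurable_funD; apply/measurable_EFinP; exact: mg.
- by move=> s _; rewrite adde_ge0.
- by rewrite lee_fin ltW.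
Qed.

(** The weight for Schur's test. For the worst term [t^-3] of [mker] the arc integral is of order
    [t^-1], not integrable at 0, while the plane integral is of order [t]. The weight [t] multiplies
    the first and divides the second, and both become bounded near 0. *)
Let w (z : R * R) : R := \1_`[0, l] z.1 * pospart z.2.

Let mw : measurable_fun setT w.
Proof.
apply: measurable_funM.
  have mi : measurable_fun setT (\1_`[0, l] : R -> R) by exact: measurable_indic.
  exact: (measurableT_comp mi (@measurable_fst _ _ R R)).
exact: (measurable_if_pos (@measurable_snd _ _ R R) (@measurable_snd _ _ R R)).
Qed.

Let w0 z : 0 <= w z.
Proof. by rewrite /w mulr_ge0 ?indicE// /pospart; case: ltP => // /ltW. Qed.

Definition potC : R := 2 / c * Num.sqrt (pi / (1 / 8)) * tail20_mass * (8 * pi * tail20_mass).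

Lemma pot_schur f : arcfun f ->
  {ae leb2, forall x, intg leb2 (fun z => mker b z.2 (esq (x - gam z.1)) * `|f z.1|)} /\
  sqintg leb2 (fun x => \int[leb2]_z (mker b z.2 (esq (x - gam z.1)) * `|f z.1|)) /\
  nsq leb2 (fun x => \int[leb2]_z (mker b z.2 (esq (x - gam z.1)) * `|f z.1|)) <=
    potC * nsq leb f.
Proof.
move=> bf; have [mf [C fC] f0] := bf.
have mK := dominated_measurable (dominated_mker b).
have mh : measurable_fun setT (fun z : R * R => f z.1).
  exact: (measurableT_comp mf (@measurable_fst _ _ R R)).
have K0 (p : (R * R) * (R * R)) : 0 <= mker b p.2.2 (esq (p.1 - gam p.2.1)) by exact: mker_ge0.
have wK (x z : R * R) : w z = 0 -> mker b z.2 (esq (x - gam z.1)) * f z.1 = 0.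
  rewrite /w indicE; have [_|zl] := boolP (z.1 \in _).
    rewrite mul1r /pospart; case: ltP => [z0 z00|z0 _]; first by move: z0; rewrite z00 ltxx.
    by rewrite /mker !gker_nonpos// addr0 mul0r.
  by move=> _; rewrite f0 ?mulr0//; move: zl; rewrite notin_setE /= in_itv.
have mKx x : measurable_fun setT (fun z : R * R => mker b z.2 (esq (x - gam z.1))).
  exact: (measurableT_comp mK (measurable_pair1 x)).
have mKw x : measurable_fun setT (fun z : R * R => mker b z.2 (esq (x - gam z.1)) * w z).
  exact: measurable_funM (mKx x) mw.
have H1 x : (\int[leb2]_z (mker b z.2 (esq (x - gam z.1)) * w z)%:E <=
    (2 / c * Num.sqrt (pi / (1 / 8)) * tail20_mass)%:E)%E.
  rewrite fubini_tonelli2; last 2 first.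
  - by apply/measurable_EFinP; exact: mKw.
  - by move=> z; rewrite lee_fin mulr_ge0// mker_ge0.
  apply: (@le_trans _ _ (\int[leb]_t (2 / c * Num.sqrt (pi / (1 / 8)) * tail20 t)%:E)%E).
    apply: ge0_le_integral => //.
    - by move=> t _; apply: integral_ge0 => s _; rewrite lee_fin mulr_ge0// mker_ge0.
    - apply: (@measurable_fun_fubini_tonelli_G _ _ _ _ _ leb (EFin \o (fun z => mker b z.2 (esq (x - gam z.1)) * w z))).
      + by apply/measurable_EFinP; exact: mKw.
      + by move=> z; rewrite lee_fin mulr_ge0// mker_ge0.
    - by apply/measurable_EFinP; apply: measurable_funM => //; apply: measurable_funD; exact: measurable_tail.
    move=> t _; rewrite /fubini_G/=.
    apply: le_trans (mker_arc t x); rewrite le_eqVlt; apply/orP; left; apply/eqP.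
    by apply: eq_integral => s _; rewrite /w/=; congr (_%:E); ring.
  rewrite -EFin_Rint; last by apply: intgZ; exact: intg_tail20.
  by rewrite RintegralZl//; exact: intg_tail20.
have H2 : (\int[leb2]_z \int[leb2]_x (mker b z.2 (esq (x - gam z.1)) * (f z.1 ^+ 2 / w z))%:E <=
    (8 * pi * tail20_mass * nsq leb f)%:E)%E.
  have E z : (\int[leb2]_x (mker b z.2 (esq (x - gam z.1)) * (f z.1 ^+ 2 / w z))%:E =
     (f z.1 ^+ 2 * (8 * pi * tail20 z.2))%:E)%E.
    have [t0|t0] := ltP 0 z.2; last first.
      rewrite /tail20 /tail ltNge t0/= addr0 !mulr0 -[RHS](@integral0 _ _ R leb2 setT).
      by apply: eq_integral => x _; rewrite /mker !gker_nonpos// addr0 mul0r.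
    have [zl|zl] := boolP (0 <= z.1 <= l); last first.
      rewrite f0; last exact/negP.
      rewrite expr0n/= !mul0r -[RHS](@integral0 _ _ R leb2 setT).
      by apply: eq_integral => x _; rewrite mulr0.
    have wE : w z = z.2 by rewrite /w indicE mem_set/= ?in_itv//= mul1r /pospart t0.
    have mgx k : measurable_fun setT (fun x : R * R => gker b (1/8) k z.2 (esq (x - gam z.1))).
      have mx : measurable_fun setT (fun x : R * R => (z.2, esq (x - gam z.1))).
        apply/measurable_fun_pairP; split; first exact: measurable_cst.
        by apply: continuous_prod_measurable; exact: continuous_esq_sub.
      exact: (measurableT_comp (measurable_gker b (1/8) k) mx).
    under eq_integral do rewrite EFinM muleC.
    rewrite ge0_integralZl//.
    - under eq_integral do rewrite /mker EFinD.
      have a0 : 0 < 1 / 8 :> R by lra.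
      rewrite ge0_integralD//.
      + rewrite !gker_space// -EFinD -EFinM wE /tail20 /tail t0; congr (_%:E).
        by field; rewrite lt0r_neq0.
      + by move=> x _; rewrite lee_fin gker_ge0.
      + by apply/measurable_EFinP; exact: mgx.
      + by move=> x _; rewrite lee_fin gker_ge0.
      + by apply/measurable_EFinP; exact: mgx.
    - by apply/measurable_EFinP; apply: measurable_funD; exact: mgx.
    - by move=> x _; rewrite lee_fin mker_ge0.
    - by rewrite lee_fin divr_ge0 ?sqr_ge0.
  under eq_integral do rewrite E.
  rewrite (@integral_prod_mul R (fun s => f s ^+ 2) (fun t => 8 * pi * tail20 t)).
  - rewrite -EFin_Rint; last by case: (arcfun_sqintg bf).
    rewrite -EFin_Rint; last by apply: intgZ; exact: intg_tail20.
    rewrite RintegralZl//; last exact: intg_tail20.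
    by rewrite -EFinM lee_fin -/(nsq leb f) [leRHS]mulrC.
  - exact: measurable_funX.
  - by apply: measurable_funM => //; apply: measurable_funD; exact: measurable_tail.
  - by move=> s; exact: sqr_ge0.
  - by move=> t; rewrite !mulr_ge0 ?pi_ge0 ?tail20_ge0.
have := @schur_ae _ _ _ _ R (plane R) (plane R) _ _ _ _ _ mK mw mh K0 w0 wK H1 H2.
have := @schur_abs _ _ _ _ R (plane R) (plane R) _ _ _ _ _ mK mw mh K0 w0 wK H1 H2.
move=> [s1 s2] s3; split; first exact: s3.
by split; [exact: s1|rewrite /potC -[leRHS]mulrA; exact: s2].
Qed.

End Potentials.

(** * Potentials of arcs *)

Lemma Rint_ae_eq d (T : measurableType d) (R : realType) (mu : {measure set T -> \bar R})
    (f g : T -> R) : measurable_fun setT f -> measurable_fun setT g ->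
  {ae mu, forall x, f x = g x} -> \int[mu]_x f x = \int[mu]_x g x.
Proof.
move=> mf mg fg; rewrite /Rintegral; congr fine; apply: ae_eq_integral => //.
- exact/measurable_EFinP.
- exact/measurable_EFinP.
- by apply: filterS fg => x /= ->.
Qed.

Lemma ae_imp d (T : measurableType d) (R : realType) (mu : {measure set T -> \bar R})
    (P Q : T -> Prop) : (forall x, P x -> Q x) ->
  {ae mu, forall x, P x} -> {ae mu, forall x, Q x}.
Proof. by move=> PQ; apply: filterS. Qed.

Section KernelDerivative.
Variable R : realType.
Implicit Types (x y v : R * R) (t : R).

Lemma derive_quad_form (A B : R) y x v :
  smooth (fun x => A - B * esq (x - y)) /\
  'D_v (fun x => A - B * esq (x - y)) x =
    - (2 * B * ((x.1 - y.1) * v.1 + (x.2 - y.2) * v.2)).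
Proof.
set q := fun x => _.
have sq : smooth q.
  apply: smoothB; first exact: smooth_cst.
  apply: smoothZ; apply: smoothD; apply: smoothX; apply: smoothB.
  - exact: smooth_fst.
  - exact: smooth_cst.
  - exact: smooth_snd.
  - exact: smooth_cst.
split=> //.
have dq : differentiable q (x + (0 : R) *: v) by exact: smooth_differentiable.
have D1 := is_derive_line dq.
have D2 : is_derive (0 : R) (1 : R) (fun s : R => q (x + s *: v))
    (- (2 * B * ((x.1 - y.1) * v.1 + (x.2 - y.2) * v.2))).
  apply: (@is_derive_quad R _ 0 _ (`|B| * esq v)) => h.
  rewrite addr0 scale0r addr0.
  have -> : q (x + h *: v) - q x - h * - (2 * B * ((x.1 - y.1) * v.1 + (x.2 - y.2) * v.2)) =
     - (B * (h ^+ 2 * esq v)) by rewrite /q /esq /= /GRing.scale/=; ring.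
  rewrite normrN normrM [`|h ^+ 2 * _|]ger0_norm; last by rewrite mulr_ge0 ?sqr_ge0 ?esq_ge0.
  by rewrite [h ^+ 2 * _]mulrC mulrA.
have := @derive_val _ _ _ _ _ _ _ D1; rewrite (@derive_val _ _ _ _ _ _ _ D2).
by rewrite scale0r addr0 => ->.
Qed.

Lemma hk_deriv b t y : smooth (fun x => hk b t (x - y)) /\
  forall x v, 'D_v (fun x => hk b t (x - y)) x =
    - (((x.1 - y.1) * v.1 + (x.2 - y.2) * v.2) / (2 * t ^+ 4)) * hk b t (x - y).
Proof.
have [t0|t0] := ltP 0 t; last first.
  have E : (fun x => hk b t (x - y)) = (fun=> 0).
    by apply/funext => x; rewrite /hk /hker gker_nonpos// mulr0.
  rewrite E; split; first exact: smooth_cst.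
  by move=> x v; rewrite derive_cst; move/(congr1 (fun f => f x)): E => ->; rewrite mulr0.
pose q x := - (b * t ^+ 4) - (1 / 4 / t ^+ 4) * esq (x - y).
have E : (fun x => hk b t (x - y)) = (fun x => pi^-1 * t^-1 * expR (q x)).
  apply/funext => x; rewrite /hk /hker /gker t0 expr1 mulrA; congr (_ * expR (_ - _)).
  by rewrite mulrAC.
have sq : smooth q by have [] := derive_quad_form (- (b * t ^+ 4)) (1 / 4 / t ^+ 4) y 0 0.
have se : smooth (fun x => expR (q x)) by exact: smooth_comp (@smooth_expR R) sq.
split; first by rewrite E; exact: smoothZ.
move=> x v; rewrite E deriveZ; last first.
  by apply: diff_derivable; exact: smooth_differentiable.
have -> : (fun x => expR (q x)) = expR \o q by [].
rewrite derive_comp_real; last 2 first.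
- exact: smooth_differentiable.
- by apply: smooth_differentiable; exact: smooth_expR.
have [_ ->] := derive_quad_form (- (b * t ^+ 4)) (1 / 4 / t ^+ 4) y x v.
have De : 'D_1 (@expR R) (q x) = expR (q x) by exact: derive_val.
rewrite De /GRing.scale/=.
have -> : hk b t (x - y) = pi^-1 * t^-1 * expR (q x) by move/(congr1 (fun f => f x)): E.
move: (pi^-1 * _) (expR _) => u w.
have t40 : t != 0 by rewrite gt_eqF.
by field.
Qed.

Lemma hk_deriv1 b t y x : 'D_(e1 R) (fun x => hk b t (x - y)) x = dk fst b t (x - y).
Proof.
have [_ ->] := hk_deriv b t y; rewrite /dk /e1 /= mulr1 mulr0 addr0.
by [].
Qed.

Lemma hk_deriv2 b t y x : 'D_(e2 R) (fun x => hk b t (x - y)) x = dk snd b t (x - y).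
Proof.
have [_ ->] := hk_deriv b t y; rewrite /dk /e2 /= mulr1 mulr0 add0r.
by [].
Qed.

End KernelDerivative.

Section PotentialsL2.
Variable R : realType.
Local Notation leb := (@lebesgue_measure R).
Local Notation leb2 := (leb \x leb)%E.
Implicit Types (x y : R * R) (s t : R).
Variables (gam : R -> R * R) (l c : R).
Hypothesis l0 : 0 < l.
Hypothesis cgam : continuous gam.
Hypothesis c0 : 0 < c.
Hypothesis gam_lb : forall s t, 0 <= s <= l -> 0 <= t <= l ->
  c ^+ 2 * (s - t) ^+ 2 <= esq (gam s - gam t).
Variable b : R.
Hypothesis b0 : 0 < b.
Implicit Types (f g : R -> R) (phi : R * R -> R).

Definition pot (N : R -> R * R -> R) f x : R :=
  \int[leb2]_z (N z.2 (x - gam z.1) * f z.1).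

Let G f x : R := \int[leb2]_z (mker b z.2 (esq (x - gam z.1)) * `|f z.1|).

Let ps f (bf : arcfun l f) := @pot_schur R gam l c l0 cgam c0 gam_lb b b0 f bf.

Let measurable_kf N f : dominated b N -> arcfun l f ->
  measurable_fun setT (fun p : (R * R) * (R * R) => N p.2.2 (p.1 - gam p.2.1) * f p.2.1).
Proof.
move=> dN [mf _ _]; apply: measurable_funM; first exact: (dominated_measurable cgam dN).
apply: (measurableT_comp mf).
exact: (measurableT_comp (@measurable_fst _ _ R R) (@measurable_snd _ _ (R * R)%type (R * R)%type)).
Qed.

Let measurable_kfx N f x : dominated b N -> arcfun l f ->
  measurable_fun setT (fun z : R * R => N z.2 (x - gam z.1) * f z.1).
Proof. by move=> dN bf; exact: (measurableT_comp (measurable_kf dN bf) (measurable_pair1 x)). Qed.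

Let kf_le N f x (z : R * R) : dominated b N ->
  `|N z.2 (x - gam z.1) * f z.1| <= mker b z.2 (esq (x - gam z.1)) * `|f z.1|.
Proof. by move=> [_ dN]; rewrite normrM ler_wpM2r. Qed.

Lemma measurable_pot N f : dominated b N -> arcfun l f -> measurable_fun setT (pot N f).
Proof.
by move=> dN bf; exact: (@measurable_Rint_fst _ _ _ _ R (plane R) _ (measurable_kf dN bf)).
Qed.

Lemma pot_ae N f : dominated b N -> arcfun l f ->
  {ae leb2, forall x, intg leb2 (fun z => N z.2 (x - gam z.1) * f z.1) /\ `|pot N f x| <= G f x}.
Proof.
move=> dN bf; have [h _] := ps bf; apply: (@ae_imp _ _ _ leb2 _ _ _ h) => x ix.
have i2 := @intg_le _ _ _ leb2 _ _ (measurable_kfx x dN bf) ix (fun z => kf_le f x z dN).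
split=> //; apply: (le_trans (@Rint_norm_le _ _ _ leb2 _ (measurable_kfx x dN bf))).
apply: le_Rintegral => //; first exact: intg_norm.
by move=> z _; exact: kf_le.
Qed.

Lemma pot_sq N f : dominated b N -> arcfun l f ->
  sqintg leb2 (pot N f) /\ nsq leb2 (pot N f) <= potC c b * nsq leb f.
Proof.
move=> dN bf; have [_ [s1 s2]] := ps bf.
have [|i2 le2] := @sqintg_ae_le _ _ _ leb2 _ _ (measurable_pot dN bf) s1.
  by apply: (@ae_imp _ _ _ leb2 _ _ _ (pot_ae dN bf)) => x [_ h]; apply: (le_trans h); exact: ler_norm.
by split; [exact: i2|exact: (le_trans le2 s2)].
Qed.

Lemma pot_pair N f phi : dominated b N -> arcfun l f -> sqintg leb2 phi ->
  intg (plane R \x plane R)%E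
    (fun p : (R * R) * (R * R) => phi p.1 * (N p.2.2 (p.1 - gam p.2.1) * f p.2.1)).
Proof.
move=> dN bf p2; have [_ [s1 _]] := ps bf.
have [mp _] := p2.
have mk := measurable_kf dN bf.
have mpk : measurable_fun setT (fun p : (R * R) * (R * R) => phi p.1 * (N p.2.2 (p.1 - gam p.2.1) * f p.2.1)).
  by apply: measurable_funM => //; exact: (measurableT_comp mp (@measurable_fst _ _ (R * R)%type (R * R)%type)).
have pn : sqintg leb2 (fun x => `|phi x|).
  by apply: (@sqintg_le _ _ _ leb2 _ phi _ p2) => [|x]; [exact: measurableT_comp|rewrite normr_id].
have ipG := sqintgM pn s1.
apply: (@intg_prodL _ _ _ _ R (plane R) (plane R) _ (\int[leb2]_x (`|phi x| * G f x)) mpk).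
rewrite EFin_Rint//; apply: ae_ge0_le_integral => //.
- by move=> x _; apply: integral_ge0 => z _; rewrite lee_fin.
- have := @measurable_fun_fubini_tonelli_F _ _ _ _ R (plane R) (EFin \o (fun p => `|phi p.1 * (N p.2.2 (p.1 - gam p.2.1) * f p.2.1)|)).
  by apply; [apply/measurable_EFinP; exact: measurableT_comp|move=> x; rewrite lee_fin normr_ge0].
- move=> x _; rewrite lee_fin mulr_ge0//; apply: Rintegral_ge0 => z _.
  by rewrite mulr_ge0// mker_ge0.
- by apply/measurable_EFinP; exact: intg_measurable ipG.
apply: (@ae_imp _ _ _ leb2 _ _ _ (ps bf).1) => x ix _.
have E : (`|phi x| * G f x)%:E = (\int[leb2]_z (`|phi x| * (mker b z.2 (esq (x - gam z.1)) * `|f z.1|))%:E)%E.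
  by rewrite -EFin_Rint; [rewrite RintegralZl|exact: intgZ].
rewrite E; apply: ge0_le_integral => //.
- have mz := measurable_funM (@measurable_cst _ _ _ _ setT (phi x)) (measurable_kfx x dN bf).
  by apply/measurable_EFinP; apply: measurableT_comp => //; exact: mz.
- by apply/measurable_EFinP; exact: intg_measurable (intgZ _ ix).
- by move=> z _; rewrite lee_fin [leLHS]normrM ler_wpM2l// kf_le.
Qed.

Lemma mker_sq t y : sqintg leb2 (fun x => mker b t (esq (x - y))).
Proof.
have me : measurable_fun setT (fun x => esq (x - y)).
  by apply: continuous_prod_measurable; exact: continuous_esq_sub.
have mg k : measurable_fun setT (fun x : R * R => gker b (1/8) k t (esq (x - y))).
  have mx : measurable_fun setT (fun x : R * R => (t, esq (x - y))).
    by apply/measurable_fun_pairP; split; first exact: measurable_cst.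
  exact: (measurableT_comp (measurable_gker b (1/8) k) mx).
have [t0|t0] := ltP 0 t; last first.
  apply: (@sqintg_le _ _ _ leb2 _ _ _ (sqintg0 leb2)) => [|x].
    by apply: measurable_funD; exact: mg.
  by rewrite /mker !gker_nonpos// addr0.
have gsq k : sqintg leb2 (fun x => gker b (1/8) k t (esq (x - y))).
  have a0 : 0 < 1 / 8 :> R by lra.
  have ig : intg leb2 (fun x => gker b (1/8) k t (esq (x - y))).
    apply: (@intg_ltoo _ _ _ leb2 _ _ (mg k)).
    under eq_integral do rewrite (ger0_norm (gker_ge0 _ _ _ _ _)).
    by rewrite gker_space.
  have tk : 0 <= t^-1 ^+ k by rewrite exprn_ge0// invr_ge0 ltW.
  split; first exact: mg.
  apply: (@intg_le _ _ _ leb2 _ _ _ (@intgZ _ _ _ leb2 (t^-1 ^+ k) _ ig)) => [|x].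
    by apply: measurable_funX; exact: mg.
  rewrite normrX ger0_norm ?gker_ge0// expr2 ler_wpM2r ?gker_ge0//.
  rewrite /gker t0 ler_piMr// -[leRHS]expR0 ler_expR -opprD oppr_le0.
  apply: addr_ge0; first by apply: mulr_ge0; [exact: ltW|rewrite exprn_ge0// ltW].
  apply: divr_ge0; last by rewrite exprn_ge0// ltW.
  by rewrite mulr_ge0// esq_ge0.
by apply: sqintgD; exact: gsq.
Qed.

Lemma dominated_sq N t y : dominated b N -> sqintg leb2 (fun x => N t (x - y)).
Proof.
move=> [mN dN]; apply: (@sqintg_le _ _ _ leb2 _ _ _ (mker_sq t y)) => [|x]; last first.
  by apply: (le_trans (dN t _)); exact: ler_norm.
have mx : measurable_fun setT (fun x : R * R => (t, x - y)).
  apply/measurable_fun_pairP; split; first exact: measurable_cst.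
  by apply/measurable_fun_pairP; split; apply: measurable_funB.
exact: (measurableT_comp mN mx).
Qed.

(** Fubini, justified by [pot_pair]. The inner integral is over the plane at a fixed arc point and
    time, where the heat kernel is smooth; this is where integrations by parts can be carried
    out. *)
Lemma pot_dot N f phi : dominated b N -> arcfun l f -> sqintg leb2 phi ->
  intg leb2 (fun z => (\int[leb2]_x (phi x * N z.2 (x - gam z.1))) * f z.1) /\
  dot leb2 phi (pot N f) = \int[leb2]_z ((\int[leb2]_x (phi x * N z.2 (x - gam z.1))) * f z.1).
Proof.
move=> dN bf p2; have ip := pot_pair dN bf p2.
have [iL EL] := Rint_fubiniL ip.
have [iR ER] := Rint_fubiniR ip.
have E z : \int[leb2]_x (phi x * (N z.2 (x - gam z.1) * f z.1)) =
  (\int[leb2]_x (phi x * N z.2 (x - gam z.1))) * f z.1.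
  rewrite mulrC -RintegralZl//; last exact: sqintgM p2 (dominated_sq _ _ dN).
  by apply: eq_Rintegral => x _; ring.
split; first by apply: eq_intg iR => z; exact: E.
transitivity (\int[leb2]_z \int[leb2]_x (phi x * (N z.2 (x - gam z.1) * f z.1))); last first.
  by apply: eq_Rintegral => z _; exact: E.
rewrite -[RHS]ER EL; apply: (@Rint_ae_eq _ _ _ leb2).
- by apply: measurable_funM; [case: p2|exact: measurable_pot].
- exact: intg_measurable iL.
apply: (@ae_imp _ _ _ leb2 _ _ _ (pot_ae dN bf)) => x [ix _].
by rewrite /pot -RintegralZl.
Qed.

Let by_parts t y phi e (p : R * R -> R) : (e = e1 R \/ e = e2 R) -> testf phi ->
  (forall x, 'D_e (fun x => hk b t (x - y)) x = dk p b t (x - y)) ->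
  \int[leb2]_x ('D_e phi x * hk b t (x - y)) = - \int[leb2]_x (phi x * dk p b t (x - y)).
Proof.
move=> ee tp De; have [sh _] := hk_deriv b t y.
have := test_by_parts sh tp ee.
have -> : \int[leb2]_x ('D_e (fun x => hk b t (x - y)) x * phi x) =
   \int[leb2]_x (phi x * dk p b t (x - y)).
  by apply: eq_Rintegral => x _; rewrite De mulrC.
by move=> <-; apply: eq_Rintegral => x _; rewrite mulrC.
Qed.

Lemma pot_wpart f e p : (e = e1 R /\ p = fst) \/ (e = e2 R /\ p = snd) -> arcfun l f ->
  wpart e (pot (hk b) f) (pot (dk p b) f).
Proof.
move=> ep bf.
have dp : dominated b (dk p b).
  by case: ep => -[_ ->]; [exact: dominated_dk1|exact: dominated_dk2].
have ee : e = e1 R \/ e = e2 R by case: ep => -[-> _]; [left|right].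
split; first exact: (pot_sq dp bf).1.
move=> phi tp; rewrite dotC [dot leb2 _ phi]dotC.
rewrite (pot_dot (dominated_hk b) bf (testf_sqintg (testf_derive e tp))).2.
have [ip ->] := pot_dot dp bf (testf_sqintg tp).
rewrite -mulN1r -RintegralZl//; apply: eq_Rintegral => z _.
rewrite (@by_parts _ _ _ _ p)//; last first.
  by move=> x; case: ep => -[-> ->]; [exact: hk_deriv1|exact: hk_deriv2].
by rewrite mulN1r mulNr.
Qed.

Lemma pot_isH1 f : arcfun l f -> isH1 (pot (hk b) f) (pot (dk fst b) f) (pot (dk snd b) f).
Proof.
move=> bf; split; first exact: (pot_sq (dominated_hk b) bf).1.
  by apply: pot_wpart => //; left.
by apply: pot_wpart => //; right.
Qed.

End PotentialsL2.

(** * The Green function as an integral of heat kernels *)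

Lemma intg_prod_mul d1 d2 (T1 : measurableType d1) (T2 : measurableType d2) (R : realType)
    (m1 : {sigma_finite_measure set T1 -> \bar R})
    (m2 : {sigma_finite_measure set T2 -> \bar R}) (F : T1 -> R) (H : T2 -> R) :
  intg m1 F -> intg m2 H -> intg (m1 \x m2)%E (fun p => F p.1 * H p.2).
Proof.
move=> iF iH; have mF := intg_measurable iF; have mH := intg_measurable iH.
have m : measurable_fun setT (fun p : T1 * T2 => F p.1 * H p.2).
  by apply: measurable_funM; [exact: (measurableT_comp mF)|exact: (measurableT_comp mH)].
apply: (@intg_prodL _ _ _ _ R m1 m2 _ (\int[m1]_x (`|F x| * \int[m2]_y `|H y|)) m).
rewrite EFin_Rint; last first.
  by apply: eq_intg (intgZ (\int[m2]_y `|H y|) (intg_norm iF)) => x; rewrite mulrC.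
rewrite le_eqVlt; apply/orP; left; apply/eqP; apply: eq_integral => x _.
rewrite -RintegralZl//; last exact: intg_norm.
rewrite EFin_Rint; last by apply: intgZ; exact: intg_norm.
by apply: eq_integral => y _; rewrite normrM.
Qed.

Section HeatIdentity.
Variable R : realType.
Local Notation leb := (@lebesgue_measure R).
Local Notation leb2 := (leb \x leb)%E.
Implicit Types (x y z xi : R * R) (s t : R) (phi : R * R -> R).
Variable b : R.
Hypothesis b0 : 0 < b.

(** The heat kernel at time 1: the substitution [x = y + t^2 xi] turns the heat kernel at time [t^4]
    centred at [y] into this fixed density. *)
Definition ugauss xi : R := (4 * pi)^-1 * expR (- (1 / 4 * esq xi)).

Lemma gauss_moment (p : R * R -> R) : continuous p -> (forall x, p x ^+ 2 <= esq x) ->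
  intg leb2 (fun xi => ugauss xi * p xi).
Proof.
move=> cp px; have k0 : 0 < 1 / 8 :> R by lra.
have i8 : intg leb2 (fun xi => expR (- (1 / 8 * esq xi))).
  apply: (@intg_ltoo _ _ _ leb2 _ (pi / (1 / 8))).
    apply: continuous_prod_measurable => x; apply: continuous_comp; last exact: continuous_expR.
    by apply: cvgN; apply: cvgM; [exact: cvg_cst|exact: continuous_esq].
  under eq_integral do rewrite (ger0_norm (expR_ge0 _)).
  rewrite -(integral_gauss2 0 k0) le_eqVlt; apply/orP; left; apply/eqP.
  by apply: eq_integral => x _; rewrite subr0.
apply: (@intg_le _ _ _ leb2 _ _ _ (@intgZ _ _ _ leb2 (2 / (4 * pi)) _ i8)) => [|x].
  apply: continuous_prod_measurable => x; apply: cvgM; last exact: cp.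
  apply: cvgM; first exact: cvg_cst.
  apply: continuous_comp; last exact: continuous_expR.
  by apply: cvgN; apply: cvgM; [exact: cvg_cst|exact: continuous_esq].
have pi0 : 0 < 4 * pi :> R by rewrite mulr_gt0// pi_gt0.
have pi1 : 0 <= (4 * pi)^-1 :> R by rewrite invr_ge0 ltW.
rewrite /ugauss 2!normrM (ger0_norm (expR_ge0 _)) (ger0_norm pi1).
have h : `|p x| <= 2 * expR (1 / 8 * esq x).
  have := expR_ge1Dx (1 / 8 * esq x); have := sqr_ge0 (`|p x| - 2).
  have := px x; rewrite -(real_normK (num_real (p x))).
  by move: `|p x| (esq x) (expR _) => u v w; nra.
have -> : expR (- (1 / 4 * esq x)) = expR (- (1 / 8 * esq x)) * expR (- (1 / 8 * esq x)).
  by rewrite -expRD; congr expR; field.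
have EF : expR (1 / 8 * esq x) * expR (- (1 / 8 * esq x)) = 1.
  by rewrite -expRD addrN expR0.
set F := expR (- _); have F0 : 0 <= F by exact: expR_ge0.
have := ler_wpM2r F0 h; rewrite -[leRHS]mulrA EF mulr1 => h2.
have -> : (4 * pi)^-1 * (F * F) * `|p x| = ((4 * pi)^-1 * F) * (`|p x| * F) by ring.
have -> : 2 / (4 * pi) * F = (4 * pi)^-1 * F * 2 by ring.
by rewrite ler_wpM2l// mulr_ge0// invr_ge0 ltW.
Qed.

Lemma ugauss_mass : intg leb2 ugauss /\ \int[leb2]_xi ugauss xi = 1.
Proof.
have k0 : 0 < 1 / 4 :> R by lra.
have m4 : measurable_fun setT (fun xi : R * R => expR (- (1 / 4 * esq xi))).
  apply: continuous_prod_measurable => x; apply: continuous_comp; last exact: continuous_expR.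
  by apply: cvgN; apply: cvgM; [exact: cvg_cst|exact: continuous_esq].
have E : (\int[leb2]_xi (expR (- (1 / 4 * esq xi)))%:E = (pi / (1 / 4))%:E)%E.
  by rewrite -(integral_gauss2 0 k0); apply: eq_integral => x _; rewrite subr0.
have i4 : intg leb2 (fun xi => expR (- (1 / 4 * esq xi))).
  apply: (@intg_ltoo _ _ _ leb2 _ (pi / (1 / 4)) m4).
  by under eq_integral do rewrite (ger0_norm (expR_ge0 _)); rewrite E.
split; first exact: intgZ.
rewrite RintegralZl// /Rintegral E /=.
have := lt0r_neq0 (pi_gt0 R); move: (pi : R) => q q0.
by field.
Qed.

Variables (phi : R * R -> R) (y : R * R).
Hypothesis tp : testf phi.

(** Two readings meet here: it is the derivative in [t] of [H xi] below, and for [t > 0] its product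
    with [ugauss xi] is the integrand of [heat_pairing] after the substitution [x = y + t^2 xi]. *)
Let P t xi : R := expR (- (b * t ^+ 4)) * (4 * b * t ^+ 3 * phi (y + t ^+ 2 *: xi)
  - 2 * t * (xi.1 * 'D_(e1 R) phi (y + t ^+ 2 *: xi) + xi.2 * 'D_(e2 R) phi (y + t ^+ 2 *: xi))).

Let P' t xi : R := if 0 < t then P t xi else 0.

Let H xi t : R := - expR (- (b * t ^+ 4)) * phi (y + t ^+ 2 *: xi).

Let dH xi t : is_derive t (1 : R) (H xi) (P t xi).
Proof.
have d4 : is_derive t (1 : R) (fun t : R => - (b * t ^+ 4)) (- (b * (4 * t ^+ 3))).
  have [h1 h2] := is_deriveN (is_deriveZ b
    (@is_deriveX _ _ (fun t : R => t) 4 t 1 1 (is_derive_id t (1 : R)))).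
  split; first exact: h1.
  apply: (etrans h2); rewrite /GRing.scale/= mulr1; ring.
have dE : is_derive t (1 : R) (fun t : R => expR (- (b * t ^+ 4)))
    (expR (- (b * t ^+ 4)) * - (b * (4 * t ^+ 3))).
  exact: (@is_derive1_comp _ (@expR R) (fun t : R => - (b * t ^+ 4)) _ _ _ (is_derive_expR _) d4).
have d2 : is_derive t (1 : R) (fun t : R => t ^+ 2) (2 * t).
  have [h1 h2] := @is_deriveX _ _ (fun t : R => t) 2 t 1 1 (is_derive_id t (1 : R)).
  split; first exact: h1.
  by apply: (etrans h2); rewrite /GRing.scale/= mulr1 expr1.
have sp := testf_smooth tp.
have dphi : differentiable phi (y + t ^+ 2 *: xi) by exact: smooth_differentiable.
have dl := is_derive_line dphi.
have dc : is_derive t (1 : R) (fun t : R => phi (y + t ^+ 2 *: xi))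
    ('D_xi phi (y + t ^+ 2 *: xi) * (2 * t)).
  exact: (@is_derive1_comp _ (fun s : R => phi (y + s *: xi)) (fun t : R => t ^+ 2) _ _ _ dl d2).
have [h1 h2] := is_deriveM (is_deriveN dE) dc.
split; first exact: h1.
apply: (etrans h2); rewrite (derive_e1e2 _ dphi) /GRing.scale/= /P.
by rewrite !fctE; ring.
Qed.

Let cP xi : continuous (fun t => P t xi).
Proof.
have cexp : continuous (fun t : R => expR (- (b * t ^+ 4))).
  move=> t; apply: (@continuous_comp _ _ _ (fun t : R => - (b * t ^+ 4)) (@expR R)); last exact: continuous_expR.
  by apply: cvgN; apply: cvgM; [exact: cvg_cst|exact: exprn_continuous].
have ca (psi : R * R -> R) : continuous psi -> continuous (fun t => psi (y + t ^+ 2 *: xi)).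
  move=> cpsi t; apply: (@continuous_comp _ _ _ (fun t : R => y + t ^+ 2 *: xi) psi); last exact: cpsi.
  apply: cvgD; first exact: cvg_cst.
  by apply: cvgZl; exact: exprn_continuous.
have c0 := ca _ (testf_continuous tp).
have c1 := ca _ (testf_continuous (testf_derive (e1 R) tp)).
have c2 := ca _ (testf_continuous (testf_derive (e2 R) tp)).
move=> t; apply: cvgM; first exact: cexp.
apply: cvgB.
  apply: cvgM; last exact: c0.
  by apply: cvgM; [exact: cvg_cst|exact: exprn_continuous].
apply: cvgM; first by apply: cvgM; [exact: cvg_cst|exact: cvg_id].
by apply: cvgD; apply: cvgM; [exact: cvg_cst|exact: c1|exact: cvg_cst|exact: c2].
Qed.

Let bound : exists C0 C1, [/\ 0 <= C0, 0 <= C1, forall x, `|phi x| <= C0 & forall t xi,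
  `|P' t xi| <= 4 * b * C0 * tail b 3 t + 2 * C1 * (`|xi.1| + `|xi.2|) * tail b 1 t].
Proof.
have [C0 C00 H0] := testf_bounded tp.
have [C1 C10 H1] := testf_bounded (testf_derive (e1 R) tp).
have [C2 C20 H2] := testf_bounded (testf_derive (e2 R) tp).
exists C0, (C1 + C2); split=> //; first exact: addr_ge0.
move=> t xi; rewrite /P' /P /tail; case: ltP => [t0|_]; last by rewrite normr0 !mulr0 addr0.
rewrite normrM ger0_norm ?expR_ge0//; set E := expR _; have E0 : 0 <= E by exact: expR_ge0.
set u := phi _; set v := 'D_(e1 R) phi _; set w := 'D_(e2 R) phi _.
have hu : `|u| <= C0 by exact: H0.
have hv : `|v| <= C1 by exact: H1.
have hw : `|w| <= C2 by exact: H2.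
have -> : 4 * b * C0 * (t ^+ 3 * E) + 2 * (C1 + C2) * (`|xi.1| + `|xi.2|) * (t ^+ 1 * E) =
  E * (4 * b * t ^+ 3 * C0 + 2 * t * ((`|xi.1| + `|xi.2|) * (C1 + C2))) by ring.
rewrite ler_wpM2l//; apply: (le_trans (ler_normB _ _)); apply: lerD.
  rewrite normrM ger0_norm; first by rewrite ler_wpM2l// !mulr_ge0 ?exprn_ge0// ltW.
  by rewrite !mulr_ge0 ?exprn_ge0// ltW.
have t2 : 0 <= 2 * t by rewrite mulr_ge0// ltW.
rewrite normrM (ger0_norm t2) ler_wpM2l//; apply: (le_trans (ler_normD _ _)).
rewrite !normrM; have n1 := normr_ge0 xi.1; have n2 := normr_ge0 xi.2.
have a1 : `|xi.1| * `|v| <= `|xi.1| * C1 by rewrite ler_wpM2l.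
have a2 : `|xi.2| * `|w| <= `|xi.2| * C2 by rewrite ler_wpM2l.
have a3 : 0 <= `|xi.1| * C2 by rewrite mulr_ge0.
have a4 : 0 <= `|xi.2| * C1 by rewrite mulr_ge0.
apply: (le_trans (lerD a1 a2)); rewrite mulrDl !mulrDr.
by apply: lerD; rewrite ?lerDl ?lerDr.
Qed.

Let int_P' xi : intg leb (fun t => P' t xi) /\ \int[leb]_t P' t xi = phi y.
Proof.
have [C0 [C1 [C00 C10 Hphi Hb]]] := bound.
pose D t := 4 * b * C0 * tail b 3 t + 2 * C1 * (`|xi.1| + `|xi.2|) * tail b 1 t.
have iD : intg leb D by apply: intgD; apply: intgZ; exact: intg_tail.
have P0 : P 0 xi = 0 by rewrite /P !expr0n/= !mulr0 !mul0r subr0 mulr0.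
have [|||iP cvgP'] := @Rint_dct _ _ R leb (fun n t => \1_`[0, n%:R] t * P t xi)
    (fun t => P' t xi) D _ iD.
- move=> n; apply: measurable_funM; first exact: measurable_indic.
  by apply: continuous_measurable_fun; exact: cP.
- move=> n t; apply: le_trans (Hb t xi); rewrite /P' indicE.
  have [|_] := boolP (t \in _); last by rewrite mul0r normr0.
  rewrite inE /= in_itv/= => /andP[t0 _]; rewrite mul1r; move: t0.
  by rewrite le_eqVlt => /orP[/eqP <-|->//]; rewrite P0 normr0.
- move=> t; apply/cvg_nP => e e0; exists (Num.truncn t).+1 => n tn; rewrite /P' indicE.
  have [t0|t0] := ltP 0 t.
    rewrite mem_set ?mul1r ?subrr ?normr0 ?ltW//= in_itv/= (ltW t0)/= ltW//.
    by apply: lt_le_trans (truncnS_gt _) _; rewrite ler_nat.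
  have [|_] := boolP (t \in _); last by rewrite mul0r subrr normr0 ltW.
  rewrite inE /= in_itv/= => /andP[t1 _].
  have -> : t = 0 by apply/eqP; rewrite eq_le t0 t1.
  by rewrite P0 mulr0 subrr normr0 ltW.
split=> //.
suff : \int[leb]_t (\1_`[0, n%:R] t * P t xi) @[n --> \oo] --> phi y.
  by move=> h; apply: (cvg_unique _ cvgP' h).
have Hn n : (0 < n)%N -> \int[leb]_t (\1_`[0, n%:R] t * P t xi) = H xi n%:R + phi y.
  move=> n0; have n0' : 0 < n%:R :> R by rewrite ltr0n.
  have E : (\int[leb]_(t in `[0%R, n%:R]) (P t xi)%:E = (H xi n%:R)%:E - (H xi 0)%:E)%E.
    apply: continuous_FTC2 => //.
    - by apply: continuous_subspaceT; exact: cP.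
    - have cH : continuous (H xi).
        move=> t; apply: differentiable_continuous; apply/derivable1_diffP.
        by case: (dH xi t).
      split.
      + by move=> t _; case: (dH xi t).
      + by apply: cvg_at_right_filter; exact: cH.
      + by apply: cvg_at_left_filter; exact: cH.
    - by move=> t _; rewrite derive1E; exact: (@derive_val _ _ _ _ _ _ _ (dH xi t)).
  have -> : \int[leb]_t (\1_`[0, n%:R] t * P t xi) = fine (\int[leb]_(t in `[0%R, n%:R]) (P t xi)%:E).
    rewrite [in RHS]integral_mkcond /Rintegral; congr fine; apply: eq_integral => t _.
    by rewrite patchE indicE; case: (t \in _); rewrite ?mul1r ?mul0r.
  rewrite E /H expr0n/= expr0n/= mulr0 oppr0 expR0 scale0r addr0 /=.
  by rewrite mulN1r opprK.
apply/cvg_nP => e e0.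
(* As [expR (- (b * n^4)) <= 1/(b n)], the boundary term at [n] is at most [C0/(b n)]. *)
pose N := (Num.truncn (C0 / (b * e))).+1.
exists N => n Nn; have n0 : (0 < n)%N by apply: leq_trans Nn.
rewrite Hn// addrK /H mulNr normrN normrM ger0_norm ?expR_ge0//.
have n1 : 1 <= n%:R :> R by rewrite ler1n.
have bn4 : b * n%:R <= expR (b * n%:R ^+ 4).
  have := expR_ge1Dx (b * n%:R ^+ 4).
  have : b * n%:R <= b * n%:R ^+ 4.
    by rewrite ler_wpM2l ?(ltW b0)// -[leLHS]expr1 ler_weXn2l.
  lra.
have bn0 : 0 < b * n%:R by rewrite mulr_gt0// ltr0n.
have En : expR (- (b * n%:R ^+ 4)) <= (b * n%:R)^-1.
  by rewrite expRN lef_pV2 ?posrE ?expR_gt0.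
apply: (@le_trans _ _ ((b * n%:R)^-1 * C0)); first by rewrite ler_pM ?expR_ge0.
rewrite mulrC ler_pdivrMr// mulrA -ler_pdivrMl ?mulr_gt0//.
rewrite mulrC [e * b]mulrC ltW//; apply: lt_le_trans (truncnS_gt _) _.
by rewrite ler_nat.
Qed.

Let F t x : R := b * (phi x * hk b t (x - y)) + 'D_(e1 R) phi x * dk fst b t (x - y)
  + 'D_(e2 R) phi x * dk snd b t (x - y).

Let scaled t xi : 0 < t -> (t ^+ 2) ^+ 2 * F t (y + t ^+ 2 *: xi) = ugauss xi * P' t xi.
Proof.
move=> t0; have -> : F t (y + t ^+ 2 *: xi) = b * (phi (y + t ^+ 2 *: xi) * hk b t (t ^+ 2 *: xi)) +
    'D_(e1 R) phi (y + t ^+ 2 *: xi) * dk fst b t (t ^+ 2 *: xi) +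
    'D_(e2 R) phi (y + t ^+ 2 *: xi) * dk snd b t (t ^+ 2 *: xi).
  by rewrite /F; have -> : y + t ^+ 2 *: xi - y = t ^+ 2 *: xi by rewrite addrC addKr.
rewrite /P' t0 /P /dk /hk /hker /gker t0.
have -> : esq (t ^+ 2 *: xi) = t ^+ 4 * esq xi by rewrite /esq /= /GRing.scale/=; ring.
have -> : expR (- (b * t ^+ 4) - 1 / 4 * (t ^+ 4 * esq xi) / t ^+ 4) =
   expR (- (b * t ^+ 4)) * expR (- (1 / 4 * esq xi)).
  by rewrite -expRD; congr expR; field; exact: lt0r_neq0.
rewrite /ugauss /= /GRing.scale/=.
move: (expR _) (expR _) (phi _) ('D_(e1 R) phi _) ('D_(e2 R) phi _) => A B u v w.
have t00 : t != 0 by exact: lt0r_neq0.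
have pi0 : pi != 0 :> R by rewrite gt_eqF// pi_gt0.
by move: (pi : R) pi0 => q q0; field; rewrite t00 q0.
Qed.

Let cF t : continuous (F t).
Proof.
have [sh _] := hk_deriv b t y.
have c1 : continuous (fun x => dk fst b t (x - y)).
  have -> : (fun x => dk fst b t (x - y)) = 'D_(e1 R) (fun x => hk b t (x - y)).
    by apply/funext => x; rewrite hk_deriv1.
  by apply: smooth_continuous; exact: smooth_derive.
have c2 : continuous (fun x => dk snd b t (x - y)).
  have -> : (fun x => dk snd b t (x - y)) = 'D_(e2 R) (fun x => hk b t (x - y)).
    by apply/funext => x; rewrite hk_deriv2.
  by apply: smooth_continuous; exact: smooth_derive.
have d1 := testf_continuous (testf_derive (e1 R) tp).
have d2 := testf_continuous (testf_derive (e2 R) tp).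
move=> x; apply: cvgD; first apply: cvgD.
- apply: cvgM; first exact: cvg_cst.
  by apply: cvgM; [exact: (testf_continuous tp)|exact: (smooth_continuous sh)].
- by apply: cvgM; [exact: d1|exact: c1].
- by apply: cvgM; [exact: d2|exact: c2].
Qed.

Let iF t : [/\ intg leb2 (fun x => phi x * hk b t (x - y)),
  intg leb2 (fun x => 'D_(e1 R) phi x * dk fst b t (x - y)) &
  intg leb2 (fun x => 'D_(e2 R) phi x * dk snd b t (x - y))].
Proof.
split; apply: sqintgM.
- exact: testf_sqintg.
- exact: (dominated_sq b0 t y (dominated_hk b)).
- by apply: testf_sqintg; exact: testf_derive.
- exact: (dominated_sq b0 t y (dominated_dk1 b)).
- by apply: testf_sqintg; exact: testf_derive.
- exact: (dominated_sq b0 t y (dominated_dk2 b)).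
Qed.

Definition heat_pairing t : R :=
  b * (\int[leb2]_x (phi x * hk b t (x - y))) +
  \int[leb2]_x ('D_(e1 R) phi x * dk fst b t (x - y)) +
  \int[leb2]_x ('D_(e2 R) phi x * dk snd b t (x - y)).

Let pairingE t : heat_pairing t = \int[leb2]_xi (ugauss xi * P' t xi).
Proof.
have [i0 i1 i2] := iF t.
have j0 := @intgZ _ _ _ leb2 b _ i0.
have E : heat_pairing t = \int[leb2]_x F t x.
  rewrite /heat_pairing -(RintegralZl b measurableT i0) -(RintegralD measurableT j0 i1).
  by rewrite -RintegralD//; exact: intgD.
have [t0|t0] := ltP 0 t; last first.
  rewrite E Rint0 => [|x]; last by rewrite /F /dk /hk /hker gker_nonpos// !mulr0 !addr0.
  by rewrite Rint0// => x; rewrite /P' ltNge t0 mulr0.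
have t20 : 0 < t ^+ 2 by rewrite exprn_gt0.
have iFt : intg leb2 (F t) by apply: intgD => //; exact: intgD.
have [ia Ea] := @Rint_affine2 R (F t) y _ t20 (@cF t) iFt.
rewrite E Ea -RintegralZl//; apply: eq_Rintegral => xi _.
exact: scaled.
Qed.

Let mP' : measurable_fun setT (fun p : R * (R * R) => P' p.1 p.2).
Proof.
have m1 : measurable_fun setT (fun p : R * (R * R) => p.1) by exact: (@measurable_fst _ _ R (R * R)%type).
have m21 : measurable_fun setT (fun p : R * (R * R) => p.2.1).
  exact: (measurableT_comp (@measurable_fst _ _ R R) (@measurable_snd _ _ R (R * R)%type)).
have m22 : measurable_fun setT (fun p : R * (R * R) => p.2.2).
  exact: (measurableT_comp (@measurable_snd _ _ R R) (@measurable_snd _ _ R (R * R)%type)).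
have ma : measurable_fun setT (fun p : R * (R * R) => y + p.1 ^+ 2 *: p.2).
  have mX : measurable_fun setT (fun p : R * (R * R) => p.1 ^+ 2) by exact: measurable_funX.
  apply/measurable_fun_pairP; split; (apply: measurable_funD; first exact: measurable_cst).
    exact: measurable_funM mX m21.
  exact: measurable_funM mX m22.
have mt (psi : R * R -> R) : testf psi -> measurable_fun setT (fun p : R * (R * R) => psi (y + p.1 ^+ 2 *: p.2)).
  by move=> /testf_measurable mpsi; exact: (measurableT_comp mpsi ma).
apply: measurable_if_pos => //; apply: measurable_funM.
  apply: measurableT_comp => //; apply: measurableT_comp => //; apply: measurable_funM => //.
  exact: measurable_funX.
apply: measurable_funB.
  apply: measurable_funM; last exact: mt.
  by apply: measurable_funM => //; exact: measurable_funX.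
apply: measurable_funM; first exact: measurable_funM.
apply: measurable_funD.
  exact: (measurable_funM m21 (mt _ (testf_derive (e1 R) tp))).
exact: (measurable_funM m22 (mt _ (testf_derive (e2 R) tp))).
Qed.

(** The heat kernels integrate over [t] to the fundamental solution of [b - Laplacian] at [y], here
    in weak form. At fixed [xi] the time integral is that of a derivative whose primitive runs from
    [- phi y] at 0 to 0 at infinity; the first moments of [ugauss] allow the integration over [t] to
    be done first. *)
Lemma heat_identity : intg leb heat_pairing /\ \int[leb]_t heat_pairing t = phi y.
Proof.
have [C0 [C1 [C00 C10 Hphi Hb]]] := bound.
have [iu mass] := ugauss_mass.
have mu : measurable_fun setT (fun p : R * (R * R) => ugauss p.2).
  exact: (measurableT_comp (intg_measurable iu) (@measurable_snd _ _ R (R * R)%type)).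
have m1 : intg leb2 (fun xi => ugauss xi * `|xi.1|).
  apply: gauss_moment => [x|x]; last by rewrite real_normK ?num_real ?fst_sq_le.
  by apply: (@continuous_comp _ _ _ (fst : R * R -> R) Num.norm); [exact: cvg_fst|exact: norm_continuous].
have m2 : intg leb2 (fun xi => ugauss xi * `|xi.2|).
  apply: gauss_moment => [x|x]; last by rewrite real_normK ?num_real ?snd_sq_le.
  by apply: (@continuous_comp _ _ _ (snd : R * R -> R) Num.norm); [exact: cvg_snd|exact: norm_continuous].
have i3 := intg_tail b0 (isT : (3 <= 4)%N).
have i1 := intg_tail b0 (isT : (1 <= 4)%N).
have j1 := @intg_prod_mul _ _ _ _ R leb (plane R) _ _ (intgZ (4 * b * C0) i3) iu.
have j2 := @intg_prod_mul _ _ _ _ R leb (plane R) _ _ (intgZ (2 * C1) i1) m1.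
have j3 := @intg_prod_mul _ _ _ _ R leb (plane R) _ _ (intgZ (2 * C1) i1) m2.
have iG : intg (leb \x plane R)%E (fun p : R * (R * R) => ugauss p.2 * P' p.1 p.2).
  apply: (@intg_le _ _ _ (leb \x plane R)%E _ _ _ (intgD (intgD j1 j2) j3)) => [|p].
    exact: (measurable_funM mu mP').
  have u0 : 0 <= ugauss p.2.
    by rewrite mulr_ge0 ?expR_ge0// invr_ge0 mulr_ge0// pi_ge0.
  rewrite normrM (ger0_norm u0); have := ler_wpM2l u0 (Hb p.1 p.2).
  by move/le_trans; apply; rewrite le_eqVlt; apply/orP; left; apply/eqP; ring.
have [iL _] := Rint_fubiniL iG.
have hp : heat_pairing = (fun t => \int[leb2]_xi (ugauss xi * P' t xi)).
  by apply/funext => t; exact: pairingE.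
rewrite hp; split; first exact: iL.
have := Rint_swap iG => /= ->.
rewrite -[RHS]mul1r -mass.
transitivity (\int[plane R]_xi (phi y * ugauss xi)).
  apply: eq_Rintegral => xi _; have [ix Ex] := int_P' xi.
  by rewrite RintegralZl// Ex mulrC.
by rewrite RintegralZl// mulrC.
Qed.

End HeatIdentity.

Lemma small_eq0 (R : realType) (x M : R) : 0 <= M ->
  (forall e, 0 < e -> `|x| <= M * e) -> x = 0.
Proof.
move=> M0 h; apply/normr0_eq0/eqP; rewrite eq_le normr_ge0 andbT.
apply/ler_addgt0Pr => e e0; rewrite add0r.
have M1 : 0 < M + 1 by rewrite ltr_wpDl.
have := h (e / (M + 1)) (divr_gt0 e0 M1); move/le_trans; apply.
by rewrite mulrA ler_pdivrMr// mulrDr mulr1 mulrC lerDl ltW.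
Qed.

Section EnergyForm.
Variable R : realType.
Local Notation leb := (@lebesgue_measure R).
Local Notation leb2 := (leb \x leb)%E.
Implicit Types (u v w : R * R -> R).
Variable b : R.
Hypothesis b0 : 0 < b.

Definition energy u u1 u2 v v1 v2 : R :=
  b * dot leb2 u v + dot leb2 u1 v1 + dot leb2 u2 v2.

Lemma energyC u u1 u2 v v1 v2 : energy u u1 u2 v v1 v2 = energy v v1 v2 u u1 u2.
Proof. by rewrite /energy; congr (_ * _ + _ + _); exact: dotC. Qed.

Lemma energy_diff_le u u1 u2 w w1 w2 v v1 v2 d : 0 <= d ->
  sqintg leb2 u -> sqintg leb2 u1 -> sqintg leb2 u2 ->
  sqintg leb2 w -> sqintg leb2 w1 -> sqintg leb2 w2 ->
  sqintg leb2 v -> sqintg leb2 v1 -> sqintg leb2 v2 ->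
  nsq leb2 (fun x => u x - w x) <= d ^+ 2 -> nsq leb2 (fun x => u1 x - w1 x) <= d ^+ 2 ->
  nsq leb2 (fun x => u2 x - w2 x) <= d ^+ 2 ->
  `|energy u u1 u2 v v1 v2 - energy w w1 w2 v v1 v2| <=
  (b * Num.sqrt (nsq leb2 v) + Num.sqrt (nsq leb2 v1) + Num.sqrt (nsq leb2 v2)) * d.
Proof.
move=> d0 su su1 su2 sw sw1 sw2 sv sv1 sv2 h h1 h2.
have key p q r : sqintg leb2 p -> sqintg leb2 q -> sqintg leb2 r ->
   nsq leb2 (fun x => p x - q x) <= d ^+ 2 ->
   `|dot leb2 p r - dot leb2 q r| <= Num.sqrt (nsq leb2 r) * d.
  move=> sp sq sr hpq; rewrite -dotBl//.
  apply: (le_trans (dot_CS_norm (sqintgB sp sq) sr)); rewrite mulrC.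
  rewrite ler_wpM2l ?sqrtr_ge0//.
  by rewrite -[leRHS](ger0_norm d0) -sqrtr_sqr ler_wsqrtr.
have k := key u w v su sw sv h.
have k1 := key u1 w1 v1 su1 sw1 sv1 h1.
have k2 := key u2 w2 v2 su2 sw2 sv2 h2.
have -> : energy u u1 u2 v v1 v2 - energy w w1 w2 v v1 v2 =
  b * (dot leb2 u v - dot leb2 w v) + (dot leb2 u1 v1 - dot leb2 w1 v1)
   + (dot leb2 u2 v2 - dot leb2 w2 v2) by rewrite /energy; ring.
apply: (le_trans (ler_normD _ _)); rewrite mulrDl lerD//.
apply: (le_trans (ler_normD _ _)); rewrite mulrDl lerD//.
by rewrite normrM (gtr0_norm b0) -mulrA ler_wpM2l// ltW.
Qed.

End EnergyForm.

Section GreenIdentity.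
Variable R : realType.
Local Notation leb := (@lebesgue_measure R).
Local Notation leb2 := (leb \x leb)%E.
Implicit Types (x y : R * R) (s t : R).
Variables (gam : R -> R * R) (l c : R).
Hypothesis l0 : 0 < l.
Hypothesis cgam : continuous gam.
Hypothesis c0 : 0 < c.
Hypothesis gam_lb : forall s t, 0 <= s <= l -> 0 <= t <= l ->
  c ^+ 2 * (s - t) ^+ 2 <= esq (gam s - gam t).
Variable b : R.
Hypothesis b0 : 0 < b.
Implicit Types (f g : R -> R) (phi : R * R -> R).

Let U f := pot gam (hk b) f.
Let W1 f := pot gam (dk fst b) f.
Let W2 f := pot gam (dk snd b) f.

Let sU f (bf : arcfun l f) := (pot_sq l0 cgam c0 gam_lb b0 (dominated_hk b) bf).1.
Let sW1 f (bf : arcfun l f) := (pot_sq l0 cgam c0 gam_lb b0 (dominated_dk1 b) bf).1.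
Let sW2 f (bf : arcfun l f) := (pot_sq l0 cgam c0 gam_lb b0 (dominated_dk2 b) bf).1.

(** The potential of [f] solves [(b - Laplacian) U = f] in the weak sense, the right side being a
    density on the arc: [heat_identity] holds at each arc point and is integrated against [f]. *)
Lemma green_test f phi : arcfun l f -> testf phi ->
  energy b phi ('D_(e1 R) phi) ('D_(e2 R) phi) (U f) (W1 f) (W2 f) =
  \int[leb]_s (phi (gam s) * f s).
Proof.
move=> bf tp.
have [i0 E0] := pot_dot l0 cgam c0 gam_lb b0 (dominated_hk b) bf (testf_sqintg tp).
have [i1 E1] := pot_dot l0 cgam c0 gam_lb b0 (dominated_dk1 b) bf (testf_sqintg (testf_derive (e1 R) tp)).
have [i2 E2] := pot_dot l0 cgam c0 gam_lb b0 (dominated_dk2 b) bf (testf_sqintg (testf_derive (e2 R) tp)).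
have j0 := @intgZ _ _ _ leb2 b _ i0.
rewrite /energy E0 E1 E2 -(RintegralZl b measurableT i0) -(RintegralD measurableT j0 i1).
rewrite -(RintegralD measurableT (intgD j0 i1) i2).
have E (z : R * R) : b * (\int[leb2]_x (phi x * hk b z.2 (x - gam z.1)) * f z.1) +
   \int[leb2]_x ('D_(e1 R) phi x * dk fst b z.2 (x - gam z.1)) * f z.1 +
   \int[leb2]_x ('D_(e2 R) phi x * dk snd b z.2 (x - gam z.1)) * f z.1 =
   heat_pairing b phi (gam z.1) z.2 * f z.1.
  by rewrite /heat_pairing; ring.
have ih := intgD (intgD j0 i1) i2.
have ih' : intg leb2 (fun z : R * R => heat_pairing b phi (gam z.1) z.2 * f z.1).
  by apply: eq_intg ih => z; exact: E.
under eq_Rintegral do rewrite E.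
have [_ ->] := Rint_fubiniL ih'.
apply: eq_Rintegral => s _ /=.
have [ip Ep] := heat_identity b0 (gam s) tp.
under eq_Rintegral do rewrite mulrC.
by rewrite RintegralZl// Ep mulrC.
Qed.

(** Cutoffs remove the restriction to bounded supports. The intended [phi] is a heat kernel at a
    fixed time, in [bsop_green]. *)
Lemma green_smooth f phi (C : R) : arcfun l f -> smooth phi -> sqintg leb2 phi ->
  sqintg leb2 ('D_(e1 R) phi) -> sqintg leb2 ('D_(e2 R) phi) ->
  (forall x, `|phi x| <= C) ->
  energy b phi ('D_(e1 R) phi) ('D_(e2 R) phi) (U f) (W1 f) (W2 f) =
  \int[leb]_s (phi (gam s) * f s).
Proof.
move=> bf sp p2 p12 p22 pC; have [mf [D fD] f0] := bf.
have ifn := intg_norm (arcfun_intg bf).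
have mg (psi : R * R -> R) : continuous psi -> measurable_fun setT (fun s => psi (gam s)).
  move=> cpsi; apply: continuous_measurable_fun => s.
  by apply: (@continuous_comp _ _ _ gam psi); [exact: cgam|exact: cpsi].
have [|||_ /cvg_nP cv] := @Rint_dct _ _ R leb
    (fun n s => cut n (gam s) * phi (gam s) * f s)
    (fun s => phi (gam s) * f s) (fun s => C * `|f s|) _ (intgZ C ifn).
- move=> n; apply: measurable_funM => //; apply: measurable_funM; apply: mg.
    by apply: testf_continuous; exact: testf_cut.
  exact: smooth_continuous.
- move=> n s; rewrite normrM ler_wpM2r// normrM; apply: le_trans (pC (gam s)).
  by have /andP[k0 k1] := cut01 n (gam s); rewrite ler_piMl// ger0_norm.
- move=> s; apply: cvgM; last exact: cvg_cst.
  rewrite -[X in _ --> X]mul1r; apply: cvgM; last exact: cvg_cst.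
  exact: cvg_cut.
pose K := b * Num.sqrt (nsq leb2 (U f)) + Num.sqrt (nsq leb2 (W1 f)) + Num.sqrt (nsq leb2 (W2 f)).
have K0 : 0 <= K by rewrite !addr_ge0 ?mulr_ge0 ?sqrtr_ge0// ltW.
apply/eqP; rewrite -subr_eq0; apply/eqP; apply: (@small_eq0 _ _ (K + 1)).
  by rewrite addr_ge0.
move=> e e0; have [N1 HN1] := cv e e0.
have e20 : 0 < e ^+ 2 by rewrite exprn_gt0.
have [N2 tN HN2] := cutoff_density sp p2 p12 p22 e20.
pose n := maxn N1 N2.
have h1 := HN1 n (leq_maxl _ _).
have [q0 q1 q2] := HN2 n (leq_maxr _ _).
have tn := tN n (leq_maxr _ _).
have G := green_test bf tn.
have h2 := @energy_diff_le R b b0 (fun x => cut n x * phi x) _ _ phi _ _ (U f) (W1 f) (W2 f) e (ltW e0)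
  (testf_sqintg tn) (testf_sqintg (testf_derive (e1 R) tn)) (testf_sqintg (testf_derive (e2 R) tn))
  p2 p12 p22 (sU bf) (sW1 bf) (sW2 bf) q0 q1 q2.
rewrite G -/K in h2; rewrite [(K + 1) * e]mulrDl mul1r.
set X := energy _ _ _ _ _ _ _ in h2 *; set Y := \int[leb]_s (phi (gam s) * f s) in h1 *.
set Z := \int[leb]_s _ in h1 h2.
have -> : X - Y = - (Z - X) + (Z - Y) by ring.
by apply: (le_trans (ler_normD _ _)); rewrite normrN lerD.
Qed.

Definition hkC : R := pi^-1 * (2 / c * Num.sqrt (pi / (1 / 4))).

Lemma hkC_ge0 : 0 <= hkC.
Proof.
by rewrite mulr_ge0 ?invr_ge0 ?pi_ge0// mulr_ge0 ?sqrtr_ge0// divr_ge0// ltW.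
Qed.

Lemma hk_nonpos t x : t <= 0 -> hk b t x = 0.
Proof. by move=> t0; rewrite /hk /hker gker_nonpos// mulr0. Qed.

Let measurable_hks t x : measurable_fun setT (fun s => hk b t (x - gam s)).
Proof.
apply: measurable_funM => //.
have mx : measurable_fun setT (fun s => (t, esq (x - gam s))).
  apply/measurable_fun_pairP; split; first exact: measurable_cst.
  by apply: continuous_measurable_fun; exact: continuous_arc_esq.
exact: (measurableT_comp (measurable_gker b (1/4) 1) mx).
Qed.

Lemma hk_arc t x :
  (\int[leb]_s (\1_`[0, l] s * hk b t (x - gam s))%:E <= (hkC * tail b 1 t)%:E)%E.
Proof.
have [t0|t0] := ltP 0 t; last first.
  under eq_integral do rewrite hk_nonpos// mulr0.
  by rewrite integral0 lee_fin mulr_ge0 ?hkC_ge0 ?tail_ge0.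
have a0 : 0 < 1 / 4 :> R by lra.
have h := @gker_arc R gam l c l0 cgam c0 gam_lb b (1/4) 1 t x t0 a0.
have E s : (\1_`[0, l] s * hk b t (x - gam s))%:E =
  ((pi^-1)%:E * (\1_`[0, l] s * gker b (1 / 4) 1 t (esq (x - gam s)))%:E)%E.
  by rewrite -EFinM /hk /hker; congr (_%:E); ring.
under eq_integral do rewrite E.
have mg1 : measurable_fun setT (fun s => \1_`[0, l] s * gker b (1 / 4) 1 t (esq (x - gam s))).
  apply: measurable_funM; first exact: measurable_indic.
  have mx : measurable_fun setT (fun s => (t, esq (x - gam s))).
    apply/measurable_fun_pairP; split; first exact: measurable_cst.
    by apply: continuous_measurable_fun; exact: continuous_arc_esq.
  exact: (measurableT_comp (measurable_gker b (1/4) 1) mx).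
rewrite ge0_integralZl//.
- apply: (@le_trans _ _ ((pi^-1)%:E * (2 / c * Num.sqrt (pi / (1 / 4)) * (t^-1 ^+ 1 * t ^+ 2) * expR (- (b * t ^+ 4)))%:E)%E).
    by rewrite lee_wpmul2l// lee_fin invr_ge0 pi_ge0.
  rewrite -EFinM lee_fin /hkC /tail t0 le_eqVlt; apply/orP; left; apply/eqP.
  by rewrite -[pi^-1 * (_ * _) * _]mulrA; congr (_ * _); move: (Num.sqrt _) (expR _) => u v; field; rewrite !lt0r_neq0.
- exact/measurable_EFinP.
- by move=> s _; rewrite lee_fin mulr_ge0 ?gker_ge0// indicE.
- by rewrite lee_fin invr_ge0 pi_ge0.
Qed.

Definition tail1_mass : R := \int[leb]_t tail b 1 t.

Lemma tail1_mass_ge0 : 0 <= tail1_mass.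
Proof. by apply: Rintegral_ge0 => t _; exact: tail_ge0. Qed.

Let measurable_hkf f x : measurable_fun setT f ->
  measurable_fun setT (fun z : R * R => hk b z.2 (x - gam z.1) * f z.1).
Proof.
move=> mf; apply: measurable_funM.
  exact: (measurableT_comp (dominated_measurable cgam (dominated_hk b)) (measurable_pair1 x)).
exact: (measurableT_comp mf (@measurable_fst _ _ R R)).
Qed.

Lemma hk_ge0 t x : 0 <= hk b t x.
Proof. exact: hker_ge0. Qed.

(** The arc integral of the heat kernel is at most a multiple of [t e^(-b t^4)], uniformly in the
    point [x]. Potentials are thus bounded at every point, in particular on the arc, where the
    integral operator evaluates them. *)
Lemma hk_pot_intg f (C : R) x : arcfun l f -> (forall s, `|f s| <= C) ->
  intg leb2 (fun z => hk b z.2 (x - gam z.1) * f z.1) /\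
  `|U f x| <= C * hkC * tail1_mass.
Proof.
move=> bf fC; have [mf _ f0] := bf.
have C0 : 0 <= C by exact: le_trans (normr_ge0 _) (fC 0).
have mk := measurable_hkf x mf.
have h : (\int[leb2]_z `|hk b z.2 (x - gam z.1) * f z.1|%:E <= (C * hkC * tail1_mass)%:E)%E.
  rewrite fubini_tonelli2; last 2 first.
  - by apply/measurable_EFinP; exact: measurableT_comp.
  - by move=> z; rewrite lee_fin.
  rewrite -RintegralZl//; last exact: intg_tail.
  rewrite EFin_Rint; last by apply: intgZ; exact: intg_tail.
  apply: ge0_le_integral => //.
  - by move=> t _; apply: integral_ge0 => s _; rewrite lee_fin.
  - apply: (@measurable_fun_fubini_tonelli_G _ _ _ _ _ leb (EFin \o (fun z => `|hk b z.2 (x - gam z.1) * f z.1|))).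
    + by apply/measurable_EFinP; exact: measurableT_comp.
    + by move=> z; rewrite lee_fin.
  - by apply/measurable_EFinP; apply: measurable_funM => //; exact: measurable_tail.
  move=> t _; rewrite /fubini_G/=.
  apply: (@le_trans _ _ (C%:E * \int[leb]_s (\1_`[0, l] s * hk b t (x - gam s))%:E)%E); last first.
    by rewrite -[in leRHS]mulrA [in leRHS]EFinM lee_wpmul2l ?lee_fin// hk_arc.
  rewrite -ge0_integralZl//.
  - apply: ge0_le_integral => //.
    + apply/measurable_EFinP; apply: measurableT_comp => //.
      by apply: measurable_funM; [exact: measurable_hks|exact: mf].
    + apply: measurable_funeM; apply/measurable_EFinP; apply: measurable_funM.
        exact: measurable_indic.
      exact: measurable_hks.
    move=> s _; rewrite -EFinM lee_fin normrM (ger0_norm (hk_ge0 _ _)) indicE.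
    have [_|sl] := boolP (s \in _); first by rewrite mul1r mulrC ler_wpM2r// hk_ge0.
    rewrite f0 ?normr0 ?mul0r ?mulr0//; move: sl; rewrite notin_setE /= in_itv/=.
    by [].
  - apply/measurable_EFinP; apply: measurable_funM; first exact: measurable_indic.
    exact: measurable_hks.
  - by move=> s _; rewrite lee_fin mulr_ge0 ?hk_ge0// indicE.
have ii := @intg_ltoo _ _ _ leb2 _ _ mk h.
split=> //; apply: (le_trans (@Rint_norm_le _ _ _ leb2 _ mk)).
by rewrite -lee_fin EFin_Rint//; exact: intg_norm.
Qed.

End GreenIdentity.

Section BirmanSchwinger.
Variable R : realType.
Local Notation leb := (@lebesgue_measure R).
Local Notation leb2 := (leb \x leb)%E.
Implicit Types (x y : R * R) (s t : R).

(* The kernel of the Birman-Schwinger operator depends on the arc only through the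
   squared distances [d2] between its points. *)
Definition bsop (b : R) (d2 : R -> R -> R) (f : R -> R) s : R :=
  \int[leb2]_z (hker b z.2 (d2 s z.1) * f z.1).

Definition dist2 (gam : R -> R * R) s t : R := esq (gam s - gam t).

Variables (gam : R -> R * R) (l c : R).
Hypothesis l0 : 0 < l.
Hypothesis cgam : continuous gam.
Hypothesis c0 : 0 < c.
Hypothesis gam_lb : forall s t, 0 <= s <= l -> 0 <= t <= l ->
  c ^+ 2 * (s - t) ^+ 2 <= esq (gam s - gam t).
Hypothesis gam_ub : forall s t, 0 <= s <= l -> 0 <= t <= l ->
  esq (gam s - gam t) <= (s - t) ^+ 2.
Implicit Types (b : R) (f g : R -> R).

Local Notation d2 := (dist2 gam).

Section FixedMass.
Variable b : R.
Hypothesis b0 : 0 < b.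

Let U f := pot gam (hk b) f.
Let W1 f := pot gam (dk fst b) f.
Let W2 f := pot gam (dk snd b) f.

Lemma bsop_intg f s : arcfun l f -> intg leb2 (fun z => hker b z.2 (d2 s z.1) * f z.1).
Proof.
move=> bf; have [_ [C fC] _] := bf.
exact: (hk_pot_intg l0 cgam c0 gam_lb b0 (gam s) bf fC).1.
Qed.

Lemma bsop_bound f (C : R) s : arcfun l f -> (forall s, `|f s| <= C) ->
  `|bsop b d2 f s| <= C * hkC c * tail1_mass b.
Proof. move=> bf fC; exact: (hk_pot_intg l0 cgam c0 gam_lb b0 (gam s) bf fC).2. Qed.

Lemma bsop_comb f g k s : arcfun l f -> arcfun l g ->
  bsop b d2 (fun r => f r + k * g r) s = bsop b d2 f s + k * bsop b d2 g s.
Proof.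
move=> bf bg; have i1 := bsop_intg s bf; have i2 := bsop_intg s bg.
rewrite /bsop -(RintegralZl k measurableT i2).
rewrite -(RintegralD measurableT i1 (@intgZ _ _ _ leb2 k _ i2)).
by apply: eq_Rintegral => z _; ring.
Qed.

Lemma bsop_ge0 f s : (forall r, 0 <= f r) -> 0 <= bsop b d2 f s.
Proof. by move=> f0; apply: Rintegral_ge0 => z _; rewrite mulr_ge0 ?hker_ge0. Qed.

Lemma measurable_bsop f : arcfun l f -> measurable_fun setT (bsop b d2 f).
Proof.
move=> bf; have mp := measurable_pot cgam (dominated_hk b) bf.
have mg : measurable_fun setT gam.
  apply/measurable_fun_pairP; split; apply: continuous_measurable_fun => s.
    by apply: (@continuous_comp _ _ _ gam (fst : R * R -> R)); [exact: cgam|exact: cvg_fst].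
  by apply: (@continuous_comp _ _ _ gam (snd : R * R -> R)); [exact: cgam|exact: cvg_snd].
exact: (measurableT_comp mp mg).
Qed.

Lemma hker_le_inv t r : 0 <= r -> 0 < t -> hker b t r <= pi^-1 * t^-1.
Proof.
move=> r0 t0; rewrite /hker /gker t0 expr1 ler_wpM2l ?invr_ge0 ?pi_ge0//.
rewrite ler_piMr ?invr_ge0 ?(ltW t0)// -[leRHS]expR0 ler_expR -opprD oppr_le0.
apply: addr_ge0; first by apply: mulr_ge0; [exact: ltW|rewrite exprn_ge0// ltW].
by apply: divr_ge0; [rewrite mulr_ge0|rewrite exprn_ge0// ltW].
Qed.

(** One potential is expanded into heat kernels over arc and time, and each of these is admissible
    in [green_smooth] against the other potential. Symmetry of the operator follows from that of the
    energy, and the energy of a potential becomes a quadratic form on the arc. *)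
Lemma bsop_green f g : arcfun l f -> arcfun l g ->
  energy b (U g) (W1 g) (W2 g) (U f) (W1 f) (W2 f) = \int[leb]_s (bsop b d2 g s * f s).
Proof.
move=> bf bg.
have sU := (pot_sq l0 cgam c0 gam_lb b0 (dominated_hk b) bf).1.
have sW1 := (pot_sq l0 cgam c0 gam_lb b0 (dominated_dk1 b) bf).1.
have sW2 := (pot_sq l0 cgam c0 gam_lb b0 (dominated_dk2 b) bf).1.
have [i0 E0] := pot_dot l0 cgam c0 gam_lb b0 (dominated_hk b) bg sU.
have [i1 E1] := pot_dot l0 cgam c0 gam_lb b0 (dominated_dk1 b) bg sW1.
have [i2 E2] := pot_dot l0 cgam c0 gam_lb b0 (dominated_dk2 b) bg sW2.
have j0 := @intgZ _ _ _ leb2 b _ i0.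
have G (z : R * R) : b * (\int[leb2]_x (U f x * hk b z.2 (x - gam z.1)) * g z.1) +
   \int[leb2]_x (W1 f x * dk fst b z.2 (x - gam z.1)) * g z.1 +
   \int[leb2]_x (W2 f x * dk snd b z.2 (x - gam z.1)) * g z.1 =
   (\int[leb]_s (hker b z.2 (d2 s z.1) * f s)) * g z.1.
  have [sh _] := hk_deriv b z.2 (gam z.1).
  have D1 : 'D_(e1 R) (fun x => hk b z.2 (x - gam z.1)) = (fun x => dk fst b z.2 (x - gam z.1)).
    by apply/funext => x; exact: hk_deriv1.
  have D2 : 'D_(e2 R) (fun x => hk b z.2 (x - gam z.1)) = (fun x => dk snd b z.2 (x - gam z.1)).
    by apply/funext => x; exact: hk_deriv2.
  have h0 := dominated_sq b0 z.2 (gam z.1) (dominated_hk b).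
  have h1 : sqintg leb2 ('D_(e1 R) (fun x => hk b z.2 (x - gam z.1))).
    by rewrite D1; exact: (dominated_sq b0 _ _ (dominated_dk1 b)).
  have h2 : sqintg leb2 ('D_(e2 R) (fun x => hk b z.2 (x - gam z.1))).
    by rewrite D2; exact: (dominated_sq b0 _ _ (dominated_dk2 b)).
  have h3 x : `|hk b z.2 (x - gam z.1)| <= if 0 < z.2 then pi^-1 * z.2^-1 else 0.
    rewrite ger0_norm ?hker_ge0//; case: ltP => t0.
      by apply: hker_le_inv => //; exact: esq_ge0.
    by rewrite /hk /hker gker_nonpos// mulr0.
  have GS := green_smooth l0 cgam c0 gam_lb b0 bf sh h0 h1 h2 h3.
  transitivity (energy b (fun x => hk b z.2 (x - gam z.1))
    (fun x => dk fst b z.2 (x - gam z.1)) (fun x => dk snd b z.2 (x - gam z.1))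
    (U f) (W1 f) (W2 f) * g z.1); last first.
    by congr (_ * g z.1); rewrite -D1 -D2; exact: GS.
  rewrite energyC /energy /dot.
  by rewrite [in RHS]mulrDl [in RHS]mulrDl mulrA.
have ih : intg leb2 (fun z => (\int[leb]_s (hker b z.2 (d2 s z.1) * f s)) * g z.1).
  by apply: eq_intg (intgD (intgD j0 i1) i2) => z; exact: G.
rewrite energyC /energy E0 E1 E2 -(RintegralZl b measurableT i0) -(RintegralD measurableT j0 i1).
rewrite -(RintegralD measurableT (intgD j0 i1) i2).
under eq_Rintegral do rewrite G.
have [mf [Cf fC] f0] := bf; have [mg [Cg gC] g0] := bg.
have Cf0 : 0 <= Cf by exact: le_trans (normr_ge0 _) (fC 0).
have Cg0 : 0 <= Cg by exact: le_trans (normr_ge0 _) (gC 0).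
have mgam : measurable_fun setT gam.
  apply/measurable_fun_pairP; split; apply: continuous_measurable_fun => s.
    by apply: (@continuous_comp _ _ _ gam (fst : R * R -> R)); [exact: cgam|exact: cvg_fst].
  by apply: (@continuous_comp _ _ _ gam (snd : R * R -> R)); [exact: cgam|exact: cvg_snd].
have mk : measurable_fun setT (fun p : R * (R * R) => hk b p.2.2 (gam p.1 - gam p.2.1)).
  have mx : measurable_fun setT (fun p : R * (R * R) => (gam p.1, p.2)).
    apply/measurable_fun_pairP; split; last exact: (@measurable_snd _ _ R (R * R)%type).
    exact: (measurableT_comp mgam (@measurable_fst _ _ R (R * R)%type)).
  exact: (measurableT_comp (dominated_measurable cgam (dominated_hk b)) mx).
have mt : measurable_fun setT (fun p : R * (R * R) =>
    hk b p.2.2 (gam p.1 - gam p.2.1) * f p.1 * g p.2.1).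
  apply: measurable_funM; first apply: measurable_funM => //.
    exact: (measurableT_comp mf (@measurable_fst _ _ R (R * R)%type)).
  apply: (measurableT_comp mg).
  exact: (measurableT_comp (@measurable_fst _ _ R R) (@measurable_snd _ _ R (R * R)%type)).
have i3 : intg leb (fun s => Cf * (hkC c * tail1_mass b) * `|g s|).
  by apply: intgZ; apply: intg_norm; exact: arcfun_intg bg.
have it : intg (leb \x plane R)%E (fun p : R * (R * R) =>
    hk b p.2.2 (gam p.1 - gam p.2.1) * f p.1 * g p.2.1).
  pose D z := Cf * `|g z.1| * (hkC c * tail b 1 z.2).
  have iD : intg leb2 D.
    have := @intg_prod_mul _ _ _ _ R leb leb _ _ (intgZ Cf (intg_norm (arcfun_intg bg)))
      (intgZ (hkC c) (intg_tail b0 (isT : (1 <= 4)%N))).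
    by [].
  apply: (@intg_prodR _ _ _ _ R leb (plane R) _ (\int[leb2]_z D z) mt).
  rewrite EFin_Rint//; apply: ge0_le_integral => //.
  - by move=> z _; apply: integral_ge0 => s _; rewrite lee_fin.
  - have := @measurable_fun_fubini_tonelli_G _ _ _ _ R leb (EFin \o (fun p : R * (R * R) => `|hk b p.2.2 (gam p.1 - gam p.2.1) * f p.1 * g p.2.1|)).
    apply; first by apply/measurable_EFinP; exact: measurableT_comp.
    by move=> p; rewrite lee_fin.
  - by apply/measurable_EFinP; exact: intg_measurable iD.
  move=> z _.
  have mhs : measurable_fun setT (fun s => hk b z.2 (gam z.1 - gam s)).
    have m2 : measurable_fun setT (fun s : R => (s, z.2)).
      by apply/measurable_fun_pairP; split; [exact: measurable_id|exact: measurable_cst].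
    have mx : measurable_fun setT (fun s => (z.1, (s, z.2))).
      by apply/measurable_fun_pairP; split; [exact: measurable_cst|exact: m2].
    exact: (measurableT_comp mk mx).
  apply: (@le_trans _ _ ((Cf * `|g z.1|)%:E * \int[leb]_s (\1_`[0, l] s * hk b z.2 (gam z.1 - gam s))%:E)%E); last first.
    rewrite /D [X in (_ <= X)%E]EFinM; apply: lee_wpmul2l; first by rewrite lee_fin mulr_ge0.
    exact: (hk_arc l0 cgam c0 gam_lb b z.2 (gam z.1)).
  rewrite -ge0_integralZl//.
  - apply: ge0_le_integral => //.
    + have m1 := measurableT_comp mt (measurable_pair2 z).
      by apply/measurable_EFinP; apply: measurableT_comp => //; exact: m1.
    + by apply: measurable_funeM; apply/measurable_EFinP; apply: measurable_funM.
    move=> s _; rewrite -EFinM lee_fin 2!normrM (ger0_norm (hker_ge0 _ _ _)) indicE.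
    have -> : hker b (s, z).2.2 (esq (gam (s, z).1 - gam (s, z).2.1)) = hk b z.2 (gam z.1 - gam s).
      by rewrite /hk esq_subC.
    rewrite -[`|f _|]/`|f s| -[`|g _|]/`|g z.1|.
    have [_|sl] := boolP (s \in _).
      rewrite mul1r [leRHS]mulrC mulrA ler_wpM2r// ler_wpM2l ?hker_ge0//.
    rewrite f0 ?normr0 ?mulr0 ?mul0r ?mulr0//; move: sl; rewrite notin_setE /= in_itv/=.
    by [].
  - apply/measurable_EFinP; apply: measurable_funM => //; exact: measurable_indic.
  - by move=> s _; rewrite lee_fin mulr_ge0 ?hker_ge0// indicE.
  - by rewrite lee_fin mulr_ge0.
have sw := Rint_swap it.
transitivity (\int[leb2]_z \int[leb]_s (hk b z.2 (gam s - gam z.1) * f s * g z.1)).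
  apply: eq_Rintegral => z _; rewrite mulrC -RintegralZl//.
    by apply: eq_Rintegral => s _; rewrite mulrC.
  have [t0|t0] := ltP 0 z.2; last first.
    have -> : (fun s => hker b z.2 (d2 s z.1) * f s) = (fun=> 0).
      by apply/funext => s; rewrite /hker gker_nonpos// mulr0 mul0r.
    exact: intg0.
  apply: (@intg_le _ _ _ leb _ _ _ (intgZ (pi^-1 * z.2^-1) (intg_norm (arcfun_intg bf)))) => [|s].
    by apply: measurable_funM => //; exact: (measurableT_comp mk (measurable_pair2 z)).
  rewrite normrM (ger0_norm (hker_ge0 _ _ _)) ler_wpM2r//; apply: hker_le_inv => //.
  exact: esq_ge0.
rewrite -[LHS]sw; apply: eq_Rintegral => s _.
rewrite mulrC -RintegralZl//; last exact: bsop_intg.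
by apply: eq_Rintegral => z _ /=; rewrite /hk /dist2; ring.
Qed.

Lemma bsop_sym f g : arcfun l f -> arcfun l g ->
  \int[leb]_s (bsop b d2 g s * f s) = \int[leb]_s (bsop b d2 f s * g s).
Proof. by move=> bf bg; rewrite -(bsop_green bf bg) energyC (bsop_green bg bf). Qed.

End FixedMass.

End BirmanSchwinger.

(** * Positive eigenfunctions of positive operators *)

(** With [c n] the remainder of the geometric series, the intervals from [u n - c n] to [u n + c n]
    are nested; [L] is the supremum of their left ends. *)
Lemma geo_limit (R : realType) (u : nat -> R) (D th : R) : 0 <= D -> 0 <= th < 1 ->
  (forall n, `|u n.+1 - u n| <= D * th ^+ n) ->
  exists L, forall n, `|u n - L| <= D / (1 - th) * th ^+ n.
Proof.
move=> D0 /andP[th0 th1] hu.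
have t1 : 0 < 1 - th by rewrite subr_gt0.
pose c n := D / (1 - th) * th ^+ n.
have c0 n : 0 <= c n by rewrite mulr_ge0 ?exprn_ge0// divr_ge0// ltW.
have cS n : c n - c n.+1 = D * th ^+ n.
  by rewrite /c exprS; field; exact: lt0r_neq0.
have up m n : (m <= n)%N -> u n + c n <= u m + c m.
  elim: n => [|n IH]; first by rewrite leqn0 => /eqP ->.
  rewrite leq_eqVlt => /orP[/eqP <-//|]; rewrite ltnS => /IH; apply: le_trans.
  by have := hu n; rewrite ler_norml -cS => /andP[_]; lra.
have lo m n : (m <= n)%N -> u m - c m <= u n - c n.
  elim: n => [|n IH]; first by rewrite leqn0 => /eqP ->.
  rewrite leq_eqVlt => /orP[/eqP <-//|]; rewrite ltnS => /IH h; apply: (le_trans h).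
  by have := hu n; rewrite ler_norml -cS => /andP[+ _]; lra.
have ub m n : u m - c m <= u n + c n.
  have h1 := lo m _ (leq_maxl m n); have h2 := up n _ (leq_maxr m n).
  by have := c0 (maxn m n); lra.
pose S := [set u n - c n | n in setT].
have S0 : S !=set0 by exists (u 0 - c 0), 0.
have Su n : ubound S (u n + c n) by move=> _ [m _ <-]; exact: ub.
exists (sup S) => n; rewrite ler_norml; apply/andP; split.
  by have : sup S <= u n + c n by [exact: ge_sup]; rewrite -/(c n); lra.
have : u n - c n <= sup S by apply: ub_le_sup; [exists (u 0 + c 0); exact: Su|exists n].
rewrite -/(c n); lra.
Qed.

Lemma geo_le0 (R : realType) (x K th : R) : 0 <= K -> 0 <= th < 1 ->
  (forall n, x <= K * th ^+ n) -> x <= 0.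
Proof.
move=> K0 /andP[th0 th1] h.
have cv : K * th ^+ n @[n --> \oo] --> (0 : R).
  rewrite -[X in _ --> X](mulr0 K); apply: cvgM; first exact: cvg_cst.
  by apply: cvg_expr; rewrite ger0_norm.
have := cv; move/cvgP => ic; rewrite -(cvg_lim _ cv)//.
by apply: limr_ge => //; exact: nearW.
Qed.

(* Birkhoff's argument: an operator that squeezes nonnegative functions between
   multiples of their integral contracts the oscillation of [T f / f], so its
   normalized iterates converge uniformly to a positive eigenfunction. *)
Section PositiveOperator.
Variable R : realType.
Local Notation leb := (@lebesgue_measure R).
Implicit Types (f g : R -> R) (s : R).
Variable l : R.
Hypothesis l0 : 0 < l.

Let I s := 0 <= s <= l.

Lemma arcfun_comb f g k : arcfun l f -> arcfun l g -> arcfun l (fun s => f s + k * g s).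
Proof.
move=> [mf [C fC] f0] [mg [D gD] g0]; split.
- by apply: measurable_funD => //; exact: measurable_funM.
- exists (C + `|k| * D) => s; apply: (le_trans (ler_normD _ _)).
  by rewrite lerD// normrM ler_wpM2l.
- by move=> s sl; rewrite f0// g0// mulr0 addr0.
Qed.

Lemma arcfun_Z f k : arcfun l f -> arcfun l (fun s => k * f s).
Proof.
move=> [mf [C fC] f0]; split; first exact: measurable_funM.
  by exists (`|k| * C) => s; rewrite normrM ler_wpM2l.
by move=> s /f0 ->; rewrite mulr0.
Qed.

Lemma arcfun_norm f : arcfun l f -> arcfun l (fun s => `|f s|).
Proof.
move=> [mf [C fC] f0]; split; first exact: measurableT_comp.
  by exists C => s; rewrite normr_id.
by move=> s /f0 ->; rewrite normr0.
Qed.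

Lemma arcfun_ind k : arcfun l (fun s => k * \1_`[0, l] s).
Proof.
split; first by apply: measurable_funM => //; exact: measurable_indic.
  by exists `|k| => s; rewrite normrM ler_piMr// indic_norm_le1.
move=> s sl; rewrite indicE (_ : s \in _ = false) ?mulr0//.
by apply/negbTE; rewrite notin_setE /= in_itv.
Qed.

Lemma Rint_ind : \int[leb]_s \1_`[0, l] s = l.
Proof.
rewrite /Rintegral integral_indic// setIT -[RHS]subr0 -(lebesgue_itv (ltW l0)).
by [].
Qed.

Lemma arcfun_int_comb f g k : arcfun l f -> arcfun l g ->
  \int[leb]_s (f s + k * g s) = \int[leb]_s f s + k * \int[leb]_s g s.
Proof.
move=> /arcfun_intg i1 /arcfun_intg i2.
by rewrite RintegralD ?RintegralZl//; exact: intgZ.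
Qed.

Lemma arcfun_int_le f g : arcfun l f -> arcfun l g -> (forall s, I s -> f s <= g s) ->
  \int[leb]_s f s <= \int[leb]_s g s.
Proof.
move=> bf bg fg; have [_ _ f0] := bf; have [_ _ g0] := bg.
apply: le_Rintegral => //; [exact: arcfun_intg bf|exact: arcfun_intg bg|].
move=> s _; have [sl|/negP sl] := boolP (I s); first exact: fg.
by rewrite f0// g0.
Qed.

Lemma arcfun_int_bound f (C : R) : arcfun l f -> (forall s, I s -> `|f s| <= C) ->
  \int[leb]_s `|f s| <= C * l.
Proof.
move=> bf fC; have i1 := arcfun_ind C.
have -> : C * l = \int[leb]_s (C * \1_`[0, l] s).
  rewrite RintegralZl ?Rint_ind//.
  by have := arcfun_intg (arcfun_ind 1); apply: eq_intg => s; rewrite mul1r.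
apply: arcfun_int_le => //; first exact: arcfun_norm.
by move=> s sl; rewrite indicE mem_set ?mulr1 ?fC//= in_itv.
Qed.

Lemma arcfun_int_ge0 f : (forall s, 0 <= f s) -> 0 <= \int[leb]_s f s.
Proof. by move=> f0; apply: Rintegral_ge0. Qed.

Variables (T : (R -> R) -> (R -> R)) (m M : R).
Hypothesis m0 : 0 < m.
Hypothesis TB : forall f, arcfun l f -> arcfun l (T f).
Hypothesis TL : forall f g k s, arcfun l f -> arcfun l g ->
  T (fun r => f r + k * g r) s = T f s + k * T g s.
Hypothesis Tlb : forall f s, arcfun l f -> (forall r, 0 <= f r) -> I s ->
  m * \int[leb]_r f r <= T f s.
Hypothesis Tub : forall f s, arcfun l f -> (forall r, 0 <= f r) -> I s ->
  T f s <= M * \int[leb]_r f r.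

Let mM : m <= M.
Proof.
have b1 := arcfun_ind 1; have n1 s : 0 <= 1 * \1_`[0, l] s :> R by rewrite mul1r indicE.
have I0 : I 0 by rewrite /I lexx ltW.
have := le_trans (Tlb b1 n1 I0) (Tub b1 n1 I0).
under eq_Rintegral do rewrite mul1r.
by rewrite Rint_ind ler_pM2r.
Qed.

Let M0 : 0 < M. Proof. exact: lt_le_trans mM. Qed.

Let TZ f k s : arcfun l f -> T (fun r => k * f r) s = k * T f s.
Proof.
move=> bf; have bz := arcfun_Z 0 bf.
have h1 := TL 0 s bz bf.
have E : (fun r => 0 * f r + 0 * f r) = (fun r => 0 * f r) by apply/funext => r; rewrite mul0r addr0.
rewrite E mul0r addr0 in h1.
have h2 := TL (-1) s bz bz.
have E2 : (fun r => 0 * f r + -1 * (0 * f r)) = (fun r => 0 * f r).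
  by apply/funext => r; rewrite mul0r mulr0 addr0.
rewrite E2 mulN1r subrr in h2.
have := TL k s bz bf; rewrite h2 add0r => <-; congr (T _ s).
by apply/funext => r; rewrite mul0r add0r.
Qed.

(** Positivity applied to [|f| + f] and [|f| - f] gives [|T f| <= T |f|]. *)
Let T_norm f s : arcfun l f -> I s -> `|T f s| <= M * \int[leb]_r `|f r|.
Proof.
move=> bf sl; have bn := arcfun_norm bf.
have pos k : `|k| <= 1 -> 0 <= T (fun r => `|f r|) s + k * T f s.
  move=> k1; rewrite -TL//.
  have b1 := arcfun_comb k bn bf.
  have n1 r : 0 <= `|f r| + k * f r.
    by rewrite -lerBlDr sub0r; apply: (le_trans (ler_norm _)); rewrite normrN normrM ler_piMl.
  apply: le_trans (Tlb b1 n1 sl); rewrite mulr_ge0 ?(ltW m0)//.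
  exact: arcfun_int_ge0.
have h1 := pos 1; have h2 := pos (-1).
rewrite normrN normr1 in h2; rewrite normr1 in h1.
have {}h1 := h1 (lexx _); have {}h2 := h2 (lexx _).
apply: le_trans (Tub bn (fun r => normr_ge0 _) sl).
by rewrite ler_norml; move: h1 h2; rewrite mul1r mulN1r => h1 h2; lra.
Qed.

Let k0 := m / M.
Let th := 1 - k0.

Let k01 : 0 < k0 <= 1.
Proof. by rewrite divr_gt0//= ler_pdivrMr// mul1r. Qed.

Let th01 : 0 <= th < 1.
Proof. by rewrite /th; case/andP: k01 => h1 h2; apply/andP; split; lra. Qed.

Fixpoint iter_norm n : R -> R :=
  if n is k.+1 then (fun s => (\int[leb]_r T (iter_norm k) r)^-1 * T (iter_norm k) s)
  else (fun s => l^-1 * \1_`[0, l] s).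

Let u := iter_norm.
Let rho n := \int[leb]_r T (u n) r.

Let osc n a A := forall s, I s -> a * u n s <= T (u n) s <= A * u n s.

Let B0 : R := Num.max l^-1 (M / (m * l)).

(** The last item carries the contraction. If [a u <= T u <= A u] with [u = u n], then
    [p = T u - a u] and [q = A u - T u] are nonnegative, so [T p] and [T q] are at least [m] times
    their integrals, whereas [T u <= M]. This moves [a] and [A] towards [rho n] by the fraction
    [m / M] of their distance to it, and the gap shrinks by [1 - m / M]. *)
Let inv n : [/\ arcfun l (u n), forall s, 0 <= u n s, \int[leb]_r u n r = 1,
   forall s, I s -> Num.min l^-1 (m / (M * l)) <= u n s <= B0 &
   exists a A, [/\ m * l <= a, osc n a A & A - a = (M * l - m * l) * th ^+ n]].
Proof.
have ml : 0 < m * l by rewrite mulr_gt0.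
have Ml : 0 < M * l by rewrite mulr_gt0.
elim: n => [|n [bu u0 u1 ub [a [A [a0 hosc hA]]]]].
  have b1 := arcfun_ind l^-1.
  have p1 s : 0 <= u 0 s by rewrite /u/= mulr_ge0 ?invr_ge0 ?(ltW l0)// indicE.
  have i1 : \int[leb]_r u 0 r = 1.
    rewrite /u/= RintegralZl//; last first.
      by have := arcfun_intg (arcfun_ind 1); apply: eq_intg => s; rewrite mul1r.
    by rewrite Rint_ind mulVf// gt_eqF.
  have uE s : I s -> u 0 s = l^-1 by move=> sl; rewrite /u/= indicE mem_set ?mulr1//= in_itv.
  split=> //.
    by move=> s sl; rewrite uE// ge_min lexx/= le_max lexx.
  exists (m * l), (M * l); split; rewrite ?expr0 ?mulr1// => s sl.
  rewrite uE// -!mulrA divff ?gt_eqF// !mulr1.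
  have := Tlb b1 p1 sl; have := Tub b1 p1 sl; rewrite -/(u 0) i1 !mulr1 => -> ->.
  by [].
have bT := TB bu.
have Tm s : I s -> m <= T (u n) s <= M.
  by move=> sl; have := Tlb bu u0 sl; have := Tub bu u0 sl; rewrite u1 !mulr1 => -> ->.
have tail0_mass s : 0 <= T (u n) s.
  have [/Tm /andP[h _]|/negP sl] := boolP (I s); first by apply: le_trans h; rewrite ltW.
  by have [_ _ h] := bT; rewrite h.
have intc k : \int[leb]_r (k * \1_`[0, l] r) = k * l.
  rewrite RintegralZl ?Rint_ind//.
  by have := arcfun_intg (arcfun_ind 1); apply: eq_intg => s; rewrite mul1r.
have rlb : m * l <= rho n.
  rewrite -intc; apply: arcfun_int_le => //; first exact: arcfun_ind.
  by move=> s sl; rewrite indicE mem_set ?mulr1 ?in_itv//=; case/andP: (Tm s sl).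
have rub : rho n <= M * l.
  rewrite -intc; apply: arcfun_int_le => //; first exact: arcfun_ind.
  by move=> s sl; rewrite indicE mem_set ?mulr1 ?in_itv//=; case/andP: (Tm s sl).
have r0 : 0 < rho n by exact: lt_le_trans rlb.
have uS s : u n.+1 s = (rho n)^-1 * T (u n) s by [].
have bS : arcfun l (u n.+1) by exact: arcfun_Z.
have iS : \int[leb]_r u n.+1 r = 1.
  rewrite /u/= -/u -/(rho n) RintegralZl//; last exact: arcfun_intg bT.
  by rewrite -/(rho n) mulVf// gt_eqF.
split=> //.
- by move=> s; rewrite uS mulr_ge0// invr_ge0 ltW.
- move=> s sl; have /andP[t1 t2] := Tm s sl; rewrite uS; apply/andP; split.
    rewrite ge_min; apply/orP; right; rewrite mulrC.
    by apply: ler_pM => //; rewrite ?invr_ge0 ?(ltW m0) ?(ltW Ml)// lef_pV2.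
  rewrite le_max; apply/orP; right; rewrite mulrC.
  by apply: ler_pM => //; rewrite ?invr_ge0 ?(ltW r0) ?tail0_mass// lef_pV2.
pose p s := T (u n) s + - a * u n s.
pose q s := A * u n s + -1 * T (u n) s.
have bp : arcfun l p by exact: arcfun_comb.
have bq : arcfun l q by apply: arcfun_comb => //; exact: arcfun_Z.
have p0 s : 0 <= p s.
  have [/hosc /andP[h _]|/negP sl] := boolP (I s); first by rewrite /p mulNr subr_ge0.
  by have [_ _ h] := bp; rewrite h.
have q0 s : 0 <= q s.
  have [/hosc /andP[_ h]|/negP sl] := boolP (I s); first by rewrite /q mulN1r subr_ge0.
  by have [_ _ h] := bq; rewrite h.
have ip : \int[leb]_r p r = rho n - a by rewrite arcfun_int_comb// u1 mulr1.
have iq : \int[leb]_r q r = A - rho n.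
  rewrite arcfun_int_comb//; last exact: arcfun_Z.
  by rewrite mulN1r RintegralZl ?u1 ?mulr1//; exact: arcfun_intg bu.
have key (w : R -> R) s : arcfun l w -> (forall r, 0 <= w r) -> I s ->
    k0 * (\int[leb]_r w r) * T (u n) s <= T w s.
  move=> bw w0 sl; apply: le_trans (Tlb bw w0 sl).
  have iw := arcfun_int_ge0 w0.
  have -> : k0 * (\int[leb]_r w r) * T (u n) s = m * (\int[leb]_r w r) * T (u n) s / M.
    by rewrite /k0; ring.
  rewrite ler_pdivrMr// ler_wpM2l//; first by rewrite mulr_ge0// ltW.
  by case/andP: (Tm s sl).
have an : 0 <= rho n - a by rewrite -ip; exact: arcfun_int_ge0.
exists (a + k0 * (rho n - a)), (A - k0 * (A - rho n)); split.
- by case/andP: k01 => h1 h2; apply: (le_trans a0); rewrite lerDl mulr_ge0// ltW.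
- move=> s sl; rewrite uS.
  have TS : T (u n.+1) s = (rho n)^-1 * T (T (u n)) s by exact: TZ.
  have h1 := key p s bp p0 sl; have h2 := key q s bq q0 sl.
  rewrite ip in h1; rewrite iq in h2.
  rewrite /p TL// in h1; rewrite /q TL ?TZ// in h2; last exact: arcfun_Z.
  rewrite TS; set X := T (T (u n)) s in h1 h2 *; set Y := T (u n) s in h1 h2 *.
  have ri : 0 <= (rho n)^-1 by rewrite invr_ge0 ltW.
  by rewrite ![_ * ((rho n)^-1 * _)]mulrCA !ler_wpM2l//; move: h1 h2; rewrite !(mulrDl, mulNr); lra.
- by rewrite exprS mulrCA -hA /th; ring.
Qed.

Let osc_rho n s : I s -> `|T (u n) s - rho n * u n s| <= (M * l - m * l) * B0 * th ^+ n.
Proof.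
move=> sl; have [bu u0 u1 ub [a [A [a0 hosc hA]]]] := inv n.
have bT := TB bu.
have h1 : a <= rho n.
  rewrite -[leLHS]mulr1 -u1 -RintegralZl//; last exact: arcfun_intg bu.
  by apply: arcfun_int_le => //; [exact: arcfun_Z|move=> r /hosc /andP[]].
have h2 : rho n <= A.
  rewrite -[leRHS]mulr1 -u1 -RintegralZl//; last exact: arcfun_intg bu.
  by apply: arcfun_int_le => //; [exact: arcfun_Z|move=> r /hosc /andP[]].
have /andP[h3 h4] := hosc s sl.
have /andP[_ ubs] := ub s sl.
have Aa : 0 <= A - a by lra.
apply: (@le_trans _ _ ((A - a) * u n s)); last by rewrite [leRHS]mulrAC -hA ler_wpM2l.
have := ler_wpM2r (u0 s) h1; have := ler_wpM2r (u0 s) h2.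
by rewrite ler_norml mulrBl; lra.
Qed.

Lemma positive_eigenfunction : exists h lam, [/\ arcfun l h, 0 < lam,
  exists2 a, 0 < a & forall s, I s -> a <= h s & forall s, T h s = lam * h s].
Proof.
have ml : 0 < m * l by rewrite mulr_gt0.
have Ml : 0 < M * l by rewrite mulr_gt0.
have B00 : 0 <= B0 by rewrite le_max invr_ge0 ltW.
have Mm : 0 <= M * l - m * l by rewrite -mulrBl mulr_ge0 ?subr_ge0// ltW.
pose D := (M * l - m * l) * B0 / (m * l).
have D0 : 0 <= D by rewrite divr_ge0 ?mulr_ge0// ltW.
have rlb n : m * l <= rho n.
  have [bu u0 u1 ub [a [A [a0 hosc hA]]]] := inv n.
  apply: (le_trans a0); rewrite -[leLHS]mulr1 -u1 -RintegralZl//; last exact: arcfun_intg bu.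
  by apply: arcfun_int_le => //; [exact: arcfun_Z|exact: TB|move=> r /hosc /andP[]].
have r0 n : 0 < rho n by exact: lt_le_trans (rlb n).
have uoff n s : ~ I s -> u n s = 0 by move=> sl; have [[_ _ h] _ _ _ _] := inv n; exact: h.
have step s n : `|u n.+1 s - u n s| <= D * th ^+ n.
  have [sl|/negP sl] := boolP (I s); last first.
    rewrite !uoff// subrr normr0 mulr_ge0// exprn_ge0//.
    by case/andP: th01.
  have -> : u n.+1 s - u n s = (rho n)^-1 * (T (u n) s - rho n * u n s).
    by rewrite mulrBr mulKf// gt_eqF.
  rewrite normrM gtr0_norm ?invr_gt0// /D mulrAC [leRHS]mulrC.
  apply: ler_pM => //; first by rewrite invr_ge0 ltW.
    by rewrite lef_pV2 ?posrE.
  exact: osc_rho.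
pose K := D / (1 - th).
have K0 : 0 <= K by rewrite divr_ge0// subr_ge0; case/andP: th01 => _ /ltW.
have /choice [h Hh] : forall s, exists L, forall n, `|u n s - L| <= K * th ^+ n.
  by move=> s; exact: geo_limit D0 th01 (step s).
have thn n : 0 <= th ^+ n by rewrite exprn_ge0//; case/andP: th01.
have cvK (k : R) : k * th ^+ n @[n --> \oo] --> (0 : R).
  rewrite -[X in _ --> X](mulr0 k); apply: cvgM; first exact: cvg_cst.
  by apply: cvg_expr; case/andP: th01 => t0 t1; rewrite ger0_norm.
have bh : arcfun l h.
  split.
  - apply: (@measurable_fun_cvg _ _ _ _ u) => [n|s _].
      by have [[]] := inv n.
    apply/cvg_nP => e e0; have /cvg_nP/(_ e e0) [N HN] := cvK K.
    exists N => n /HN; rewrite subr0 => hn.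
    exact: le_trans (Hh s n) (le_trans (ler_norm _) hn).
  - have [[_ [C uC] _] _ _ _ _] := inv 0.
    exists (C + K) => s; have := Hh s 0; rewrite expr0 mulr1 => hs.
    have -> : h s = u 0 s - (u 0 s - h s) by ring.
    by apply: (le_trans (ler_normB _ _)); rewrite lerD.
  - move=> s sl; apply/normr0_eq0/eqP; rewrite eq_le normr_ge0 andbT.
    apply: (geo_le0 K0 th01) => n; have := Hh s n.
    by rewrite uoff// sub0r normrN.
pose a0 := Num.min l^-1 (m / (M * l)).
have a00 : 0 < a0 by rewrite lt_min invr_gt0 l0 divr_gt0.
have ha s : I s -> a0 <= h s.
  move=> sl; rewrite -subr_le0; apply: (geo_le0 K0 th01) => n.
  have [_ _ _ /(_ s sl)/andP[h1 _] _] := inv n.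
  by have := Hh s n; rewrite ler_norml => /andP[_]; rewrite -/a0 in h1; lra.
have h0 s : 0 <= h s.
  have [/ha|/negP sl] := boolP (I s); first by apply: le_trans; exact: ltW.
  by have [_ _ e] := bh; rewrite e.
pose lam := \int[leb]_s T h s.
have bTh := TB bh.
have dT n s : I s -> `|T h s - T (u n) s| <= M * (K * th ^+ n * l).
  move=> sl; have [bu _ _ _ _] := inv n.
  have -> : T h s - T (u n) s = T (fun r => h r + -1 * u n r) s by rewrite TL// mulN1r.
  apply: (le_trans (T_norm (arcfun_comb (-1) bh bu) sl)); rewrite ler_wpM2l ?(ltW M0)//.
  apply: arcfun_int_bound; first exact: arcfun_comb.
  by move=> r _; rewrite mulN1r distrC; exact: Hh.
have drho n : `|lam - rho n| <= M * (K * th ^+ n * l) * l.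
  have [bu _ _ _ _] := inv n.
  have -> : lam - rho n = \int[leb]_s (T h s + -1 * T (u n) s).
    by rewrite arcfun_int_comb ?mulN1r//; exact: TB.
  have bTd : arcfun l (fun s => T h s + -1 * T (u n) s) by apply: arcfun_comb => //; exact: TB.
  apply: (le_trans (@Rint_norm_le _ _ _ leb _ _)); first by case: bTd.
  by apply: arcfun_int_bound => // s sl; rewrite mulN1r; exact: dT.
exists h, lam; split=> //.
- have low : m * (a0 * l) * l <= lam.
    have intc k : k * l = \int[leb]_r (k * \1_`[0, l] r).
      rewrite RintegralZl ?Rint_ind//.
      by have := arcfun_intg (arcfun_ind 1); apply: eq_intg => s; rewrite mul1r.
    rewrite intc; apply: arcfun_int_le => //; first exact: arcfun_ind.
    move=> s sl; rewrite indicE mem_set ?mulr1 ?in_itv//=.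
    apply: le_trans (Tlb bh h0 sl); rewrite ler_wpM2l ?(ltW m0)//.
    rewrite intc; apply: arcfun_int_le => //; first exact: arcfun_ind.
    by move=> r rl; rewrite indicE mem_set ?mulr1 ?in_itv//= ha.
  by apply: lt_le_trans low; rewrite !mulr_gt0.
- by exists a0.
move=> s; have [sl|/negP sl] := boolP (I s); last first.
  by have [_ _ ->//] := bTh; have [_ _ ->//] := bh; rewrite mulr0.
apply/eqP; rewrite -subr_eq0; apply/eqP/normr0_eq0/eqP; rewrite eq_le normr_ge0 andbT.
(* One summand for each of the four errors in the splitting of [T h s - lam * h s] below. *)
pose K' := M * K * l + (M * l - m * l) * B0 + M * K * l * l * B0 + `|lam| * K.
have lw := ltW l0; have Mw := ltW M0.
clearbody K.
have K'0 : 0 <= K'.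
  apply: addr_ge0; last by rewrite mulr_ge0.
  apply: addr_ge0; last by rewrite !mulr_ge0.
  by apply: addr_ge0; [rewrite !mulr_ge0|rewrite mulr_ge0].
apply: (geo_le0 K'0 th01) => n.
have [bu u0 u1 ub _] := inv n.
have -> : T h s - lam * h s = (T h s - T (u n) s) + (T (u n) s - rho n * u n s)
   + ((rho n - lam) * u n s) + lam * (u n s - h s) by ring.
apply: (le_trans (ler_normD _ _)); rewrite /K' [leRHS]mulrDl lerD//; last first.
  by rewrite normrM -mulrA ler_wpM2l.
apply: (le_trans (ler_normD _ _)); rewrite [leRHS]mulrDl lerD//; last first.
  rewrite normrM distrC (ger0_norm (u0 s)).
  have -> : M * K * l * l * B0 * th ^+ n = (M * (K * th ^+ n * l) * l) * B0 by ring.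
  by apply: ler_pM => //; case/andP: (ub s sl).
apply: (le_trans (ler_normD _ _)); rewrite [leRHS]mulrDl lerD//; last exact: osc_rho.
by apply: (le_trans (dT n s sl)); rewrite le_eqVlt; apply/orP; left; apply/eqP; ring.
Qed.

End PositiveOperator.

(** * The Birman-Schwinger operator *)

Section KernelBounds.
Variable R : realType.
Implicit Types (b t r : R).

(** Prepares Cauchy-Schwarz in arc and time: half of the mass stays with the kernel, whose square is
    of order [t^-2] and is balanced by the [t^2] of an arc integral; the other half makes the time
    factor square-integrable. *)
Lemma hker_split b t r : hker b t r = hker (b / 2) t r * tail (b / 2) 0 t.
Proof.
rewrite /hker /gker /tail; case: ltP => t0; last by rewrite !mulr0.
have -> : expR (- (b * t ^+ 4) - 1 / 4 * r / t ^+ 4) =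
    expR (- (b / 2 * t ^+ 4) - 1 / 4 * r / t ^+ 4) * expR (- (b / 2 * t ^+ 4)).
  by rewrite -expRD; congr expR; field; exact: lt0r_neq0.
by rewrite expr0 [1 * expR _]mul1r !mulrA.
Qed.

Lemma tail0_sq b t : tail (b / 2) 0 t ^+ 2 = tail b 0 t.
Proof.
rewrite /tail; case: ltP => _; last by rewrite expr0n.
by rewrite !expr0 !mul1r -expRM_natl; congr expR; field.
Qed.

Lemma hker_sq b t r : hker (b / 2) t r ^+ 2 = pi^-1 ^+ 2 * gker b (1 / 2) 2 t r.
Proof.
rewrite /hker /gker; case: ltP => t0; last by rewrite !mulr0 expr0n.
rewrite exprMn expr1 exprMn -expRM_natl; congr (_ * (_ * expR _)).
by field; exact: lt0r_neq0.
Qed.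

Lemma hker_decr b t r r' : r <= r' -> hker b t r' <= hker b t r.
Proof.
move=> rr; rewrite /hker ler_wpM2l ?invr_ge0 ?pi_ge0// /gker; case: ltP => // t0.
rewrite ler_wpM2l ?exprn_ge0 ?invr_ge0 ?(ltW t0)// ler_expR lerD2l lerN2.
by rewrite ler_wpM2r ?invr_ge0 ?exprn_ge0 ?(ltW t0)// ler_wpM2l.
Qed.

Lemma hker_mono b b' t r : b <= b' -> hker b' t r <= hker b t r.
Proof.
move=> bb; rewrite /hker ler_wpM2l ?invr_ge0 ?pi_ge0// /gker; case: ltP => // t0.
rewrite ler_wpM2l ?exprn_ge0 ?invr_ge0 ?(ltW t0)// ler_expR lerD2r lerN2.
by rewrite ler_wpM2r ?exprn_ge0 ?(ltW t0).
Qed.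

(** From [1 - e^(-z) <= z] with [z = (b' - b) T] and [T = t^4]; the factor [T] is paid for by half
    of the mass, as [T e^(-b T / 2) <= 2/b]. *)
Lemma hker_lip b b' t r : 0 < b -> b <= b' ->
  hker b t r - hker b' t r <= (b' - b) * (2 / b) * hker (b / 2) t r.
Proof.
move=> b0 bb; have [t0|t0] := ltP 0 t; last by rewrite /hker !gker_nonpos// !mulr0 subrr.
set T := t ^+ 4; have tail0_mass : 0 <= T by rewrite exprn_ge0// ltW.
rewrite /hker !gkerE// -/T.
set X := expR (- (1 / 4 / T * r)); have X0 : 0 <= X by exact: expR_ge0.
have p0 : 0 <= pi^-1 * (t^-1 ^+ 1 * X).
  by rewrite mulr_ge0 ?invr_ge0 ?pi_ge0// mulr_ge0// exprn_ge0// invr_ge0 ltW.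
set E := expR (- (b * T)); set E' := expR (- (b' * T)); set F := expR (- (b / 2 * T)).
have -> : pi^-1 * (t^-1 ^+ 1 * E * X) - pi^-1 * (t^-1 ^+ 1 * E' * X) =
  pi^-1 * (t^-1 ^+ 1 * X) * (E - E') by ring.
have -> : (b' - b) * (2 / b) * (pi^-1 * (t^-1 ^+ 1 * F * X)) =
  pi^-1 * (t^-1 ^+ 1 * X) * ((b' - b) * (2 / b) * F) by ring.
rewrite ler_wpM2l//.
have F0 : 0 <= F by exact: expR_ge0.
have EF : E = F * F by rewrite -expRD; congr expR; field.
have E'E : E' = E * expR (- ((b' - b) * T)) by rewrite -expRD; congr expR; ring.
have h1 := expR_ge1Dx (- ((b' - b) * T)).
have h2 := expR_ge1Dx (b / 2 * T).
have h3 : F * expR (b / 2 * T) = 1 by rewrite -expRD addNr expR0.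
have h4 : F * (b / 2 * T) <= 1.
  by have := ler_wpM2l F0 h2; rewrite h3 mulrDr mulr1; lra.
have E0 : 0 <= E by exact: expR_ge0.
have bb0 : 0 <= b' - b by rewrite subr_ge0.
apply: (@le_trans _ _ (E * ((b' - b) * T))).
  rewrite E'E; have := ler_wpM2l E0 h1; rewrite mulrDr mulr1 mulrN; lra.
have -> : E * ((b' - b) * T) = (b' - b) * (2 / b) * F * (F * (b / 2 * T)).
  by rewrite EF; field; exact: lt0r_neq0.
by rewrite ler_piMr// !mulr_ge0// invr_ge0 ltW.
Qed.

End KernelBounds.

Lemma Rint_prod_mul (R : realType) (F G : R -> R) :
  intg (@lebesgue_measure R) F -> intg (@lebesgue_measure R) G ->
  \int[(@lebesgue_measure R \x @lebesgue_measure R)%E]_z (F z.1 * G z.2) =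
  (\int[@lebesgue_measure R]_s F s) * \int[@lebesgue_measure R]_t G t.
Proof.
move=> iF iG; have [_ ->] := Rint_fubiniL (intg_prod_mul iF iG).
rewrite mulrC -RintegralZl//; apply: eq_Rintegral => s _ /=.
by rewrite RintegralZl// mulrC.
Qed.

Lemma Rint_le_comb d (T : measurableType d) (R : realType) (mu : {measure set T -> \bar R})
    (f g h : T -> R) k : intg mu f -> intg mu g -> intg mu h ->
  (forall x, f x <= g x + k * h x) ->
  \int[mu]_x f x <= \int[mu]_x g x + k * \int[mu]_x h x.
Proof.
move=> jf jg jh fgh; rewrite -RintegralZl// -RintegralD//; last exact: intgZ.
by apply: le_Rintegral => //; apply: intgD => //; exact: intgZ.
Qed.

Lemma Rint_le d (T : measurableType d) (R : realType) (mu : {measure set T -> \bar R})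
    (f g : T -> R) : intg mu f -> intg mu g -> (forall x, f x <= g x) ->
  \int[mu]_x f x <= \int[mu]_x g x.
Proof. by move=> jf jg fg; apply: le_Rintegral. Qed.

Section ArcOperator.
Variable R : realType.
Local Notation leb := (@lebesgue_measure R).
Local Notation leb2 := (leb \x leb)%E.
Implicit Types (x y : R * R) (s t : R).
Variables (gam : R -> R * R) (l c : R).
Hypothesis l0 : 0 < l.
Hypothesis cgam : continuous gam.
Hypothesis c0 : 0 < c.
Hypothesis gam_lb : forall s t, 0 <= s <= l -> 0 <= t <= l ->
  c ^+ 2 * (s - t) ^+ 2 <= esq (gam s - gam t).
Hypothesis gam_ub : forall s t, 0 <= s <= l -> 0 <= t <= l ->
  esq (gam s - gam t) <= (s - t) ^+ 2.
Implicit Types (b : R) (f g h : R -> R).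

Local Notation d2 := (dist2 gam).
Let I s := 0 <= s <= l.

Definition bsform b f g : R := \int[leb]_s (bsop b d2 f s * g s).

(** Cutting off outside [[0, l]] keeps the result among the densities on the arc, so that the
    operator can be iterated. *)
Definition bsopI b f s : R := \1_`[0, l] s * bsop b d2 f s.

Let d2_le s t : I s -> I t -> d2 s t <= l ^+ 2.
Proof.
move=> sl tl; apply: (le_trans (gam_ub sl tl)).
by move: sl tl; rewrite /I => /andP[h1 h2] /andP[h3 h4]; rewrite ler_sqr_norm//; rewrite (ger0_norm (ltW l0)) ler_norml; lra.
Qed.

Lemma arcfun_bsopI b f : 0 < b -> arcfun l f -> arcfun l (bsopI b f).
Proof.
move=> b0 bf; split.
- apply: measurable_funM; first exact: measurable_indic.
  exact: (measurable_bsop cgam b bf).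
- have [_ [C fC] _] := bf; exists (C * hkC c * tail1_mass b) => s.
  rewrite normrM; apply: le_trans (bsop_bound l0 cgam c0 gam_lb b0 s bf fC).
  by rewrite ler_piMl// indic_norm_le1.
- move=> s sl; rewrite /bsopI indicE (_ : s \in _ = false) ?mul0r//.
  by apply/negbTE; rewrite notin_setE /= in_itv.
Qed.

Lemma bsopIE b f s : I s -> bsopI b f s = bsop b d2 f s.
Proof. by move=> sl; rewrite /bsopI indicE mem_set ?mul1r//= in_itv. Qed.

Lemma bsformE b f g : arcfun l g -> bsform b f g = \int[leb]_s (bsopI b f s * g s).
Proof.
move=> [_ _ g0]; apply: eq_Rintegral => s _.
by have [sl|/negP sl] := boolP (I s); [rewrite bsopIE|rewrite g0// !mulr0].
Qed.

Lemma bsform_intg b f g : 0 < b -> arcfun l f -> arcfun l g -> intg leb (fun s => bsop b d2 f s * g s).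
Proof.
move=> b0 bf bg; have := arcfun_intg (arcfunM (arcfun_bsopI b0 bf) bg); apply: eq_intg => s.
have [sl|/negP sl] := boolP (I s); first by rewrite bsopIE.
by have [_ _ ->//] := bg; rewrite !mulr0.
Qed.

Lemma bsform_sym b f g : 0 < b -> arcfun l f -> arcfun l g -> bsform b f g = bsform b g f.
Proof. by move=> b0 bf bg; rewrite /bsform (bsop_sym l0 cgam c0 gam_lb b0 bg bf). Qed.

Lemma bsI_comb b f g k s : 0 < b -> arcfun l f -> arcfun l g ->
  bsopI b (fun r => f r + k * g r) s = bsopI b f s + k * bsopI b g s.
Proof.
move=> b0 bf bg; rewrite /bsopI (bsop_comb l0 cgam c0 gam_lb b0)//; ring.
Qed.

Lemma bsform_diff_le b b' f : 0 < b -> b <= b' -> arcfun l f -> (forall r, 0 <= f r) ->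
  bsform b f f <= bsform b' f f + (b' - b) * (2 / b) * bsform (b / 2) f f.
Proof.
move=> b0 bb bf f0; have b'0 : 0 < b' by exact: lt_le_trans bb.
have b20 : 0 < b / 2 by rewrite divr_gt0.
apply: (@Rint_le_comb _ _ _ leb _ _ _ _ (bsform_intg b0 bf bf) (bsform_intg b'0 bf bf) (bsform_intg b20 bf bf)) => s.
rewrite mulrA -mulrDl ler_wpM2r//.
apply: (@Rint_le_comb _ _ _ leb2 _ _ _ _ (bsop_intg l0 cgam c0 gam_lb b0 s bf)
  (bsop_intg l0 cgam c0 gam_lb b'0 s bf) (bsop_intg l0 cgam c0 gam_lb b20 s bf)) => z.
by rewrite mulrA -mulrDl ler_wpM2r// -lerBlDl; exact: hker_lip.
Qed.

Lemma bsform_mono b b' f : 0 < b -> b <= b' -> arcfun l f -> (forall r, 0 <= f r) ->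
  bsform b' f f <= bsform b f f.
Proof.
move=> b0 bb bf f0; have b'0 : 0 < b' by exact: lt_le_trans bb.
apply: (@Rint_le _ _ _ leb _ _ (bsform_intg b'0 bf bf) (bsform_intg b0 bf bf)) => s.
apply: ler_wpM2r; first exact: f0.
apply: (@Rint_le _ _ _ leb2 _ _ (bsop_intg l0 cgam c0 gam_lb b'0 s bf)
  (bsop_intg l0 cgam c0 gam_lb b0 s bf)) => z.
by rewrite ler_wpM2r// hker_mono.
Qed.

Section FixedB.
Variable b : R.
Hypothesis b0 : 0 < b.

(** A lower bound of [hker] for times in [[1, 2]] and squared distances up to [l^2]: there
    [1/t >= 1/2] and [1 <= t^4 <= 16]. *)
Let mlow : R := pi^-1 * (2^-1 * expR (- (b * 16) - 1 / 4 * l ^+ 2)).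

Let mlow0 : 0 < mlow.
Proof. by rewrite !mulr_gt0 ?expR_gt0 ?invr_gt0 ?pi_gt0. Qed.

Lemma bsop_lb f s : arcfun l f -> (forall r, 0 <= f r) -> I s ->
  mlow * \int[leb]_r f r <= bsop b d2 f s.
Proof.
move=> bf f0 sl.
have i12 : intg leb (\1_`[1, 2] : R -> R) by apply: intg_indic => //; exact: lebesgue_itv_lty.
have int12 : \int[leb]_t (\1_`[1, 2] : R -> R) t = 1.
  rewrite /Rintegral integral_indic// setIT.
  have := @lebesgue_itv R 1 2; rewrite (_ : 1 <= 2)//; last by rewrite ler1n.
  by move=> ->//; ring.
have j := intg_prod_mul (arcfun_intg bf) i12.
have -> : mlow * \int[leb]_r f r = \int[leb2]_z (mlow * (f z.1 * \1_`[1, 2] z.2)).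
  by rewrite RintegralZl// Rint_prod_mul ?int12 ?mulr1//; exact: arcfun_intg bf.
apply: (@Rint_le _ _ _ leb2 _ _ (@intgZ _ _ _ leb2 mlow _ j) (bsop_intg l0 cgam c0 gam_lb b0 s bf)) => z.
have [zl|/negP zl] := boolP (I z.1); last by have [_ _ ->//] := bf; rewrite mul0r !mulr0.
have -> : mlow * (f z.1 * \1_`[1, 2] z.2) = mlow * \1_`[1, 2] z.2 * f z.1 by ring.
rewrite ler_wpM2r//; apply: le_trans (hker_decr b z.2 (d2_le sl zl)).
rewrite indicE; have [|_] := boolP (z.2 \in _); last by rewrite mulr0 hker_ge0.
rewrite inE /= in_itv/= mulr1 => /andP[t1 t2].
have t0 : 0 < z.2 by exact: lt_le_trans t1.
have t41 : 1 <= z.2 ^+ 4 by rewrite exprn_ege1.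
have t42 : z.2 ^+ 4 <= 16.
  have -> : 16 = 2 ^+ 4 :> R by ring.
  by rewrite lerXn2r// nnegrE ltW.
rewrite /mlow /hker /gker t0 expr1 ler_wpM2l ?invr_ge0 ?pi_ge0//.
apply: ler_pM; rewrite ?expR_ge0 ?lef_pV2 ?posrE// ler_expR; apply: lerB.
  by rewrite lerN2 ler_wpM2l// ltW.
rewrite ler_pdivrMr ?(lt_le_trans _ t41)// ler_peMr//.
by rewrite mulr_ge0 ?sqr_ge0.
Qed.

Let A2 : R := 2 / c * Num.sqrt (pi / (1 / 2)).

Definition tail0_mass : R := \int[leb]_t tail b 0 t.

Let KQ : R := (pi^-1 ^+ 2 * (A2 * tail0_mass)) * tail0_mass.

Let KQ0 : 0 <= KQ.
Proof.
have t0 : 0 <= tail0_mass by apply: Rintegral_ge0 => t _; exact: tail_ge0.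
have a0 : 0 <= A2 by rewrite mulr_ge0 ?sqrtr_ge0// divr_ge0// ltW.
apply: mulr_ge0 => //; apply: mulr_ge0; last exact: mulr_ge0.
by rewrite exprn_ge0// invr_ge0 pi_ge0.
Qed.

Lemma bsop_ub2 f s : arcfun l f -> bsop b d2 f s ^+ 2 <= KQ * nsq leb f.
Proof.
move=> bf; have [mf _ f0] := bf.
have b20 : 0 < b / 2 by rewrite divr_gt0.
have A20 : 0 <= A2 by rewrite mulr_ge0 ?sqrtr_ge0// divr_ge0// ltW.
have it0 : intg leb (tail b 0) by exact: intg_tail.
pose F (z : R * R) := \1_`[0, l] z.1 * hker (b / 2) z.2 (d2 s z.1).
pose H (z : R * R) := f z.1 * tail (b / 2) 0 z.2.
have E : bsop b d2 f s = dot leb2 F H.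
  apply: eq_Rintegral => z _; rewrite /F /H hker_split indicE.
  have [_|zl] := boolP (z.1 \in _); first by rewrite mul1r; ring.
  rewrite f0 ?mul0r ?mulr0//; move: zl; rewrite notin_setE /= in_itv/=.
  by [].
have mf1 : measurable_fun setT (fun z : R * R => f z.1) by exact: (measurableT_comp mf (@measurable_fst _ _ R R)).
have mH : measurable_fun setT H.
  apply: measurable_funM => //; exact: (measurableT_comp (measurable_tail (b/2) 0) (@measurable_snd _ _ R R)).
have sH : sqintg leb2 H.
  split=> //; apply: (eq_intg _ (intg_prod_mul (arcfun_sqintg bf).2 it0)) => z.
  by rewrite /H exprMn tail0_sq.
have nH : nsq leb2 H = nsq leb f * tail0_mass.
  rewrite -[RHS](Rint_prod_mul (arcfun_sqintg bf).2 it0); apply: eq_Rintegral => z _.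
  by rewrite /H exprMn tail0_sq.
have mx : measurable_fun setT (fun z : R * R => (z.2, d2 s z.1)).
  apply/measurable_fun_pairP; split; first exact: (@measurable_snd _ _ R R).
  have cd : continuous (fun r => esq (gam s - gam r)) by exact: continuous_arc_esq.
  have md := continuous_measurable_fun cd.
  exact: (measurableT_comp md (@measurable_fst _ _ R R)).
have mg : measurable_fun setT (fun z : R * R => gker b (1/2) 2 z.2 (d2 s z.1)).
  exact: (measurableT_comp (measurable_gker b (1/2) 2) mx).
have mi : measurable_fun setT (fun z : R * R => \1_`[0, l] z.1 : R).
  have mi : measurable_fun setT (\1_`[0, l] : R -> R) by exact: measurable_indic.
  exact: (measurableT_comp mi (@measurable_fst _ _ R R)).
have F2 z : F z ^+ 2 = pi^-1 ^+ 2 * (\1_`[0, l] z.1 * gker b (1/2) 2 z.2 (d2 s z.1)).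
  by rewrite /F exprMn sqr_indic hker_sq; ring.
have mFg : measurable_fun setT (fun z : R * R => \1_`[0, l] z.1 * gker b (1/2) 2 z.2 (d2 s z.1)).
  exact: measurable_funM.
have g0 (z : R * R) : 0 <= \1_`[0, l] z.1 * gker b (1/2) 2 z.2 (d2 s z.1).
  by rewrite mulr_ge0 ?gker_ge0// indicE.
have [|ig Ig] := @Rint_le_ereal _ _ _ leb2 _ (A2 * tail0_mass) mFg g0.
  rewrite fubini_tonelli2; last 2 first.
  - exact/measurable_EFinP.
  - by move=> z; rewrite lee_fin.
  rewrite -RintegralZl// EFin_Rint; last exact: intgZ.
  apply: ge0_le_integral => //.
  - by move=> t _; apply: integral_ge0 => r _; rewrite lee_fin (g0 (r, t)).
  - apply: (@measurable_fun_fubini_tonelli_G _ _ _ _ _ leb (EFin \o (fun z : R * R => \1_`[0, l] z.1 * gker b (1/2) 2 z.2 (d2 s z.1)))).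
      exact/measurable_EFinP.
    by move=> z; rewrite lee_fin.
  - by apply/measurable_EFinP; apply: measurable_funM => //; exact: measurable_tail.
  move=> t _; rewrite /fubini_G/=.
  have [t0|t0] := ltP 0 t; last first.
    under eq_integral do rewrite gker_nonpos// mulr0.
    by rewrite integral0 lee_fin mulr_ge0// tail_ge0.
  have a0 : 0 < 1 / 2 :> R by lra.
  apply: (le_trans (@gker_arc R gam l c l0 cgam c0 gam_lb b (1/2) 2 t (gam s) t0 a0)).
  rewrite lee_fin /A2 /tail t0 expr0 [1 * expR _]mul1r exprVn mulVf ?mulr1 ?mulrA//.
  by rewrite expf_neq0// gt_eqF.
have mF : measurable_fun setT F.
  apply: measurable_funM => //.
  by apply: measurable_funM => //; exact: (measurableT_comp (measurable_gker (b/2) (1/4) 1) mx).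
have sF : sqintg leb2 F.
  by split=> //; apply: (eq_intg _ (@intgZ _ _ _ leb2 (pi^-1 ^+ 2) _ ig)) => z; rewrite F2.
have nF : nsq leb2 F <= pi^-1 ^+ 2 * (A2 * tail0_mass).
  rewrite /nsq; under eq_Rintegral do rewrite F2.
  by rewrite (RintegralZl _ measurableT ig) ler_wpM2l// sqr_ge0.
rewrite E; apply: (le_trans (dot_CS sF sH)); rewrite nH /KQ -[leRHS]mulrA [tail0_mass * _]mulrC.
by rewrite ler_wpM2r// mulr_ge0 ?nsq_ge0//; apply: Rintegral_ge0 => t _; exact: tail_ge0.
Qed.

Lemma bsI_ge0 f s : (forall r, 0 <= f r) -> 0 <= bsopI b f s.
Proof. by move=> f0; rewrite /bsopI mulr_ge0 ?bsop_ge0// indicE. Qed.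

(** With [T] for the operator, symmetry gives [|T f|^2 = <T T f, f> <= sup (T T f) \int f], and
    [bsop_ub2] gives [sup (T T f) <= k |T f|]. Hence [|T f| <= k \int f], and using [bsop_ub2]
    again, [T T f <= k^2 \int f]. *)
Lemma bsop_bs_ub f s : arcfun l f -> (forall r, 0 <= f r) -> I s ->
  bsopI b (bsopI b f) s <= KQ * \int[leb]_r f r.
Proof.
move=> bf f0 sl; have bQ := arcfun_bsopI b0 bf; have bQQ := arcfun_bsopI b0 bQ.
pose N := Num.sqrt (nsq leb (bsopI b f)).
pose k := Num.sqrt KQ.
have N0 : 0 <= N by exact: sqrtr_ge0.
have k0 : 0 <= k by exact: sqrtr_ge0.
have J0 : 0 <= \int[leb]_r f r by exact: Rintegral_ge0.
have N2 : N ^+ 2 = nsq leb (bsopI b f) by rewrite sqr_sqrtr// nsq_ge0.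
have k2 : k ^+ 2 = KQ by rewrite sqr_sqrtr// KQ0.
have ubs r : bsop b d2 (bsopI b f) r <= k * N.
  apply: (le_trans (ler_norm _)); rewrite -[leRHS]ger0_norm ?mulr_ge0//.
  by rewrite -ler_sqr ?nnegrE// !real_normK ?num_real// exprMn N2 k2; exact: bsop_ub2.
have h : N ^+ 2 <= k * N * \int[leb]_r f r.
  have -> : N ^+ 2 = bsform b (bsopI b f) f.
    rewrite N2 bsform_sym// bsformE//; apply: eq_Rintegral => r _; exact: expr2.
  rewrite -RintegralZl//; last exact: arcfun_intg bf.
  apply: (@Rint_le _ _ _ leb _ _ (bsform_intg b0 bQ bf)) => [|r].
    by apply: intgZ; exact: arcfun_intg bf.
  by rewrite ler_wpM2r.
have NJ : N <= k * \int[leb]_r f r.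
  have [->|Nn] := eqVneq N 0; first by rewrite mulr_ge0.
  have Np : 0 < N by rewrite lt_neqAle eq_sym Nn.
  by rewrite -(ler_pM2r Np) -expr2; move: h; rewrite mulrAC.
by rewrite bsopIE//; apply: (le_trans (ubs s)); rewrite -k2 expr2 -mulrA ler_wpM2l.
Qed.

Lemma bsop_bs_lb f s : arcfun l f -> (forall r, 0 <= f r) -> I s ->
  mlow * (mlow * l) * \int[leb]_r f r <= bsopI b (bsopI b f) s.
Proof.
move=> bf f0 sl; have bQ := arcfun_bsopI b0 bf.
rewrite bsopIE//; apply: le_trans (bsop_lb bQ (fun r => bsI_ge0 r f0) sl).
rewrite -[leLHS]mulrA; apply: (ler_wpM2l (ltW mlow0)).
have -> : mlow * l * (\int[leb]_r f r) = mlow * (l * \int[leb]_r f r) by rewrite mulrA.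
have -> : mlow * (l * \int[leb]_r f r) = \int[leb]_s ((mlow * \int[leb]_r f r) * \1_`[0, l] s).
  rewrite RintegralZl//; last by have := arcfun_intg (arcfun_ind l 1); apply: eq_intg => r; rewrite mul1r.
  by rewrite Rint_ind//; ring.
apply: (arcfun_int_le (arcfun_ind _ _) bQ) => r rl.
rewrite indicE mem_set ?in_itv//= mulr1 bsopIE//.
exact: bsop_lb.
Qed.

Definition perron h mu := [/\ arcfun l h, 0 < mu, exists2 a, 0 < a & forall s, I s -> a <= h s &
  forall s, bsopI b h s = mu * h s].

Lemma perron_exists : exists h mu, perron h mu.
Proof.
have [|||||h [lam [bh lam0 [a a0 ha] Th]]] := @positive_eigenfunction R l l0
    (fun f => bsopI b (bsopI b f)) (mlow * (mlow * l)) KQ.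
- by rewrite mulr_gt0// mulr_gt0.
- by move=> f bf; apply: arcfun_bsopI => //; exact: arcfun_bsopI.
- move=> f g k s bf bg.
  have -> : bsopI b (fun r => f r + k * g r) = (fun r => bsopI b f r + k * bsopI b g r).
    by apply/funext => r; exact: bsI_comb.
  by apply: bsI_comb => //; exact: arcfun_bsopI.
- exact: bsop_bs_lb.
- exact: bsop_bs_ub.
have bQ := arcfun_bsopI b0 bh.
have sl0 : 0 < Num.sqrt lam by rewrite sqrtr_gt0.
have h0 s : 0 <= h s.
  have [/ha|/negP sl] := boolP (I s); first by apply: le_trans; exact: ltW.
  by have [_ _ ->//] := bh.
(* The factorization [T^2 - lam = (T - sqrt lam) (T + sqrt lam)]: the second factor maps [h] to an
   eigenfunction of [T], which is still bounded below by a positive constant. *)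
exists (fun s => bsopI b h s + Num.sqrt lam * h s), (Num.sqrt lam); split=> //.
- exact: arcfun_comb.
- exists (Num.sqrt lam * a); first exact: mulr_gt0.
  move=> s sl; apply: ler_wpDl; first exact: bsI_ge0.
  by rewrite ler_pM2l// ha.
- move=> s; rewrite bsI_comb// Th.
  have -> : lam * h s = Num.sqrt lam ^+ 2 * h s by rewrite sqr_sqrtr// ltW.
  by ring.
Qed.

(* Schur's test with the positive eigenfunction as weight. *)
Lemma perron_bound h mu f : perron h mu -> arcfun l f -> bsform b f f <= mu * nsq leb f.
Proof.
move=> [bh mu0 [a a0 ha] Qh] bf.
have h0 s : 0 <= h s.
  have [/ha|/negP sl] := boolP (I s); first by apply: le_trans; exact: ltW.
  by have [_ _ ->//] := bh.
pose g s := f s / h s.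
have bg : arcfun l g.
  have [mf [C fC] f0] := bf; split.
  - apply: measurable_funM => //; apply: (measurableT_comp (@measurable_invr R)).
    by case: bh.
  - have C0 : 0 <= C by exact: le_trans (normr_ge0 _) (fC 0).
    exists (C / a) => s; have [sl|/negP sl] := boolP (I s); last first.
      by rewrite /g f0// mul0r normr0 divr_ge0// ltW.
    rewrite normrM normfV (ger0_norm (h0 s)); apply: ler_pM => //; first by rewrite invr_ge0.
    by rewrite lef_pV2 ?posrE ?ha// (lt_le_trans a0)// ha.
  - by move=> s /f0 fs; rewrite /g fs mul0r.
have fE s : f s = g s * h s.
  have [sl|/negP sl] := boolP (I s); last by have [_ _ ->//] := bf; have [_ _ ->//] := bh; rewrite mulr0.
  by rewrite /g divfK// gt_eqF// (lt_le_trans a0)// ha.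
pose w s := g s * g s * h s.
have bw : arcfun l w by apply: arcfunM => //; exact: arcfunM.
(* Pointwise this is [2 u v <= u^2 + v^2] for [u = g s] and [v = g z.1], multiplied by the kernel
   and by [h s * h z.1]. *)
have key s : bsop b d2 f s * f s <= 2^-1 * (bsop b d2 h s * w s) + 2^-1 * (bsop b d2 w s * h s).
  have j0 := bsop_intg l0 cgam c0 gam_lb b0 s bf.
  have j1 := bsop_intg l0 cgam c0 gam_lb b0 s bh.
  have j2 := bsop_intg l0 cgam c0 gam_lb b0 s bw.
  have j3 := @intgZ _ _ _ leb2 (2^-1 * w s) _ j1.
  have -> : 2^-1 * (bsop b d2 h s * w s) = \int[leb2]_z (2^-1 * w s * (hker b z.2 (d2 s z.1) * h z.1)).
    by rewrite (RintegralZl _ measurableT j1) /bsop; ring.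
  have -> : 2^-1 * (bsop b d2 w s * h s) = 2^-1 * h s * bsop b d2 w s by ring.
  have -> : bsop b d2 f s * f s = \int[leb2]_z (f s * (hker b z.2 (d2 s z.1) * f z.1)).
    by rewrite (RintegralZl _ measurableT j0) mulrC.
  apply: (@Rint_le_comb _ _ _ leb2 _ _ _ _ (@intgZ _ _ _ leb2 (f s) _ j0) j3 j2) => z.
  rewrite !fE /w; have k0 := hker_ge0 b z.2 (d2 s z.1).
  have hh : 0 <= hker b z.2 (d2 s z.1) * (h s * h z.1) by rewrite mulr_ge0// mulr_ge0.
  have := mulr_ge0 hh (sqr_ge0 (g s - g z.1)).
  move: (hker _ _ _) (h s) (h z.1) (g s) (g z.1) => K p q u v; nra.
have e1 := bsform_intg b0 bh bw; have e2 := bsform_intg b0 bw bh.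
have := @Rint_le_comb _ _ _ leb _ _ _ _ (bsform_intg b0 bf bf) (@intgZ _ _ _ leb (2^-1) _ e1) e2 key.
move/le_trans; apply.
rewrite (RintegralZl _ measurableT e1) -/(bsform b h w) -/(bsform b w h) (bsform_sym b0 bw bh).
have -> : bsform b h w = mu * nsq leb f.
  rewrite bsformE// -RintegralZl//; last exact: (arcfun_sqintg bf).2.
  by apply: eq_Rintegral => s _; rewrite Qh fE /w; ring.
by move: (mu * _) => X; lra.
Qed.

Lemma perron_bsform h mu : perron h mu -> bsform b h h = mu * nsq leb h /\ 0 < nsq leb h.
Proof.
move=> [bh mu0 [a a0 ha] Qh]; split.
  rewrite bsformE// -RintegralZl//; last exact: (arcfun_sqintg bh).2.
  by apply: eq_Rintegral => s _; rewrite Qh expr2 mulrA.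
have : \int[leb]_s (a ^+ 2 * \1_`[0, l] s) <= nsq leb h.
  apply: arcfun_int_le => //; first exact: arcfun_ind.
    by under eq_fun do rewrite expr2; exact: arcfunM.
  move=> s sl; rewrite indicE mem_set ?in_itv//= mulr1.
  by rewrite lerXn2r ?nnegrE ?ha ?(ltW a0)// (le_trans (ltW a0))// ha.
apply: lt_le_trans; rewrite RintegralZl ?Rint_ind//.
  by rewrite mulr_gt0// exprn_gt0.
by have := arcfun_intg (arcfun_ind l 1); apply: eq_intg => s; rewrite mul1r.
Qed.

(** The right side bounds the operator in the sup norm. If [mu] exceeded it, iterating [mu h = T h]
    would give [|h| <= C th^n] with [th < 1], against the positive lower bound of [h]. *)
Lemma perron_le h mu : perron h mu -> mu <= hkC c * tail1_mass b.
Proof.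
move=> [bh mu0 [a a0 ha] Qh]; rewrite leNgt; apply/negP => lt.
pose k := hkC c * tail1_mass b; pose th := k / mu.
have k0 : 0 <= k by rewrite mulr_ge0 ?hkC_ge0 ?tail1_mass_ge0.
have [_ [C hC] hoff] := bh.
have C0 : 0 <= C by exact: le_trans (normr_ge0 _) (hC 0).
have th0 : 0 <= th by rewrite divr_ge0// ltW.
have hn n s : `|h s| <= C * th ^+ n.
  elim: n s => [|n IH] s; first by rewrite expr0 mulr1.
  have [sl|/negP sl] := boolP (I s); last first.
    by rewrite hoff// normr0 mulr_ge0// exprn_ge0.
  have := bsop_bound l0 cgam c0 gam_lb b0 s bh IH.
  rewrite -bsopIE// Qh normrM (gtr0_norm mu0) -mulrA -/k mulrC -ler_pdivlMr// exprSr.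
  by rewrite /th !mulrA.
have : a <= 0.
  apply: (@geo_le0 _ _ C th) => // [|n]; first by rewrite th0/= ltr_pdivrMr// mul1r.
  have I0 : I 0 by rewrite /I lexx ltW.
  exact: le_trans (ha 0 I0) (le_trans (ler_norm _) (hn n 0)).
by rewrite leNgt a0.
Qed.

End FixedB.

End ArcOperator.

(** * Dependence of the largest eigenvalue on the mass *)

Section CriticalMass.
Variable R : realType.
Local Notation leb := (@lebesgue_measure R).
Local Notation leb2 := (leb \x leb)%E.
Implicit Types (s t : R).
Variables (gam : R -> R * R) (l c : R).
Hypothesis l0 : 0 < l.
Hypothesis cgam : continuous gam.
Hypothesis c0 : 0 < c.
Hypothesis gam_lb : forall s t, 0 <= s <= l -> 0 <= t <= l ->
  c ^+ 2 * (s - t) ^+ 2 <= esq (gam s - gam t).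
Hypothesis gam_ub : forall s t, 0 <= s <= l -> 0 <= t <= l ->
  esq (gam s - gam t) <= (s - t) ^+ 2.
Implicit Types (b mu : R) (f g h : R -> R).

Let ex_perron b (b0 : 0 < b) := perron_exists l0 cgam c0 gam_lb gam_ub b0.

Lemma perron_ge0 b h mu s : perron gam l b h mu -> 0 <= h s.
Proof.
move=> [[_ _ hoff] _ [a a0 ha] _].
have [/ha|/negP sl] := boolP (0 <= s <= l); first by apply: le_trans; exact: ltW.
by rewrite hoff.
Qed.

(** The eigenfunction for [b'] serves as trial function at [b]: its quadratic form does not decrease
    when the mass is lowered, and [perron_bound] caps the form by [mu]. *)
Lemma perron_mono b b' h h' mu mu' : 0 < b -> b <= b' ->
  perron gam l b h mu -> perron gam l b' h' mu' -> mu' <= mu.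
Proof.
move=> b0 bb p p'; have b'0 : 0 < b' by exact: lt_le_trans bb.
have [E n0] := perron_bsform l0 p'.
have bh : arcfun l h' by case: p'.
rewrite -(ler_pM2r n0) -E.
apply: le_trans (perron_bound l0 cgam c0 gam_lb b0 p bh).
by apply: (bsform_mono l0 cgam c0 gam_lb b0 bb bh) => r; exact: perron_ge0 p'.
Qed.

(** Conversely the eigenfunction for [b] is tried at [b']; the loss is controlled by [hker_lip]
    through the quadratic form at mass [b / 2]. *)
Lemma perron_lip b b' h h' h2 mu mu' mu2 : 0 < b -> b <= b' ->
  perron gam l b h mu -> perron gam l b' h' mu' -> perron gam l (b / 2) h2 mu2 ->
  mu <= mu' + (b' - b) * (2 / b) * mu2.
Proof.
move=> b0 bb p p' p2; have b'0 : 0 < b' by exact: lt_le_trans bb.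
have b20 : 0 < b / 2 by rewrite divr_gt0.
have [E n0] := perron_bsform l0 p.
have bh : arcfun l h by case: p.
rewrite -(ler_pM2r n0) -E.
have h0 r : 0 <= h r by exact: perron_ge0 p.
apply: (le_trans (bsform_diff_le l0 cgam c0 gam_lb b0 bb bh h0)).
rewrite [leRHS]mulrDl; apply: lerD; first exact: (perron_bound l0 cgam c0 gam_lb b'0 p' bh).
rewrite -[leRHS]mulrA ler_wpM2l//.
  by rewrite mulr_ge0 ?subr_ge0// divr_ge0// ltW.
exact: (perron_bound l0 cgam c0 gam_lb b20 p2 bh).
Qed.

Lemma tail1_mass_small (e b1 : R) : 0 < e -> 0 < b1 -> exists2 b, b1 <= b & tail1_mass b <= e.
Proof.
move=> e0 b10.
have i1 : intg leb (tail b1 1) by exact: intg_tail.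
have tE (n : nat) t : tail (b1 + n%:R) 1 t = tail b1 1 t * expR (- (n%:R * t ^+ 4)).
  rewrite /tail; case: ltP => _; last by rewrite mul0r.
  by rewrite -mulrA -expRD; congr (_ * expR _); ring.
have [|||_ /cvg_nP cv] := @Rint_dct _ _ R leb (fun n t => tail (b1 + n%:R) 1 t) (fun=> 0) (tail b1 1) _ i1.
- by move=> n; exact: measurable_tail.
- move=> n t; rewrite ger0_norm ?tail_ge0// tE ler_piMr ?tail_ge0//.
  rewrite -[leRHS]expR0 ler_expR oppr_le0 mulr_ge0//.
  by rewrite (_ : t ^+ 4 = (t ^+ 2) ^+ 2) ?sqr_ge0//; ring.
- move=> t; apply/cvg_nP => d d0.
  have [t0|t0] := ltP 0 t; last first.
    by exists 0 => n _; rewrite /tail ltNge t0/= subrr normr0 ltW.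
  have t40 : 0 < t ^+ 4 by rewrite exprn_gt0.
  exists (Num.truncn (tail b1 1 t / (t ^+ 4 * d))).+1 => n nN.
  rewrite subr0 ger0_norm ?tail_ge0// tE.
  have n0 : 0 < n%:R :> R by rewrite ltr0n; exact: leq_trans nN.
  have h1 : n%:R * t ^+ 4 <= expR (n%:R * t ^+ 4).
    by apply: le_trans (expR_ge1Dx _); rewrite lerDr.
  have h2 : expR (- (n%:R * t ^+ 4)) <= (n%:R * t ^+ 4)^-1.
    by rewrite expRN lef_pV2 ?posrE ?expR_gt0// mulr_gt0.
  apply: (le_trans (ler_wpM2l (tail_ge0 _ _ _) h2)).
  rewrite ler_pdivrMr ?mulr_gt0// [d * _]mulrC -mulrA -ler_pdivrMr ?mulr_gt0// ltW//.
  by apply: lt_le_trans (truncnS_gt _) _; rewrite ler_nat.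
have [N /(_ N (leqnn N))] := cv e e0.
rewrite (@Rint0 _ _ R leb (fun=> 0))// subr0 => hN.
exists (b1 + N%:R); first by rewrite lerDl.
exact: le_trans (ler_norm _) hN.
Qed.

(** An intermediate value argument in which the eigenvalue is a relation with the mass rather than a
    function of it: at the supremum of the masses with eigenvalue at least [k], the Lipschitz bound
    on both sides forces the value [k]. The final clause is what separates other arcs from the
    segment. *)
Lemma perron_crossing k b1 h1 mu1 : 0 < k -> 0 < b1 -> perron gam l b1 h1 mu1 -> k <= mu1 ->
  exists b h, [/\ b1 <= b, perron gam l b h k & k < mu1 -> b1 < b].
Proof.
move=> k0 b10 p1 km.
have [h2 [mu2 p2]] : exists h mu, perron gam l (b1 / 2) h mu.
  by apply: ex_perron; rewrite divr_gt0.
pose S := [set b | b1 <= b /\ exists h mu, perron gam l b h mu /\ k <= mu].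
have Sb1 : S b1 by split=> //; exists h1, mu1.
have hC0 : 0 < hkC c + 1 by rewrite ltr_wpDl// hkC_ge0.
(* At mass [bm] the eigenvalue is at most [hkC c * tail1_mass bm <= k / 2], so [bm] bounds the set;
   the [+ 1] keeps the divisor positive. *)
have [bm bm1 bmT] := tail1_mass_small (divr_gt0 k0 (mulr_gt0 (ltr0n R 2) hC0)) b10.
have bm0 : 0 < bm by exact: lt_le_trans bm1.
have Sub : ubound S bm.
  move=> b [bb [h [mu [p kmu]]]]; rewrite leNgt; apply/negP => lt.
  have b0 : 0 < b by exact: lt_le_trans bb.
  have [hm [mum pm]] := ex_perron bm0.
  have l1 := perron_mono bm0 (ltW lt) pm p.
  have l2 := perron_le l0 cgam c0 gam_lb bm0 pm.
  have l3 : hkC c * tail1_mass bm <= k / 2.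
    apply: (@le_trans _ _ (hkC c * (k / (2 * (hkC c + 1))))); first by rewrite ler_wpM2l// hkC_ge0.
    rewrite mulrA ler_pdivrMr ?mulr_gt0//.
    have -> : k / 2 * (2 * (hkC c + 1)) = k * hkC c + k by field.
    by rewrite [hkC c * k]mulrC lerDl ltW.
  by have := le_trans kmu (le_trans l1 (le_trans l2 l3)); lra.
have hS : has_sup S by split; [exists b1|exists bm].
pose b := sup S.
have bb1 : b1 <= b by apply: ub_le_sup => //; exists bm.
have b0 : 0 < b by exact: lt_le_trans bb1.
have [h [mu p]] := ex_perron b0.
pose L := (2 / b1) * mu2.
have L0 : 0 <= L by rewrite mulr_ge0 ?divr_ge0 ?(ltW b10)//; case: p2 => _ /ltW.
have lip b' b'' h' h'' mu' mu'' : b1 <= b' -> b' <= b'' -> perron gam l b' h' mu' ->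
    perron gam l b'' h'' mu'' -> mu' <= mu'' + (b'' - b') * L.
  move=> bb' bb'' p' p''; have b'0 : 0 < b' by exact: lt_le_trans bb'.
  have b'20 : 0 < b' / 2 by rewrite divr_gt0.
  have [hh [muh ph]] := ex_perron b'20.
  apply: (le_trans (perron_lip b'0 bb'' p' p'' ph)); rewrite lerD2l -mulrA ler_wpM2l ?subr_ge0//.
  have m2 : muh <= mu2.
    have b120 : 0 < b1 / 2 by rewrite divr_gt0.
    by apply: (perron_mono b120 _ p2 ph); rewrite ler_pM2r.
  apply: ler_pM => //; first by rewrite divr_ge0// ltW.
    by case: ph => _ /ltW.
  by rewrite ler_pM2l// lef_pV2.
have muk : mu = k.
  apply/eqP; rewrite eq_le; apply/andP; split.
    apply/ler_addgt0Pr => e e0.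
    pose b' := b + e / (L + 1).
    have L1 : 0 < L + 1 by rewrite ltr_wpDl.
    have bb' : b < b' by rewrite ltrDl divr_gt0.
    have b'0 : 0 < b' by exact: lt_trans bb'.
    have [h' [mu' p']] := ex_perron b'0.
    have mk : mu' < k.
      rewrite ltNge; apply/negP => km'.
      have : S b' by split; [exact: le_trans bb1 (ltW bb')|exists h', mu'].
      by move=> /(ub_le_sup (ex_intro _ bm Sub)); rewrite leNgt bb'.
    apply: (le_trans (lip _ _ _ _ _ _ bb1 (ltW bb') p p')); apply: lerD; first exact: ltW.
    rewrite /b' addrAC subrr add0r mulrAC ler_pdivrMr// ler_wpM2l ?(ltW e0)//.
    by rewrite lerDl.
  apply/ler_addgt0Pr => e e0.
  have L1 : 0 < L + 1 by rewrite ltr_wpDl.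
  have [b' [bb' [h' [mu' [p' km']]]] lb'] := sup_adherent (divr_gt0 e0 L1) hS.
  have bb : b' <= b by apply: ub_le_sup; [exists bm|split=> //; exists h', mu'].
  apply: (le_trans km'); apply: (le_trans (lip _ _ _ _ _ _ bb' bb p' p)); rewrite lerD2l.
  apply: (@le_trans _ _ (e / (L + 1) * L)).
    by rewrite ler_wpM2r// lerBlDr -lerBlDl ltW.
  by rewrite mulrAC ler_pdivrMr// ler_wpM2l ?(ltW e0)// lerDl.
exists b, h; split=> //; first by rewrite -muk.
move=> km1; rewrite lt_neqAle bb1 andbT; apply/eqP => be.
move: p; rewrite -be => p.
by have := perron_mono b10 (lexx b1) p p1; rewrite muk leNgt km1.
Qed.

(** The Green function diverges logarithmically as the mass tends to 0. For [b = N^-4] the factor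
    [e^(-b t^4)] is at least [e^-1] on [[1, N]], where [1/t] has integral [ln N = A]. Testing with
    the constant function on the arc gives an eigenvalue of at least [K l A = |k| + K l]. *)
Lemma perron_large k : exists b h mu, [/\ 0 < b, perron gam l b h mu & k <= mu].
Proof.
pose K := pi^-1 * expR (- 1 - 1 / 4 * l ^+ 2).
have K0 : 0 < K by rewrite mulr_gt0 ?expR_gt0 ?invr_gt0 ?pi_gt0.
pose A := `|k| / (K * l) + 1.
have A0 : 0 < A by rewrite ltr_wpDl// divr_ge0// mulr_ge0 ?(ltW K0)// ltW.
pose N := expR A.
have N1 : 1 < N by rewrite -expR0 ltr_expR.
have N0 : 0 < N by exact: expR_gt0.
pose b := (N ^+ 4)^-1.
have b0 : 0 < b by rewrite invr_gt0 exprn_gt0.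
have [h [mu p]] := ex_perron b0.
exists b, h, mu; split=> //.
pose g t : R := \1_`[1, N] t * t^-1.
have [ig Ig] : intg leb g /\ \int[leb]_t g t = A.
  have E : (\int[leb]_(t in `[1%R, N]) (t^-1)%:E = (ln N)%:E - (ln 1)%:E)%E.
    have dln t : 0 < t -> is_derive t (1 : R) (@ln R) t^-1 by move=> t0; exact: is_derive1_ln.
    apply: continuous_FTC2 => //.
    - apply: continuous_in_subspaceT => t; rewrite inE /= in_itv/= => /andP[t1 _].
      by apply: inv_continuous; rewrite gt_eqF// (lt_le_trans ltr01).
    - have cln t : 0 < t -> {for t, continuous (@ln R)}.
        by move=> t0; apply: differentiable_continuous; apply/derivable1_diffP; case: (dln t t0).
      split.
      + by move=> t; rewrite in_itv/= => /andP[t1 _]; case: (dln t (lt_trans ltr01 t1)).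
      + by apply: cvg_at_right_filter; apply: cln.
      + by apply: cvg_at_left_filter; apply: cln.
    - move=> t; rewrite in_itv/= => /andP[t1 _]; rewrite derive1E.
      exact: (@derive_val _ _ _ _ _ _ _ (dln t (lt_trans ltr01 t1))).
  have Eg : (\int[leb]_t (g t)%:E = A%:E)%E.
    rewrite ln1 sube0 expRK in E; rewrite -E [RHS]integral_mkcond; apply: eq_integral => t _.
    by rewrite patchE /g indicE; case: (t \in _); rewrite ?mul1r ?mul0r.
  have mg : measurable_fun setT g.
    by apply: measurable_funM; [exact: measurable_indic|exact: measurable_invr].
  have g0 t : 0 <= g t.
    rewrite /g indicE; have [|_] := boolP (t \in _); last by rewrite mul0r.
    by rewrite inE /= in_itv/= mul1r invr_ge0 => /andP[/(le_trans ler01)].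
  have ig : intg leb g.
    by apply: (@intg_ltoo _ _ _ leb _ A mg); under eq_integral do rewrite ger0_norm//; rewrite Eg.
  by split=> //; rewrite /Rintegral Eg.
pose f (s : R) : R := 1 * \1_`[0, l] s.
have bf : arcfun l f by exact: arcfun_ind.
have intf : \int[leb]_s f s = l by rewrite /f; under eq_Rintegral do rewrite mul1r; exact: Rint_ind.
have nf : nsq leb f = l.
  by rewrite -[RHS]intf; apply: eq_Rintegral => s _; rewrite /f !mul1r sqr_indic.
have j := intg_prod_mul (arcfun_intg bf) ig.
have low s : 0 <= s <= l -> K * (l * A) <= bsop b (dist2 gam) f s.
  move=> sl; have -> : l * A = \int[leb2]_z (f z.1 * g z.2).
    by rewrite (Rint_prod_mul (arcfun_intg bf) ig) intf Ig.
  rewrite -(RintegralZl K measurableT j).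
  apply: (@Rint_le _ _ _ leb2 _ _ (@intgZ _ _ _ leb2 K _ j) (bsop_intg l0 cgam c0 gam_lb b0 s bf)) => z.
  have [zl|/negP zl] := boolP (0 <= z.1 <= l); last by have [_ _ ->//] := bf; rewrite mul0r !mulr0.
  have -> : K * (f z.1 * g z.2) = K * g z.2 * f z.1 by ring.
  rewrite ler_wpM2r//; first by rewrite /f mul1r indicE.
  have d2l : dist2 gam s z.1 <= l ^+ 2.
    apply: (le_trans (gam_ub sl zl)); move: sl zl => /andP[h3 h4] /andP[h5 h6].
    by rewrite ler_sqr_norm// (ger0_norm (ltW l0)) ler_norml; apply/andP; split; lra.
  apply: le_trans (hker_decr b z.2 d2l).
  rewrite /g indicE; have [|_] := boolP (z.2 \in _); last by rewrite mul0r mulr0 hker_ge0.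
  rewrite inE /= in_itv/= mul1r => /andP[t1 t2].
  have t0 : 0 < z.2 by exact: lt_le_trans t1.
  have t41 : 1 <= z.2 ^+ 4 by rewrite exprn_ege1.
  have t42 : z.2 ^+ 4 <= N ^+ 4 by rewrite lerXn2r// nnegrE ltW.
  rewrite /K /hker /gker t0 expr1 -[leLHS]mulrA ler_wpM2l ?invr_ge0 ?pi_ge0//.
  rewrite mulrC ler_wpM2l ?invr_ge0 ?(ltW t0)// ler_expR; apply: lerB.
    by rewrite lerN2 /b mulrC ler_pdivrMr ?mul1r// exprn_gt0.
  rewrite ler_pdivrMr ?(lt_le_trans _ t41)// ler_peMr//.
  by rewrite mulr_ge0 ?sqr_ge0.
have bsform_low : K * (l * A) * l <= bsform gam b f f.
  rewrite (bsformE gam b f bf) -[X in _ * X]intf -RintegralZl//; last exact: arcfun_intg bf.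
  apply: (arcfun_int_le (arcfun_Z _ bf) (arcfunM (arcfun_bsopI l0 cgam c0 gam_lb b0 bf) bf)) => s sl.
  by rewrite bsopIE// ler_wpM2r ?low// /f mul1r indicE.
have := le_trans bsform_low (perron_bound l0 cgam c0 gam_lb b0 p bf).
rewrite nf ler_pM2r// => hmu; apply: le_trans hmu.
rewrite mulrA /A mulrDr mulr1 mulrCA divff ?mulr1; last by rewrite mulf_neq0// gt_eqF.
by apply: ler_wpDr; [rewrite mulr_ge0 ?(ltW K0) ?(ltW l0)|exact: ler_norm].
Qed.

End CriticalMass.

(** * Traces and the lowest eigenvalue *)

Section ComplexL2Facts.
Context d (T : measurableType d) (R : realType) (mu : {measure set T -> \bar R}).
Implicit Types (D : set T) (f g : T -> R[i]).

(** Extension by 0 from [D] brings complex functions on a subset under the real [L^2] theory of the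
    whole space. *)
Definition cutre D f (x : T) : R := \1_D x * complex.Re (f x).
Definition cutim D f (x : T) : R := \1_D x * complex.Im (f x).

Lemma cutre_setT f : cutre setT f = (fun x => complex.Re (f x)).
Proof. by apply/funext => x; rewrite /cutre indicE in_setT mul1r. Qed.

Lemma cutim_setT f : cutim setT f = (fun x => complex.Im (f x)).
Proof. by apply/funext => x; rewrite /cutim indicE in_setT mul1r. Qed.

Lemma normc_sq (z : R[i]) : Normc.normc z ^+ 2 = complex.Re z ^+ 2 + complex.Im z ^+ 2.
Proof. by case: z => a b /=; rewrite sqr_sqrtr// addr_ge0 ?sqr_ge0. Qed.

Lemma measurable_cut D (h : T -> R) : measurable D -> measurable_fun D h ->
  measurable_fun setT (fun x => \1_D x * h x).
Proof.
move=> mD /(measurable_restrictT _ mD).1; apply: eq_measurable_fun => x _.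
by rewrite patchE indicE; case: (x \in D); rewrite ?mul1r ?mul0r.
Qed.

Lemma Rint_cut D (h : T -> R) : \int[mu]_(x in D) h x = \int[mu]_x (\1_D x * h x).
Proof.
rewrite Rintegral_mkcond; apply: eq_Rintegral => x _.
by rewrite patchE indicE; case: (x \in D); rewrite ?mul1r ?mul0r.
Qed.

Lemma norm2sq_cut D f : norm2sq mu D f =
  (\int[mu]_x (cutre D f x ^+ 2 + cutim D f x ^+ 2)%:E)%E.
Proof.
rewrite /norm2sq integral_mkcond; apply: eq_integral => x _.
rewrite patchE /cutre /cutim indicE normc_sq.
by case: (x \in D); rewrite ?mul1r ?mul0r ?expr0n//= addr0.
Qed.

Lemma memL2_cut D f : measurable D -> memL2 mu D f ->
  sqintg mu (cutre D f) /\ sqintg mu (cutim D f).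
Proof.
move=> mD [mr mi lt]; have mr' := measurable_cut mD mr; have mi' := measurable_cut mD mi.
have [c Ec] : exists c : R, (\int[mu]_x (cutre D f x ^+ 2 + cutim D f x ^+ 2)%:E = c%:E)%E.
  move: lt; rewrite norm2sq_cut.
  have : (0 <= \int[mu]_x (cutre D f x ^+ 2 + cutim D f x ^+ 2)%:E)%E.
    by apply: integral_ge0 => x _; rewrite lee_fin addr_ge0 ?sqr_ge0.
  by case: (\int[mu]_x _)%E => [r _ _|//|//]; exists r.
have m2 : measurable_fun setT (fun x => cutre D f x ^+ 2 + cutim D f x ^+ 2).
  by apply: measurable_funD; apply: measurable_funX.
have ib : intg mu (fun x => cutre D f x ^+ 2 + cutim D f x ^+ 2).
  apply: (@intg_ltoo _ _ _ mu _ c m2); rewrite -Ec le_eqVlt; apply/orP; left; apply/eqP.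
  by apply: eq_integral => x _; rewrite ger0_norm// addr_ge0 ?sqr_ge0.
split; split=> //; apply: (@intg_le _ _ _ mu _ _ _ ib) => [|x].
- exact: measurable_funX.
- by rewrite ger0_norm ?sqr_ge0// lerDl sqr_ge0.
- exact: measurable_funX.
- by rewrite ger0_norm ?sqr_ge0// lerDr sqr_ge0.
Qed.

Lemma norm2sqE D f : sqintg mu (cutre D f) -> sqintg mu (cutim D f) ->
  norm2sq mu D f = (nsq mu (cutre D f) + nsq mu (cutim D f))%:E.
Proof.
move=> [mr ir] [mi ii]; rewrite norm2sq_cut /nsq -RintegralD//.
by rewrite EFin_Rint//; exact: intgD.
Qed.

Lemma memL2I D f : measurable_fun D (fun x => complex.Re (f x)) ->
  measurable_fun D (fun x => complex.Im (f x)) ->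
  sqintg mu (cutre D f) -> sqintg mu (cutim D f) -> memL2 mu D f.
Proof. by move=> mr mi sr si; split=> //; rewrite norm2sqE// ltry. Qed.

Lemma innerE D f g : sqintg mu (cutre D f) -> sqintg mu (cutim D f) ->
  sqintg mu (cutre D g) -> sqintg mu (cutim D g) ->
  inner mu D f g = Complex (dot mu (cutre D f) (cutre D g) + dot mu (cutim D f) (cutim D g))
    (dot mu (cutim D f) (cutre D g) - dot mu (cutre D f) (cutim D g)).
Proof.
move=> fr fi gr gi; rewrite /inner /cintegral; congr Complex; rewrite Rint_cut.
- rewrite /dot -RintegralD//; try exact: sqintgM.
  apply: eq_Rintegral => x _; rewrite /cutre /cutim indicE.
  by case: (x \in D); rewrite ?mul1r ?mul0r ?addr0//; case: (f x) (g x) => a b [p q] /=; ring.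
- rewrite /dot -RintegralB//; try exact: sqintgM.
  apply: eq_Rintegral => x _; rewrite /cutre /cutim indicE.
  by case: (x \in D); rewrite ?mul1r ?mul0r ?subr0//; case: (f x) (g x) => a b [p q] /=; ring.
Qed.

Lemma dot_nsq0 (f g h : T -> R) : sqintg mu f -> sqintg mu g -> sqintg mu h ->
  nsq mu (fun x => f x - g x) = 0 -> dot mu f h = dot mu g h.
Proof.
move=> sf sg sh fg; apply/eqP; rewrite -subr_eq0 -dotBl//.
have := dot_CS (sqintgB sf sg) sh; rewrite fg mul0r => le0.
by rewrite -sqrf_eq0 eq_le le0 sqr_ge0.
Qed.

Lemma dot_cvg (f : nat -> T -> R) (g h : T -> R) : (forall n, sqintg mu (f n)) ->
  sqintg mu g -> sqintg mu h ->
  nsq mu (fun x => f n x - g x) @[n --> \oo] --> (0 : R) ->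
  dot mu (f n) h @[n --> \oo] --> dot mu g h.
Proof.
move=> sf sg sh /cvg_nP cf; apply/cvg_nP => e e0.
pose K := nsq mu h + 1.
have K0 : 0 < K by rewrite ltr_wpDl// nsq_ge0.
have [N HN] := cf (e ^+ 2 / K) (divr_gt0 (exprn_gt0 2 e0) K0).
exists N => n /HN; rewrite subr0 ger0_norm ?nsq_ge0// => hn.
rewrite -dotBl// -ler_sqr ?nnegrE ?(ltW e0)// real_normK ?num_real//.
apply: (le_trans (dot_CS (sqintgB (sf n) sg) sh)).
have hK : nsq mu h <= K by rewrite lerDl.
apply: (@le_trans _ _ (e ^+ 2 / K * K)); last by rewrite divfK// gt_eqF.
by apply: ler_pM; rewrite ?nsq_ge0.
Qed.

Lemma nsq_cvg (f : nat -> T -> R) (g : T -> R) : (forall n, sqintg mu (f n)) ->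
  sqintg mu g -> nsq mu (fun x => f n x - g x) @[n --> \oo] --> (0 : R) ->
  nsq mu (f n) @[n --> \oo] --> nsq mu g.
Proof.
move=> sf sg cf.
have c1 := dot_cvg sf sg sg cf; rewrite dotff in c1.
have E n : nsq mu (f n) = nsq mu (fun x => f n x - g x) + 2 * dot mu (f n) g - nsq mu g.
  by rewrite nsqB//; ring.
have -> : nsq mu g = 0 + 2 * nsq mu g - nsq mu g by ring.
under eq_cvg do rewrite E.
apply: cvgB; last exact: cvg_cst.
by apply: cvgD => //; apply: cvgM => //; exact: cvg_cst.
Qed.

End ComplexL2Facts.

Section EnergyCauchySchwarz.
Variable R : realType.
Local Notation leb2 := (@lebesgue_measure R \x @lebesgue_measure R)%E.
Variable b : R.
Hypothesis b0 : 0 < b.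

Lemma energy_CS u u1 u2 v v1 v2 :
  sqintg leb2 u -> sqintg leb2 u1 -> sqintg leb2 u2 ->
  sqintg leb2 v -> sqintg leb2 v1 -> sqintg leb2 v2 ->
  energy b u u1 u2 v v1 v2 ^+ 2 <= energy b u u1 u2 u u1 u2 * energy b v v1 v2 v v1 v2.
Proof.
move=> su su1 su2 sv sv1 sv2; rewrite mulrC; apply: discriminant_le0.
  by rewrite /energy !dotff !addr_ge0 ?mulr_ge0 ?nsq_ge0// ltW.
move=> t.
have E p q : sqintg leb2 p -> sqintg leb2 q ->
    nsq leb2 (fun x => t * q x + p x) = t ^+ 2 * nsq leb2 q + 2 * t * dot leb2 p q + nsq leb2 p.
  move=> sp sq; rewrite nsqD ?nsqZ ?dotZl//; last exact: sqintgZ.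
  by rewrite (dotC _ q p); ring.
have -> : energy b v v1 v2 v v1 v2 * t ^+ 2 + 2 * energy b u u1 u2 v v1 v2 * t + energy b u u1 u2 u u1 u2 =
  b * nsq leb2 (fun x => t * v x + u x) + nsq leb2 (fun x => t * v1 x + u1 x) +
  nsq leb2 (fun x => t * v2 x + u2 x).
  by rewrite !E// /energy !dotff; ring.
by rewrite !addr_ge0 ?mulr_ge0 ?nsq_ge0// ltW.
Qed.

Lemma energy_cvg (phi : nat -> R * R -> R) u u1 u2 v v1 v2 : (forall n, testf (phi n)) ->
  sqintg leb2 u -> sqintg leb2 u1 -> sqintg leb2 u2 ->
  sqintg leb2 v -> sqintg leb2 v1 -> sqintg leb2 v2 ->
  nsq leb2 (fun x => phi n x - u x) @[n --> \oo] --> (0 : R) ->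
  nsq leb2 (fun x => 'D_(e1 R) (phi n) x - u1 x) @[n --> \oo] --> (0 : R) ->
  nsq leb2 (fun x => 'D_(e2 R) (phi n) x - u2 x) @[n --> \oo] --> (0 : R) ->
  energy b (phi n) ('D_(e1 R) (phi n)) ('D_(e2 R) (phi n)) v v1 v2 @[n --> \oo] -->
  energy b u u1 u2 v v1 v2.
Proof.
move=> tphi su su1 su2 sv sv1 sv2 c0 c1 c2; rewrite /energy.
apply: cvgD; first apply: cvgD.
- apply: cvgM; first exact: cvg_cst.
  by apply: dot_cvg => // n; exact: testf_sqintg.
- by apply: dot_cvg => // n; apply: testf_sqintg; exact: testf_derive.
- by apply: dot_cvg => // n; apply: testf_sqintg; exact: testf_derive.
Qed.

End EnergyCauchySchwarz.

(** * Traces on the arc of real functions in H^1 *)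

Section RealTraces.
Variable R : realType.
Local Notation leb := (@lebesgue_measure R).
Local Notation leb2 := (leb \x leb)%E.
Implicit Types (s t : R) (phi u v : R * R -> R).
Variables (gam : R -> R * R) (l c : R).
Hypothesis l0 : 0 < l.
Hypothesis cgam : continuous gam.
Hypothesis c0 : 0 < c.
Hypothesis gam_lb : forall s t, 0 <= s <= l -> 0 <= t <= l ->
  c ^+ 2 * (s - t) ^+ 2 <= esq (gam s - gam t).
Variables (b mu : R) (h : R -> R).
Hypothesis b0 : 0 < b.
Hypothesis ph : perron gam l b h mu.

Let U f := pot gam (hk b) f.
Let W1 f := pot gam (dk fst b) f.
Let W2 f := pot gam (dk snd b) f.

Let sU f (bf : arcfun l f) := (pot_sq l0 cgam c0 gam_lb b0 (dominated_hk b) bf).1.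
Let sW1 f (bf : arcfun l f) := (pot_sq l0 cgam c0 gam_lb b0 (dominated_dk1 b) bf).1.
Let sW2 f (bf : arcfun l f) := (pot_sq l0 cgam c0 gam_lb b0 (dominated_dk2 b) bf).1.

Let mu0 : 0 < mu. Proof. by case: ph. Qed.
Let bh : arcfun l h. Proof. by case: ph. Qed.

Definition arc_tr phi s : R := \1_`[0, l] s * phi (gam s).

Lemma arcfun_arc_tr phi : continuous phi -> arcfun l (arc_tr phi).
Proof.
move=> cphi; have cp : continuous (fun s => phi (gam s)).
  by move=> s; apply: (@continuous_comp _ _ _ gam phi); [exact: cgam|exact: cphi].
apply: (eq_rect _ (arcfun l) (arcfun_cont_mul l0 (arcfun_ind l 1) cp)).
by apply/funext => s; rewrite /arc_tr mul1r mulrC.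
Qed.

Lemma arc_trB phi psi s : arc_tr (fun x => phi x - psi x) s = arc_tr phi s - arc_tr psi s.
Proof. by rewrite /arc_tr mulrBr. Qed.

Lemma green_arc phi f : testf phi -> arcfun l f ->
  energy b phi ('D_(e1 R) phi) ('D_(e2 R) phi) (U f) (W1 f) (W2 f) = dot leb (arc_tr phi) f.
Proof.
move=> tp bf; rewrite (green_test l0 cgam c0 gam_lb b0 bf tp).
apply: eq_Rintegral => s _; rewrite /arc_tr indicE.
have [_|sl] := boolP (s \in _); first by rewrite mul1r.
have [_ _ ->] := bf; rewrite ?mulr0//; move: sl; rewrite notin_setE /= in_itv/=.
by [].
Qed.

(** For [f] the restriction of [phi] to the arc, [|f|^2] is the energy pairing of [phi] with the
    potential of [f]. By Cauchy-Schwarz its square is at most the energy of [phi] times [<T f, f>],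
    and [<T f, f> <= mu |f|^2]; one factor [|f|^2] cancels. *)
Lemma trace_ineq phi : testf phi -> nsq leb (arc_tr phi) <=
  mu * energy b phi ('D_(e1 R) phi) ('D_(e2 R) phi) phi ('D_(e1 R) phi) ('D_(e2 R) phi).
Proof.
move=> tp; have bf := arcfun_arc_tr (testf_continuous tp); set f := arc_tr phi.
set B := energy _ _ _ _ _ _ _.
have B0 : 0 <= B by rewrite /B /energy !dotff !addr_ge0 ?mulr_ge0 ?nsq_ge0// ltW.
have E := green_arc tp bf; rewrite dotff -/f in E.
have s0 := testf_sqintg tp.
have s1 := testf_sqintg (testf_derive (e1 R) tp).
have s2 := testf_sqintg (testf_derive (e2 R) tp).
have := energy_CS b0 s0 s1 s2 (sU bf) (sW1 bf) (sW2 bf).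
rewrite E (bsop_green l0 cgam c0 gam_lb b0 bf bf) -/(bsform gam b f f) -/B => CS.
have eb := perron_bound l0 cgam c0 gam_lb b0 ph bf.
have n0 := nsq_ge0 leb f.
have [->|nn] := eqVneq (nsq leb f) 0; first by rewrite mulr_ge0// ltW.
have np : 0 < nsq leb f by rewrite lt_neqAle eq_sym nn.
rewrite -(ler_pM2r np) -expr2; apply: (le_trans CS).
by rewrite [mu * B]mulrC -mulrA ler_wpM2l.
Qed.

Definition rtrace u u1 u2 (tau : R -> R) := sqintg leb tau /\
  exists phi : nat -> R * R -> R, [/\ forall n, testf (phi n),
    nsq leb2 (fun x => phi n x - u x) @[n --> \oo] --> (0 : R),
    nsq leb2 (fun x => 'D_(e1 R) (phi n) x - u1 x) @[n --> \oo] --> (0 : R),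
    nsq leb2 (fun x => 'D_(e2 R) (phi n) x - u2 x) @[n --> \oo] --> (0 : R) &
    nsq leb (fun s => arc_tr (phi n) s - tau s) @[n --> \oo] --> (0 : R)].

(** By [trace_ineq] the restrictions of approximating test functions form a Cauchy sequence in [L^2]
    of the arc. *)
Lemma rtrace_exists u u1 u2 : isH1 u u1 u2 -> exists tau, rtrace u u1 u2 tau.
Proof.
move=> H; have [su [su1 _] [su2 _]] := H.
have eps n : 0 < n.+1%:R^-1 :> R by rewrite invr_gt0.
have /choice [phi Hphi] : forall n, exists phi, testf phi /\
  [/\ nsq leb2 (fun x => phi x - u x) <= n.+1%:R^-1,
      nsq leb2 (fun x => 'D_(e1 R) phi x - u1 x) <= n.+1%:R^-1 &
      nsq leb2 (fun x => 'D_(e2 R) phi x - u2 x) <= n.+1%:R^-1].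
  by move=> n; have [phi] := H1_density H (eps n); exists phi.
have tphi n : testf (phi n) by case: (Hphi n).
have toz (r : nat -> R) : (forall n, 0 <= r n) -> (forall n, r n <= n.+1%:R^-1) ->
    r n @[n --> \oo] --> (0 : R).
  move=> r0 r1; apply/cvg_nP => e e0.
  have [N _ HN] := near_infty_natSinv_lt (PosNum e0); exists N => n /HN/= hn.
  by rewrite subr0 ger0_norm//; exact: le_trans (r1 n) (ltW hn).
have c0' := toz _ (fun n => nsq_ge0 leb2 _) (fun n => let: conj _ (And3 h _ _) := Hphi n in h).
have c1' := toz _ (fun n => nsq_ge0 leb2 _) (fun n => let: conj _ (And3 _ h _) := Hphi n in h).
have c2' := toz _ (fun n => nsq_ge0 leb2 _) (fun n => let: conj _ (And3 _ _ h) := Hphi n in h).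
have st n : sqintg leb (arc_tr (phi n)).
  by apply: arcfun_sqintg; apply: arcfun_arc_tr; exact: testf_continuous.
have tri (p q r : R * R -> R) e : sqintg leb2 p -> sqintg leb2 q -> sqintg leb2 r ->
    nsq leb2 (fun x => p x - r x) <= e -> nsq leb2 (fun x => q x - r x) <= e ->
    nsq leb2 (fun x => p x - q x) <= 4 * e.
  move=> sp sq sr h1 h2.
  have -> : nsq leb2 (fun x => p x - q x) = nsq leb2 (fun x => (p x - r x) + (r x - q x)).
    by apply: eq_Rintegral => x _; congr (_ ^+ 2); ring.
  apply: (le_trans (nsqD_le (sqintgB sp sr) (sqintgB sr sq))).
  have -> : 4 * e = 2 * e + 2 * e by ring.
  by apply: lerD; rewrite ler_wpM2l// nsq_subC.
have [|tau stau Htau] := riesz_fischer st.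
  (* Squared distances of at most [4 d] for the functions and both derivatives cost at most
     [mu * (b + 2) * 4 d] on the arc. *)
  move=> e e0; pose K := mu * (b + 2) * 4.
  have K0 : 0 < K by rewrite !mulr_gt0// addr_gt0.
  have [N _ HN] := near_infty_natSinv_lt (PosNum (divr_gt0 e0 K0)).
  exists N => n m Nn Nm; set d := e / K.
  have [_ [n0 n1 n2]] := Hphi n; have [_ [m0 m1 m2]] := Hphi m.
  have led_n : n.+1%:R^-1 <= d := ltW (HN n Nn); have led_m : m.+1%:R^-1 <= d := ltW (HN m Nm).
  have tB := testfB (tphi n) (tphi m).
  have -> : nsq leb (fun x => arc_tr (phi n) x - arc_tr (phi m) x) =
      nsq leb (arc_tr (fun x => phi n x - phi m x)).
    by apply: eq_Rintegral => s _; rewrite arc_trB.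
  apply: (le_trans (trace_ineq tB)); rewrite /energy !dotff.
  have DB (v : R * R) : 'D_v (fun x => phi n x - phi m x) = (fun x => 'D_v (phi n) x - 'D_v (phi m) x).
    by apply/funext => x; rewrite deriveB//; apply: diff_derivable; apply: smooth_differentiable; exact: testf_smooth.
  rewrite !DB.
  have h0 := tri _ _ _ d (testf_sqintg (tphi n)) (testf_sqintg (tphi m)) su (le_trans n0 led_n) (le_trans m0 led_m).
  have h1 := tri _ _ _ d (testf_sqintg (testf_derive (e1 R) (tphi n))) (testf_sqintg (testf_derive (e1 R) (tphi m))) su1 (le_trans n1 led_n) (le_trans m1 led_m).
  have h2 := tri _ _ _ d (testf_sqintg (testf_derive (e2 R) (tphi n))) (testf_sqintg (testf_derive (e2 R) (tphi m))) su2 (le_trans n2 led_n) (le_trans m2 led_m).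
  have -> : e = mu * (b * (4 * d) + 4 * d + 4 * d).
    have -> : mu * (b * (4 * d) + 4 * d + 4 * d) = K * d by rewrite /K; ring.
    by rewrite mulrC divfK// gt_eqF.
  rewrite ler_pM2l//; apply: lerD; last exact: h2.
  by apply: lerD; [rewrite ler_pM2l//; exact: h0|exact: h1].
exists tau; split=> //; exists phi; split=> //.
apply/cvg_nP => e e0; have [N HN] := Htau e e0; exists N => n /HN.
by rewrite subr0 ger0_norm// nsq_ge0.
Qed.

Section OneTrace.
Variables (u u1 u2 : R * R -> R) (tau : R -> R).
Hypothesis su : sqintg leb2 u.
Hypothesis su1 : sqintg leb2 u1.
Hypothesis su2 : sqintg leb2 u2.
Hypothesis tautr : rtrace u u1 u2 tau.

Lemma rtrace_pair f : arcfun l f -> dot leb tau f = energy b u u1 u2 (U f) (W1 f) (W2 f).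
Proof.
move=> bf; have [st [phi [tphi p0 p1 p2 pt]]] := tautr.
have c1 := energy_cvg (b := b) tphi su su1 su2 (sU bf) (sW1 bf) (sW2 bf) p0 p1 p2.
have sn n : sqintg leb (arc_tr (phi n)).
  by apply: arcfun_sqintg; apply: arcfun_arc_tr; exact: testf_continuous.
have c2 := dot_cvg sn st (arcfun_sqintg bf) pt.
have E n : energy b (phi n) ('D_(e1 R) (phi n)) ('D_(e2 R) (phi n)) (U f) (W1 f) (W2 f) =
   dot leb (arc_tr (phi n)) f by exact: green_arc.
move: c1; under eq_cvg do rewrite E.
by move=> c1; exact: (cvg_unique _ c2 c1).
Qed.

Lemma rtrace_bound : nsq leb tau <= mu * energy b u u1 u2 u u1 u2.
Proof.
have [st [phi [tphi p0 p1 p2 pt]]] := tautr.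
have sn n : sqintg leb (arc_tr (phi n)).
  by apply: arcfun_sqintg; apply: arcfun_arc_tr; exact: testf_continuous.
have c2 := nsq_cvg sn st pt.
have q0 := nsq_cvg (fun n => testf_sqintg (tphi n)) su p0.
have q1 := nsq_cvg (fun n => testf_sqintg (testf_derive (e1 R) (tphi n))) su1 p1.
have q2 := nsq_cvg (fun n => testf_sqintg (testf_derive (e2 R) (tphi n))) su2 p2.
have c1 : mu * (b * nsq leb2 (phi n) + nsq leb2 ('D_(e1 R) (phi n)) + nsq leb2 ('D_(e2 R) (phi n)))
    @[n --> \oo] --> mu * (b * nsq leb2 u + nsq leb2 u1 + nsq leb2 u2).
  apply: cvgM; first exact: cvg_cst.
  by apply: cvgD => //; apply: cvgD => //; apply: cvgM => //; exact: cvg_cst.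
rewrite /energy !dotff; apply: (ler_cvg_to c2 c1); apply: nearW => n.
by have := trace_ineq (tphi n); rewrite /energy !dotff.
Qed.

(** The trace of the potential of [h] is [T h = mu h], here tested against the trace of an arbitrary
    [u]. On restrictions of test functions it is [bsop_green] with the eigenvalue equation, and both
    sides pass to the limit. *)
Lemma rtrace_eigen v v1 v2 sigma : rtrace v v1 v2 sigma ->
  sqintg leb2 v -> sqintg leb2 v1 -> sqintg leb2 v2 ->
  nsq leb2 (fun x => v x - U h x) = 0 -> nsq leb2 (fun x => v1 x - W1 h x) = 0 ->
  nsq leb2 (fun x => v2 x - W2 h x) = 0 ->
  (forall f, arcfun l f -> dot leb sigma f = energy b v v1 v2 (U f) (W1 f) (W2 f)) ->
  dot leb sigma tau = mu * energy b u u1 u2 (U h) (W1 h) (W2 h).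
Proof.
move=> [ss _] sv sv1 sv2 n0 n1 n2 pair.
have [st [phi [tphi p0 p1 p2 pt]]] := tautr.
have bn n : arcfun l (arc_tr (phi n)) by apply: arcfun_arc_tr; exact: testf_continuous.
have c1 := dot_cvg (fun n => arcfun_sqintg (bn n)) st ss pt.
have c2 := dot_cvg (fun n => arcfun_sqintg (bn n)) st (arcfun_sqintg bh) pt.
rewrite -(rtrace_pair bh).
have E n : dot leb (arc_tr (phi n)) sigma = mu * dot leb (arc_tr (phi n)) h.
  rewrite dotC pair// /energy.
  rewrite (dot_nsq0 sv (sU bh) (sU (bn n)) n0) (dot_nsq0 sv1 (sW1 bh) (sW1 (bn n)) n1).
  rewrite (dot_nsq0 sv2 (sW2 bh) (sW2 (bn n)) n2) -/(energy b (U h) (W1 h) (W2 h) _ _ _).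
  rewrite (bsop_green l0 cgam c0 gam_lb b0 (bn n) bh) -/(bsform gam b h _) (bsformE gam b h (bn n)).
  have [_ _ _ Qh] := ph; rewrite -dotZr; [|exact: arcfun_sqintg (bn n)|exact: arcfun_sqintg bh].
  by apply: eq_Rintegral => s _; rewrite Qh mulrC.
move: c1; under eq_cvg do rewrite E.
move=> c1; rewrite dotC.
have c3 : mu * dot leb (arc_tr (phi n)) h @[n --> \oo] --> mu * dot leb tau h.
  by apply: cvgM; [exact: cvg_cst|exact: c2].
exact: (cvg_unique _ c1 c3).
Qed.

End OneTrace.

End RealTraces.

Lemma wpart0 (R : realType) (e : R * R) g : wpart e (fun=> 0) g ->
  nsq (@lebesgue_measure R \x @lebesgue_measure R)%E g = 0.
Proof.
move=> wg; have w0 : wpart e (fun=> 0) (fun=> 0).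
  split; first exact: sqintg0.
  by move=> phi _; rewrite /dot !Rint0 ?oppr0// => x; rewrite mul0r.
rewrite -[RHS](wpart_uniq (sqintg0 _) wg w0).
by apply: eq_Rintegral => x _; rewrite subr0.
Qed.

Section ComplexPlane.
Variable R : realType.
Local Notation leb := (@lebesgue_measure R).
Local Notation leb2 := (leb \x leb)%E.
Implicit Types (f g u v : R * R -> R[i]).

Let re f : R * R -> R := fun x => complex.Re (f x).
Let im f : R * R -> R := fun x => complex.Im (f x).

Lemma memL2_plane f : memL2 leb2 setT f <-> sqintg leb2 (re f) /\ sqintg leb2 (im f).
Proof.
split=> [/(memL2_cut measurableT)|[sr si]]; first by rewrite cutre_setT cutim_setT.
apply: memL2I; [exact: sr.1|exact: si.1|by rewrite cutre_setT|by rewrite cutim_setT].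
Qed.

Lemma inner_plane f g : memL2 leb2 setT f -> memL2 leb2 setT g ->
  inner leb2 setT f g = Complex (dot leb2 (re f) (re g) + dot leb2 (im f) (im g))
    (dot leb2 (im f) (re g) - dot leb2 (re f) (im g)).
Proof.
move=> /memL2_plane [fr fi] /memL2_plane [gr gi].
by rewrite innerE ?cutre_setT ?cutim_setT.
Qed.

Lemma test_function_plane f : test_function f <-> testf (re f) /\ testf (im f).
Proof.
split=> [[sr si [K cK K0]]|[[sr [M1 H1]] [si [M2 H2]]]].
  have [M [_ HM]] := compact_bounded cK.
  have off x : M + 1 < `|x| -> f x = 0.
    move=> Mx; apply: K0 => Kx; have := HM (M + 1); rewrite ltrDl ltr01 => /(_ isT x Kx).
    by rewrite /= leNgt Mx.
  by split; split=> //; exists (M + 1) => x /off; rewrite /re /im => ->.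
split=> //; exists (box (Num.max M1 M2)); first exact: compact_box.
move=> x /negP; rewrite -ltNge gt_max => /andP[/H1 + /H2].
by rewrite /re /im; case: (f x) => p q /= -> ->.
Qed.

Lemma test_functionI (p q : R * R -> R) : testf p -> testf q ->
  test_function (fun x => Complex (p x) (q x)).
Proof. by move=> tp tq; apply/test_function_plane. Qed.

Lemma cpartial_memL2 e f : test_function f -> memL2 leb2 setT (cpartial e f).
Proof.
move=> /test_function_plane [tr ti]; apply/memL2_plane.
by split; apply: testf_sqintg; exact: testf_derive.
Qed.

Lemma test_function_memL2 f : test_function f -> memL2 leb2 setT f.
Proof. by move=> /test_function_plane [tr ti]; apply/memL2_plane; split; exact: testf_sqintg. Qed.

(** Real test functions separate the real and imaginary parts of the complex identity; conversely
    the identity for a complex test function is a combination of four real ones. *)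
Lemma is_weak_partial_plane e u g : memL2 leb2 setT u ->
  is_weak_partial e u g <-> wpart e (re u) (re g) /\ wpart e (im u) (im g).
Proof.
move=> mu; have [ur ui] := (memL2_plane u).1 mu.
split=> [[mg H]|[[gr Hr] [gi Hi]]].
  have [gr gi] := (memL2_plane g).1 mg.
  have key phi : testf phi -> dot leb2 (re u) ('D_e phi) = - dot leb2 (re g) phi /\
     dot leb2 (im u) ('D_e phi) = - dot leb2 (im g) phi.
    move=> tp; have tf := test_functionI tp (testf_cst0 R).
    have := H _ tf; rewrite !inner_plane//; try exact: cpartial_memL2; try exact: test_function_memL2.
    have z w : dot leb2 w (fun x : R * R => 'D_e (fun=> 0 : R) x) = 0.
      by apply: Rint0 => x; rewrite derive_cst mulr0.
    have z' w : dot leb2 w (fun x : R * R => (0 : R)) = 0.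
      by apply: Rint0 => x; rewrite mulr0.
    rewrite /re /im /cpartial /= !z !z' !addr0 !subr0.
    by move=> [-> ->].
  by split; split=> // phi /key [].
have mg : memL2 leb2 setT g by apply/memL2_plane.
split=> // phi tphi; rewrite !inner_plane//; try exact: cpartial_memL2; try exact: test_function_memL2.
have [tr ti] := (test_function_plane phi).1 tphi.
have := Hr _ tr; have := Hi _ ti; have := Hr _ ti; have := Hi _ tr.
move=> h1 h2 h3 h4.
rewrite -[LHS]/(Complex (dot leb2 (re u) ('D_e (re phi)) + dot leb2 (im u) ('D_e (im phi)))
  (dot leb2 (im u) ('D_e (re phi)) - dot leb2 (re u) ('D_e (im phi)))).
by rewrite h1 h2 h3 h4; congr Complex; rewrite /= opprD// opprK.
Qed.

Lemma weak_partialP e u : (exists g, is_weak_partial e u g) ->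
  is_weak_partial e u (weak_partial e u).
Proof. by move=> ex; exact: (@xgetPex _ (cst 0) [set g | is_weak_partial e u g] ex). Qed.

Lemma memH1_isH1 u : memH1 u ->
  isH1 (re u) (re (weak_partial (e1 R) u)) (re (weak_partial (e2 R) u)) /\
  isH1 (im u) (im (weak_partial (e1 R) u)) (im (weak_partial (e2 R) u)).
Proof.
move=> [mu /weak_partialP w1 /weak_partialP w2]; have [ur ui] := (memL2_plane u).1 mu.
have [r1 i1] := (is_weak_partial_plane (e1 R) _ mu).1 w1.
by have [r2 i2] := (is_weak_partial_plane (e2 R) _ mu).1 w2.
Qed.

Lemma isH1_memH1 u p1 p2 q1 q2 : isH1 (re u) p1 p2 -> isH1 (im u) q1 q2 -> memH1 u.
Proof.
move=> [sr wr1 wr2] [si wi1 wi2]; have mu : memL2 leb2 setT u by apply/memL2_plane.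
split=> //; [exists (fun x => Complex (p1 x) (q1 x))|exists (fun x => Complex (p2 x) (q2 x))];
  by apply/(is_weak_partial_plane _ _ mu).
Qed.

End ComplexPlane.

Lemma norm2sq_cvg0 d (T : measurableType d) (R : realType) (mu : {measure set T -> \bar R})
    (D : set T) (f : nat -> T -> R[i]) (p q : nat -> T -> R) :
  (forall n, cutre D (f n) = p n) -> (forall n, cutim D (f n) = q n) ->
  (forall n, sqintg mu (p n)) -> (forall n, sqintg mu (q n)) ->
  (norm2sq mu D (f n) @[n --> \oo] --> 0%E) <->
  (nsq mu (p n) @[n --> \oo] --> (0 : R)) /\ (nsq mu (q n) @[n --> \oo] --> (0 : R)).
Proof.
move=> Ep Eq sr si.
have E : (fun n => norm2sq mu D (f n)) = EFin \o (fun n => nsq mu (p n) + nsq mu (q n)).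
  by apply/funext => n; rewrite norm2sqE ?Ep ?Eq.
rewrite E; split=> [/fine_cvgP [_ /cvg_nP cv]|[cr ci]].
  split; apply/cvg_nP => e e0; have [N HN] := cv e e0; exists N => n /HN; rewrite /= !subr0.
    rewrite !ger0_norm ?addr_ge0 ?nsq_ge0//; apply: le_trans.
    by rewrite lerDl nsq_ge0.
  rewrite !ger0_norm ?addr_ge0 ?nsq_ge0//; apply: le_trans.
  by rewrite lerDr nsq_ge0.
by apply: cvg_EFin; [exact: nearW|rewrite -[0]addr0; exact: cvgD].
Qed.

Lemma norm2sqB_cvg0 d (T : measurableType d) (R : realType) (mu : {measure set T -> \bar R})
    (f : nat -> T -> R[i]) (g : T -> R[i]) :
  (forall n, sqintg mu (fun x => complex.Re (f n x))) ->
  (forall n, sqintg mu (fun x => complex.Im (f n x))) ->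
  sqintg mu (fun x => complex.Re (g x)) -> sqintg mu (fun x => complex.Im (g x)) ->
  (norm2sq mu setT (f n \- g) @[n --> \oo] --> 0%E) <->
  (nsq mu (fun x => complex.Re (f n x) - complex.Re (g x)) @[n --> \oo] --> (0 : R)) /\
  (nsq mu (fun x => complex.Im (f n x) - complex.Im (g x)) @[n --> \oo] --> (0 : R)).
Proof.
move=> fr fi gr gi.
have Er n : cutre setT (f n \- g) = fun x => complex.Re (f n x) - complex.Re (g x).
  by rewrite cutre_setT; apply/funext => x /=; case: (f n x) (g x) => ? ? [].
have Ei n : cutim setT (f n \- g) = fun x => complex.Im (f n x) - complex.Im (g x).
  by rewrite cutim_setT; apply/funext => x /=; case: (f n x) (g x) => ? ? [].
by apply: norm2sq_cvg0 => // n; exact: sqintgB.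
Qed.

Section ComplexTraces.
Variable R : realType.
Local Notation leb := (@lebesgue_measure R).
Local Notation leb2 := (leb \x leb)%E.
Variable S : set (R * R).
Variable c : R.
Let gam := (arc_param S).1.
Let l := (arc_param S).2.
Hypothesis l0 : 0 < l.
Hypothesis cgam : continuous gam.
Hypothesis gam_inj : {in `[0, l] &, injective gam}.
Hypothesis c0 : 0 < c.
Hypothesis gam_lb : forall s t, 0 <= s <= l -> 0 <= t <= l ->
  c ^+ 2 * (s - t) ^+ 2 <= esq (gam s - gam t).

Let re (f : R * R -> R[i]) : R * R -> R := fun x => complex.Re (f x).
Let im (f : R * R -> R[i]) : R * R -> R := fun x => complex.Im (f x).
Let w1 v := weak_partial (e1 R) v.
Let w2 v := weak_partial (e2 R) v.
Let tre t := cutre (arc_dom S) (on_arc S t).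
Let tim t := cutim (arc_dom S) (on_arc S t).

Let mD : measurable (arc_dom S). Proof. exact: measurable_itv. Qed.

Lemma is_trace_rtrace v t : memH1 v -> is_trace S v t ->
  rtrace gam l (re v) (re (w1 v)) (re (w2 v)) (tre t) /\
  rtrace gam l (im v) (im (w1 v)) (im (w2 v)) (tim t).
Proof.
move=> /memH1_isH1 [[sr [sr1 _] [sr2 _]] [si [si1 _] [si2 _]]].
move=> [mt [phi [tphi q0 q1 q2 qt]]].
have [str sti] := @memL2_cut _ (measurableTypeR R) R leb _ _ mD mt.
have tr n : testf (re (phi n)) := ((test_function_plane (phi n)).1 (tphi n)).1.
have ti n : testf (im (phi n)) := ((test_function_plane (phi n)).1 (tphi n)).2.
have [r0 i0] := (norm2sqB_cvg0 (fun n => testf_sqintg (tr n)) (fun n => testf_sqintg (ti n)) sr si).1 q0.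
have [r1 i1] := (@norm2sqB_cvg0 _ _ R leb2 (fun n => cpartial (e1 R) (phi n)) (w1 v)
  (fun n => testf_sqintg (testf_derive (e1 R) (tr n)))
  (fun n => testf_sqintg (testf_derive (e1 R) (ti n))) sr1 si1).1 q1.
have [r2 i2] := (@norm2sqB_cvg0 _ _ R leb2 (fun n => cpartial (e2 R) (phi n)) (w2 v)
  (fun n => testf_sqintg (testf_derive (e2 R) (tr n)))
  (fun n => testf_sqintg (testf_derive (e2 R) (ti n))) sr2 si2).1 q2.
have arcr f : cutre (arc_dom S) (on_arc S (f \- t)) = fun s => arc_tr gam l (re f) s - tre t s.
  apply/funext => s; rewrite /cutre /arc_tr /tre /cutre -mulrBr; congr (_ * _).
  by rewrite /on_arc /re /=; case: (f _) (t _) => ? ? [].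
have arci f : cutim (arc_dom S) (on_arc S (f \- t)) = fun s => arc_tr gam l (im f) s - tim t s.
  apply/funext => s; rewrite /cutim /arc_tr /tim /cutim -mulrBr; congr (_ * _).
  by rewrite /on_arc /im /=; case: (f _) (t _) => ? ? [].
have sar f : testf f -> sqintg leb (arc_tr gam l f).
  by move=> tf; apply: arcfun_sqintg; apply: (arcfun_arc_tr l0 cgam); exact: testf_continuous.
have [rt it] := (@norm2sq_cvg0 _ (measurableTypeR R) R leb _ _ _ _
  (fun n => arcr (phi n)) (fun n => arci (phi n))
  (fun n => sqintgB (sar _ (tr n)) str) (fun n => sqintgB (sar _ (ti n)) sti)).1 qt.
split; split; [exact: str| |exact: sti|].
  by exists (fun n => re (phi n)); exact: (And5 tr r0 r1 r2 rt).
by exists (fun n => im (phi n)); exact: (And5 ti i0 i1 i2 it).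
Qed.

Variables (b mu : R) (h : R -> R).
Hypothesis b0 : 0 < b.
Hypothesis ph : perron gam l b h mu.

(** Traces are functions on the plane of which only the values on the arc count; here values given
    along the parameter are transported to the plane, consistently since the curve is injective. *)
Let at_arc (tau sigma : R -> R) (x : R * R) : R[i] :=
  let s := xget 0 [set s | 0 <= s <= l /\ gam s = x] in Complex (tau s) (sigma s).

Let at_arcE tau sigma s : 0 <= s <= l -> at_arc tau sigma (gam s) = Complex (tau s) (sigma s).
Proof.
move=> sl; rewrite /at_arc; set r := xget _ _.
suff -> : r = s by [].
have [rl rE] : 0 <= r <= l /\ gam r = gam s.
  by apply: (@xgetPex _ 0 [set r | 0 <= r <= l /\ gam r = gam s]); exists s.
by apply: gam_inj => //; rewrite in_itv.
Qed.

Lemma is_trace_exists v : memH1 v -> exists t, is_trace S v t.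
Proof.
move=> Hv; have [hr hi] := memH1_isH1 Hv.
have [sr [sr1 _] [sr2 _]] := hr; have [si [si1 _] [si2 _]] := hi.
have [tau [st [phi [tphi p0 p1 p2 pt]]]] := rtrace_exists l0 cgam c0 gam_lb b0 ph hr.
have [sig [ss [psi [tpsi q0 q1 q2 qt]]]] := rtrace_exists l0 cgam c0 gam_lb b0 ph hi.
pose t := at_arc tau sig; exists t.
have tE s : 0 <= s <= l -> on_arc S t s = Complex (tau s) (sig s) := @at_arcE tau sig s.
have inE' s : s \in arc_dom S -> 0 <= s <= l by rewrite inE /arc_dom /= in_itv.
have treE : tre t = fun s => \1_`[0, l] s * tau s.
  apply/funext => s; rewrite /tre /cutre /arc_dom -/l !indicE.
  by have [/inE' /tE ->|_] := boolP (s \in _); rewrite ?mul0r.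
have timE : tim t = fun s => \1_`[0, l] s * sig s.
  apply/funext => s; rewrite /tim /cutim /arc_dom -/l !indicE.
  by have [/inE' /tE ->|_] := boolP (s \in _); rewrite ?mul0r.
have ind_le w : sqintg leb w -> sqintg leb (fun s => \1_`[0, l] s * w s).
  move=> sw; apply: (sqintg_le _ sw).
    by apply: measurable_funM; [exact: measurable_indic|exact: sw.1].
  by move=> s; rewrite normrM ler_piMl ?indic_norm_le1.
have str : sqintg leb (tre t) by rewrite treE; exact: ind_le.
have sti : sqintg leb (tim t) by rewrite timE; exact: ind_le.
split.
  apply: memL2I => //.
    apply: (@eq_measurable_fun _ _ _ _ _ tau).
      by move=> s /inE' /tE ->.
    by apply: (@measurable_funS _ _ _ _ setT) => //; exact: st.1.
  apply: (@eq_measurable_fun _ _ _ _ _ sig).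
    by move=> s /inE' /tE ->.
  by apply: (@measurable_funS _ _ _ _ setT) => //; exact: ss.1.
pose F n x : R[i] := Complex (phi n x) (psi n x); exists F.
have tphis n : sqintg leb2 (phi n) := testf_sqintg (tphi n).
have tpsis n : sqintg leb2 (psi n) := testf_sqintg (tpsi n).
split.
- by move=> n; exact: test_functionI.
- exact: ((@norm2sqB_cvg0 _ _ R leb2 F v tphis tpsis sr si).2 (conj p0 q0)).
- exact: ((@norm2sqB_cvg0 _ _ R leb2 (fun n => cpartial (e1 R) (F n)) (w1 v)
    (fun n => testf_sqintg (testf_derive (e1 R) (tphi n)))
    (fun n => testf_sqintg (testf_derive (e1 R) (tpsi n))) sr1 si1).2 (conj p1 q1)).
- exact: ((@norm2sqB_cvg0 _ _ R leb2 (fun n => cpartial (e2 R) (F n)) (w2 v)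
    (fun n => testf_sqintg (testf_derive (e2 R) (tphi n)))
    (fun n => testf_sqintg (testf_derive (e2 R) (tpsi n))) sr2 si2).2 (conj p2 q2)).
have FtE n s : 0 <= s <= l ->
    on_arc S (F n \- t) s = Complex (phi n (gam s) - tau s) (psi n (gam s) - sig s).
  by move=> /tE E; rewrite -[LHS]/(F n (gam s) - on_arc S t s) E.
have arcr n : cutre (arc_dom S) (on_arc S (F n \- t)) =
    fun s => \1_`[0, l] s * (arc_tr gam l (phi n) s - tau s).
  apply/funext => s; rewrite /cutre /arc_tr /arc_dom -/l !indicE.
  by have [/inE' /FtE ->|_] := boolP (s \in _); rewrite ?mul0r//= !mul1r.
have arci n : cutim (arc_dom S) (on_arc S (F n \- t)) =
    fun s => \1_`[0, l] s * (arc_tr gam l (psi n) s - sig s).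
  apply/funext => s; rewrite /cutim /arc_tr /arc_dom -/l !indicE.
  by have [/inE' /FtE ->|_] := boolP (s \in _); rewrite ?mul0r//= !mul1r.
have sar n : sqintg leb (fun s => arc_tr gam l (phi n) s - tau s).
  apply: sqintgB => //; apply: arcfun_sqintg.
  by apply: (arcfun_arc_tr l0 cgam); exact: testf_continuous.
have sai n : sqintg leb (fun s => arc_tr gam l (psi n) s - sig s).
  apply: sqintgB => //; apply: arcfun_sqintg.
  by apply: (arcfun_arc_tr l0 cgam); exact: testf_continuous.
have sq (w : nat -> R -> R) : (forall n, sqintg leb (w n)) ->
    nsq leb (w n) @[n --> \oo] --> (0 : R) ->
    nsq leb (fun s => \1_`[0, l] s * w n s) @[n --> \oo] --> (0 : R).
  move=> sw /cvg_nP cw; apply/cvg_nP => e e0; have [N HN] := cw e e0; exists N => n /HN.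
  rewrite !subr0 !ger0_norm ?nsq_ge0//; apply: le_trans.
  apply: nsq_le => //; first exact: ind_le.
  by move=> s; rewrite normrM ler_piMl ?indic_norm_le1.
apply: (@norm2sq_cvg0 _ (measurableTypeR R) R leb _ _ _ _ arcr arci (fun n => ind_le _ (sar n)) (fun n => ind_le _ (sai n))).2.
by split; [exact: sq pt|exact: sq qt].
Qed.

Lemma traceP v : memH1 v -> is_trace S v (trace S v).
Proof.
by move=> /is_trace_exists ex; exact: (@xgetPex _ (cst 0) [set t | is_trace S v t] ex).
Qed.

Lemma trace_rtrace v : memH1 v ->
  rtrace gam l (re v) (re (w1 v)) (re (w2 v)) (tre (trace S v)) /\
  rtrace gam l (im v) (im (w1 v)) (im (w2 v)) (tim (trace S v)).
Proof. by move=> Hv; exact: is_trace_rtrace Hv (traceP Hv). Qed.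

Lemma delta_formE a u v : memH1 u -> memH1 v -> delta_form a S u v = Complex
  (dot leb2 (re (w1 u)) (re (w1 v)) + dot leb2 (im (w1 u)) (im (w1 v)) +
   (dot leb2 (re (w2 u)) (re (w2 v)) + dot leb2 (im (w2 u)) (im (w2 v))) -
   a * (dot leb (tre (trace S u)) (tre (trace S v)) + dot leb (tim (trace S u)) (tim (trace S v))))
  (dot leb2 (im (w1 u)) (re (w1 v)) - dot leb2 (re (w1 u)) (im (w1 v)) +
   (dot leb2 (im (w2 u)) (re (w2 v)) - dot leb2 (re (w2 u)) (im (w2 v))) -
   a * (dot leb (tim (trace S u)) (tre (trace S v)) - dot leb (tre (trace S u)) (tim (trace S v)))).
Proof.
move=> Hu Hv; have sar w : memH1 w -> sqintg leb (tre (trace S w)) /\ sqintg leb (tim (trace S w)).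
  by move=> /trace_rtrace [[? _] [? _]].
have [ur ui] := sar _ Hu; have [vr vi] := sar _ Hv.
have mw e w : (exists g, is_weak_partial e w g) -> memL2 leb2 setT (weak_partial e w).
  by move=> /weak_partialP [].
have [_ /mw u1 /mw u2] := Hu; have [_ /mw v1 /mw v2] := Hv.
have key (i1 i2 i3 z1 z2 z3 : R[i]) : i1 = z1 -> i2 = z2 -> i3 = z3 ->
    i1 + i2 - real_complex R a * i3 = z1 + z2 - real_complex R a * z3 by move=> -> -> ->.
apply: (etrans (key _ _ _ _ _ _ (inner_plane u1 v1) (inner_plane u2 v2) (innerE ur ui vr vi))).
by congr Complex; rewrite /= ?mul0r ?addr0 ?subr0.
Qed.

End ComplexTraces.

Lemma ae_imp2 d (T : measurableType d) (R : realType) (mu : {measure set T -> \bar R})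
    (P Q W : T -> Prop) : (forall x, P x -> Q x -> W x) ->
  {ae mu, forall x, P x} -> {ae mu, forall x, Q x} -> {ae mu, forall x, W x}.
Proof. by move=> PQW; apply: filterS2. Qed.

Lemma energy_self (R : realType) (b : R) f f1 f2 : energy b f f1 f2 f f1 f2 =
  b * nsq (@lebesgue_measure R \x @lebesgue_measure R)%E f +
  nsq (@lebesgue_measure R \x @lebesgue_measure R)%E f1 +
  nsq (@lebesgue_measure R \x @lebesgue_measure R)%E f2.
Proof. by rewrite /energy !dotff. Qed.

Lemma energy_self0 (R : realType) (b : R) f f1 f2 :
  nsq (@lebesgue_measure R \x @lebesgue_measure R)%E f = 0 ->
  nsq (@lebesgue_measure R \x @lebesgue_measure R)%E f1 = 0 ->
  nsq (@lebesgue_measure R \x @lebesgue_measure R)%E f2 = 0 -> energy b f f1 f2 f f1 f2 = 0.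
Proof. by move=> h h1 h2; rewrite energy_self h h1 h2 mulr0 !addr0. Qed.

Lemma eigenvalue_bound (R : realFieldType) (a b m x1 x2 x3 x4 x5 x6 x7 x8 : R) : 0 < a ->
  x1 + x2 + (x3 + x4) - a * (x5 + x6) = m * (x7 + x8) ->
  x5 <= a^-1 * (b * x7 + x1 + x3) -> x6 <= a^-1 * (b * x8 + x2 + x4) -> 0 < x7 + x8 -> - b <= m.
Proof.
move=> a0 e; rewrite ler_pdivlMl// => h1; rewrite ler_pdivlMl// => h2 n0.
by rewrite -(ler_pM2r n0) -e; lra.
Qed.

Section LowestEigenvalue.
Variable R : realType.
Local Notation leb := (@lebesgue_measure R).
Local Notation leb2 := (leb \x leb)%E.
Variable S : set (R * R).
Variable c : R.
Let gam := (arc_param S).1.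
Let l := (arc_param S).2.
Hypothesis l0 : 0 < l.
Hypothesis cgam : continuous gam.
Hypothesis gam_inj : {in `[0, l] &, injective gam}.
Hypothesis c0 : 0 < c.
Hypothesis gam_lb : forall s t, 0 <= s <= l -> 0 <= t <= l ->
  c ^+ 2 * (s - t) ^+ 2 <= esq (gam s - gam t).

Let re (f : R * R -> R[i]) : R * R -> R := fun x => complex.Re (f x).
Let im (f : R * R -> R[i]) : R * R -> R := fun x => complex.Im (f x).
Let w1 v := weak_partial (e1 R) v.
Let w2 v := weak_partial (e2 R) v.
Let tre t := cutre (arc_dom S) (on_arc S t).
Let tim t := cutim (arc_dom S) (on_arc S t).

Variables (b a : R) (h : R -> R).
Hypothesis b0 : 0 < b.
Hypothesis a0 : 0 < a.
Hypothesis ph : perron gam l b h a^-1.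

Let bh : arcfun l h. Proof. by case: ph. Qed.
Let U := pot gam (hk b) h.
Let W1 := pot gam (dk fst b) h.
Let W2 := pot gam (dk snd b) h.
Let HU : isH1 U W1 W2 := pot_isH1 l0 cgam c0 gam_lb b0 bh.
Let u : R * R -> R[i] := fun x => Complex (U x) 0.

Let am : a * a^-1 = 1. Proof. by rewrite divff// gt_eqF. Qed.

Let H10 : isH1 (im u) (fun=> 0) (fun=> 0).
Proof.
have w0 e : wpart e (im u) (fun=> 0).
  split; first exact: sqintg0.
  by move=> phi _; rewrite /dot !Rint0 ?oppr0// => x; rewrite mul0r.
by split=> //; exact: sqintg0.
Qed.

Let memu : memH1 u. Proof. exact: (@isH1_memH1 _ u _ _ _ _ HU H10). Qed.

(** A potential vanishing almost everywhere would have zero weak gradient and so zero energy, but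
    the energy of the potential of [h] is [a^-1 |h|^2 > 0]. *)
Let U_neq0 : ~ {ae leb2, forall x, u x = 0}.
Proof.
have [sU [sW1 H1] [sW2 H2]] := HU.
move=> u0; have U0 : nsq leb2 U = 0.
  apply: ae_eq0_nsq; first exact: sU.1.
  by apply: (@ae_imp _ _ _ leb2 _ _ _ u0) => x [].
have dU0 w : sqintg leb2 w -> dot leb2 U w = 0.
  move=> sw; rewrite (dot_nsq0 sU (sqintg0 _) sw); last first.
    by rewrite -[RHS]U0; apply: eq_Rintegral => x _; rewrite subr0.
  by apply: Rint0 => x; rewrite mul0r.
have z e w : sqintg leb2 w -> (forall phi, testf phi -> dot leb2 U ('D_e phi) = - dot leb2 w phi) ->
    nsq leb2 w = 0.
  move=> sw Hw; apply: (@wpart0 _ e); split=> // phi tphi; rewrite -Hw// dU0.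
    by apply: Rint0 => x; rewrite mul0r.
  by apply: testf_sqintg; exact: testf_derive.
have [E n0] := perron_bsform l0 ph.
have G := bsop_green l0 cgam c0 gam_lb b0 bh bh.
have : bsform gam b h h = 0.
  apply: (etrans (esym G)); apply: energy_self0; first exact: U0.
    exact: (z (e1 R) W1 sW1 H1).
  exact: (z (e2 R) W2 sW2 H2).
by move/eqP; rewrite E mulf_eq0 invr_eq0 !gt_eqF.
Qed.

Let memL2_scale (k : R) v : memL2 leb2 setT v ->
  memL2 leb2 setT (fun x => real_complex R k * v x).
Proof.
move=> /memL2_plane [vr vi]; apply/memL2_plane; split.
  have -> : (fun x => complex.Re (real_complex R k * v x)) = (fun x => k * complex.Re (v x)).
    by apply/funext => x; case: (v x) => p q /=; rewrite mul0r subr0.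
  exact: sqintgZ.
have -> : (fun x => complex.Im (real_complex R k * v x)) = (fun x => k * complex.Im (v x)).
  by apply/funext => x; case: (v x) => p q /=; rewrite mul0r addr0.
exact: sqintgZ.
Qed.

Let inner_scale (k : R) f g : memL2 leb2 setT f -> memL2 leb2 setT g ->
  inner leb2 setT (fun x => real_complex R k * f x) g =
  Complex (k * (dot leb2 (re f) (re g) + dot leb2 (im f) (im g)))
    (k * (dot leb2 (im f) (re g) - dot leb2 (re f) (im g))).
Proof.
move=> mf mg; have [fr fi] := (memL2_plane f).1 mf; have [gr gi] := (memL2_plane g).1 mg.
rewrite (inner_plane (memL2_scale k mf) mg).
have -> : (fun x => complex.Re (real_complex R k * f x)) = (fun x => k * re f x).
  by apply/funext => x; rewrite /re; case: (f x) => p q /=; rewrite mul0r subr0.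
have -> : (fun x => complex.Im (real_complex R k * f x)) = (fun x => k * im f x).
  by apply/funext => x; rewrite /im; case: (f x) => p q /=; rewrite mul0r addr0.
by rewrite !dotZl//; congr Complex; rewrite ?mulrDr ?mulrN.
Qed.

Let rtrace_u := (trace_rtrace l0 cgam gam_inj c0 gam_lb b0 ph memu).

Let tim_u : nsq leb (tim (trace S u)) = 0.
Proof.
have [_ [s0 [s1 n1] [s2 n2]]] := memH1_isH1 memu.
apply/eqP; rewrite eq_le nsq_ge0 andbT.
apply: (le_trans (rtrace_bound l0 cgam c0 gam_lb b0 ph s0 s1 s2 rtrace_u.2)).
have le0 (x y : R) : y = 0 -> x * y <= 0 by move=> ->; rewrite mulr0.
apply: le0; apply: energy_self0; [|exact: (wpart0 (conj s1 n1))|exact: (wpart0 (conj s2 n2))].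
by apply: Rint0 => x; rewrite expr0n.
Qed.

Let tre_u f : arcfun l f -> dot leb (tre (trace S u)) f =
  energy b (re u) (re (w1 u)) (re (w2 u)) (pot gam (hk b) f) (pot gam (dk fst b) f) (pot gam (dk snd b) f).
Proof.
have [[s0 [s1 _] [s2 _]] _] := memH1_isH1 memu.
exact: (rtrace_pair l0 cgam c0 gam_lb b0 s0 s1 s2 rtrace_u.1).
Qed.

Let re_w1u : nsq leb2 (fun x => re (w1 u) x - W1 x) = 0.
Proof.
by have [[s0 n1 _] _] := memH1_isH1 memu; have [_ n _] := HU; exact: (wpart_uniq s0 n1 n).
Qed.

Let re_w2u : nsq leb2 (fun x => re (w2 u) x - W2 x) = 0.
Proof.
by have [[s0 _ n1] _] := memH1_isH1 memu; have [_ _ n] := HU; exact: (wpart_uniq s0 n1 n).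
Qed.

Let tre_u_dot v v1 v2 tau : rtrace gam l v v1 v2 tau -> sqintg leb2 v -> sqintg leb2 v1 ->
  sqintg leb2 v2 -> a * dot leb (tre (trace S u)) tau = energy b v v1 v2 U W1 W2.
Proof.
move=> tv sv sv1 sv2; have [[s0 [s1 _] [s2 _]] _] := memH1_isH1 memu.
rewrite (rtrace_eigen l0 cgam c0 gam_lb b0 ph sv sv1 sv2 tv rtrace_u.1 s0 s1 s2 _ re_w1u re_w2u tre_u).
  by rewrite mulrA am mul1r.
by apply: Rint0 => x; rewrite subrr expr0n.
Qed.

Let dot_nsq00 d (T : measurableType d) (m : {measure set T -> \bar R}) (f g : T -> R) :
  sqintg m f -> sqintg m g -> nsq m f = 0 -> dot m f g = 0.
Proof.
move=> sf sg n0; rewrite (dot_nsq0 sf (sqintg0 _) sg).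
  by apply: Rint0 => x; rewrite mul0r.
by rewrite -[RHS]n0; apply: eq_Rintegral => x _; rewrite subr0.
Qed.

(** Because [a * a^-1 = 1], the trace term [a <tr u, tr v>] equals the whole energy
    [b <u, v> + <grad u, grad v>]. In the form the gradients cancel and [- b <u, v>] remains. *)
Lemma eigenvalue_perron : delta_eigenvalue a S (- b).
Proof.
exists u; split; last exact: U_neq0.
have [mu _ _] := memu; split=> //; first exact: memL2_scale.
move=> v Hv; have [mv _ _] := Hv.
have [[sU [sW1 _] [sW2 _]] [s0 i1 i2]] := memH1_isH1 memu.
have [[vr [vr1 _] [vr2 _]] [vi [vi1 _] [vi2 _]]] := memH1_isH1 Hv.
have [tvr tvi] := trace_rtrace l0 cgam gam_inj c0 gam_lb b0 ph Hv.
have [_ [pU _] [pW1 _]] := HU; have pW2 : sqintg leb2 W2 by case: HU => _ _ [].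
have E1 := dot_nsq0 sW1 pU _ re_w1u; have E2 := dot_nsq0 sW2 pW2 _ re_w2u.
have n1 := wpart0 i1; have n2 := wpart0 i2.
have st : sqintg leb (tim (trace S u)) by case: rtrace_u => _ [].
have D1 := dot_nsq00 i1.1 _ n1; have D2 := dot_nsq00 i2.1 _ n2; have D3 := dot_nsq00 st _ tim_u.
have [sr _] := tvr; have [si _] := tvi.
rewrite (delta_formE l0 cgam gam_inj c0 gam_lb b0 ph a memu Hv) (inner_scale _ mu mv).
have F1 := tre_u_dot tvr vr vr1 vr2; have F2 := tre_u_dot tvi vi vi1 vi2.
have Z w : dot leb2 (im u) w = 0 by apply: Rint0 => x; rewrite mul0r.
have algR (x1 x2 x3 x4 x5 x6 y0 y1 y2 y7 : R) : x1 = y1 -> x2 = 0 -> x3 = y2 -> x4 = 0 ->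
    a * x5 = b * y0 + y1 + y2 -> x6 = 0 -> y7 = 0 ->
    x1 + x2 + (x3 + x4) - a * (x5 + x6) = - b * (y0 + y7).
  by move=> -> -> -> -> E -> ->; rewrite mulrDr E; ring.
have algI (x1 x2 x3 x4 x5 x6 y0 y1 y2 y7 : R) : x1 = 0 -> x2 = y1 -> x3 = 0 -> x4 = y2 ->
    x5 = 0 -> a * x6 = b * y0 + y1 + y2 -> y7 = 0 ->
    x1 - x2 + (x3 - x4) - a * (x5 - x6) = - b * (y7 - y0).
  by move=> -> -> -> -> -> E ->; rewrite mulrBr E; ring.
congr Complex.
- apply: (algR _ _ _ _ _ _ _ _ _ _ (etrans (E1 _ vr1) (dotC _ _ _)) (D1 _ vi1)
    (etrans (E2 _ vr2) (dotC _ _ _)) (D2 _ vi2) (etrans F1 _) (D3 _ si) (Z _)).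
  by rewrite /energy; congr (b * _ + _ + _); exact: dotC.
- apply: (algI _ _ _ _ _ _ _ _ _ _ (D1 _ vr1) (etrans (E1 _ vi1) (dotC _ _ _)) (D2 _ vr2)
    (etrans (E2 _ vi2) (dotC _ _ _)) (D3 _ sr) (etrans F2 _) (Z _)).
  by rewrite /energy; congr (b * _ + _ + _); exact: dotC.
Qed.

(** The eigenfunction [v] is its own test function: the trace bound with [mu = a^-1] reads
    [a |tr v|^2 <= b |v|^2 + |grad v|^2], so the form at [v] is at least [- b |v|^2]. *)
Lemma eigenvalue_ge m : delta_eigenvalue a S m -> - b <= m.
Proof.
move=> [v [[Hv _ H] v0]]; have [mv _ _] := Hv.
have [[vr [vr1 _] [vr2 _]] [vi [vi1 _] [vi2 _]]] := memH1_isH1 Hv.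
have [tvr tvi] := trace_rtrace l0 cgam gam_inj c0 gam_lb b0 ph Hv.
have := H v Hv; rewrite (delta_formE l0 cgam gam_inj c0 gam_lb b0 ph a Hv Hv) (inner_scale _ mv mv).
move=> /(congr1 (@complex.Re R)) E.
have B1 := rtrace_bound l0 cgam c0 gam_lb b0 ph vr vr1 vr2 tvr.
have B2 := rtrace_bound l0 cgam c0 gam_lb b0 ph vi vi1 vi2 tvi.
rewrite energy_self in B1; rewrite energy_self in B2.
have N0 : 0 < nsq leb2 (re v) + nsq leb2 (im v).
  rewrite lt_neqAle addr_ge0 ?nsq_ge0// andbT eq_sym; apply/eqP => N0; apply: v0.
  have nr : nsq leb2 (re v) = 0.
    by apply/eqP; rewrite eq_le nsq_ge0 andbT -N0 lerDl nsq_ge0.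
  have ni : nsq leb2 (im v) = 0.
    by apply/eqP; rewrite eq_le nsq_ge0 andbT -N0 lerDr nsq_ge0.
  apply: (@ae_imp2 _ _ _ leb2 _ _ _ _ (nsq_eq0 vr nr) (nsq_eq0 vi ni)) => x.
  by case: (v x) => p q /= -> ->.
have alg (d1 d2 d3 d4 d5 d6 d7 d8 x1 x2 x3 x4 x5 x6 x7 x8 : R) :
    d1 = x1 -> d2 = x2 -> d3 = x3 -> d4 = x4 -> d5 = x5 -> d6 = x6 -> d7 = x7 -> d8 = x8 ->
    d1 + d2 + (d3 + d4) - a * (d5 + d6) = m * (d7 + d8) ->
    x5 <= a^-1 * (b * x7 + x1 + x3) -> x6 <= a^-1 * (b * x8 + x2 + x4) -> 0 < x7 + x8 -> - b <= m.
  move=> -> -> -> -> -> -> -> -> e.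
  exact: eigenvalue_bound.
exact: (alg _ _ _ _ _ _ _ _ _ _ _ _ _ _ _ _ (dotff _ _) (dotff _ _) (dotff _ _) (dotff _ _)
  (dotff _ _) (dotff _ _) (dotff _ _) (dotff _ _) E B1 B2 N0).
Qed.

Lemma lambda1_perron : lambda1 a S = - b.
Proof.
have [e1' e2'] : [set m | delta_eigenvalue a S m /\ forall k, delta_eigenvalue a S k -> m <= k] (lambda1 a S).
  by apply: xgetPex; exists (- b); split; [exact: eigenvalue_perron|exact: eigenvalue_ge].
by apply: le_anti; rewrite e2'//=; [exact: eigenvalue_ge|exact: eigenvalue_perron].
Qed.

End LowestEigenvalue.

(** * Unit-speed arcs *)

Section SmoothCurves.
Variable R : realType.
Implicit Types (c : R -> R * R) (x y v w : R * R) (s t : R).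

Lemma derive_fst_curve c t (u : R) : differentiable c t ->
  'D_u (fun r => (c r).1) t = ('D_u c t).1.
Proof.
move=> dc; have h : derivable c t u by exact: diff_derivable.
apply: cvg_lim => //.
have hf : fst @ nbhs ('D_u c t) --> ('D_u c t).1 by exact: cvg_fst.
exact: (cvg_comp _ _ h hf).
Qed.

Lemma derive_snd_curve c t (u : R) : differentiable c t ->
  'D_u (fun r => (c r).2) t = ('D_u c t).2.
Proof.
move=> dc; have h : derivable c t u by exact: diff_derivable.
apply: cvg_lim => //.
have hf : snd @ nbhs ('D_u c t) --> ('D_u c t).2 by exact: cvg_snd.
exact: (cvg_comp _ _ h hf).
Qed.

Lemma smooth_curveP c : smooth c <-> smooth (fun t => (c t).1) /\ smooth (fun t => (c t).2).
Proof.
split=> [sc|[s1 s2] s x].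
  have d1 (g : R -> R * R) (x : R) : differentiable g x ->
      differentiable (fun t => (g t).1) x /\ differentiable (fun t => (g t).2) x.
    move=> dg; have h : derivable g x 1 by exact: diff_derivable.
    split; apply/derivable1_diffP; apply: cvgP.
      have hf : fst @ nbhs ('D_1 g x) --> ('D_1 g x).1 by exact: cvg_fst.
      exact: (cvg_comp _ _ h hf).
    have hf : snd @ nbhs ('D_1 g x) --> ('D_1 g x).2 by exact: cvg_snd.
    exact: (cvg_comp _ _ h hf).
  have E (vs : seq R) : foldr (fun u g => 'D_u g) (fun t => (c t).1) vs =
        (fun t => (foldr (fun u g => 'D_u g) c vs t).1) /\
      foldr (fun u g => 'D_u g) (fun t => (c t).2) vs =
        (fun t => (foldr (fun u g => 'D_u g) c vs t).2).
    elim: vs => // u vs [ih1 ih2] /=; rewrite ih1 ih2; split; apply/funext => t.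
      by rewrite derive_fst_curve//; exact: sc.
    by rewrite derive_snd_curve//; exact: sc.
  by split=> vs x; [rewrite (E vs).1|rewrite (E vs).2]; have [] := d1 _ _ (sc vs x).
have -> : foldr (fun u g => 'D_u g) c s = (fun t =>
    (foldr (fun u g => 'D_u g) (fun t : R => (c t).1) s t, foldr (fun u g => 'D_u g) (fun t : R => (c t).2) s t)).
  elim: s {x} => [|u s ih] /=; first by apply/funext => t /=; case: (c t).
  rewrite ih; apply/funext => t.
  set g := (fun t => (_, _)); have dg : differentiable g t.
    by apply: differentiable_pair; [exact: s1|exact: s2].
  by rewrite [LHS]surjective_pairing -derive_fst_curve// -derive_snd_curve.
by apply: differentiable_pair; [exact: s1|exact: s2].
Qed.

Definition dotv v w : R := v.1 * w.1 + v.2 * w.2.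

Lemma smooth_dotv_curve c v : smooth c -> smooth (fun t => dotv v (c t)).
Proof.
by move=> /smooth_curveP [s1 s2]; apply: smoothD; apply: smoothM => //; exact: smooth_cst.
Qed.

Lemma derive_dotv_curve c v t : smooth c ->
  'D_1 (fun t => dotv v (c t)) t = dotv v ('D_1 c t).
Proof.
move=> sc; have [s1 s2] := (smooth_curveP c).1 sc.
have d1 := smooth_differentiable t s1; have d2 := smooth_differentiable t s2.
have dc : differentiable c t by exact: (sc [::]).
have E1 : 'D_1 (fun t => v.1 * (c t).1) t = v.1 * ('D_1 c t).1.
  by rewrite -derive_fst_curve//; exact: (deriveZ v.1 (diff_derivable d1)).
have E2 : 'D_1 (fun t => v.2 * (c t).2) t = v.2 * ('D_1 c t).2.
  by rewrite -derive_snd_curve//; exact: (deriveZ v.2 (diff_derivable d2)).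
rewrite /dotv -E1 -E2; apply: deriveD; apply: diff_derivable.
  by apply: smooth_differentiable; apply: smoothM => //; exact: smooth_cst.
by apply: smooth_differentiable; apply: smoothM => //; exact: smooth_cst.
Qed.

Lemma mvt_smooth (f : R -> R) s t : smooth f -> s <= t ->
  exists2 r, s <= r <= t & f t - f s = 'D_1 f r * (t - s).
Proof.
move=> sf st.
have [||r rst E] := @MVT_segment R f ('D_1 f) s t st.
- move=> x _; split; [|by []].
  by apply: diff_derivable; exact: smooth_differentiable.
- by apply: continuous_subspaceT; exact: smooth_continuous.
by exists r => //; move: rst; rewrite in_itv.
Qed.

Lemma dotv_CS v w : dotv v w ^+ 2 <= esq v * esq w.
Proof.
rewrite -subr_ge0; have -> : esq v * esq w - dotv v w ^+ 2 = (v.1 * w.2 - v.2 * w.1) ^+ 2.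
  by rewrite /esq /dotv; ring.
exact: sqr_ge0.
Qed.

Lemma enorm_sq v : enorm v ^+ 2 = esq v.
Proof. by rewrite sqr_sqrtr// esq_ge0. Qed.

Lemma enorm_ge0 v : 0 <= enorm v.
Proof. exact: sqrtr_ge0. Qed.

Lemma enorm_gt0 v : v != 0 -> 0 < enorm v.
Proof.
move=> v0; rewrite sqrtr_gt0 lt_neqAle addr_ge0 ?sqr_ge0// andbT eq_sym.
by rewrite paddr_eq0 ?sqr_ge0// !sqrf_eq0 -xpair_eqE -surjective_pairing.
Qed.

End SmoothCurves.

Section UnitSpeed.
Variable R : realType.
Implicit Types (v w : R * R) (s t : R).
Variables (gam : R -> R * R) (l : R).
Hypothesis l0 : 0 < l.
Hypothesis sgam : smooth gam.
Hypothesis speed : {in `[0, l], forall t, enorm ('D_1 gam t) = 1}.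

Let unit t : 0 <= t <= l -> esq ('D_1 gam t) = 1.
Proof. by move=> tl; rewrite -enorm_sq speed ?expr1n// in_itv. Qed.

Lemma smooth_curve_continuous : continuous gam.
Proof. by move=> t; apply: differentiable_continuous; exact: (sgam [::]). Qed.

(** The mean value theorem fails for plane curves but holds for their product with a fixed
    vector. *)
Lemma mvt_dotv v s t : s <= t -> exists2 r, s <= r <= t &
  dotv v (gam t - gam s) = dotv v ('D_1 gam r) * (t - s).
Proof.
move=> st; have [r rst E] := mvt_smooth (smooth_dotv_curve v sgam) st.
exists r => //; rewrite -derive_dotv_curve// -E /dotv /=; ring.
Qed.

(** The mean value theorem in the direction of the chord itself, followed by Cauchy-Schwarz with the
    unit velocity. *)
Lemma arc_ub s t : 0 <= s <= l -> 0 <= t <= l -> esq (gam s - gam t) <= (s - t) ^+ 2.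
Proof.
wlog st : s t / s <= t => [H sl tl|sl tl].
  have [st|ts] := leP s t; first exact: H.
  by rewrite esq_subC -[(s - t) ^+ 2]sqrrN opprB; apply: H => //; exact: ltW.
rewrite esq_subC -[(s - t) ^+ 2]sqrrN opprB; set v := gam t - gam s.
have [r /andP[sr rt] E] := mvt_dotv v st.
have rl : 0 <= r <= l by case/andP: sl tl => ? _ /andP[_ ?]; apply/andP; split; lra.
have : dotv v v ^+ 2 <= esq v * (t - s) ^+ 2.
  rewrite [dotv v v]E exprMn ler_wpM2r ?sqr_ge0//.
  by have := dotv_CS v ('D_1 gam r); rewrite unit// mulr1.
have -> : dotv v v = esq v by rewrite /dotv /esq; ring.
have [->|v0] := eqVneq (esq v) 0; first by rewrite sqr_ge0.
by rewrite expr2 ler_pM2l// lt_neqAle eq_sym v0 esq_ge0.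
Qed.

Let lip_speed : exists2 M, 0 < M & forall r t, 0 <= r <= l -> 0 <= t <= l ->
  esq ('D_1 gam r - 'D_1 gam t) <= M * (r - t) ^+ 2.
Proof.
have [s1 s2] := (smooth_curveP gam).1 sgam.
have key (f : R -> R) : smooth f -> exists2 M, 0 <= M & forall r t, 0 <= r <= l -> 0 <= t <= l ->
    ('D_1 f r - 'D_1 f t) ^+ 2 <= M * (r - t) ^+ 2.
  move=> sf; have sf' := smooth_derive (1 : R) sf; have sf2 := smooth_derive (1 : R) sf'.
  have [|m _ Hm] := @EVT_max R (fun r => ('D_1 ('D_1 f) r) ^+ 2) 0 l (ltW l0).
    apply: continuous_subspaceT; apply: smooth_continuous; exact: smoothX.
  exists ('D_1 ('D_1 f) m ^+ 2); first exact: sqr_ge0.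
  have aux r t : 0 <= r <= l -> 0 <= t <= l -> r <= t ->
      ('D_1 f t - 'D_1 f r) ^+ 2 <= 'D_1 ('D_1 f) m ^+ 2 * (t - r) ^+ 2.
    move=> /andP[r0 rl] /andP[t0 tl] rt; have [q /andP[rq qt] ->] := mvt_smooth sf' rt.
    have ql : q \in `[0, l] by rewrite in_itv/= (le_trans r0 rq) (le_trans qt tl).
    by rewrite exprMn; apply: ler_wpM2r (Hm q ql); exact: sqr_ge0.
  move=> r t rl tl; have [rt|tr] := leP r t; last by apply: aux => //; exact: ltW.
  by rewrite -[leLHS]sqrrN -[(r - t) ^+ 2]sqrrN !opprB; exact: aux.
have [M1 M10 H1] := key _ s1; have [M2 M20 H2] := key _ s2.
exists (M1 + M2 + 1); first by rewrite ltr_wpDl// addr_ge0.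
move=> r t rl tl; have := H1 r t rl tl; have := H2 r t rl tl.
have dg x : differentiable gam x by exact: (sgam [::]).
rewrite !derive_fst_curve// !derive_snd_curve// => h1 h2.
rewrite !mulrDl mul1r /esq /=; apply: ler_wpDr; first exact: sqr_ge0.
exact: lerD.
Qed.

Hypothesis gam_inj : {in `[0, l] &, injective gam}.

(* Nearby points are controlled by the almost constant velocity; pairs at distance at
   least [d] form a compact set. *)
Lemma arc_lb : exists2 c, 0 < c & forall s t, 0 <= s <= l -> 0 <= t <= l ->
  c ^+ 2 * (s - t) ^+ 2 <= esq (gam s - gam t).
Proof.
have [M M0 HM] := lip_speed.
(* For [(s - t)^2 <= 1/M] the velocities between [s] and [t] differ by at most 1 in norm from the
   unit velocity at [s], so their inner product with it is at least [1/2]. *)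
pose e : R := M^-1; have e0 : 0 < e by rewrite invr_gt0.
have near_lb s t : 0 <= s <= l -> 0 <= t <= l -> (s - t) ^+ 2 <= e ->
    1 / 4 * (s - t) ^+ 2 <= esq (gam s - gam t).
  wlog st : s t / s <= t => [H sl tl|sl tl].
    have [st|ts] := leP s t; first exact: H.
    by rewrite esq_subC -[(s - t) ^+ 2]sqrrN opprB; apply: H => //; exact: ltW.
  rewrite esq_subC -[(s - t) ^+ 2]sqrrN opprB => d.
  have [r /andP[sr rt] E] := mvt_dotv ('D_1 gam s) st.
  have rl : 0 <= r <= l by case/andP: sl tl => ? _ /andP[_ ?]; apply/andP; split; lra.
  have h1 : esq ('D_1 gam s - 'D_1 gam r) <= 1.
    apply: (le_trans (HM s r sl rl)); rewrite -[leRHS](divff (lt0r_neq0 M0)).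
    rewrite ler_pM2l//; apply: le_trans d; rewrite -[(s - r) ^+ 2]sqrrN opprB.
    by rewrite lerXn2r ?nnegrE//; lra.
  have h2 : 1 / 2 <= dotv ('D_1 gam s) ('D_1 gam r).
    have u1 := unit sl; have u2 := unit rl; move: h1 u1 u2.
    rewrite /esq /dotv /=; move: ('D_1 gam s) ('D_1 gam r) => [p1 p2] [q1 q2] /=.
    nra.
  have h3 := dotv_CS ('D_1 gam s) (gam t - gam s).
  rewrite unit// mul1r E exprMn in h3; apply: le_trans h3.
  rewrite ler_wpM2r ?sqr_ge0//.
  have -> : 1 / 4 = (1 / 2) ^+ 2 :> R by field.
  by rewrite lerXn2r ?nnegrE//; lra.
(* The second term is positive on the diagonal and injectivity makes the first one positive off it,
   so [G] has a positive minimum on the whole square. Where [(s - t)^2 > e] the second term is 0 and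
   the minimum bounds the chord. *)
pose G (p : R * R) := esq (gam p.1 - gam p.2) + Num.max 0 (e - (p.1 - p.2) ^+ 2).
have cG : continuous G.
  have c1 : continuous (fun p : R * R => gam p.1).
    by move=> p; apply: continuous_comp; [exact: cvg_fst|exact: smooth_curve_continuous].
  have c2 : continuous (fun p : R * R => gam p.2).
    by move=> p; apply: continuous_comp; [exact: cvg_snd|exact: smooth_curve_continuous].
  move=> p; apply: cvgD.
    apply: (@continuous_comp _ _ _ (fun p : R * R => gam p.1 - gam p.2) (@esq R)).
      by apply: cvgB; [exact: c1|exact: c2].
    exact: continuous_esq.
  apply: (@continuous_max _ _ (fun=> 0) (fun x : R * R => e - (x.1 - x.2) ^+ 2) p).
    exact: cvg_cst.
  apply: cvgB; first exact: cvg_cst.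
  rewrite expr2; apply: cvgM; apply: cvgB; try exact: cvg_fst; exact: cvg_snd.
have cI : compact (`[0, l] `*` `[0, l] : set (R * R)).
  by apply: compact_setX; exact: segment_compact.
have [|[p1 p2] pI Hp] := compact_EVT_min _ cI (continuous_subspaceT cG).
  by exists (0, 0); split; rewrite /= in_itv/= lexx ltW.
have Ip : (0 <= p1 <= l) /\ (0 <= p2 <= l) by move: pI; rewrite inE => -[/=]; rewrite !in_itv.
have m0 : 0 < G (p1, p2).
  rewrite /G /=; have [->|ne] := eqVneq p1 p2.
    by rewrite !subrr expr0n/= subr0 ltr_wpDl ?esq_ge0// lt_max e0 orbT.
  rewrite ltr_wpDr// ?le_max ?lexx// lt_neqAle esq_ge0 andbT eq_sym.
  rewrite paddr_eq0 ?sqr_ge0// !sqrf_eq0 -xpair_eqE -surjective_pairing subr_eq0.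
  by apply: contra_neq ne; apply: gam_inj; rewrite in_itv/=; case: Ip.
set m := G (p1, p2) in m0 Hp.
pose k := Num.min (1 / 4) (m / l ^+ 2).
have l20 : 0 < l ^+ 2 by rewrite exprn_gt0.
have k0 : 0 < k by rewrite lt_min !divr_gt0.
exists (Num.sqrt k); first by rewrite sqrtr_gt0.
move=> s t sl tl; rewrite sqr_sqrtr ?(ltW k0)//.
have [d|d] := leP ((s - t) ^+ 2) e.
  by apply: le_trans (near_lb s t sl tl d); rewrite ler_wpM2r ?sqr_ge0// ge_min lexx.
have := Hp (s, t); rewrite inE => /(_ (conj _ _)); rewrite /= !in_itv => /(_ sl tl).
rewrite {1}/G /= max_l ?addr0; last by rewrite subr_le0 ltW.
apply: le_trans; apply: (@le_trans _ _ (m / l ^+ 2 * l ^+ 2)); last by rewrite divfK// gt_eqF.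
apply: ler_pM; rewrite ?(ltW k0) ?sqr_ge0//; first by rewrite ge_min lexx orbT.
case/andP: sl tl => s0 sl /andP[t0 tl].
by rewrite ler_sqr_norm// (ger0_norm (ltW l0)) ler_norml; apply/andP; split; lra.
Qed.

End UnitSpeed.

Section Segments.
Variable R : realType.
Implicit Types (A B P Q v w x : R * R) (s t l : R).

Lemma segmentP A B x : segment A B x <->
  exists2 t, 0 <= t <= 1 & x = A + t *: (B - A).
Proof.
have E t : (1 - t) *: A + t *: B = A + t *: (B - A).
  by rewrite scalerBl scale1r scalerBr addrAC addrA.
split=> [[t + <-]|[t t01 ->]]; last by exists t => //=; rewrite in_itv.
by rewrite /= in_itv/= => t01; exists t.
Qed.

Lemma segmentC A B : segment A B = segment B A.
Proof.
by apply/seteqP; split=> _ [t + <-]; rewrite /= in_itv/= => /andP[t0 t1]; exists (1 - t);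
  rewrite ?subKr 1?addrC//= in_itv/=; apply/andP; split; lra.
Qed.

Lemma esqZ (k : R) v : esq (k *: v) = k ^+ 2 * esq v.
Proof. by rewrite /esq /=  mulrDr -!exprMn. Qed.

Lemma esq_eq0 v : esq v = 0 -> v = 0.
Proof.
move/eqP; rewrite paddr_eq0 ?sqr_ge0// !sqrf_eq0.
by move=> /andP[/eqP h1 /eqP h2]; rewrite [v]surjective_pairing h1 h2.
Qed.

Definition seg_curve A B t : R * R := A + (t / enorm (A - B)) *: (B - A).

Lemma seg_curve0 A B : seg_curve A B 0 = A.
Proof. by rewrite /seg_curve mul0r scale0r addr0. Qed.

Lemma seg_curveL A B : A != B -> seg_curve A B (enorm (A - B)) = B.
Proof.
move=> AB; have L0 : 0 < enorm (A - B) by rewrite enorm_gt0// subr_eq0.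
by rewrite /seg_curve divff ?gt_eqF// scale1r addrC subrK.
Qed.

Lemma derive_affine (a k t : R) : 'D_1 (fun r : R => a + r * k) t = k.
Proof.
have H : is_derive t (1 : R) (fun r : R => a + r * k) k.
  by apply: (is_derive_quad (C := 0)) => h; rewrite mul0r normr_le0; apply/eqP; ring.
by have [] := H.
Qed.

Lemma seg_curve_arclength A B : A != B ->
  arclength_param (segment A B) (seg_curve A B) (enorm (A - B)).
Proof.
move=> AB; set L := enorm (A - B).
have L0 : 0 < L by rewrite enorm_gt0// subr_eq0.
have LN : L != 0 by rewrite gt_eqF.
have sq : esq (B - A) = L ^+ 2 by rewrite esq_subC -enorm_sq.
have sc : smooth (seg_curve A B).
  apply/smooth_curveP; split; rewrite /seg_curve /=.
    apply: smoothD; first exact: smooth_cst.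
    apply: smoothM; last exact: smooth_cst.
    by apply: smoothM; [exact: smooth_id|exact: smooth_cst].
  apply: smoothD; first exact: smooth_cst.
  apply: smoothM; last exact: smooth_cst.
  by apply: smoothM; [exact: smooth_id|exact: smooth_cst].
have esqs s t : esq (seg_curve A B s - seg_curve A B t) = (s - t) ^+ 2.
  have -> : seg_curve A B s - seg_curve A B t = ((s - t) / L) *: (B - A).
    by rewrite /seg_curve opprD addrACA subrr add0r -scalerBl -mulrBl.
  by rewrite esqZ sq -exprMn divfK.
split=> //.
- move=> t _; have dc : differentiable (seg_curve A B) t by exact: (sc [::]).
  suff E : 'D_1 (seg_curve A B) t = L^-1 *: (B - A).
    by rewrite E /enorm -[_ + _]/(esq (L^-1 *: (B - A))) esqZ sq -exprMn mulVf// expr1n sqrtr1.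
  rewrite [LHS]surjective_pairing -derive_fst_curve// -derive_snd_curve//.
  have key (p q : R) : 'D_1 (fun r : R => p + r / L * q) t = L^-1 * q.
    have -> : (fun r : R => p + r / L * q) = (fun r => p + r * (L^-1 * q)).
      by apply/funext => r; rewrite mulrA.
    exact: derive_affine.
  by congr pair; exact: key.
- move=> s t _ _ E; have := esqs s t; rewrite E subrr /esq /= expr0n/= addr0 => /esym/eqP.
  by rewrite sqrf_eq0 subr_eq0 => /eqP.
apply/seteqP; split=> x.
  move=> [t + <-]; rewrite /= in_itv/= => /andP[t0 tL]; apply/segmentP; exists (t / L) => //.
  by rewrite divr_ge0 ?(ltW L0)//= ler_pdivrMr// mul1r.
move=> /segmentP [t /andP[t0 t1] ->]; exists (t * L) => /=.
  by rewrite in_itv/= mulr_ge0 ?(ltW L0)//= ler_piMl ?(ltW L0).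
by rewrite /seg_curve mulfK.
Qed.

(** [arc_param] may return any unit-speed parametrization of the segment. The component along the
    normal [K] is constant, so the velocity inside is parallel to [D]; Lagrange's identity turns
    unit speed into the size of the component along [D], up to a sign that squaring removes. *)
Lemma segment_arc_isometry A B (gam : R -> R * R) l : A != B ->
  arclength_param (segment A B) gam l ->
  l = enorm (A - B) /\
  forall s t, 0 <= s <= l -> 0 <= t <= l -> esq (gam s - gam t) = (s - t) ^+ 2.
Proof.
move=> AB [l0 sg speed inj img]; pose D := B - A; set N := esq D.
have N0 : 0 < N.
  rewrite lt_neqAle esq_ge0 andbT eq_sym; apply: contra_neq AB => /esq_eq0 /eqP.
  by rewrite subr_eq0 => /eqP.
pose K : R * R := (- D.2, D.1).
have lagrange w : dotv D w ^+ 2 + dotv K w ^+ 2 = N * esq w.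
  by rewrite /N /esq /dotv /=; ring.
have on_seg s : 0 <= s <= l -> exists2 r, 0 <= r <= 1 & gam s = A + r *: D.
  by move=> sl; apply/segmentP; rewrite -img; exists s => //=; rewrite in_itv.
have flatK s : 0 <= s <= l -> dotv K (gam s) = dotv K A.
  by move=> /on_seg [r _ ->]; rewrite /dotv /K /= /GRing.scale /=; ring.
(* Restricted to interior points: the curve may leave the line of the segment outside [[0, l]], and
   the derivative is two-sided. *)
have dK s : 0 < s < l -> dotv K ('D_1 gam s) = 0.
  move=> sl; rewrite -derive_dotv_curve//.
  rewrite -[RHS](derive_cst (dotv K A) s 1); apply: near_eq_derive.
  have : s \in `]0, l[ by rewrite in_itv.
  move=> /near_in_itvoo; apply: filterS => r; rewrite in_itv/= => /andP[r0 rl].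
  by rewrite flatK// !ltW.
have iso s t : 0 <= s <= l -> 0 <= t <= l -> s < t -> esq (gam s - gam t) = (s - t) ^+ 2.
  move=> sl tl st.
  have [||r] := @MVT R (fun t => dotv D (gam t)) (fun t => dotv D ('D_1 gam t)) s t st.
  - move=> x _; split; last exact: derive_dotv_curve.
    by apply: diff_derivable; apply: smooth_differentiable; exact: smooth_dotv_curve.
  - by apply: continuous_subspaceT; apply: smooth_continuous; exact: smooth_dotv_curve.
  rewrite in_itv/= => /andP[sr rt] E.
  have r1 : 0 < r < l by case/andP: sl tl => ? _ /andP[_ ?]; apply/andP; split; lra.
  have u : esq ('D_1 gam r) = 1.
    by case/andP: r1 => ? ?; rewrite -enorm_sq speed ?expr1n// in_itv/= !ltW.
  have h1 := lagrange ('D_1 gam r); rewrite dK// u expr0n/= addr0 mulr1 in h1.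
  have h2 := lagrange (gam t - gam s).
  have dotB v p q : dotv v (p - q) = dotv v p - dotv v q by rewrite /dotv /=; ring.
  rewrite !dotB E (flatK s)// (flatK t)// subrr expr0n/= addr0 exprMn h1 in h2.
  have := mulfI (lt0r_neq0 N0) h2; rewrite esq_subC => <-.
  by rewrite -[(t - s) ^+ 2]sqrrN opprB.
have iso2 s t : 0 <= s <= l -> 0 <= t <= l -> esq (gam s - gam t) = (s - t) ^+ 2.
  move=> sl tl; have [st|ts|->] := ltgtP s t; first exact: iso.
    by rewrite esq_subC iso// -[(t - s) ^+ 2]sqrrN opprB.
  by rewrite !subrr /esq /= expr0n/= addr0.
split=> //.
have ends : 0 <= (0 : R) <= l /\ 0 <= l <= l by rewrite !lexx (ltW l0).
have [a /= al Ea] : (gam @` `[0, l]) A.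
  by rewrite img; apply/segmentP; exists 0; rewrite ?lexx ?ler01// scale0r addr0.
have [b /= bl Eb] : (gam @` `[0, l]) B.
  rewrite img; apply/segmentP; exists 1; first by rewrite ler01 lexx.
  by rewrite scale1r addrC subrK.
rewrite in_itv/= in al; rewrite in_itv/= in bl.
have E1 : N = (b - a) ^+ 2 by rewrite -iso2// Ea Eb.
have NL : N = enorm (A - B) ^+ 2 by rewrite enorm_sq esq_subC.
have N_le : N <= l ^+ 2.
  rewrite E1 ler_sqr_norm// (ger0_norm (ltW l0)) ler_norml.
  by case/andP: al bl => ? ? /andP[? ?]; apply/andP; split; lra.
have le_N : l ^+ 2 <= N.
  have := iso2 _ _ ends.2 ends.1; rewrite subr0 => <-.
  have [p /andP[p0 p1] ->] := on_seg _ ends.2; have [q /andP[q0 q1] ->] := on_seg _ ends.1.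
  have -> : A + p *: D - (A + q *: D) = (p - q) *: D.
    by rewrite opprD addrACA subrr add0r -scalerBl.
  rewrite esqZ -/N ler_piMl ?(ltW N0)// -[leRHS](expr1n _ 2) ler_sqr_norm// normr1 ler_norml.
  by apply/andP; split; lra.
have /eqP : l ^+ 2 = enorm (A - B) ^+ 2 by rewrite -NL; apply: le_anti; rewrite le_N N_le.
by rewrite eqrXn2 ?(ltW l0) ?enorm_ge0// => /eqP.
Qed.

(** The equality case of the triangle inequality [|w| <= |v| + |w - v|]: expanding, the squared norm
    of [l v - t w] is at most 0. *)
Lemma straight_point v w t l : 0 < l -> 0 <= t <= l -> esq w = l ^+ 2 ->
  esq v <= t ^+ 2 -> esq (w - v) <= (l - t) ^+ 2 -> v = (t / l) *: w.
Proof.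
move=> l0 /andP[t0 tl] Ew Ev Ewv.
have E1 : esq (w - v) = l ^+ 2 - 2 * dotv w v + esq v by rewrite -Ew /esq /dotv /=; ring.
have E2 : esq (l *: v - t *: w) = l ^+ 2 * esq v - 2 * l * t * dotv w v + t ^+ 2 * l ^+ 2.
  by rewrite -{2}Ew /esq /dotv /= /GRing.scale /=; ring.
have z : esq (l *: v - t *: w) = 0.
  apply/eqP; rewrite eq_le esq_ge0 andbT E2; rewrite E1 in Ewv.
  move: (esq v) (dotv w v) Ev Ewv => e d Ev Ewv.
  have h1 : l * t * (e + 2 * l * t - t ^+ 2) <= l * t * (2 * d).
    by apply: ler_wpM2l; [rewrite mulr_ge0// ltW|lra].
  have h2 : l * (l - t) * (e - t ^+ 2) <= 0.
    by apply: mulr_ge0_le0; [rewrite mulr_ge0 ?subr_ge0// ltW|rewrite subr_le0].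
  rewrite -(addr0 (_ + _)).
  have -> : l ^+ 2 * e - 2 * l * t * d + t ^+ 2 * l ^+ 2 + 0 =
    l * (l - t) * (e - t ^+ 2) + (l * t * (e + 2 * l * t - t ^+ 2) - l * t * (2 * d)) by ring.
  by rewrite -[leRHS]addr0; apply: lerD => //; rewrite subr_le0.
move/esq_eq0/eqP: z; rewrite subr_eq0 => /eqP E.
by rewrite mulrC -scalerA -E scalerA mulVf ?scale1r// gt_eqF.
Qed.

(** A chord as long as the whole arc must join the two ends of the parameter interval, and every
    intermediate point is then in the situation of [straight_point]. *)
Lemma arc_straight (S : set (R * R)) (gam : R -> R * R) l p q : arclength_param S gam l ->
  0 <= p <= l -> 0 <= q <= l -> esq (gam p - gam q) = l ^+ 2 -> S = segment (gam p) (gam q).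
Proof.
move=> [l0 sg speed inj img].
wlog pq : p q / p <= q => [H pl ql E|pl ql E].
  have [pq|qp] := leP p q; first exact: H.
  by rewrite segmentC; apply: H => //; rewrite ?(ltW qp)// esq_subC.
have ub := arc_ub sg speed.
have [p0 ql'] : p = 0 /\ q = l.
  have := ub _ _ pl ql; rewrite E -[(p - q) ^+ 2]sqrrN opprB.
  case/andP: pl ql => p0 _ /andP[_ ql].
  by rewrite ler_sqr ?nnegrE ?subr_ge0 ?(ltW l0)// => h; split; lra.
rewrite {}p0 {}ql' in E *.
have ends : 0 <= (0 : R) <= l /\ 0 <= l <= l by rewrite !lexx (ltW l0).
have key t : 0 <= t <= l -> gam t = gam 0 + (t / l) *: (gam l - gam 0).
  move=> tl; apply/eqP; rewrite addrC -subr_eq; apply/eqP; apply: straight_point => //.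
  - by rewrite esq_subC.
  - by have := ub _ _ tl ends.1; rewrite subr0.
  - rewrite opprB addrA subrK.
    by apply: ub => //; exact: ends.2.
rewrite -img; apply/seteqP; split=> x.
  move=> [t + <-]; rewrite /= in_itv/= => tl; apply/segmentP; exists (t / l); last exact: key.
  by case/andP: tl => t0 tl; rewrite divr_ge0 ?(ltW l0)//= ler_pdivrMr// mul1r.
move=> /segmentP [t /andP[t0 t1] ->]; exists (t * l) => /=.
  by rewrite in_itv/= mulr_ge0 ?(ltW l0)//= ler_piMl ?(ltW l0).
rewrite key ?mulfK ?gt_eqF//.
by rewrite mulr_ge0 ?(ltW l0)//= ler_piMl ?(ltW l0).
Qed.

End Segments.

(** * Segments are smooth open arcs *)

Section ConvexSublevel.
Variable R : realType.
Variables (rho : R * R -> R) (p0 : R * R).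
Hypothesis srho : smooth rho.
Hypothesis convex_rho : forall x y s, 0 <= s <= 1 ->
  rho (x + s *: (y - x)) <= (1 - s) * rho x + s * rho y.
Hypothesis rho0 : rho p0 < 0.

Let Om : set (R * R) := [set x | rho x < 0].

Let crho : continuous rho. Proof. exact: smooth_continuous. Qed.

Let Om_open : open Om.
Proof. by apply: (@open_comp _ _ rho [set y | y < 0]) => [x _|]; [exact: crho|exact: open_lt]. Qed.

Let Om_convex x y s : 0 <= s <= 1 -> Om x -> Om y -> Om (x + s *: (y - x)).
Proof.
move=> /[dup] s01 /andP[s0 s1] /= rx ry; apply: (le_lt_trans (convex_rho x y s01)).
have [->|s10] := eqVneq s 1; first by rewrite subrr mul0r add0r mul1r.
rewrite -[ltRHS]addr0; apply: ltr_leD; last by rewrite mulr_ge0_le0// ltW.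
by rewrite pmulr_rlt0// subr_gt0 lt_neqAle s10.
Qed.

Let ray_continuous (x v : R * R) : continuous (fun s : R => x + s *: v).
Proof.
by move=> s; apply: cvgD; [exact: cvg_cst|apply: cvgZ; [exact: cvg_id|exact: cvg_cst]].
Qed.

Let Om_connected : connected Om.
Proof.
have -> : Om = \bigcup_(x in Om) ((fun s : R => p0 + s *: (x - p0)) @` `[0, 1]).
  apply/seteqP; split=> [x Ox|x [y Oy [s /= + <-]]].
    exists x => //; exists 1; first by rewrite /= in_itv/= lexx ler01.
    by rewrite scale1r addrC subrK.
  by rewrite in_itv/= => s01; exact: Om_convex.
apply: bigcup_connected.
  exists p0 => x _; exists 0; first by rewrite /= in_itv/= lexx ler01.
  by rewrite scale0r addr0.
move=> x _; apply: connected_continuous_connected; first exact: segment_connected.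
by apply: continuous_subspaceT; exact: ray_continuous.
Qed.

Let Om_simply_connected : simply_connected Om.
Proof.
split=> [|c cc cOm c01]; first exact: Om_connected.
have Oc t : 0 <= t <= 1 -> Om (c t) by move=> t01; apply: cOm; exists t => //=; rewrite in_itv.
have z01 : 0 <= (0 : R) <= 1 by rewrite lexx ler01.
exists (fun p => c p.1 + p.2 *: (c 0 - c p.1)); split.
- apply/subspace_continuousP => p [/= p1 p2].
  have c1 : c x.1 @[x --> within (`[0, 1] `*` `[0, 1]) (nbhs p)] --> c p.1.
    have cp := (@subspace_continuousP _ _ _ _).1 cc p.1 p1.
    apply: cvg_trans cp => W hW.
    have hf : fst @ nbhs p --> p.1 by exact: cvg_fst.
    have h : nbhs p.1 (fun y => `[0, 1]%classic y -> W (c y)) := hW.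
    have h' : nbhs p (fun x : R * R => (`[0, 1] `*` `[0, 1])%classic x -> W (c x.1)).
      by apply: (@filterS _ (nbhs p) _ _ _ _ (hf _ h)) => x /= hx [x1 _]; exact: hx.
    exact: h'.
  apply: cvgD; first exact: c1.
  apply: cvgZ; last by apply: cvgB; [exact: cvg_cst|exact: c1].
  by apply: cvg_within_filter; exact: cvg_snd.
- move=> _ [[t s] [/= + + <-]]; rewrite !in_itv/= => t01 s01.
  by apply: Om_convex => //; exact: Oc.
- by move=> t _; rewrite scale0r addr0.
- by move=> t _; rewrite scale1r addrC subrK.
- by move=> s _; rewrite -c01 subrr scaler0 addr0.
Qed.

(** By convexity the difference quotients towards the centre are at most [rho p0]. This is the
    nonvanishing gradient asked of a smooth boundary. *)
Let derive_to_center p : rho p = 0 -> 'D_(p0 - p) rho p < 0.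
Proof.
move=> rp; set v := p0 - p; pose f (s : R) := rho (p + s *: v).
have df : is_derive (0 : R) (1 : R) f ('D_v rho p).
  have := @is_derive_line _ _ rho p v 0; rewrite scale0r addr0; apply.
  exact: smooth_differentiable.
have [d1 E] := df; apply: le_lt_trans rho0; rewrite -E.
have h : h^-1 *: ((f \o shift (0 : R)) (h *: (1 : R)) - f 0) @[h --> 0^'] --> 'D_1 f 0 by exact: d1.
have h' := cvg_dnbhs_at_right h.
apply: (ler_cvg_to h' (cvg_cst (rho p0))).
near=> s; have s0 : 0 < s by near: s; exact: nbhs_right_gt.
have s1 : s <= 1 by near: s; apply: nbhs_right_le.
rewrite /= /shift /f addr0 scale0r addr0 rp subr0 [s *: 1]mulr1 /GRing.scale/=.
rewrite ler_pdivrMl//; apply: le_trans (convex_rho p p0 _) _; first by rewrite (ltW s0).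
by rewrite rp mulr0 add0r.
Unshelve. all: by end_near. Qed.

Let zero_boundary p : rho p = 0 -> boundary Om p.
Proof.
move=> rp; split; last first.
  by move=> /interior_subset; rewrite /Om /= rp ltxx.
move=> U pU.
have c1 : p + s *: (p0 - p) @[s --> 0^'+] --> p.
  have h : p + s *: (p0 - p) @[s --> (0 : R)] --> p + (0 : R) *: (p0 - p).
    exact: ray_continuous.
  by rewrite scale0r addr0 in h; exact: cvg_at_right_filter.
have [s []] : exists s, Om (p + s *: (p0 - p)) /\ U (p + s *: (p0 - p)).
  apply: (@filter_ex _ (0^'+ : set_system R)).
  near=> s; split; last by near: s; exact: (c1 _ pU).
  have s0 : 0 < s by near: s; exact: nbhs_right_gt.
  have s1 : s <= 1 by near: s; apply: nbhs_right_le.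
  rewrite /Om /=; apply: le_lt_trans (convex_rho p p0 _) _; first by rewrite (ltW s0).
  by rewrite rp mulr0 add0r pmulr_rlt0.
by exists (p + s *: (p0 - p)).
Unshelve. all: by end_near. Qed.

(** A single convex [rho] describes the boundary near all of its points, and a loop contracts to its
    base point along straight lines, which stay in the convex set. *)
Lemma convex_sublevel_domain : bounded_set Om ->
  smooth_domain Om /\ forall p, rho p = 0 -> boundary Om p.
Proof.
move=> bOm; split; last exact: zero_boundary.
split; [by exists p0|exact: Om_open|exact: bOm|exact: Om_simply_connected|].
move=> p [clp nip]; exists rho; split=> //.
  exists (p0 - p); rewrite lt_eqF//; apply: derive_to_center; apply: le_anti.
  apply/andP; split; last first.
    by rewrite leNgt; apply/negP => rp; apply: nip; apply: open_nbhs_nbhs; split; [exact: Om_open|exact: rp].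
  have cl : closed [set x | rho x <= 0].
    apply: (@closed_comp _ _ rho [set y | y <= 0]) => [x _|]; first exact: crho.
    exact: closed_le.
  apply: cl; apply: closureS clp => x /=; exact: ltW.
by apply: (@nearW _ (nbhs p)).
Qed.

End ConvexSublevel.

Section FlatConvex.
Variable R : realType.
Implicit Types (x y : R).

(** [flat 0] is not convex on the line, but its product with [x] is convex, and it still vanishes
    for [x <= 0]. In [rho] below it keeps the boundary straight along the segment and bends it
    beyond the ends. *)
Definition theta x : R := x * flat 0 x.

Lemma theta_ge0 x : 0 <= theta x.
Proof.
rewrite /theta /flat; case: ltP => [x0|_]; last by rewrite mulr0.
by rewrite mulr_ge0 ?(ltW x0)// expr0 mul1r expR_ge0.
Qed.

Lemma theta_nonpos x : x <= 0 -> theta x = 0.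
Proof. by move=> x0; rewrite /theta /flat ltNge x0/= mulr0. Qed.

Lemma smooth_theta : smooth theta.
Proof. by apply: smoothM; [exact: smooth_id|exact: smooth_flat]. Qed.

(* The perspective [y e^(-1/y)] of the exponential lies above its tangents because
   [e^z >= 1 + z] for [z = 1/x - 1/y]. *)
Lemma theta_tangent x : exists k, forall y, theta x + k * (y - x) <= theta y.
Proof.
have [x0|x0] := ltP 0 x; last first.
  by exists 0 => y; rewrite theta_nonpos// mul0r addr0 theta_ge0.
have xn0 : x != 0 by rewrite gt_eqF.
exists (expR (- x^-1) * (1 + x^-1)) => y.
have -> : theta x + expR (- x^-1) * (1 + x^-1) * (y - x) = expR (- x^-1) * (y + y / x - 1).
  by rewrite /theta /flat x0 expr0 mul1r; field.
have [y0|y0] := ltP 0 y; last first.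
  rewrite theta_nonpos// mulr_ge0_le0 ?expR_ge0//.
  have : y / x <= 0 by rewrite mulr_le0_ge0// invr_ge0 ltW.
  by move: (y / x) => z; lra.
rewrite /theta /flat y0 expr0 mul1r.
have -> : expR (- y^-1) = expR (- x^-1) * expR (x^-1 - y^-1) by rewrite -expRD addKr.
rewrite mulrCA ler_wpM2l ?expR_ge0//.
have yn0 : y != 0 by rewrite gt_eqF.
have -> : y + y / x - 1 = y * (1 + (x^-1 - y^-1)) by field; rewrite xn0 yn0.
by rewrite ler_wpM2l ?(ltW y0)// expR_ge1Dx.
Qed.

Lemma theta_ge x : x - 1 <= theta x.
Proof.
have [x0|x0] := ltP 0 x; last by rewrite theta_nonpos//; lra.
rewrite /theta /flat x0 expr0 mul1r.
have -> : x - 1 = x * (1 - x^-1) by rewrite mulrBr mulr1 divff// gt_eqF.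
by rewrite ler_wpM2l ?(ltW x0)// expR_ge1Dx.
Qed.

Lemma theta_convex x y s : 0 <= s <= 1 ->
  theta ((1 - s) * x + s * y) <= (1 - s) * theta x + s * theta y.
Proof.
move=> /andP[s0 s1]; set z := _ + s * y; have [k Hk] := theta_tangent z.
have h1 : (1 - s) * (theta z + k * (x - z)) <= (1 - s) * theta x.
  by rewrite ler_wpM2l// subr_ge0.
have h2 : s * (theta z + k * (y - z)) <= s * theta y by rewrite ler_wpM2l.
apply: le_trans (lerD h1 h2); rewrite le_eqVlt; apply/orP; left; apply/eqP.
have -> : (1 - s) * (theta z + k * (x - z)) + s * (theta z + k * (y - z)) =
  theta z + k * ((1 - s) * x + s * y - z) by ring.
by rewrite -/z subrr mulr0 addr0.
Qed.

End FlatConvex.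

Lemma sqr_convex (R : realType) (x y s : R) : 0 <= s <= 1 ->
  ((1 - s) * x + s * y) ^+ 2 <= (1 - s) * x ^+ 2 + s * y ^+ 2.
Proof.
move=> /andP[s0 s1]; rewrite -subr_ge0.
have -> : (1 - s) * x ^+ 2 + s * y ^+ 2 - ((1 - s) * x + s * y) ^+ 2 =
  s * (1 - s) * (x - y) ^+ 2 by ring.
by rewrite mulr_ge0 ?sqr_ge0// mulr_ge0// subr_ge0.
Qed.

Section SegmentDomain.
Variable R : realType.
Variables P Q : R * R.
Hypothesis PQ : P != Q.

Let D := Q - P.
Let K : R * R := (- D.2, D.1).
Let N := esq D.

Let N0 : 0 < N.
Proof.
rewrite lt_neqAle esq_ge0 andbT eq_sym; apply: contra_neq PQ => /esq_eq0 /eqP.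
by rewrite subr_eq0 => /eqP.
Qed.

Let coord (v x : R * R) : R := dotv v (x - P) / N.

Let smooth_coord v : smooth (coord v).
Proof.
apply: smoothM; last exact: smooth_cst.
apply: smoothD; apply: smoothM; try exact: smooth_cst.
  by apply: smoothB; [exact: smooth_fst|exact: smooth_cst].
by apply: smoothB; [exact: smooth_snd|exact: smooth_cst].
Qed.

Let coord_affine v x y s : coord v (x + s *: (y - x)) = (1 - s) * coord v x + s * coord v y.
Proof. by rewrite /coord /dotv /= /GRing.scale /=; ring. Qed.

Let coord_decomp x : x = P + coord D x *: D + coord K x *: K.
Proof.
have NN : D.1 ^+ 2 + D.2 ^+ 2 != 0 by rewrite gt_eqF.
rewrite /coord /dotv /K /N /esq; move: NN; case: D => d1 d2 /= NN; case: x => x1 x2.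
by congr pair; rewrite /= /GRing.scale /=; field.
Qed.

(* A smoothed stadium [0 <= coord D <= 1], [0 <= coord K <= 2]. *)
Let rho x : R := theta (coord D x - 1) + theta (- coord D x) + (coord K x - 1) ^+ 2 - 1.

Let smooth_rho : smooth rho.
Proof.
apply: smoothB; last exact: smooth_cst.
apply: smoothD; first apply: smoothD.
- apply: (@smooth_comp R _ (@theta R) (fun x => coord D x - 1)); first exact: smooth_theta.
  by apply: smoothB; [exact: smooth_coord|exact: smooth_cst].
- by apply: (@smooth_comp R _ (@theta R) (fun x => - coord D x)); [exact: smooth_theta|apply: smoothN]; exact: smooth_coord.
- by apply: smoothX; apply: smoothB; [exact: smooth_coord|exact: smooth_cst].
Qed.

Let rho_convex x y s : 0 <= s <= 1 -> rho (x + s *: (y - x)) <= (1 - s) * rho x + s * rho y.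
Proof.
move=> s01; rewrite /rho !coord_affine.
move: (coord D x) (coord D y) (coord K x) (coord K y) => a1 a2 b1 b2.
have h1 := theta_convex (a1 - 1) (a2 - 1) s01.
have h2 := theta_convex (- a1) (- a2) s01.
have h3 := sqr_convex (b1 - 1) (b2 - 1) s01.
have E1 : (1 - s) * a1 + s * a2 - 1 = (1 - s) * (a1 - 1) + s * (a2 - 1) by ring.
have E2 : - ((1 - s) * a1 + s * a2) = (1 - s) * - a1 + s * - a2 by ring.
have E3 : (1 - s) * b1 + s * b2 - 1 = (1 - s) * (b1 - 1) + s * (b2 - 1) by ring.
rewrite E1 E2 E3; apply: le_trans (lerD (lerD (lerD h1 h2) h3) (lexx (-1))) _.
by rewrite le_eqVlt; apply/orP; left; apply/eqP; ring.
Qed.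

Let coord_at t u : coord D (P + t *: D + u *: K) = t /\ coord K (P + t *: D + u *: K) = u.
Proof.
have NN : D.1 ^+ 2 + D.2 ^+ 2 != 0 by rewrite gt_eqF.
rewrite /coord /dotv /K /N /esq; move: NN; case: D => d1 d2 /= NN.
by split; rewrite /= /GRing.scale /=; field.
Qed.

Let rho_center : rho (P + (1 / 2) *: D + 1 *: K) < 0.
Proof.
rewrite /rho; have [-> ->] := coord_at (1 / 2) 1.
by rewrite !theta_nonpos ?subrr ?expr0n/=; lra.
Qed.

Let rho_segment x : segment P Q x -> rho x = 0.
Proof.
move=> /segmentP [t /andP[t0 t1] ->]; rewrite -/D -[_ + t *: D]addr0 -(scale0r K).
rewrite /rho; have [-> ->] := coord_at t 0.
by rewrite !theta_nonpos; [ring|lra|lra].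
Qed.

Let rho_bounded : bounded_set [set x | rho x < 0].
Proof.
exists (`|P| + 3 * `|D| + 2 * `|K|); split; first exact: num_real.
move=> M HM x /= rx; apply: ltW; apply: le_lt_trans HM.
have h1 := theta_ge (coord D x - 1); have h2 := theta_ge (- coord D x).
have h3 := theta_ge0 (coord D x - 1); have h4 := theta_ge0 (- coord D x).
have h5 := sqr_ge0 (coord K x - 1).
(* [rho x < 0] leaves less than 1 for each [theta] term and at most 1 for the square;
   [theta y >= y - 1] then bounds the coordinate along [D]. *)
have b1 : `|coord D x| <= 3 by rewrite ler_norml; move: rx; rewrite /rho; lra.
have b2 : `|coord K x| <= 2.
  have : `|coord K x - 1| <= `|1 : R|.
    by rewrite -ler_sqr ?nnegrE// !real_normK ?num_real// expr1n; move: rx; rewrite /rho; lra.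
  by rewrite normr1 !ler_norml => /andP[h6 h7]; apply/andP; split; lra.
rewrite (coord_decomp x); apply: (le_trans (ler_normD _ _)); apply: lerD.
  apply: (le_trans (ler_normD _ _)); apply: lerD => //.
  by rewrite normrZ ler_wpM2r.
by rewrite normrZ ler_wpM2r.
Qed.

Lemma segment_smooth_open_arc : smooth_open_arc (segment P Q).
Proof.
split; first by exists (seg_curve P Q), (enorm (P - Q)); exact: seg_curve_arclength.
have [dom bd0] := convex_sublevel_domain smooth_rho rho_convex rho_center rho_bounded.
by exists [set x | rho x < 0] => // x /rho_segment; exact: bd0.
Qed.

End SegmentDomain.

(** * Comparison with the segment *)

Section Comparison.
Variable R : realType.
Local Notation leb := (@lebesgue_measure R).
Local Notation leb2 := (leb \x leb)%E.
Implicit Types (s t l b mu : R) (f g h : R -> R) (gam sig : R -> R * R).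

Lemma bsop_eq gam sig l b f s : arcfun l f -> 0 <= s <= l ->
  (forall s t, 0 <= s <= l -> 0 <= t <= l -> dist2 gam s t = dist2 sig s t) ->
  bsop b (dist2 gam) f s = bsop b (dist2 sig) f s.
Proof.
move=> [_ _ off] sl E; apply: eq_Rintegral => z _.
have [zl|/negP zl] := boolP (0 <= z.1 <= l); first by rewrite E.
by rewrite off// !mulr0.
Qed.

Lemma perron_transfer gam sig l b h mu :
  (forall s t, 0 <= s <= l -> 0 <= t <= l -> dist2 gam s t = dist2 sig s t) ->
  perron gam l b h mu -> perron sig l b h mu.
Proof.
move=> E [bh mu0 ha Q]; split; [exact: bh|exact: mu0|exact: ha|move=> s].
apply: (etrans _ (Q s)); have [sl|/negP sl] := boolP (0 <= s <= l).
  exact: (etrans (bsopIE sig b h sl) (etrans (esym (bsop_eq b bh sl E)) (esym (bsopIE gam b h sl)))).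
have off : \1_`[0, l] s = 0 :> R by rewrite indicE memNset//= in_itv.
by rewrite /bsopI off; exact: (etrans (mul0r _) (esym (mul0r _))).
Qed.

Lemma arcfun_widen l l' f : l <= l' -> arcfun l f -> arcfun l' f.
Proof.
move=> ll' [mf bf off]; split=> // s sl; apply: off => /andP[s0 s1]; apply: sl.
by rewrite s0 (le_trans s1 ll').
Qed.

Variables (sig gam : R -> R * R) (L l c c' : R).
Hypothesis L0 : 0 < L.
Hypothesis Ll : L <= l.
Hypothesis csig : continuous sig.
Hypothesis c'0 : 0 < c'.
Hypothesis sig_lb : forall s t, 0 <= s <= L -> 0 <= t <= L ->
  c' ^+ 2 * (s - t) ^+ 2 <= esq (sig s - sig t).
Hypothesis cgam : continuous gam.
Hypothesis c0 : 0 < c.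
Hypothesis gam_lb : forall s t, 0 <= s <= l -> 0 <= t <= l ->
  c ^+ 2 * (s - t) ^+ 2 <= esq (gam s - gam t).
Hypothesis gam_ub : forall s t, 0 <= s <= l -> 0 <= t <= l ->
  esq (gam s - gam t) <= (s - t) ^+ 2.
Hypothesis closer : forall s t, 0 <= s <= L -> 0 <= t <= L ->
  dist2 gam s t <= dist2 sig s t.

(* Testing the eigenvalue equation of [h1] against [h]. *)
Lemma perron_comparison b h k h1 mu1 : 0 < b -> perron sig L b h k -> perron gam l b h1 mu1 ->
  k <= mu1 /\ (L < l -> k < mu1).
Proof.
move=> b0 p p1; have l0 : 0 < l := lt_le_trans L0 Ll.
have [bh k0 [a a0 ha] Qh] := p; have [bh1 mu10 [a1 a10 ha1] Qh1] := p1.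
have bhl := arcfun_widen Ll bh.
have h_ge0 r : 0 <= h r by exact: perron_ge0 p.
have h1_ge0 r : 0 <= h1 r by exact: perron_ge0 p1.
pose X := \int[leb]_s (h s * h1 s).
have bX : arcfun L (fun s => h s * h1 s).
  have [m1 [C1 B1] off1] := bh; have [m2 [C2 B2] _] := bh1.
  split; first exact: measurable_funM.
    by exists (C1 * C2) => s; rewrite normrM ler_pM.
  by move=> s /off1 ->; rewrite mul0r.
have X0 : 0 < X.
  apply: (@lt_le_trans _ _ (\int[leb]_s (a * a1 * \1_`[0, L] s))).
    rewrite RintegralZl//; last by have := arcfun_intg (arcfun_ind L 1); under eq_fun do rewrite mul1r.
    by rewrite Rint_ind// !mulr_gt0.
  apply: (arcfun_int_le (arcfun_ind L _) bX) => s sL.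
  rewrite indicE mem_set ?mulr1/=; last by rewrite in_itv.
  apply: ler_pM; rewrite ?(ltW a0) ?(ltW a10) ?ha//; apply: ha1.
  by case/andP: sL => -> /le_trans ->.
have inth : 0 < \int[leb]_r h r.
  apply: (@lt_le_trans _ _ (\int[leb]_s (a * \1_`[0, L] s))).
    rewrite RintegralZl//; last by have := arcfun_intg (arcfun_ind L 1); under eq_fun do rewrite mul1r.
    by rewrite Rint_ind// !mulr_gt0.
  apply: (arcfun_int_le (arcfun_ind L _) bh) => s sL.
  by rewrite indicE mem_set ?mulr1 ?ha//= in_itv.
(* The operator spreads [h] over the whole arc, also beyond [L] where [h] is 0; this is the source
   of the strict inequality. *)
have [kap kap0 Hkap] : exists2 kap, 0 < kap & forall s, 0 <= s <= l -> kap <= bsop b (dist2 gam) h s.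
  exists (pi^-1 * (2^-1 * expR (- (b * 16) - 1 / 4 * l ^+ 2)) * \int[leb]_r h r).
    by rewrite !mulr_gt0 ?invr_gt0 ?pi_gt0 ?expR_gt0.
  by move=> s sl; exact: (bsop_lb l0 cgam c0 gam_lb gam_ub b0 bhl h_ge0 sl).
have low s : 0 <= s <= L -> k * h s <= bsop b (dist2 gam) h s.
  move=> sL; rewrite -Qh (bsopIE sig b h sL).
  apply: (@Rint_le _ _ _ leb2 _ _ (bsop_intg L0 csig c'0 sig_lb b0 s bh)
    (bsop_intg l0 cgam c0 gam_lb b0 s bhl)) => z.
  have [zL|/negP zL] := boolP (0 <= z.1 <= L); last by have [_ _ ->//] := bh; rewrite !mulr0.
  by apply: ler_wpM2r => //; apply: hker_decr; exact: closer.
have E : bsform gam b h h1 = mu1 * X.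
  rewrite (bsform_sym l0 cgam c0 gam_lb b0 bhl bh1) (bsformE gam b h1 bhl) -RintegralZl//; last exact: arcfun_intg bX.
  by apply: eq_Rintegral => s _; rewrite Qh1; ring.
(* A minorant of the product of [h1] with the operator of the arc applied to [h]. On [[0, L]] it
   uses that the arc's kernel dominates that of the segment, beyond [L] the lower bounds of both
   factors, whose contribution is [kap * a1 * (l - L)]. *)
pose f s := k * (h s * h1 s) + kap * a1 * (\1_`[0, l] s - \1_`[0, L] s).
have bf : arcfun l f.
  have bX' := arcfun_widen Ll bX; have bI := arcfun_ind l 1; have bI' := arcfun_widen Ll (arcfun_ind L 1).
  apply: (eq_rect _ (arcfun l) (arcfun_comb (kap * a1) (arcfun_Z k bX') (arcfun_comb (-1) bI bI'))).
  by apply/funext => s; rewrite /f; ring.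
have If : \int[leb]_s f s = k * X + kap * a1 * (l - L).
  have iI r : intg leb (\1_`[0, r] : R -> R).
    by have := arcfun_intg (arcfun_ind r 1); under eq_fun do rewrite mul1r.
  rewrite /f RintegralD//; last 2 first.
  - by apply: intgZ; exact: arcfun_intg bX.
  - by apply: intgZ; apply: intgB; exact: iI.
  rewrite RintegralZl//; last exact: arcfun_intg bX.
  rewrite RintegralZl//; last by apply: intgB; exact: iI.
  by rewrite RintegralB//; [rewrite !Rint_ind|exact: iI|exact: iI].
have key : k * X + kap * a1 * (l - L) <= mu1 * X.
  rewrite -If -E (bsformE gam b h bh1).
  apply: (arcfun_int_le bf (arcfunM (arcfun_bsopI l0 cgam c0 gam_lb b0 bhl) bh1)) => s sl.
  rewrite bsopIE// /f !indicE mem_set/=; last by rewrite in_itv.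
  have [sL|sL] := boolP (0 <= s <= L).
    rewrite mem_set/=; last by rewrite in_itv.
    by rewrite subrr mulr0 addr0 mulrA ler_wpM2r// low.
  rewrite memNset/=; last by rewrite in_itv; exact/negP.
  have [_ _ ->] := bh; last exact/negP.
  by rewrite mul0r mulr0 add0r subr0 mulr1 ler_pM ?(ltW kap0) ?(ltW a10) ?Hkap ?ha1.
split=> [|lt].
  rewrite -(ler_pM2r X0); apply: le_trans key; rewrite lerDl mulr_ge0 ?subr_ge0//.
  by rewrite mulr_ge0// ltW.
rewrite -(ltr_pM2r X0); apply: lt_le_trans key; rewrite ltrDl mulr_gt0 ?subr_gt0//.
exact: mulr_gt0.
Qed.

End Comparison.

Section GroundStates.
Variable R : realType.
Implicit Types (S : set (R * R)) (A B P Q : R * R) (a b k L : R).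

Lemma arc_paramP S : (exists c l, arclength_param S c l) ->
  arclength_param S (arc_param S).1 (arc_param S).2.
Proof.
move=> [c [l cl]].
apply: (@xgetPex _ (cst 0, 0) [set cl | arclength_param S cl.1 cl.2]).
by exists (c, l).
Qed.

Lemma lambda1_arc S a b h : (exists c l, arclength_param S c l) -> 0 < a -> 0 < b ->
  perron (arc_param S).1 (arc_param S).2 b h a^-1 -> lambda1 a S = - b.
Proof.
move=> /arc_paramP [l0 sg speed inj _] a0 b0 p.
have [c c0 lb] := arc_lb l0 sg speed inj.
exact: (lambda1_perron l0 (smooth_curve_continuous sg) inj c0 lb b0 a0 p).
Qed.

(** The model of all segments: the integral operator sees only distances, and in any segment
    traversed at unit speed these are [|s - t|]. *)
Definition axis (s : R) : R * R := (s, 0).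

Lemma dist2_axis s t : dist2 axis s t = (s - t) ^+ 2.
Proof. by rewrite /dist2 /esq /= subrr expr0n/= addr0. Qed.

Lemma continuous_axis : continuous axis.
Proof.
move=> s; have h1 : (fun r : R => r) @ s --> s by exact: cvg_id.
have h2 : (fun r : R => (0 : R)) @ s --> (0 : R) by exact: cvg_cst.
exact: (cvg_pair h1 h2).
Qed.

Lemma axis_lb L s t : 0 <= s <= L -> 0 <= t <= L ->
  1 ^+ 2 * (s - t) ^+ 2 <= esq (axis s - axis t).
Proof. by move=> _ _; rewrite expr1n mul1r -[leRHS]/(dist2 axis s t) dist2_axis. Qed.

Lemma axis_ub L s t : 0 <= s <= L -> 0 <= t <= L ->
  esq (axis s - axis t) <= (s - t) ^+ 2.
Proof. by move=> _ _; rewrite -[leLHS]/(dist2 axis s t) dist2_axis. Qed.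

Lemma axis_perron L k : 0 < L -> 0 < k -> exists b h, 0 < b /\ perron axis L b h k.
Proof.
move=> L0 k0.
have [b1 [h1 [mu1 [b10 p1 km]]]] :=
  perron_large L0 continuous_axis ltr01 (@axis_lb L) (@axis_ub L) k.
have [b [h [bb p _]]] :=
  perron_crossing L0 continuous_axis ltr01 (@axis_lb L) (@axis_ub L) k0 b10 p1 km.
by exists b, h; split=> //; exact: lt_le_trans bb.
Qed.

Lemma lambda1_segment A B a b h : A != B -> 0 < a -> 0 < b ->
  perron axis (enorm (A - B)) b h a^-1 -> lambda1 a (segment A B) = - b.
Proof.
move=> AB a0 b0 p.
have ex : exists c l, arclength_param (segment A B) c l.
  by exists (seg_curve A B), (enorm (A - B)); exact: seg_curve_arclength.
have [lE iso] := segment_arc_isometry AB (arc_paramP ex).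
apply: (lambda1_arc ex a0 b0 (h := h)); rewrite lE.
apply: (perron_transfer _ p) => s t; rewrite -lE => sl tl.
by rewrite dist2_axis /dist2 iso.
Qed.

Lemma lambda1_connecting S P Q a b h : P != Q -> 0 < a -> 0 < b ->
  perron axis (enorm (P - Q)) b h a^-1 -> connects P Q S ->
  lambda1 a S <= - b /\ (S <> segment P Q -> lambda1 a S < - b).
Proof.
move=> PQ a0 b0 p [c' [l' [Hc ends]]].
have ex : exists c l, arclength_param S c l by exists c', l'.
have Hg := arc_paramP ex; have [l0 sg speed inj img] := Hg.
set g := (arc_param S).1 in Hg l0 sg speed inj img; set l := (arc_param S).2 in Hg l0 sg speed inj img.
have cg := smooth_curve_continuous sg; have ub := arc_ub sg speed.
have [c c0 lb] := arc_lb l0 sg speed inj.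
have [_ _ _ _ img'] := Hc.
have l'0 : 0 <= l' by case: Hc => /ltW.
(* The parametrization given by [connects] and the one chosen by [arc_param] may differ; what is
   carried over is that the latter passes through [P] and [Q], at the parameters [q0] and [q1]. *)
have on_arc x : [set c' 0; c' l'] x -> exists2 r, 0 <= r <= l & g r = x.
  move=> xe; have : S x.
    by rewrite -img'; case: xe => ->; [exists 0|exists l'] => //=; rewrite in_itv/= ?lexx ?l'0.
  by rewrite -img => -[r /=]; rewrite in_itv => rl <-; exists r.
have [q0 q0l Pq] : exists2 r, 0 <= r <= l & g r = P by apply: on_arc; rewrite ends; left.
have [q1 q1l Qq] : exists2 r, 0 <= r <= l & g r = Q by apply: on_arc; rewrite ends; right.
set L := enorm (P - Q) in p *.
have L0 : 0 < L by rewrite enorm_gt0// subr_eq0.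
have L2 : L ^+ 2 = esq (P - Q) by exact: enorm_sq.
have Ll : L <= l.
  rewrite -ler_sqr ?nnegrE ?(ltW L0) ?(ltW l0)// L2 -Pq -Qq.
  apply: (le_trans (ub _ _ q0l q1l)).
  rewrite ler_sqr_norm// (ger0_norm (ltW l0)) ler_norml.
  by case/andP: q0l q1l => ? ? /andP[? ?]; apply/andP; split; lra.
have closer s t : 0 <= s <= L -> 0 <= t <= L -> dist2 g s t <= dist2 axis s t.
  move=> /andP[s0 sL] /andP[t0 tL]; rewrite dist2_axis; apply: ub.
    by rewrite s0 (le_trans sL Ll).
  by rewrite t0 (le_trans tL Ll).
have [h1 [mu1 p1]] := perron_exists l0 cg c0 lb ub b0.
have [km lt] := perron_comparison L0 Ll continuous_axis ltr01 (@axis_lb L) cg c0 lb ub closer b0 p p1.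
have ia0 : 0 < a^-1 by rewrite invr_gt0.
(* At the mass [b] of the segment the arc has an eigenvalue of at least [a^-1]; raising the mass
   brings it down to [a^-1] at some [b' >= b], and [- b'] is the lowest eigenvalue for the arc. *)
have [b' [h' [bb p' lt']]] := perron_crossing l0 cg c0 lb ub ia0 b0 p1 km.
have b'0 : 0 < b' by exact: lt_le_trans bb.
rewrite (lambda1_arc ex a0 b'0 p') lerN2 ltrN2; split=> // nS.
(* An arc other than the segment is strictly longer than [L], for otherwise [arc_straight] would
   identify the two. *)
apply: lt'; apply: lt; rewrite lt_neqAle Ll andbT; apply/eqP => LE.
by apply: nS; rewrite -Pq -Qq; apply: (arc_straight Hg) => //; rewrite Pq Qq -L2 LE.
Qed.

End GroundStates.

Theorem proposition5p1 (R : realType) (alpha : R) (P Q : R * R)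
    (halpha : 0 < alpha) (hPQ : P <> Q)
    (A B : R * R) (hAB : enorm (A - B) = enorm (P - Q)) :
  is_max [set lambda1 alpha S | S in
            [set S | smooth_open_arc S /\ connects P Q S]]
         (lambda1 alpha (segment A B)) /\
  (forall S : set (R * R), smooth_open_arc S -> connects P Q S ->
     (lambda1 alpha S = lambda1 alpha (segment A B) <-> S = segment P Q)).
Proof.
have PQ : P != Q by apply/eqP.
have L0 : 0 < enorm (P - Q) by rewrite enorm_gt0// subr_eq0.
have AB : A != B.
  apply/eqP => AB; move: L0; rewrite -hAB AB subrr /enorm /= expr0n/= addr0 sqrtr0.
  by rewrite ltxx.
have ia0 : 0 < alpha^-1 by rewrite invr_gt0.
(* One critical mass serves all segments of this length, so [segment A B] and [segment P Q] share
   the lowest eigenvalue [- b]. *)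
have [b [h [b0 p]]] := axis_perron L0 ia0.
have EAB : lambda1 alpha (segment A B) = - b by apply: (lambda1_segment AB halpha b0 (h := h)); rewrite hAB.
have EPQ : lambda1 alpha (segment P Q) = - b by exact: (lambda1_segment PQ halpha b0 p).
have cmp S (cS : connects P Q S) := lambda1_connecting PQ halpha b0 p cS.
rewrite EAB; split; first split.
- exists (segment P Q) => //; split; first exact: segment_smooth_open_arc.
  exists (seg_curve P Q), (enorm (P - Q)); split; first exact: seg_curve_arclength.
  by rewrite seg_curve0 seg_curveL.
- by move=> _ [S [_ cS] <-]; exact: (cmp S cS).1.
move=> S _ cS; split=> [E|->//].
by apply: contrapT => nS; have := (cmp S cS).2 nS; rewrite E ltxx.
Qed.
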